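(* Let $\sigma\in\mathbb{R}$ be a constant and $\gamma:\mathbb{R}_0\to\mathbb{R}$ a function with $\int_{\mathbb{R}_0}\gamma^2(\zeta)\nu(d\zeta)<\infty$. Let $\mathcal{A}$ be the set of $\mathbb{F}$-predictable processes $u$ with $u(t)\ge0$ for all $t\in[0,T]$ and $\mathbb{E}[\int_0^Tu^2(t)dt]<\infty$. For $u\in\mathcal{A}$ let $X=X^u$ be given by $$dX(t)=u(t)dt+\sigma\,dB(t)+\int_{\mathbb{R}_0}\gamma(\zeta)\tilde N(dt,d\zeta),\quad t\in[0,T],\qquad X(0)=x_0\in\mathbb{R},$$ and let $$J(u)=\mathbb{E}\Big[-\tfrac12 (X^u(T))^2-\tfrac12\int_0^Tu^2(t)dt\Big].$$ Suppose there is an optimal control $\hat u\in\mathcal{A}$, i.e. $J(\hat u)=\sup_{u\in\mathcal{A}}J(u)$. Then, for almost all $(t,\omega)\in[0,T]\times\Omega$, $$\hat u(t)=\max\{\hat p(t),0\}=\max\{-\mathbb{E}[\hat X(T)\mid\mathcal{F}_t],0\},$$ where $(\hat p,\hat X)$ (together with $\hat q,\hat r$) is the solution of the coupled forward-backward SDE system $$d\hat X(t)=\max\{\hat p(t),0\}dt+\sigma\,dB(t)+\int_{\mathbb{R}_0}\gamma(\zeta)\tilde N(dt,d\zeta),\quad t\in[0,T],\qquad \hat X(0)=x_0,$$ $$d\hat p(t)=\hat q(t)dB(t)+\int_{\mathbb{R}_0}\hat r(t,\zeta)\tilde N(dt,d\zeta),\quad t\in[0,T],\qquad \hat p(T)=-\hat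 X(T),$$ and $\hat X=X^{\hat u}$ is the state process corresponding to $\hat u$.
   Context: $T>0$ is a constant and $\mathbb{R}_0=\mathbb{R}\setminus\{0\}$. $B$ is a one-dimensional Brownian motion and $\tilde N(dt,d\zeta)=N(dt,d\zeta)-\nu(d\zeta)dt$ is an independent compensated Poisson random measure on $[0,T]\times\mathbb{R}_0$ with Lévy measure $\nu$ satisfying $\int_{\mathbb{R}_0}\zeta^2\nu(d\zeta)<\infty$. Both are defined on a filtered probability space $(\Omega,\mathcal{F},\mathbb{F}=\{\mathcal{F}_t\}_{t\ge0},P)$ satisfying the usual conditions, where $\mathbb{F}$ is the (augmented) filtration generated by $B$ and $N$. Solutions of the forward-backward system are understood with $\hat X,\hat p\in\mathcal{S}^2$, $\hat q\in\mathbb{L}^2$, $\hat r\in\mathbb{L}^2_\nu$. Here $\mathcal{S}^2$ is the set of real-valued $\mathbb{F}$-adapted càdlàg processes $Y$ with $\mathbb{E}[\sup_{t\in[0,T]}|Y(t)|^2]<\infty$. $\mathbb{L}^2$ is the set of real-valued $\mathbb{F}$-predictable $Q$ with $\mathbb{E}[\int_0^T|Q(t)|^2dt]<\infty$. $\mathbb{L}^2_\nu$ is the set of $\mathbb{F}$-predictable $r:[0,T]\times\mathbb{R}_0\times\Omega\to\mathbb{R}$ with $\mathbb{E}[\int_0^T\int_{\mathbb{R}_0}|r(t,\zeta)|^2\nu(d\zeta)dt]<\infty$. *)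

(* Defs.v *)
From HB Require Import structures.
From mathcomp Require Import all_boot all_order all_algebra.
From mathcomp Require Import all_classical all_reals all_analysis.
From mathcomp Require Import measurable_realfun.

Set Implicit Arguments.
Unset Strict Implicit.
Unset Printing Implicit Defensive.
Import Order.TTheory GRing.Theory Num.Theory.
Import numFieldNormedType.Exports.

Local Open Scope classical_set_scope.
Local Open Scope ring_scope.

(* The set R \ {0} of jump sizes.  Objects living on it (the Levy measure, the
   random measure, the integrands) are defined on all of R, and only their
   restriction to it is ever used.  A measure integrating z^2 over R \ {0} is
   sigma-finite there, so typing the Levy measure as sigma-finite on R is no
   restriction. *)
Definition Rnz (R : realType) : set R := ~` [set 0].
Arguments Rnz : clear implicits.

Section probability_notions.
Context {R : realType} {d : measure_display} {Omega : measurableType d}.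
Variable P : probability Omega R.

Definition generated_by {I : Type} {d' : measure_display}
    {E : measurableType d'} (J : set I) (X : I -> Omega -> E) :
    set (set Omega) :=
  <<s \bigcup_(i in J) g_sigma_algebra_preimage (X i)>>.

Definition independent_algebras (G H : set (set Omega)) :=
  forall A C, G A -> H C -> P (A `&` C) = (P A * P C)%E.

(* Taking some of the [C i] equal to [setT] gives the product rule for all
   subfamilies. *)
Definition mutually_independent {d' : measure_display}
    {E : measurableType d'} (n : nat) (X : 'I_n -> Omega -> E) :=
  forall C : 'I_n -> set E, (forall i, measurable (C i)) ->
    P (\bigcap_i (X i @^-1` C i)) =
    (\big[mule/1%E]_(i < n) P (X i @^-1` C i))%E.

Definition measurable_wrt (G : set (set Omega)) (X : Omega -> R) :=
  forall C : set R, measurable C -> G (X @^-1` C).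

(* [Y] is a version of the conditional expectation of [X] given [G]. *)
Definition is_cond_exp (G : set (set Omega)) (X Y : Omega -> R) :=
  [/\ measurable_wrt G Y, P.-integrable setT (EFin \o Y) &
      forall A, G A ->
        (\int[P]_(w in A) (Y w)%:E = \int[P]_(w in A) (X w)%:E)%E].

Definition filtration (F : R -> set (set Omega)) :=
  (forall t, 0 <= t -> sigma_algebra setT (F t) /\ F t `<=` measurable) /\
  (forall s t, 0 <= s -> s <= t -> F s `<=` F t).

Definition usual_conditions (F : R -> set (set Omega)) :=
  [/\ measure_is_complete P, P.-negligible `<=` F 0 &
      forall t, 0 <= t -> F t = \bigcap_(s in `]t, +oo[) F s].

Definition brownian_motion (B : R -> Omega -> R) :=
  [/\ {ae P, forall w, B 0 w = 0},
      {ae P, forall w, {within `[0, +oo[, continuous (B ^~ w)}},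
      forall s t, 0 <= s -> s < t ->
        independent_algebras (generated_by `[0, s] B)
          (g_sigma_algebra_preimage (fun w => B t w - B s w)) &
      forall s t, 0 <= s -> s < t -> forall C : set R, measurable C ->
        P [set w | C (B t w - B s w)] = normal_prob 0 (Num.sqrt (t - s)) C].

End probability_notions.

Section random_measure.
Context {R : realType} {d : measure_display} {Omega : measurableType d}.
Variables (P : probability Omega R) (T : R).
Variable nu : {sigma_finite_measure set (measurableTypeR R) -> \bar R}.
Variable N : R.-ker Omega ~> (measurableTypeR R * measurableTypeR R)%type.

Definition jump_sets (t : R) :
    set (set (measurableTypeR R * measurableTypeR R)) :=
  [set E | measurable E /\ E `<=` `[0, t] `*` Rnz R].

(* The law of [N E] when [E] has infinite intensity is determined by the
   finite case and independence.  The second argument of [poisson_prob] is not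
   used by the library. *)
Definition poisson_random_measure :=
  (forall E m, jump_sets T E -> (lebesgue_measure \x nu)%E E = m%:E ->
     forall k : nat,
       P [set w | N w E = k%:R%:E] = poisson_prob m 0 [set k]) /\
  (forall n (E : 'I_n -> set (measurableTypeR R * measurableTypeR R)),
     (forall i, jump_sets T (E i)) -> trivIset setT E ->
     mutually_independent P (fun i w => N w (E i))).

Definition compensated (E : set (measurableTypeR R * measurableTypeR R))
    (w : Omega) : R :=
  fine (N w E) - fine ((lebesgue_measure \x nu)%E E).

(* [B] is indexed by all nonnegative times and [N] lives on [0, T]. *)
Definition augmented_filtration (B : R -> Omega -> R) (t : R) :
    set (set Omega) :=
  <<s generated_by `[0, t] B `|`
      generated_by (jump_sets (Num.min t T)) (fun E w => N w E) `|`
      P.-negligible>>.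

End random_measure.

Section stochastic_integrals.
Context {R : realType} {d : measure_display} {Omega : measurableType d}.
Variables (P : probability Omega R) (T : R) (F : R -> set (set Omega)).
Variable nu : {sigma_finite_measure set (measurableTypeR R) -> \bar R}.
Variable N : R.-ker Omega ~> (measurableTypeR R * measurableTypeR R)%type.
Variable B : R -> Omega -> R.

Definition adapted (Y : R -> Omega -> R) :=
  forall t, 0 <= t <= T -> measurable_wrt (F t) (Y t).

Definition cadlag (f : R -> R) :=
  (forall t, 0 <= t < T -> f x @[x --> t^'+] --> f t) /\
  (forall t, 0 < t <= T -> cvg (f x @[x --> t^'-])).

Definition cadlag_adapted (Y : R -> Omega -> R) :=
  adapted Y /\ forall w, cadlag (Y ^~ w).

Definition predictable_sets : set (set (R * Omega)) :=
  <<s `[0, T] `*` setT,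
      [set D | (exists2 A, F 0 A & D = [set 0] `*` A) \/
               (exists s t A, [/\ 0 <= s, s <= t, t <= T, F s A &
                                  D = `]s, t] `*` A])]>>.

Definition predictable (u : R -> Omega -> R) :=
  forall C : set R, measurable C ->
    predictable_sets [set x | 0 <= x.1 <= T /\ C (u x.1 x.2)].

(* The product of the predictable sigma-algebra with the Borel sets of
   R \ {0}. *)
Definition predictable_marked_sets : set (set (R * R * Omega)) :=
  <<s `[0, T] `*` Rnz R `*` setT,
      [set D | exists G (C : set R),
         [/\ predictable_sets G, measurable C, C `<=` Rnz R &
             D = [set x | G (x.1.1, x.2) /\ C x.1.2]]]>>.

Definition predictable_marked (r : R -> R -> Omega -> R) :=
  forall C : set R, measurable C ->
    predictable_marked_sets
      [set x | [/\ 0 <= x.1.1 <= T, Rnz R x.1.2 & C (r x.1.1 x.1.2 x.2)]].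

Definition sqnorm (q : R -> Omega -> R) : \bar R :=
  (\int[P]_w \int[lebesgue_measure]_(t in `[0%R, T]) ((q t w) ^+ 2)%:E)%E.

Definition sqnorm_nu (r : R -> R -> Omega -> R) : \bar R :=
  (\int[P]_w \int[lebesgue_measure]_(t in `[0%R, T])
     \int[nu]_(z in Rnz R) ((r t z w) ^+ 2)%:E)%E.

Definition S2 (Y : R -> Omega -> R) :=
  cadlag_adapted Y /\
  (\int[P]_w ereal_sup [set ((Y t w) ^+ 2)%:E | t in `[0%R, T]] < +oo)%E.

Definition L2 (q : R -> Omega -> R) :=
  predictable q /\ (sqnorm q < +oo)%E.

Definition L2nu (r : R -> R -> Omega -> R) :=
  predictable_marked r /\ (sqnorm_nu r < +oo)%E.

Record step := Step {
  step_lo : R;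
  step_hi : R;
  step_height : Omega -> R;
  step_lo_ge0 : 0 <= step_lo;
  step_lo_le_hi : step_lo <= step_hi;
  step_hi_leT : step_hi <= T;
  step_measurable : measurable_wrt (F step_lo) step_height;
  step_bounded : exists K : R, forall w, `|step_height w| <= K }.

Record marked_step := MarkedStep {
  marked_step_base :> step;
  step_marks : set (measurableTypeR R);
  step_marks_measurable : measurable step_marks;
  step_marks_nz : step_marks `<=` Rnz R;
  step_marks_finite : (nu step_marks < +oo)%E }.

(* A finite list of steps stands for the sum of the corresponding elementary
   integrands. *)
Definition step_fun (Q : seq step) (t : R) (w : Omega) : R :=
  \sum_(a <- Q) step_height a w * \1_`]step_lo a, step_hi a] t.

Definition step_integral (Q : seq step) (t : R) (w : Omega) : R :=
  \sum_(a <- Q) step_height a w *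
    (B (Num.min (step_hi a) t) w - B (Num.min (step_lo a) t) w).

Definition marked_step_fun (Q : seq marked_step) (t z : R) (w : Omega) : R :=
  \sum_(a <- Q)
    step_height a w * \1_`]step_lo a, step_hi a] t * \1_(step_marks a) z.

Definition marked_step_integral (Q : seq marked_step) (t : R) (w : Omega) : R :=
  \sum_(a <- Q) step_height a w *
    compensated nu N
      (`]Num.min (step_lo a) t, Num.min (step_hi a) t] `*` step_marks a) w.

(* [M] is a cadlag version of the process [int_0^t q dB], the L2-limit of the
   integrals of elementary integrands converging to [q]. *)
Definition is_ito_integral (q : R -> Omega -> R) (M : R -> Omega -> R) :=
  [/\ L2 q, cadlag_adapted M &
      exists Q : nat -> seq step,
        sqnorm (fun t w => q t w - step_fun (Q k) t w) @[k --> \oo]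
          --> 0%E /\
        forall t, 0 <= t <= T ->
          (\int[P]_w ((M t w - step_integral (Q k) t w) ^+ 2)%:E)%E
            @[k --> \oo] --> 0%E].

(* The same for [int_0^t int r dNtilde]. *)
Definition is_poisson_integral (r : R -> R -> Omega -> R)
    (M : R -> Omega -> R) :=
  [/\ L2nu r, cadlag_adapted M &
      exists Q : nat -> seq marked_step,
        sqnorm_nu (fun t z w => r t z w - marked_step_fun (Q k) t z w)
          @[k --> \oo] --> 0%E /\
        forall t, 0 <= t <= T ->
          (\int[P]_w ((M t w - marked_step_integral (Q k) t w) ^+ 2)%:E)%E
            @[k --> \oo] --> 0%E].

(* Jointly measurable version of the process [E[X | F_t]]. *)
Definition is_cond_exp_process (X : Omega -> R) (Z : R -> Omega -> R) :=
  measurable_fun (`[0, T] `*` setT : set (measurableTypeR R * Omega))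
    (fun x => Z x.1 x.2) /\
  forall t, 0 <= t <= T -> is_cond_exp P (F t) X (Z t).

End stochastic_integrals.

Section control_problem.
Context {R : realType} {d : measure_display} {Omega : measurableType d}.
Variables (P : probability Omega R) (T : R) (F : R -> set (set Omega)).
Variable nu : {sigma_finite_measure set (measurableTypeR R) -> \bar R}.
Variable N : R.-ker Omega ~> (measurableTypeR R * measurableTypeR R)%type.
Variables (B : R -> Omega -> R) (sigma : R) (gamma : R -> R) (x0 : R).

Definition admissible (u : R -> Omega -> R) :=
  L2 P T F u /\ forall t w, 0 <= t <= T -> 0 <= u t w.

(* dX = u dt + sigma dB + int gamma dNtilde on [0, T], X(0) = x0 *)
Definition state_equation (u X : R -> Omega -> R) :=
  cadlag_adapted T F X /\
  exists MB MN,
    [/\ is_ito_integral P T F B (fun _ _ => sigma) MB,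
        is_poisson_integral P T F nu N (fun _ z _ => gamma z) MN &
        {ae P, forall w, forall t, 0 <= t <= T ->
          X t w = x0 + \int[lebesgue_measure]_(s in `[0, t]) u s w
                  + MB t w + MN t w}].

Definition performance (X u : R -> Omega -> R) : \bar R :=
  'E_P[fun w => - 2^-1 * (X T w) ^+ 2
                - 2^-1 * \int[lebesgue_measure]_(t in `[0, T]) (u t w) ^+ 2].

Definition optimal (u X : R -> Omega -> R) :=
  [/\ admissible u, state_equation u X &
      performance X u =
      ereal_sup [set j | exists v Y,
        [/\ admissible v, state_equation v Y & j = performance Y v]]].

Definition fbsde_solution (X p : R -> Omega -> R) (q : R -> Omega -> R)
    (r : R -> R -> Omega -> R) :=
  [/\ S2 P T F X, S2 P T F p, L2 P T F q, L2nu P T F nu r &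
      state_equation (fun t w => Num.max (p t w) 0) X /\
      exists MB MN,
        [/\ is_ito_integral P T F B q MB,
            is_poisson_integral P T F nu N r MN,
            {ae P, forall w, forall t, 0 <= t <= T ->
              p t w = p 0 w + MB t w + MN t w} &
            {ae P, forall w, p T w = - X T w}]].

End control_problem.

(* Main.v *)
(* Square-integrable F_T-measurable variables are stochastic integrals with respect
   to B and Ntilde: on a dyadic grid, indicators of {B_{t_1} <= a_1, ..., no jump in
   given boxes} generate F_T, and each is a limit of products of one-interval factors
   phi(B_t) 1_{no jump in ]s, t] x C}, which a backward first-order expansion in dB
   and dNtilde over n substeps represents up to an error of order 1/n.

   Applied to - Xhat(T), the representation yields the martingale phat.  Perturbing
   uhat towards an admissible v and using the martingale property gives
   E int (phat - uhat)(v - uhat) dt <= 0.  Taking for v the positive parts of phat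
   frozen on dyadic intervals and passing to the limit gives the inequality for
   v = phat^+, whose integrand dominates (phat^+ - uhat)^2; hence uhat = phat^+.

   For uniqueness, if p - p' is the difference of two solutions, the terminal
   conditions give E (p - p')(T)^2 = - E int (p - p')(p^+ - p'^+) dt <= 0. *)
Require Import Defs.
From HB Require Import structures.
From mathcomp Require Import all_boot all_order all_algebra.
From mathcomp Require Import all_classical all_reals all_analysis.
From mathcomp Require Import measurable_realfun.
From mathcomp Require Import ring lra.

Set Implicit Arguments.
Unset Strict Implicit.
Unset Printing Implicit Defensive.
Import Order.TTheory GRing.Theory Num.Theory.
Import numFieldNormedType.Exports.
Import HBSimple HBNNSimple.

Local Open Scope classical_set_scope.
Local Open Scope ring_scope.

(** * Square-integrable functions *)

(** The stochastic integrals are defined as L2 limits, at each time, of elementary integrals, with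
    versions that are cadlag for every outcome. Everything is therefore reduced to finite sums of
    one-step integrals, where the isometry is a finite computation; limits are taken along
    subsequences so fast that Doob's inequality gives almost sure uniform convergence, and paths are
    set to 0 off a good event. Void events are used because two of them intersect in the void event
    of the union: they form a pi-system and are multiplicative over time slices, so that the
    expansion only ever meets bounded factors. It runs backwards because averaging a function over a
    Gaussian increment keeps its bounds, so that one constant controls every substep. The positive
    part of [phat] is adapted and cadlag but need not be predictable, so it is not directly
    available as a control; freezing it at the left ends of dyadic intervals makes it predictable
    and gives its time integral an explicit cadlag form. The constraint u >= 0 enters the final
    comparison through the sign of p u where p <= 0. *)

Section square_integrable.
Context {d : measure_display} {X : measurableType d} {R : realType}.
Variable mu : {measure set X -> \bar R}.
Implicit Types (f g h : X -> R) (a b c : R).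

Definition intg f := mu.-integrable setT (EFin \o f).

Definition sqint f :=
  measurable_fun setT f /\ (\int[mu]_x ((f x) ^+ 2)%:E < +oo)%E.

(** The measure is arbitrary on purpose: the same algebra is used on the sample space and on the
    products time x sample space and time x mark x sample space. *)
Definition Ex f : R := \int[mu]_x f x.

Lemma intg_meas f : intg f -> measurable_fun setT f.
Proof. by move=> /integrableP[/measurable_EFinP]. Qed.

Lemma intg_ext f g : f =1 g -> intg f -> intg g.
Proof. by move=> /funext ->. Qed.

Lemma sqint_ext f g : f =1 g -> sqint f -> sqint g.
Proof. by move=> /funext ->. Qed.

Lemma Ex_ext f g : f =1 g -> Ex f = Ex g.
Proof. by move=> /funext ->. Qed.

Lemma intgD f g : intg f -> intg g -> intg (fun x => f x + g x).
Proof. by move=> fi gi; have := integrableD measurableT fi gi. Qed.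

Lemma intgZ c f : intg f -> intg (fun x => c * f x).
Proof. by move=> fi; have := integrableZl measurableT c fi. Qed.

Lemma intgN f : intg f -> intg (fun x => - f x).
Proof. by move=> fi; have := integrableN fi. Qed.

Lemma intgB f g : intg f -> intg g -> intg (fun x => f x - g x).
Proof. by move=> fi gi; apply: intgD => //; exact: intgN. Qed.

Lemma intg0 : intg (fun=> 0).
Proof. exact: integrable0. Qed.

Lemma intg_sum (I : Type) (s : seq I) (F : I -> X -> R) :
  (forall i, intg (F i)) -> intg (fun x => \sum_(i <- s) F i x).
Proof.
move=> Fi; elim: s => [|i s ih].
  by apply: intg_ext intg0 => x; rewrite big_nil.
by apply: intg_ext (intgD (Fi i) ih) => x; rewrite big_cons.
Qed.

Lemma ExD f g : intg f -> intg g -> Ex (fun x => f x + g x) = Ex f + Ex g.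
Proof. by move=> fi gi; rewrite /Ex RintegralD. Qed.

Lemma ExB f g : intg f -> intg g -> Ex (fun x => f x - g x) = Ex f - Ex g.
Proof. by move=> fi gi; rewrite /Ex RintegralB. Qed.

Lemma ExZ c f : intg f -> Ex (fun x => c * f x) = c * Ex f.
Proof. by move=> fi; rewrite /Ex RintegralZl. Qed.

Lemma Ex0 : Ex (fun=> 0) = 0.
Proof. by rewrite /Ex /Rintegral integral0. Qed.

Lemma ExN f : intg f -> Ex (fun x => - f x) = - Ex f.
Proof.
move=> fi; rewrite (@Ex_ext _ (fun x => (-1) * f x)) ?ExZ ?mulN1r//.
by move=> x; rewrite mulN1r.
Qed.

Lemma Ex_sum (I : Type) (s : seq I) (F : I -> X -> R) :
  (forall i, intg (F i)) ->
  Ex (fun x => \sum_(i <- s) F i x) = \sum_(i <- s) Ex (F i).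
Proof.
move=> Fi; elim: s => [|i s ih].
  by rewrite big_nil -[RHS]Ex0; apply: Ex_ext => x; rewrite big_nil.
rewrite big_cons -ih -ExD//; last exact: intg_sum.
by apply: Ex_ext => x; rewrite big_cons.
Qed.

Lemma Ex_ge0 f : (forall x, 0 <= f x) -> 0 <= Ex f.
Proof. by move=> f0; apply: Rintegral_ge0. Qed.

Lemma Ex_le f g : intg f -> intg g -> (forall x, f x <= g x) -> Ex f <= Ex g.
Proof. by move=> fi gi fg; apply: le_Rintegral. Qed.

Lemma intg_dom f g : measurable_fun setT f -> intg g ->
  (forall x, `|f x| <= g x) -> intg f.
Proof.
move=> mf gi fg; apply: (le_integrable measurableT _ _ gi).
  exact/measurable_EFinP.
by move=> x _ /=; rewrite lee_fin (le_trans (fg x))// ler_norm.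
Qed.

Lemma intg_lty f : measurable_fun setT f -> (forall x, 0 <= f x) ->
  (\int[mu]_x (f x)%:E < +oo)%E -> intg f.
Proof.
move=> mf f0 foo; apply/integrableP; split; first exact/measurable_EFinP.
by under eq_integral do rewrite /= ger0_norm//.
Qed.

Lemma ExE f : intg f -> (\int[mu]_x (f x)%:E)%E = (Ex f)%:E.
Proof.
by move=> fi; rewrite /Ex /Rintegral fineK//; exact: integrable_fin_num fi.
Qed.

Lemma Ex_ae f g : measurable_fun setT f -> measurable_fun setT g ->
  {ae mu, forall x, f x = g x} -> Ex f = Ex g.
Proof.
move=> mf mg fg; congr fine; apply: ae_eq_integral => //.
- exact/measurable_EFinP.
- exact/measurable_EFinP.
- by apply: filterS fg => x + _ /= => ->.
Qed.

Lemma ae_intg f g : measurable_fun setT f -> measurable_fun setT g ->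
  {ae mu, forall x, f x = g x} -> intg f -> intg g.
Proof.
move=> mf mg fg /integrableP[_ foo]; apply/integrableP; split.
  exact/measurable_EFinP.
suff <- : (\int[mu]_x `|(f x)%:E| = \int[mu]_x `|(g x)%:E|)%E by [].
apply: ae_eq_integral => //.
- by apply/measurable_EFinP; exact: measurableT_comp.
- by apply/measurable_EFinP; exact: measurableT_comp.
- by apply: filterS fg => x + _ /= => ->.
Qed.

Lemma ae_sqint f g : measurable_fun setT g ->
  {ae mu, forall x, f x = g x} -> sqint f -> sqint g.
Proof.
move=> mg fg [mf foo]; split=> //.
suff <- : (\int[mu]_x ((f x) ^+ 2)%:E = \int[mu]_x ((g x) ^+ 2)%:E)%E by [].
apply: ae_eq_integral => //.
- by apply/measurable_EFinP; exact: measurable_funX.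
- by apply/measurable_EFinP; exact: measurable_funX.
- by apply: filterS fg => x + _ /= => ->.
Qed.

Lemma sqintP f : sqint f <->
  measurable_fun setT f /\ intg (fun x => f x ^+ 2).
Proof.
split=> -[mf fi]; split=> //.
  by apply: intg_lty => //; [exact: measurable_funX|move=> x; exact: sqr_ge0].
move/integrableP : fi => [_].
by under eq_integral do rewrite /= ger0_norm ?sqr_ge0//.
Qed.

Lemma sqintM f g : sqint f -> sqint g -> intg (fun x => f x * g x).
Proof.
move=> /sqintP[mf fi] /sqintP[mg gi].
apply: (intg_dom _ (intgD fi gi)); first exact: measurable_funM.
move=> x; rewrite normrM -(real_normK (num_real (f x))).
rewrite -(real_normK (num_real (g x))).
have := sqr_ge0 (`|f x| - `|g x|); have := mulr_ge0 (normr_ge0 (f x)) (normr_ge0 (g x)).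
by nra.
Qed.

Lemma sqint_dom f g : measurable_fun setT f -> sqint g ->
  (forall x, `|f x| <= `|g x|) -> sqint f.
Proof.
move=> mf /sqintP[mg gi] fg; apply/sqintP; split => //.
apply: (intg_dom _ gi); first exact: measurable_funX.
move=> x; rewrite normrX -(real_normK (num_real (g x))).
by rewrite lerXn2r// nnegrE.
Qed.

Lemma sqintD f g : sqint f -> sqint g -> sqint (fun x => f x + g x).
Proof.
move=> sf sg; have [mf fi] := (sqintP f).1 sf; have [mg gi] := (sqintP g).1 sg.
apply/sqintP; split; first exact: measurable_funD.
apply: intg_ext (intgD (intgD fi gi) (intgZ 2 (sqintM sf sg))) => x; ring.
Qed.

Lemma sqintZ c f : sqint f -> sqint (fun x => c * f x).
Proof.
move=> /sqintP[mf fi]; apply/sqintP; split; first exact: measurable_funM.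
by apply: intg_ext (intgZ (c ^+ 2) fi) => x; rewrite exprMn.
Qed.

Lemma sqintN f : sqint f -> sqint (fun x => - f x).
Proof. by move=> /(sqintZ (-1)); apply: sqint_ext => x; rewrite mulN1r. Qed.

Lemma sqintB f g : sqint f -> sqint g -> sqint (fun x => f x - g x).
Proof. by move=> sf sg; apply: sqintD => //; exact: sqintN. Qed.

Lemma sqint0 : sqint (fun=> 0).
Proof. by apply/sqintP; split=> //; apply: intg_ext intg0 => x; rewrite expr0n. Qed.

Lemma sqint_sum (I : Type) (s : seq I) (F : I -> X -> R) :
  (forall i, sqint (F i)) -> sqint (fun x => \sum_(i <- s) F i x).
Proof.
move=> Fi; elim: s => [|i s ih].
  by apply: sqint_ext sqint0 => x; rewrite big_nil.
by apply: sqint_ext (sqintD (Fi i) ih) => x; rewrite big_cons.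
Qed.

Lemma sqint_norm f : sqint f -> sqint (fun x => `|f x|).
Proof.
move=> sf; apply: (sqint_dom _ sf); first exact: measurableT_comp sf.1.
by move=> x; rewrite normr_id.
Qed.

Lemma sqintMb f g c : sqint f -> measurable_fun setT g ->
  (forall x, `|g x| <= c) -> sqint (fun x => g x * f x).
Proof.
move=> sf mg gc; apply: (sqint_dom _ (sqintZ c sf)).
  by apply: measurable_funM => //; exact: sf.1.
move=> x; rewrite !normrM ler_wpM2r//; apply: (le_trans (gc x)); exact: ler_norm.
Qed.

(** The squared L2 norm. No square root is taken, so the triangle inequality appears below with
    factors 2 ([sqn_leD], [sqn_tri]). *)
Definition sqn f := Ex (fun x => f x ^+ 2).

Lemma sqnE f : sqint f -> (\int[mu]_x ((f x) ^+ 2)%:E)%E = (sqn f)%:E.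
Proof. by move=> /sqintP[_ fi]; exact: ExE. Qed.

Lemma sqn_ge0 f : 0 <= sqn f.
Proof. by apply: Ex_ge0 => x; exact: sqr_ge0. Qed.

Lemma sqn_ext f g : f =1 g -> sqn f = sqn g.
Proof. by move=> /funext ->. Qed.

Lemma sqnZ c f : sqint f -> sqn (fun x => c * f x) = c ^+ 2 * sqn f.
Proof.
move=> /sqintP[_ fi]; rewrite /sqn -ExZ//.
by apply: Ex_ext => x; rewrite exprMn.
Qed.

Lemma sqnD f g : sqint f -> sqint g ->
  sqn (fun x => f x + g x) = sqn f + sqn g + 2 * Ex (fun x => f x * g x).
Proof.
move=> sf sg; have [_ fi] := (sqintP f).1 sf; have [_ gi] := (sqintP g).1 sg.
rewrite /sqn -ExZ ?sqintM// -!ExD//; last 2 first.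
- exact: intgD.
- by apply: intgZ; exact: sqintM.
by apply: Ex_ext => x; ring.
Qed.

Lemma sqnB f g : sqint f -> sqint g ->
  sqn (fun x => f x - g x) = sqn f + sqn g - 2 * Ex (fun x => f x * g x).
Proof.
move=> sf sg; rewrite sqnD//; last exact: sqintN.
congr (_ + _ + _); first by apply: Ex_ext => x; rewrite sqrrN.
rewrite -mulrN; congr (_ * _); rewrite -ExN ?sqintM//.
by apply: Ex_ext => x; rewrite mulrN.
Qed.

Lemma sqn_leD f g : sqint f -> sqint g ->
  sqn (fun x => f x + g x) <= 2 * sqn f + 2 * sqn g.
Proof.
move=> sf sg; have [_ fi] := (sqintP f).1 sf; have [_ gi] := (sqintP g).1 sg.
rewrite /sqn -!ExZ// -ExD; [|exact: intgZ|exact: intgZ].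
apply: Ex_le; first by have /sqintP[] := sqintD sf sg.
  by apply: intgD; exact: intgZ.
by move=> x; have := sqr_ge0 (f x - g x); nra.
Qed.

Lemma sqnN f : sqn (fun x => - f x) = sqn f.
Proof. by apply: Ex_ext => x; rewrite sqrrN. Qed.

Lemma sqn_leB f g : sqint f -> sqint g ->
  sqn (fun x => f x - g x) <= 2 * sqn f + 2 * sqn g.
Proof.
by move=> sf sg; rewrite -(sqnN g); apply: sqn_leD => //; exact: sqintN.
Qed.

Lemma sqnBC f g : sqn (fun x => f x - g x) = sqn (fun x => g x - f x).
Proof. by apply: Ex_ext => x; rewrite -sqrrN opprB. Qed.

Lemma sqn_tri g f h : sqint f -> sqint g -> sqint h ->
  sqn (fun x => f x - h x) <=
  2 * sqn (fun x => f x - g x) + 2 * sqn (fun x => g x - h x).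
Proof.
move=> sf sg sh; rewrite (@sqn_ext _ (fun x => (f x - g x) + (g x - h x))).
  by apply: sqn_leD; exact: sqintB.
by move=> x; ring.
Qed.

Lemma sqn_le f g : sqint f -> sqint g -> (forall x, `|f x| <= `|g x|) ->
  sqn f <= sqn g.
Proof.
move=> /sqintP[_ fi] /sqintP[_ gi] fg; apply: Ex_le => // x.
rewrite -(real_normK (num_real (f x))) -(real_normK (num_real (g x))).
by rewrite lerXn2r// nnegrE.
Qed.

(** The squared norm of f - t g is nonnegative for every t: t = b / C is the minimiser, and for C =
    0 the expression is affine in t, so that t = (A + 1) / b forces b = 0. *)
Lemma cauchy_schwarz f g : sqint f -> sqint g ->
  (Ex (fun x => f x * g x)) ^+ 2 <= sqn f * sqn g.
Proof.
move=> sf sg; set b := Ex _; set A := sqn f; set C := sqn g.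
have key t : 0 <= A + t ^+ 2 * C - 2 * (t * b).
  rewrite -(sqnZ t sg) /b -(ExZ t); last exact: sqintM.
  rewrite (@Ex_ext _ (fun x => f x * (t * g x))); last by move=> x; ring.
  by rewrite -sqnB ?sqn_ge0//; exact: sqintZ.
have C0 : 0 <= C := sqn_ge0 g.
have A0 : 0 <= A := sqn_ge0 f.
have [C_eq0|C_neq0] := eqVneq C 0.
  rewrite C_eq0 mulr0; have := key (A / b).
  rewrite C_eq0 mulr0 addr0; have [->|b0] := eqVneq b 0; first by rewrite expr0n.
  have := key ((A + 1) / b); rewrite C_eq0 mulr0 addr0 divfK//; lra.
have := key (b / C).
rewrite (_ : A + _ - _ = (A * C - b ^+ 2) / C); last by field.
by rewrite pmulr_lge0 ?subr_ge0// invr_gt0 lt_neqAle eq_sym C_neq0.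
Qed.

Lemma Ex_eq0_ae f : intg f -> (forall x, 0 <= f x) -> Ex f = 0 ->
  {ae mu, forall x, f x = 0}.
Proof.
move=> fi f0 Ef; have mf := intg_meas fi.
have : (\int[mu]_x `|(f x)%:E| = 0)%E.
  by under eq_integral do rewrite /= ger0_norm//; rewrite ExE// Ef.
have mEf : measurable_fun setT (EFin \o f) by exact/measurable_EFinP.
move=> /(ae_eq_integral_abs mu measurableT mEf).
by apply: filterS => x /(_ Logic.I) [].
Qed.

Lemma sqn_eq0_ae f : sqint f -> sqn f = 0 -> {ae mu, forall x, f x = 0}.
Proof.
move=> /sqintP[_ fi] f0; have := Ex_eq0_ae fi (fun x => sqr_ge0 (f x)) f0.
by apply: filterS => x /eqP; rewrite sqrf_eq0 => /eqP.
Qed.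

Definition sq_cvg (f_ : nat -> X -> R) f :=
  sqn (fun x => f x - f_ k x) @[k --> \oo] --> 0.

(** Passes between extended-real limits of integrals and limits of real norms. If the integrals tend
    to 0 they are finite from some index N on, and f = (f - f_N) + f_N is then square-integrable. *)
Lemma sq_cvgE (f_ : nat -> X -> R) f :
  (forall k, sqint (f_ k)) -> measurable_fun setT f ->
  (\int[mu]_x ((f x - f_ k x) ^+ 2)%:E)%E @[k --> \oo] --> 0%E <->
  sqint f /\ sq_cvg f_ f.
Proof.
move=> fk mf; split=> [|[sf f0]]; last first.
  apply/fine_cvgP; split; last exact: f0.
  by near=> k; rewrite sqnE//; exact: sqintB.
move=> /fine_cvgP[[N _ Nf] f0]; split; last exact: f0.
have /= := Nf N (leqnn N); set I := (\int[mu]_x _)%E => Ifin.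
have sN : sqint (fun x => f x - f_ N x).
  split; first by apply: measurable_funB => //; exact: (fk N).1.
  by rewrite -/I ltey_eq Ifin.
by apply: sqint_ext (sqintD sN (fk N)) => x; ring.
Unshelve. all: by end_near. Qed.

Lemma sq_cvg_inner (f_ : nat -> X -> R) f h : (forall k, sqint (f_ k)) ->
  sqint f -> sqint h -> sq_cvg f_ f ->
  Ex (fun x => h x * f_ k x) @[k --> \oo] --> Ex (fun x => h x * f x).
Proof.
move=> fk sf sh f0; apply/cvgrPdist_lt => e e0.
(* The 1 keeps the denominator positive when h vanishes. *)
have e1 : 0 < e ^+ 2 / (sqn h + 1).
  by rewrite divr_gt0 ?exprn_gt0// ltr_wpDl ?sqn_ge0.
near=> k.
have sd : sqint (fun x => f x - f_ k x) by exact: sqintB.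
rewrite -ExB; [|exact: sqintM|exact: sqintM].
rewrite (@Ex_ext _ (fun x => h x * (f x - f_ k x))); last by move=> x; ring.
rewrite -(ltr_pXn2r (n := 2))// ?nnegrE ?(ltW e0)//.
rewrite real_normK ?num_real//.
apply: (le_lt_trans (cauchy_schwarz sh sd)).
have : sqn (fun x => f x - f_ k x) < e ^+ 2 / (sqn h + 1).
  near: k; move/cvgr0Pnorm_lt : f0 => /(_ _ e1); apply: filterS => k /=.
  by apply: le_lt_trans; exact: ler_norm.
rewrite ltr_pdivlMr ?ltr_wpDl ?sqn_ge0//.
have := sqn_ge0 h; have := sqn_ge0 (fun x => f x - f_ k x); nra.
Unshelve. all: by end_near. Qed.

(** The squared norm of f_k is that of f - f_k, plus twice the inner product of f and f_k, minus the
    squared norm of f; the middle term converges by [sq_cvg_inner]. *)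
Lemma sq_cvg_sqn (f_ : nat -> X -> R) f : (forall k, sqint (f_ k)) ->
  sqint f -> sq_cvg f_ f -> sqn (f_ k) @[k --> \oo] --> sqn f.
Proof.
move=> fk sf f0.
have -> : (fun k => sqn (f_ k)) = (fun k => sqn (fun x => f x - f_ k x)
    + (Ex (fun x => f x * f_ k x) *+ 2 - sqn f)).
  apply/funext => k; rewrite sqnB//; ring.
rewrite -[X in _ --> X]add0r; apply: cvgD => //.
rewrite [X in _ --> X](_ : _ = sqn f *+ 2 - sqn f); last by ring.
apply: cvgB; last exact: cvg_cst.
by under eq_fun do rewrite mulr2n; rewrite mulr2n; apply: cvgD;
  exact: sq_cvg_inner.
Qed.

Lemma sq_cvgD (f_ g_ : nat -> X -> R) f g :
  (forall k, sqint (f_ k)) -> (forall k, sqint (g_ k)) ->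
  sqint f -> sqint g -> sq_cvg f_ f -> sq_cvg g_ g ->
  sq_cvg (fun k x => f_ k x + g_ k x) (fun x => f x + g x).
Proof.
move=> fk gk sf sg f0 g0.
apply: (@squeeze_cvgr _ _ _ _ (fun=> 0) (fun k =>
   2 * sqn (fun x => f x - f_ k x) + 2 * sqn (fun x => g x - g_ k x))).
- near=> k; rewrite sqn_ge0/=.
  rewrite (@sqn_ext _ (fun x => (f x - f_ k x) + (g x - g_ k x))).
    by apply: sqn_leD; exact: sqintB.
  by move=> x; ring.
- exact: cvg_cst.
- rewrite [X in _ --> X](_ : _ = 2 * 0 + 2 * 0); last by ring.
  by apply: cvgD; apply: cvgM => //; exact: cvg_cst.
Unshelve. all: by end_near. Qed.

Lemma sq_cvg_le (f_ : nat -> X -> R) f (u : nat -> R) :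
  (forall k, sqn (fun x => f x - f_ k x) <= u k) -> u @ \oo --> 0 ->
  sq_cvg f_ f.
Proof.
move=> fu u0; apply: (@squeeze_cvgr _ _ _ _ (fun=> 0) u) => //.
  by near=> k; rewrite sqn_ge0/=.
exact: cvg_cst.
Unshelve. all: by end_near. Qed.

Lemma sq_cvg_unique (f_ : nat -> X -> R) f g : (forall k, sqint (f_ k)) ->
  sqint f -> sqint g -> sq_cvg f_ f -> sq_cvg f_ g ->
  {ae mu, forall x, f x = g x}.
Proof.
move=> fk sf sg f0 g0.
have sd : sqint (fun x => f x - g x) by exact: sqintB.
suff /(sqn_eq0_ae sd) : sqn (fun x => f x - g x) = 0.
  by apply: filterS => x /eqP; rewrite subr_eq0 => /eqP.
apply/eqP; rewrite eq_le sqn_ge0 andbT.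
have u0 : 2 * sqn (fun x => f x - f_ k x) + 2 * sqn (fun x => g x - f_ k x)
    @[k --> \oo] --> (0 : R).
  rewrite [X in _ --> X](_ : _ = 2 * 0 + 2 * 0); last by ring.
  by apply: cvgD; apply: cvgM => //; exact: cvg_cst.
rewrite -(cvg_lim _ u0)//; apply: limr_ge; first by apply/cvg_ex; exists 0.
by near=> k; rewrite (sqnBC g); exact: sqn_tri.
Unshelve. all: by end_near. Qed.

(** Completeness from an almost sure limit: Fatou's lemma is applied to (f_(l + k) - f_k)^2, with
    the index shifted by k so that the bound e is valid for every l. *)
Lemma fatou_sqn (f_ : nat -> X -> R) f (k : nat) (e : R) :
  (forall k, sqint (f_ k)) -> measurable_fun setT f ->
  {ae mu, forall x, f_ ^~ x @ \oo --> f x} ->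
  (forall l, (k <= l)%N -> sqn (fun x => f_ l x - f_ k x) <= e) ->
  sqint f /\ sqn (fun x => f x - f_ k x) <= e.
Proof.
move=> fk mf fc fe; pose g l x := ((f_ (l + k)%N x - f_ k x) ^+ 2)%:E.
have mg l : measurable_fun setT (g l).
  by apply/measurable_EFinP/measurable_funX/measurable_funB; exact: (fk _).1.
have mfk : measurable_fun setT (fun x => f x - f_ k x).
  by apply: measurable_funB => //; exact: (fk _).1.
have Ile : (\int[mu]_x ((f x - f_ k x) ^+ 2)%:E <= e%:E)%E.
  have -> : (\int[mu]_x ((f x - f_ k x) ^+ 2)%:E =
      \int[mu]_x limn_einf (g^~ x))%E.
    apply: ae_eq_integral => //.
    - exact/measurable_EFinP/measurable_funX.
    - rewrite (_ : (fun _ => _) = (fun x => - limn_esup (-%E \o g^~ x))%E).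
        apply: measurableT_comp => //.
        apply: measurable_fun_limn_esup => l; exact: measurableT_comp.
      by apply/funext => x; rewrite limn_esupN oppeK.
    - apply: filterS fc => x fx _; apply/esym.
      apply: (cvg_limn_einf_sup _).1; apply/fine_cvgP; split => //=.
        by near=> l.
      rewrite /comp /= expr2; under eq_fun do rewrite expr2.
      have fxk : f_ (l + k)%N x - f_ k x @[l --> \oo] --> f x - f_ k x.
        apply: cvgB; last exact: cvg_cst.
        by rewrite (cvg_shiftn k (f_ ^~ x)).
      exact: cvgM.
  apply: (le_trans (fatou _ measurableT mg _)).
    by move=> n x _; rewrite lee_fin sqr_ge0.
  rewrite limn_einf_lim; apply: lime_le; first exact: is_cvg_einfs.
  near=> n; apply: (@le_trans _ _ (\int[mu]_x g n x)%E).
    by apply: ereal_inf_lbound; exists n => //=.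
  by rewrite sqnE ?lee_fin ?fe ?leq_addl//; exact: sqintB.
have sd : sqint (fun x => f x - f_ k x).
  by split=> //; apply: (le_lt_trans Ile); rewrite ltry.
split; last by rewrite -lee_fin -sqnE.
by apply: sqint_ext (sqintD sd (fk k)) => x; ring.
Unshelve. all: by end_near. Qed.

(** The series of 4^k a_k has integral at most the sum of 2^-k, so it is finite almost everywhere
    and bounds each of its terms. The decay 8^-k in mean is traded for 4^-k pointwise, whose square
    root is still summable. *)
Lemma ae_geometric_bound (a : nat -> X -> \bar R) :
  (forall k, measurable_fun setT (a k)) -> (forall k x, 0 <= a k x)%E ->
  (forall k, \int[mu]_x a k x <= (8 ^- k)%:E)%E ->
  {ae mu, forall x, exists C : R, forall k, (a k x <= (C * 4 ^- k)%:E)%E}.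
Proof.
move=> ma a0 ia; pose g x := (\sum_(0 <= k <oo) ((4 ^+ k)%:E * a k x))%E.
have t0 k x : (0 <= (4 ^+ k)%:E * a k x)%E.
  by rewrite mule_ge0// lee_fin exprn_ge0.
have mt k : measurable_fun setT (fun x => (4 ^+ k)%:E * a k x)%E.
  by apply: emeasurable_funM => //.
have ig : (\int[mu]_x g x < +oo)%E.
  rewrite integral_nneseries//.
  apply: (@le_lt_trans _ _ (\sum_(0 <= k <oo) (2 / (2 ^ (k + 1))%:R)%:E)%E).
    apply: lee_nneseries => [k _ _|k _]; first exact: integral_ge0.
    rewrite ge0_integralZl_EFin ?exprn_ge0//.
    apply: (@le_trans _ _ ((4 ^+ k)%:E * (8 ^- k)%:E)%E).
      by rewrite lee_pmul2l ?lte_fin ?exprn_gt0.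
    rewrite -EFinM lee_fin addn1 expnS natrM invfM mulrA divff// mul1r natrX.
    by rewrite -!exprVn -exprMn (_ : 4 / 8 = 2^-1 :> R)//; field.
  by have /cvg_lim := @cvg_geometric_eseries_half R 2 0; rewrite /eseries => ->//; rewrite ltry.
have mg : measurable_fun setT g by apply: ge0_emeasurable_sum.
have g0 x : (0 <= g x)%E by exact: nneseries_ge0.
have : mu.-integrable setT g.
  apply/integrableP; split => //.
  by under eq_integral do rewrite gee0_abs//.
move=> /(integrable_ae measurableT); apply: filterS => x /(_ Logic.I) gx.
exists (fine (g x)) => k.
have : ((4 ^+ k)%:E * a k x <= (fine (g x))%:E)%E.
  rewrite fineK// /g; apply: le_trans (nneseries_lim_ge k.+1 _) => //.
  by rewrite big_nat_recr//= leeDr// sume_ge0.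
by rewrite EFinM lee_pdivlMr ?exprn_gt0// muleC.
Qed.

End square_integrable.

(** * Rapidly converging sequences and subsequences *)

Section fast_cauchy.
Context {R : realType}.
Implicit Types u : nat -> R.

Lemma geometric_steps_cauchy u (C : R) :
  (forall k, `|u k.+1 - u k| <= C * 2 ^- k) ->
  forall k l, (k <= l)%N -> `|u l - u k| <= 2 * C * 2 ^- k.
Proof.
move=> uC k l /subnK <-; move: (l - k)%N => n; elim: n k => [|n ih] k.
  rewrite add0n subrr normr0 mulr_ge0 ?invr_ge0 ?exprn_ge0//.
  by have := le_trans (normr_ge0 _) (uC 0); rewrite expr0 invr1 mulr1 => ?; rewrite mulr_ge0.
rewrite addSnnS (_ : u _ - u k = (u (n + k.+1)%N - u k.+1) + (u k.+1 - u k)); last by ring.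
apply: (le_trans (ler_normD _ _)); apply: (le_trans (lerD (ih _) (uC _))).
by rewrite exprS invfM le_eqVlt; apply/orP; left; apply/eqP; field; rewrite expf_neq0.
Qed.

Lemma cvg_bound0 (u : nat -> R) (C : R) : (forall k, 0 <= u k <= C * 2 ^- k) ->
  u @ \oo --> 0.
Proof.
move=> uC; apply: (@squeeze_cvgr _ _ _ _ (fun=> 0) (geometric C 2^-1)).
- by near=> k; rewrite /= exprVn uC.
- exact: cvg_cst.
- apply: cvg_geometric; rewrite ger0_norm ?invr_ge0// invf_lt1//; lra.
Unshelve. all: by end_near. Qed.

Lemma geometric_steps_cvg u (C : R) :
  (forall k, `|u k.+1 - u k| <= C * 2 ^- k) ->
  cvgn u /\ forall k, `|limn u - u k| <= 2 * C * 2 ^- k.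
Proof.
move=> uC; have H := geometric_steps_cauchy uC.
have cu : cvgn u.
  apply/cauchy_cvgP/cauchy_exP => _/posnumP[e].
  have /cvgr0Pnorm_lt/(_ _ (gt0 e)) [N _ Ne] : (2 * C * 2 ^- k : R) @[k --> \oo] --> 0.
    apply: (@cvg_bound0 _ (2 * C)) => k; rewrite lexx andbT.
    by apply: le_trans (H k k (leqnn k)); exact: normr_ge0.
  exists (u N); exists N => // l Nl; rewrite /ball /= distrC.
  apply: (le_lt_trans (H _ _ Nl)); apply: le_lt_trans (Ne _ (leqnn N)).
  exact: ler_norm.
split=> // k; have cl : `|u l - u k| @[l --> \oo] --> `|limn u - u k|.
  by apply: cvg_norm; apply: cvgB => //; exact: cvg_cst.
rewrite -(cvg_lim _ cl)//; apply: limr_le; first by apply/cvg_ex; eexists; exact: cl.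
by exists k => // l /= kl; exact: H.
Qed.

End fast_cauchy.

Section subsequence.
Context {R : realType}.

(** [D] is any function of two indices because it will be a multiple of a squared distance, for
    which the triangle inequality fails. The maximum in [s] makes the subsequence strictly
    increasing. *)
Lemma cauchy_fast_subseq (D : nat -> nat -> R) (r : R) : 0 < r ->
  (forall e, 0 < e -> exists N, forall k l, (N <= k)%N -> (N <= l)%N -> D k l <= e) ->
  exists s : nat -> nat, (forall k, (s k < s k.+1)%N) /\
    forall k l, (s k <= l)%N -> forall m, (s k <= m)%N -> D l m <= r ^+ k.
Proof.
move=> r0 DC.
have /choice[N HN] : forall k, exists N, forall l m, (N <= l)%N -> (N <= m)%N -> D l m <= r ^+ k.
  by move=> k; apply: DC; rewrite exprn_gt0.
pose s := fix s k := if k is k'.+1 then maxn (s k').+1 (N k) else N 0%N.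
exists s; split=> [k|k l skl m skm]; first by rewrite /= leq_max leqnn.
have Ns : (N k <= s k)%N by case: k {skl skm} => //= k; rewrite leq_maxr.
by apply: HN; [exact: leq_trans skl|exact: leq_trans skm].
Qed.

Lemma subseq_ge (s : nat -> nat) : (forall k, (s k < s k.+1)%N) ->
  forall k, (k <= s k)%N.
Proof. by move=> si; elim=> // k ih; exact: leq_ltn_trans (si k). Qed.

Lemma subseq_le (s : nat -> nat) : (forall k, (s k < s k.+1)%N) ->
  forall k l, (k <= l)%N -> (s k <= s l)%N.
Proof.
move=> si k l /subnK <-; elim: (l - k)%N => [|n ih]; first by rewrite add0n.
by rewrite addSn; apply: (leq_trans ih); exact: ltnW.
Qed.

End subsequence.

(** * Probability spaces and independence *)

Section probability_space.
Context {d : measure_display} {X : measurableType d} {R : realType}.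
Variable P : probability X R.
Implicit Types (f g h : X -> R) (c : R).

Lemma intg_cst c : intg P (fun=> c).
Proof. exact: finite_measure_integrable_cst. Qed.

Lemma Ex_cst c : Ex P (fun=> c) = c.
Proof.
by rewrite /Ex Rintegral_cst//= probability_setT mulr1.
Qed.

Lemma sqint_cst c : sqint P (fun=> c).
Proof. by apply/sqintP; split=> //; exact: intg_cst. Qed.

Lemma sqint_intg f : sqint P f -> intg P f.
Proof.
move=> sf; apply: intg_ext (sqintM sf (sqint_cst 1)) => x; exact: mulr1.
Qed.

Lemma bounded_sqint f c : measurable_fun setT f -> (forall x, `|f x| <= c) ->
  sqint P f.
Proof.
move=> mf fc; apply: (sqint_dom mf (sqint_cst c)) => x.
by rewrite (le_trans (fc x))// ler_norm.
Qed.

Lemma bounded_intg f c : measurable_fun setT f -> (forall x, `|f x| <= c) ->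
  intg P f.
Proof. by move=> mf fc; apply: sqint_intg; exact: bounded_sqint fc. Qed.

Lemma Ex_bound f c : intg P f -> (forall x, `|f x| <= c) -> `|Ex P f| <= c.
Proof.
move=> fi fc; rewrite ler_norml; apply/andP; split.
  rewrite -[leLHS]Ex_cst; apply: Ex_le => //; first exact: intg_cst.
  by move=> x; have := fc x; rewrite ler_norml => /andP[].
rewrite -[leRHS]Ex_cst; apply: Ex_le => //; first exact: intg_cst.
by move=> x; have := fc x; rewrite ler_norml => /andP[].
Qed.

(** The variance is at most the second moment. In the representation theorem this replaces the
    unknown constant of an approximation by the expectation. *)
Lemma sqn_center f : sqint P f -> sqn P (fun x => f x - Ex P f) <= sqn P f.
Proof.
move=> sf; have fi := sqint_intg sf.
rewrite sqnB//; last exact: sqint_cst.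
rewrite [X in _ + X - _]Ex_cst.
have -> : Ex P (fun x => f x * Ex P f) = Ex P f * Ex P f.
  by rewrite -ExZ//; apply: Ex_ext => x; rewrite mulrC.
by have := sqr_ge0 (Ex P f); lra.
Qed.

Lemma bounded_cvg_sq (f_ : nat -> X -> R) f c :
  (forall k, measurable_fun setT (f_ k)) -> measurable_fun setT f ->
  (forall k x, `|f_ k x| <= c) -> {ae P, forall x, f_ ^~ x @ \oo --> f x} ->
  sqint P f /\ sq_cvg P f_ f.
Proof.
move=> mf_ mf fc ff.
have sf_ k : sqint P (f_ k) by exact: bounded_sqint (fc k).
(* Convergence holds only almost everywhere, and so does the bound inherited by f; its
   square-integrability therefore comes from comparing integrals. *)
have aec : {ae P, forall x, `|f x| <= c}.
  apply: filterS ff => x fx; rewrite -(cvg_lim _ (cvg_norm fx))//.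
  apply: limr_le; last by near=> k.
  by apply/cvg_ex; eexists; exact: cvg_norm fx.
have c0 : 0 <= c by have := fc 0 point; exact: le_trans.
have sf : sqint P f.
  split=> //; apply: (@le_lt_trans _ _ (\int[P]_x (c ^+ 2)%:E)%E); last first.
    by rewrite integral_cst//= probability_setT mule1 ltry.
  apply: ae_ge0_le_integral => //.
  - by move=> x _; rewrite lee_fin sqr_ge0.
  - exact/measurable_EFinP/measurable_funX.
  - by move=> x _; rewrite lee_fin sqr_ge0.
  - apply: filterS aec => x fxc _; rewrite lee_fin.
    by rewrite -(real_normK (num_real (f x))) lerXn2r// nnegrE.
split=> //.
have mdk k : measurable_fun setT (fun x => (f x - f_ k x) ^+ 2).
  by apply/measurable_funX/measurable_funB.
have [//||||//|_ _ H] := @dominated_convergence _ _ _ P setT measurableT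
  (fun k x => ((f x - f_ k x) ^+ 2)%:E) (fun=> 0%E) (fun=> ((2 * c) ^+ 2)%:E).
- by move=> k; exact/measurable_EFinP.
- exact: measurable_cst.
- apply: filterS ff => x fx _; apply/fine_cvgP; split; first by near=> k.
  rewrite /comp /=; under eq_fun do rewrite expr2.
  have d0 : f x - f_ k x @[k --> \oo] --> 0.
    by rewrite -(subrr (f x)); apply: cvgB => //; exact: cvg_cst.
  have d1 := cvgM d0 d0; rewrite mulr0 in d1; exact: d1.
- exact: intg_cst.
- apply: filterS aec => x fxc k _ /=; rewrite lee_fin normrX.
  rewrite lerXn2r ?nnegrE ?mulr_ge0// (le_trans (ler_normB _ _))//.
  by rewrite mulr2n mulrDl mul1r lerD.
by move: H => /=; rewrite integral0 => /fine_cvgP[_].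
Unshelve. all: by end_near. Qed.

End probability_space.

Section independence.
Context {d : measure_display} {X : measurableType d} {R : realType}.
Variable P : probability X R.

(** The sets A satisfying the product rule with C are stable under proper differences and increasing
    unions, so a pi-system suffices. Used for each side in turn it gives [pi_indep]. *)
Lemma pi_indep1 (G : set (set X)) (C : set X) : setI_closed G ->
  G `<=` measurable -> measurable C ->
  (forall A, G A -> P (A `&` C) = (P A * P C)%E) ->
  forall A, <<s G >> A -> P (A `&` C) = (P A * P C)%E.
Proof.
move=> GI Gm mC GC.
suff : <<s G >> `<=` [set A | measurable A /\ P (A `&` C) = (P A * P C)%E].
  by move=> H A /H[].
apply: lambda_system_subset => //; last by move=> A GA; split; [exact: Gm|exact: GC].
split => //.
- split; first exact: measurableT.
  by rewrite setTI probability_setT mul1e.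
- move=> A B BA [mA PA] [mB PB]; split; first exact: measurableD.
  have mAC := measurableI _ _ mA mC; have mBC := measurableI _ _ mB mC.
  have PBC : P (B `&` C) \is a fin_num by exact: fin_num_measure.
  have PB' : P B \is a fin_num by exact: fin_num_measure.
  rewrite [in RHS]measureD// ?ltey_eq ?fin_num_measure//.
  rewrite (_ : (A `\` B) `&` C = (A `&` C) `\` (B `&` C)); last first.
    apply/seteqP; split=> [x [[Ax Bx] Cx]|x [[Ax Cx] BCx]]; split=> //.
    - by move=> [].
    - by split=> // Bx; apply: BCx.
  rewrite measureD// ?ltey_eq ?fin_num_measure//.
  rewrite (_ : A `&` C `&` (B `&` C) = B `&` C); last first.
    by apply/seteqP; split=> [x [_ []]|x [Bx Cx]]; [|split; split=> //; exact: BA].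
  transitivity (P A * P C - P B * P C)%E; first by congr (_ - _)%E.
  rewrite -muleBl ?fin_num_measure//; first by rewrite (setIidr BA).
  by rewrite fin_num_adde_defl// fin_numN fin_num_measure.
- move=> F ndF FH; split; first by apply: bigcupT_measurable => n; case: (FH n).
  have mF n : measurable (F n) by case: (FH n).
  have mFC n : measurable (F n `&` C) by exact: measurableI.
  have c1 : P (F n `&` C) @[n --> \oo] --> P (\bigcup_n (F n `&` C)).
    apply: nondecreasing_cvg_mu => //; first exact: bigcupT_measurable.
    move=> m n mn; have /subsetPset FF := ndF _ _ mn.
    by apply/subsetPset => x [Fx Cx]; split=> //; exact: FF.
  have c2 : (P (F n) * P C)%E @[n --> \oo] --> (P (\bigcup_n F n) * P C)%E.
    apply: cvgeZr; first exact: fin_num_measure.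
    by apply: nondecreasing_cvg_mu => //; exact: bigcupT_measurable.
  have E : (fun n => P (F n `&` C)) = (fun n => P (F n) * P C)%E.
    by apply/funext => n; case: (FH n).
  rewrite -E in c2; rewrite setI_bigcupl.
  exact: (cvg_unique (@ereal_hausdorff R) c1 c2).
Qed.

Lemma pi_indep (G H : set (set X)) : setI_closed G -> setI_closed H ->
  G `<=` measurable -> H `<=` measurable ->
  (forall A C, G A -> H C -> P (A `&` C) = (P A * P C)%E) ->
  independent_algebras P <<s G >> <<s H >>.
Proof.
move=> GI HI Gm Hm GH A C GA HC.
have sm (K : set (set X)) : K `<=` measurable -> <<s K >> `<=` measurable.
  by move=> Km; apply: smallest_sub => //; exact: sigma_algebra_measurable.
rewrite setIC muleC; apply: (pi_indep1 HI) HC => //; first exact: sm GA.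
move=> D HD; rewrite setIC muleC; apply: (pi_indep1 GI) GA => //; first exact: Hm.
by move=> E GE; exact: GH.
Qed.

(** The target spaces are general because [freeze] needs the pair (H, B_u) to be independent of an
    increment. *)
Definition indep_maps {d1 d2 : measure_display} {T1 : measurableType d1}
    {T2 : measurableType d2} (U : X -> T1) (V : X -> T2) :=
  forall A C, measurable A -> measurable C ->
    P (U @^-1` A `&` V @^-1` C) = (P (U @^-1` A) * P (V @^-1` C))%E.

Section joint_law.
Context {d1 d2 : measure_display} {T1 : measurableType d1}
  {T2 : measurableType d2}.
Variables (U : {mfun X >-> T1}) (V : {mfun X >-> T2}).
Hypothesis UV : indep_maps U V.

Let W : X -> T1 * T2 := fun w => (U w, V w).

Let mW : measurable_fun setT W.
Proof. by apply: measurable_fun_pair; exact: measurable_funPT. Qed.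

Lemma joint_lawE (A : set (T1 * T2)) : measurable A ->
  pushforward P W A = (distribution P U \x distribution P V)%E A.
Proof.
move=> mA.
pose Wm : {mfun X >-> (T1 * T2)%type} := mfun_Sub (mem_set mW).
rewrite (@product_measure_unique _ _ _ _ _ (distribution P U)
  (distribution P V) (distribution P Wm))//.
Qed.

Lemma joint_law_ge0 (g : T1 * T2 -> \bar R) : measurable_fun setT g ->
  (forall z, 0 <= g z)%E ->
  (\int[P]_w g (U w, V w) = \int[P]_w \int[P]_v g (U w, V v))%E.
Proof.
move=> mg g0.
transitivity (\int[pushforward P W]_z g z)%E.
  by rewrite ge0_integral_pushforward.
rewrite (eq_measure_integral (distribution P U \x distribution P V)%E); last first.
  by move=> A mA _; exact: joint_lawE.
rewrite fubini_tonelli1// /fubini_F.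
have mF : measurable_fun setT (fun x => \int[distribution P V]_y g (x, y))%E.
  exact: measurable_fun_fubini_tonelli_F.
rewrite ge0_integral_pushforward//=; last by move=> x _; exact: integral_ge0.
apply: eq_integral => w _ /=; rewrite ge0_integral_pushforward//=.
exact: measurableT_comp.
Qed.

Lemma joint_law_Ex (g : T1 * T2 -> R) : measurable_fun setT g ->
  intg P (fun w => g (U w, V w)) ->
  (forall w, intg P (fun v => g (U w, V v))) ->
  intg P (fun w => Ex P (fun v => g (U w, V v))) /\
  Ex P (fun w => g (U w, V w)) = Ex P (fun w => Ex P (fun v => g (U w, V v))).
Proof.
move=> mg gi giw.
have fiwE h w : intg P (fun v => h (g (U w, V v))) ->
    (\int[P]_v (h (g (U w, V v)))%:E = (Ex P (fun v => h (g (U w, V v))))%:E)%E.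
  by move=> hi; rewrite ExE.
(* [h] is the positive or the negative part: Tonelli applies to each of them, and integrability lets
   them be subtracted. *)
have giE (h : R -> R) : (forall x, 0 <= h x <= `|x|) -> measurable_fun setT h ->
    [/\ intg P (fun w => h (g (U w, V w))),
     (forall w, intg P (fun v => h (g (U w, V v)))),
     intg P (fun w => Ex P (fun v => h (g (U w, V v)))) &
     Ex P (fun w => h (g (U w, V w))) = Ex P (fun w => Ex P (fun v => h (g (U w, V v))))].
  move=> h0 mh.
  have mhg : measurable_fun setT (fun z => h (g z)) by exact: measurableT_comp.
  have hi : intg P (fun w => h (g (U w, V w))).
    apply: (intg_dom _ (g := fun w => `|g (U w, V w)|)).
    - exact: (measurableT_comp mhg mW).
    - exact: integrable_norm gi.
    - by move=> w; have /andP[? ?] := h0 (g (U w, V w)); rewrite ger0_norm.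
  have hiw w : intg P (fun v => h (g (U w, V v))).
    apply: (intg_dom _ (g := fun v => `|g (U w, V v)|)).
    - apply: (measurableT_comp mhg); apply: measurable_fun_pair => //.
    - exact: integrable_norm (giw w).
    - by move=> v; have /andP[? ?] := h0 (g (U w, V v)); rewrite ger0_norm.
  have hE : (\int[P]_w (h (g (U w, V w)))%:E =
      \int[P]_w (Ex P (fun v => h (g (U w, V v))))%:E)%E.
    rewrite (@joint_law_ge0 (fun z => (h (g z))%:E)).
    - by apply: eq_integral => w _; rewrite -fiwE.
    - exact/measurable_EFinP.
    - by move=> z; rewrite lee_fin; have /andP[] := h0 (g z).
  split=> //; last by rewrite /Ex /Rintegral hE.
  apply: intg_lty; last by rewrite -hE ExE// ltry.
  - apply/measurable_EFinP.
    have : measurable_fun setT ((fun x => \int[distribution P V]_y (h (g (x, y)))%:E)%E \o U).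
      apply: measurableT_comp; last exact: measurable_funPT.
      apply: (@measurable_fun_fubini_tonelli_F _ _ _ _ _ _ (fun z => (h (g z))%:E)).
        exact/measurable_EFinP.
      by move=> z; rewrite lee_fin; have /andP[] := h0 (g z).
    congr (measurable_fun _ _); apply/funext => w /=.
    rewrite ge0_integral_pushforward//=; last first.
    - by move=> y _; rewrite lee_fin; have /andP[] := h0 (g (U w, y)).
    - apply/measurable_EFinP.
      exact: (measurableT_comp mhg (pair1_measurable (U w))).
    exact: fiwE.
  - by move=> w; apply: Ex_ge0 => v; have /andP[] := h0 (g (U w, V v)).
have [|//|p1 p2 p3 p4] := giE (fun x => Num.max x 0).
  by move=> x; rewrite le_max lexx orbT/= ge_max normr_ge0 ler_norm.
  exact: measurable_maxr.
have [|//|n1 n2 n3 n4] := giE (fun x => Num.max (- x) 0).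
  by move=> x; rewrite le_max lexx orbT/= ge_max normr_ge0 -normrN ler_norm.
  by apply: measurable_maxr => //; exact: measurable_funN.
have gE x : x = Num.max x 0 - Num.max (- x) 0 :> R.
  by case: (lerP x 0) => x0; [rewrite (max_l _) ?oppr_ge0// opprK add0r|rewrite (max_r _) ?oppr_le0 ?subr0 ?ltW].
have GE w : Ex P (fun v => g (U w, V v)) =
    Ex P (fun v => Num.max (g (U w, V v)) 0) - Ex P (fun v => Num.max (- g (U w, V v)) 0).
  by rewrite -ExB//; apply: Ex_ext => v; exact: gE.
split; first by apply: intg_ext (intgB p3 n3) => w; rewrite GE.
transitivity (Ex P (fun w => Num.max (g (U w, V w)) 0 - Num.max (- g (U w, V w)) 0)).
  by apply: Ex_ext => w; exact: gE.
rewrite (Ex_ext P GE) ExB// p4 n4; exact: esym (ExB p3 n3).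
Qed.

End joint_law.

(** Integrability of the product is part of the conclusion: Tonelli for |f g| under the joint law
    gives the product of the means of |f| and |g|. *)
Lemma Ex_indep (f g : X -> R) : indep_maps f g -> intg P f -> intg P g ->
  intg P (fun w => f w * g w) /\ Ex P (fun w => f w * g w) = Ex P f * Ex P g.
Proof.
move=> fg fi gi; have mf := intg_meas fi; have mg := intg_meas gi.
pose U : {mfun X >-> R} := mfun_Sub (mem_set mf).
pose V : {mfun X >-> R} := mfun_Sub (mem_set mg).
have mm : measurable_fun setT (fun z : R * R => z.1 * z.2).
  by apply: measurable_funM; [exact: measurable_fst|exact: measurable_snd].
have inw (w : X) : intg P (fun v => f w * g v) by exact: intgZ.
have fgi : intg P (fun w => f w * g w).
  apply/integrableP; split; first by apply/measurable_EFinP; exact: measurable_funM.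
  have := @joint_law_ge0 _ _ _ _ U V fg (fun z => `|(z.1 * z.2)%:E|)%E.
  move=> /= ->; last 2 first.
  - by apply/measurable_EFinP; apply: measurableT_comp.
  - by move=> z; rewrite lee_fin.
  have ni := integrable_norm fi; have nj := integrable_norm gi.
  under eq_integral => w _.
    under eq_integral do rewrite normrM.
    rewrite ExE; last exact: intgZ.
    rewrite ExZ// mulrC; over.
  by rewrite ExE ?ltry//; exact: intgZ.
split=> //; have [_ ->] := @joint_law_Ex _ _ _ _ U V fg _ mm fgi inw.
rewrite mulrC -ExZ//; apply: Ex_ext => w /=; rewrite ExZ// mulrC//.
Qed.

End independence.

(** * Doob's maximal inequality along a path *)

Section doob_pathwise.
Context {R : realType}.
Implicit Types s : nat -> R.

Fixpoint runmax s (n : nat) : R :=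
  if n is n'.+1 then Num.max (runmax s n') (s n) else s 0%N.

Lemma runmax_ge s n i : (i <= n)%N -> s i <= runmax s n.
Proof.
elim: n => [|n ih]; first by rewrite leqn0 => /eqP ->.
by rewrite leq_eqVlt => /predU1P[->|/ih H] /=; rewrite le_max ?lexx ?H ?orbT.
Qed.

Lemma runmax_ge0 s n : (forall i, 0 <= s i) -> 0 <= runmax s n.
Proof. by move=> s0; apply: le_trans (s0 0%N) (runmax_ge _ (leq0n n)). Qed.

(* The pathwise form of Doob's L2 inequality: the sum is a discrete integral of a
   predictable process, whose expectation is nonnegative for a submartingale. *)
Lemma doob_pathwise s n :
  runmax s n ^+ 2 + 4 * (\sum_(0 <= i < n) runmax s i * (s i.+1 - s i))
  <= 4 * s n ^+ 2.
Proof.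
(* This sharper form is preserved by induction, as long as the maximum m does not change even with
   the same increment on both sides; the claim follows from it by (m - 2 s_n)^2 >= 0. *)
suff : runmax s n ^+ 2 + 2 * (\sum_(0 <= i < n) runmax s i * (s i.+1 - s i))
    <= 2 * (s n * runmax s n).
  by have := sqr_ge0 (runmax s n - 2 * s n); nra.
elim: n => [|n]; first by rewrite big_geq//=; have := sqr_ge0 (s 0%N); nra.
rewrite big_nat_recr//=; set S := \sum_(_ <= _ < _) _; set m := runmax s n.
case: (lerP (s n.+1) m) => sm ih.
  by nra.
by have := sqr_ge0 (s n.+1 - m); nra.
Qed.

End doob_pathwise.

Lemma dominated_sq (d : measure_display) (X : measurableType d) (R : realType)
    (mu : {measure set X -> \bar R}) (f_ : nat -> X -> R) (f g : X -> R) :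
  (forall k, measurable_fun setT (f_ k)) -> measurable_fun setT f -> sqint mu g ->
  {ae mu, forall x k, `|f x - f_ k x| <= `|g x|} ->
  {ae mu, forall x, f_ ^~ x @ \oo --> f x} -> sq_cvg mu f_ f.
Proof.
move=> mf_ mf sg fg ff.
have mdk k : measurable_fun setT (fun x => (f x - f_ k x) ^+ 2).
  by apply/measurable_funX/measurable_funB.
have [//||||//|_ _ H] := @dominated_convergence _ _ _ mu setT measurableT
  (fun k x => ((f x - f_ k x) ^+ 2)%:E) (fun=> 0%E) (fun x => ((g x) ^+ 2)%:E).
- by move=> k; exact/measurable_EFinP.
- exact: measurable_cst.
- apply: filterS ff => x fx _; apply/fine_cvgP; split; first by near=> k.
  rewrite /comp /=; under eq_fun do rewrite expr2.
  have d0 : f x - f_ k x @[k --> \oo] --> 0.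
    by rewrite -(subrr (f x)); apply: cvgB => //; exact: cvg_cst.
  have d1 := cvgM d0 d0; rewrite mulr0 in d1; exact: d1.
- exact: ((sqintP mu g).1 sg).2.
- apply: filterS fg => x fxc k _ /=; rewrite lee_fin normrX -(real_normK (num_real (g x))).
  by rewrite lerXn2r ?nnegrE.
by move: H => /=; rewrite integral0 => /fine_cvgP[_].
Unshelve. all: by end_near. Qed.

(** * Measurability with respect to a sigma-algebra *)

Section measurable_wrt_theory.
Context {R : realType} {d : measure_display} {Omega : measurableType d}.
Variable G : set (set Omega).
Hypothesis sG : sigma_algebra setT G.
Implicit Types X Y : Omega -> R.

Lemma mwrt_id : @measurable _ (g_sigma_algebraType G) = G.
Proof. exact: sigma_algebra_id. Qed.

(** The members of the filtration are plain families of sets; taking one as the measurable structure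
    of Omega makes the usual closure properties available. *)
Lemma mwrtP X : measurable_wrt G X <->
  measurable_fun (setT : set (g_sigma_algebraType G)) X.
Proof.
split=> [GX _ C mC|mX C mC]; first by rewrite setTI mwrt_id; exact: GX.
by have := mX measurableT C mC; rewrite setTI mwrt_id.
Qed.

Lemma mwrt_comp X (h : R -> R) : measurable_fun setT h -> measurable_wrt G X ->
  measurable_wrt G (fun w => h (X w)).
Proof. by move=> mh /mwrtP mX; apply/mwrtP; exact: measurableT_comp mX. Qed.

Lemma mwrt_cst (c : R) : measurable_wrt G (fun=> c).
Proof. by apply/mwrtP; exact: measurable_cst. Qed.

Lemma mwrtD X Y : measurable_wrt G X -> measurable_wrt G Y ->
  measurable_wrt G (fun w => X w + Y w).
Proof. by move=> /mwrtP mX /mwrtP mY; apply/mwrtP; exact: measurable_funD. Qed.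

Lemma mwrtB X Y : measurable_wrt G X -> measurable_wrt G Y ->
  measurable_wrt G (fun w => X w - Y w).
Proof. by move=> /mwrtP mX /mwrtP mY; apply/mwrtP; exact: measurable_funB. Qed.

Lemma mwrtM X Y : measurable_wrt G X -> measurable_wrt G Y ->
  measurable_wrt G (fun w => X w * Y w).
Proof. by move=> /mwrtP mX /mwrtP mY; apply/mwrtP; exact: measurable_funM. Qed.

Lemma mwrt_max X Y : measurable_wrt G X -> measurable_wrt G Y ->
  measurable_wrt G (fun w => Num.max (X w) (Y w)).
Proof. by move=> /mwrtP mX /mwrtP mY; apply/mwrtP; exact: measurable_maxr. Qed.

Lemma mwrt_sum (I : Type) (s : seq I) (X : I -> Omega -> R) :
  (forall i, measurable_wrt G (X i)) ->
  measurable_wrt G (fun w => \sum_(i <- s) X i w).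
Proof.
move=> mX; elim: s => [|i s ih].
  by under [X in measurable_wrt _ X]eq_fun do rewrite big_nil; exact: mwrt_cst.
by under [X in measurable_wrt _ X]eq_fun do rewrite big_cons; exact: mwrtD.
Qed.

Lemma mwrt_cvg (X_ : nat -> Omega -> R) X :
  (forall k, measurable_wrt G (X_ k)) ->
  (forall w, X_ ^~ w @ \oo --> X w) -> measurable_wrt G X.
Proof.
move=> mX cX; apply/mwrtP; apply: (@measurable_fun_cvg _ (g_sigma_algebraType G) R setT X_ X) => //.
by move=> k; apply/mwrtP.
Qed.

Lemma mwrt_indic A : G A -> measurable_wrt G (\1_A : Omega -> R).
Proof. by move=> GA; apply/mwrtP/measurable_indic; rewrite mwrt_id. Qed.

Lemma mwrt_measurable X : G `<=` measurable -> measurable_wrt G X ->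
  measurable_fun setT X.
Proof. by move=> Gm GX _ C mC; rewrite setTI; apply: Gm; exact: GX. Qed.

Lemma mwrt_sub (H : set (set Omega)) X : G `<=` H -> measurable_wrt G X ->
  measurable_wrt H X.
Proof. by move=> GH GX C mC; apply: GH; exact: GX. Qed.

Lemma salgC A : G A -> G (~` A).
Proof. by move=> GA; rewrite -setTD; case: sG => _ + _; exact. Qed.

Lemma salgT : G setT.
Proof. by rewrite -setC0; apply: salgC; case: sG. Qed.

Lemma salg_bigcup (A : nat -> set Omega) : (forall n, G (A n)) ->
  G (\bigcup_n A n).
Proof. by case: sG => _ _; exact. Qed.

Lemma salgU A C : G A -> G C -> G (A `|` C).
Proof.
move=> GA GC; rewrite -bigcup2E; apply: salg_bigcup => -[|[|n]] //=.
by case: sG.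
Qed.

Lemma salgI A C : G A -> G C -> G (A `&` C).
Proof. by move=> GA GC; rewrite -(setCK (_ `&` _)) setCI; apply/salgC/salgU; exact: salgC. Qed.

Lemma salg_bigcap (A : nat -> set Omega) : (forall n, G (A n)) ->
  G (\bigcap_n A n).
Proof.
move=> GA; rewrite -(setCK (\bigcap_n _)) setC_bigcap; apply/salgC/salg_bigcup => n.
exact: salgC.
Qed.

End measurable_wrt_theory.

Section completed.
Context {R : realType} {d : measure_display} {Omega : measurableType d}.
Variables (P : probability Omega R) (G : set (set Omega)).
Hypothesis sG : sigma_algebra setT G.
Hypothesis nG : P.-negligible `<=` G.

(** C agrees with A outside a negligible set Z, and its part within Z is itself negligible, hence in
    G. *)
Lemma ae_eq_salg A C : G A -> {ae P, forall w, A w <-> C w} -> G C.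
Proof.
move=> GA AC; pose Z := ~` [set w | A w <-> C w].
have GZ : G Z by exact: nG.
have -> : C = (A `&` ~` Z) `|` (C `&` Z).
  apply/seteqP; split=> w; last by case=> [[Aw /contrapT [+ _]]|[]//]; exact.
  move=> Cw; have [Zw|nZw] := pselect (Z w); first by right.
  by left; split=> //; exact: (contrapT nZw).2.
apply: salgU => //; first by apply: salgI => //; exact: salgC.
by apply: nG; apply: (@negligibleS _ _ _ _ Z) => // w [].
Qed.

Lemma ae_eq_mwrt (X Y : Omega -> R) : measurable_wrt G X ->
  {ae P, forall w, X w = Y w} -> measurable_wrt G Y.
Proof.
move=> GX XY C mC; apply: (ae_eq_salg (GX C mC)).
by apply: filterS XY => w /= ->.
Qed.

Lemma ae_cvg_mwrt (X_ : nat -> Omega -> R) (X : Omega -> R) :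
  (forall k, measurable_wrt G (X_ k)) ->
  {ae P, forall w, X_ ^~ w @ \oo --> X w} -> measurable_wrt G X.
Proof.
move=> mX cX; pose Z := ~` [set w | X_ ^~ w @ \oo --> X w].
have GZ : G (~` Z) by apply: salgC => //; exact: nG.
(* Cutting off at the set of convergence, which lies in G because its complement is negligible,
   turns almost sure convergence into convergence everywhere. *)
apply: (@ae_eq_mwrt (fun w => X w * \1_(~` Z) w)); last first.
  apply: filterS cX => w cw; rewrite indicE mem_set ?mulr1//.
apply: (@mwrt_cvg _ _ _ _ sG (fun k w => X_ k w * \1_(~` Z) w)) => [k|w].
  by apply: mwrtM => //; exact: mwrt_indic.
rewrite indicE; case: (pselect ((~` Z) w)) => Zw.
  rewrite mem_set//; apply: cvgM; last exact: cvg_cst.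
  by move: Zw; rewrite /Z setCK.
by rewrite memNset// mulr0; under eq_fun do rewrite mulr0; exact: cvg_cst.
Qed.

End completed.

Section ae_probability.
Context {R : realType} {d : measure_display} {Omega : measurableType d}.
Variable P : probability Omega R.

Lemma ae_eq_prob (A C : set Omega) : measurable A -> measurable C ->
  {ae P, forall w, A w <-> C w} -> P A = P C.
Proof.
move=> mA mC AC; rewrite -(setIT A) -(setIT C) -!integral_indic//.
apply: ae_eq_integral => //.
- exact/measurable_EFinP/measurable_indic.
- exact/measurable_EFinP/measurable_indic.
- apply: filterS AC => w AC _; rewrite /= !indicE.
  by rewrite (_ : (w \in A) = (w \in C))//; apply/idP/idP; rewrite !inE => /AC.
Qed.

End ae_probability.

(** * Moments of the Poisson and Gaussian laws *)

Section poisson_moments.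
Context {R : realType}.
Local Open Scope ereal_scope.
Variable m : R.
Hypothesis m0 : (0 <= m)%R.

Local Notation pmf := (fun k => poisson_prob m 0 [set k]).

Lemma poisson_set1 (k : nat) : (0 < m)%R ->
  poisson_prob m 0 [set k] = (m ^+ k * k`!%:R^-1 * expR (- m))%:E.
Proof.
by move=> m_gt0; rewrite /poisson_prob m_gt0 esum_set1 ?lee_fin ?poisson_pmf_ge0//
  /poisson_pmf m_gt0.
Qed.

Lemma poisson_total : \sum_(0 <= k <oo) poisson_prob m 0 [set k] = 1.
Proof.
rewrite -(@probability_setT _ _ _ (poisson_prob m 0)).
rewrite (_ : [set: nat] = \bigcup_k [set k]); last first.
  by apply/seteqP; split=> k // _; exists k.
rewrite measure_bigcup//=; last by move=> i j _ _ [x [-> ->]].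
by apply: eq_eseriesl => k; rewrite in_setT.
Qed.

(** Lowers the index by one: used once it gives the mean, twice the second factorial moment. For m =
    0 the law is the Dirac mass at 0, treated apart. *)
Lemma poisson_shift (k : nat) :
  k.+1%:R%:E * poisson_prob m 0 [set k.+1] = m%:E * poisson_prob m 0 [set k].
Proof.
have [->|mn0] := eqVneq m 0%R.
  by rewrite mul0e /poisson_prob ltxx diracE memNset ?mule0.
have m_gt0 : (0 < m)%R by rewrite lt_neqAle eq_sym mn0.
rewrite !poisson_set1// -!EFinM factS natrM invfM exprS; congr EFin.
by field; rewrite pnatr_eq0 -lt0n fact_gt0/= nat1r pnatr_eq0.
Qed.

Lemma poisson_mean : \sum_(0 <= k <oo) (k%:R%:E * poisson_prob m 0 [set k]) = m%:E.
Proof.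
rewrite nneseries_recl//; last by move=> k _; rewrite mule_ge0.
rewrite mul0e add0e -(@nneseries_addn _ _ 1); last by move=> k; rewrite mule_ge0.
under eq_eseriesr do rewrite addn1 poisson_shift.
by rewrite nneseriesZl// poisson_total mule1.
Qed.

Lemma poisson_mean2 :
  \sum_(0 <= k <oo) ((k%:R * k.-1%:R)%:E * poisson_prob m 0 [set k]) = (m ^+ 2)%:E.
Proof.
rewrite nneseries_recl//; last by move=> k _; rewrite mule_ge0// lee_fin mulr_ge0.
rewrite mul0r mul0e add0e -(@nneseries_addn _ _ 1); last by move=> k; rewrite mule_ge0// lee_fin mulr_ge0.
under eq_eseriesr => k _.
  rewrite addn1 /= mulrC EFinM -muleA poisson_shift muleCA; over.
rewrite nneseriesZl ?poisson_mean -?EFinM// => k _.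
by rewrite mule_ge0.
Qed.

End poisson_moments.

Section density.
Context {d : measure_display} {X : measurableType d} {R : realType}.
Variables (m n : {measure set X -> \bar R}) (g : X -> R).
Hypotheses (mg : measurable_fun setT g) (g0 : forall x, 0 <= g x).
Hypothesis ng : forall A, measurable A -> n A = (\int[m]_(x in A) (g x)%:E)%E.

Lemma integral_density (f : X -> \bar R) : measurable_fun setT f ->
  (forall x, 0 <= f x)%E ->
  (\int[n]_x f x = \int[m]_x (f x * (g x)%:E))%E.
Proof.
move=> mf f0; pose h := nnsfun_approx measurableT mf.
have hf x : (h k x)%:E @[k --> \oo] --> f x.
  by apply: cvg_nnsfun_approx.
have mh k : measurable_fun setT (fun x => (h k x)%:E).
  exact/measurable_EFinP/measurable_funPT.
have mhg k : measurable_fun setT (fun x => ((h k x)%:E * (g x)%:E)%E).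
  by apply: emeasurable_funM => //; exact/measurable_EFinP.
have hnd x : {homo (fun k => (h k x)%:E) : a b / (a <= b)%N >-> (a <= b)%E}.
  by move=> a b ab; rewrite lee_fin; exact/lefP/nd_nnsfun_approx.
transitivity (limn (fun k => \int[n]_x (h k x)%:E)%E).
  rewrite -monotone_convergence//.
  - by apply: eq_integral => x _; apply/esym/cvg_lim.
  - by move=> k x _; rewrite lee_fin.
transitivity (limn (fun k => \int[m]_x ((h k x)%:E * (g x)%:E))%E); last first.
  rewrite -monotone_convergence//.
  - apply: eq_integral => x _; apply/cvg_lim => //.
    by apply: cvgeZr => //; exact: hf.
  - by move=> k x _; rewrite mule_ge0// lee_fin.
  - by move=> x _ a b ab; rewrite lee_wpmul2r ?lee_fin//; exact: hnd.
congr (limn _); apply/funext => k.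
transitivity (\int[n]_x (\sum_(y \in range (h k)) (y * \1_(h k @^-1` [set y]) x)%:E))%E.
  by apply: eq_integral => x _; rewrite fimfunE -fsumEFin.
have mi r : measurable_fun setT (fun x => (r * \1_(h k @^-1` [set r]) x)%:E).
  by apply/measurable_EFinP; exact: measurable_funM.
rewrite ge0_integral_fsum//; last by move=> r x _; exact: nnfun_muleindic_ge0.
transitivity (\int[m]_x (\sum_(y \in range (h k))
    (y * \1_(h k @^-1` [set y]) x)%:E * (g x)%:E))%E; last first.
  apply: eq_integral => x _; rewrite -ge0_mule_fsuml => [|y]; last exact: nnfun_muleindic_ge0.
  by rewrite fsumEFin// -(fimfunE _ x).
rewrite ge0_integral_fsum//; last 2 first.
- by move=> r; apply: emeasurable_funM => //; exact/measurable_EFinP.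
- move=> r x _; rewrite mule_ge0 ?lee_fin//.
  by have := nnfun_muleindic_ge0 (h k) r x; rewrite -EFinM lee_fin.
apply: eq_fsbigr => r; rewrite inE => -[x0 _ <-].
have r0 : 0 <= h k x0 by [].
under eq_integral do rewrite EFinM.
rewrite ge0_integralZl_EFin//; last exact/measurable_EFinP.
under [RHS]eq_integral do rewrite EFinM -muleA.
rewrite ge0_integralZl_EFin//; last 2 first.
- by move=> x _; rewrite mule_ge0// lee_fin.
- by apply: emeasurable_funM; exact/measurable_EFinP.
rewrite integral_indic// setIT ng//; congr (_ * _)%E.
rewrite integral_mkcond; apply: eq_integral => x _.
rewrite patchE indicE; case: ifPn => _ /=; first by rewrite mul1e.
by rewrite mul0e.
Qed.

End density.

Section gaussian_moments.
Context {R : realType}.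
Variable s : R.
Hypothesis s0 : 0 < s.
Local Notation mu := (@lebesgue_measure R).
Local Notation pdf := (normal_pdf 0 s).

Lemma normal_pdf_expE x : pdf x = normal_peak s * expR (- x ^+ 2 / (s ^+ 2 *+ 2)).
Proof. by rewrite normal_pdfE ?gt_eqF// /normal_fun subr0. Qed.

(** With y = x^2 / (4 s^2) the Gaussian factor is the square of exp(-y). One factor absorbs x^4 = 16
    s^4 y^2 through y^2 exp(-y) <= 2; the other is the density of twice the variance, up to the
    ratio sqrt 2 of the peaks. The fourth moment is thus bounded by a total mass. *)
Lemma pow4_normal_le x : x ^+ 4 * pdf x <=
  32 * s ^+ 4 * Num.sqrt 2 * normal_pdf 0 (s * Num.sqrt 2) x.
Proof.
have r2 : 0 < Num.sqrt 2 :> R by rewrite sqrtr_gt0.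
have s2 : 0 < s * Num.sqrt 2 by rewrite mulr_gt0.
rewrite normal_pdf_expE normal_pdfE ?gt_eqF// /normal_fun subr0.
have -> : normal_peak (s * Num.sqrt 2) = normal_peak s / Num.sqrt 2.
  rewrite /normal_peak exprMn sqr_sqrtr// -invfM; congr (_^-1).
  rewrite [LHS](_ : _ = Num.sqrt ((s ^+ 2 * pi *+ 2) * 2)); last by congr (Num.sqrt _); ring.
  by rewrite sqrtrM// mulrn_wge0// mulr_ge0 ?sqr_ge0 ?pi_ge0.
have e1 : expR (- x ^+ 2 / (s ^+ 2 *+ 2)) =
    expR (- x ^+ 2 / ((s * Num.sqrt 2) ^+ 2 *+ 2)) ^+ 2.
  rewrite [RHS]expr2 -expRD; congr expR; rewrite exprMn sqr_sqrtr//.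
  by field; rewrite gt_eqF.
rewrite e1; set y := x ^+ 2 / ((s * Num.sqrt 2) ^+ 2 *+ 2).
rewrite mulNr -/y; have yE : x ^+ 4 = 16 * s ^+ 4 * y ^+ 2.
  have e2 : (s * Num.sqrt 2) ^+ 2 *+ 2 = 4 * s ^+ 2 by rewrite exprMn sqr_sqrtr//; ring.
  by rewrite /y e2; field; rewrite gt_eqF.
have y0 : 0 <= y by rewrite divr_ge0 ?sqr_ge0// mulrn_wge0// sqr_ge0.
have e0 := expR_gt0 (- y); have p0 := normal_peak_ge0 s.
have ey : y ^+ 2 * expR (- y) <= 2.
  have := expR_ge1Dxn 1 y0; rewrite expRN ler_pdivrMr ?expR_gt0//.
  rewrite (_ : (2`!)%:R = 2 :> R)//; lra.
rewrite yE expr2 (_ : 32 * s ^+ 4 * Num.sqrt 2 * (normal_peak s / Num.sqrt 2 * expR (- y)) =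
   16 * s ^+ 4 * normal_peak s * expR (- y) * 2); last by field; rewrite gt_eqF.
rewrite [leLHS](_ : _ = 16 * s ^+ 4 * normal_peak s * expR (- y) * (y ^+ 2 * expR (- y))); last by ring.
by rewrite ler_wpM2l// !mulr_ge0// ?ltW// exprn_gt0.
Qed.

Lemma is_derive_normal_pdf (x : R) :
  is_derive x (1 : R) pdf (- (x / s ^+ 2) * pdf x).
Proof.
have -> : pdf = fun x => normal_peak s * expR (- x ^+ 2 / (s ^+ 2 *+ 2)).
  by apply/funext => y; rewrite normal_pdf_expE.
have d1 : is_derive x (1 : R) (fun y : R => - y ^+ 2 / (s ^+ 2 *+ 2)) (- (x / s ^+ 2)).
  apply: is_derive_eq; rewrite /GRing.scale/= !(mulr0, addr0, mulr1).
  by field; rewrite gt_eqF.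
have d2 := @is_derive1_comp _ expR (fun y : R => - y ^+ 2 / (s ^+ 2 *+ 2)) x _ _
  (is_derive_expR (- x ^+ 2 / (s ^+ 2 *+ 2))) d1.
have H := is_deriveM (is_derive_cst (normal_peak s) x (1 : R)) d2.
by apply: (is_derive_eq H); rewrite /GRing.scale/=; ring.
Qed.

(** Explicit antiderivatives give the first two moments: x pdf is the derivative of - s^2 pdf, and
    (x^2 - s^2) pdf that of - s^2 x pdf; both antiderivatives vanish at infinity. *)
Lemma derivable_integral_eq0 (F G : R -> R) : continuous G ->
  mu.-integrable setT (EFin \o G) ->
  (forall x : R, is_derive x 1 F (G x)) ->
  F n%:R @[n --> \oo] --> 0 -> F (- n%:R) @[n --> \oo] --> 0 ->
  (\int[mu]_x (G x)%:E = 0)%E.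
Proof.
move=> cG iG dF F0 F0'.
have mG : measurable_fun setT G by exact: continuous_measurable_fun.
pose D n : set R := [set` `[- n.+1%:R, n.+1%:R]%R].
have I n : (\int[mu]_x (((EFin \o G) \_ (D n)) x) =
    (F n.+1%:R - F (- n.+1%:R))%:E)%E.
  have n0 : 0 < n.+1%:R :> R by [].
  rewrite -integral_mkcond (@continuous_FTC2 _ G F) ?EFinB//.
  - lra.
  - exact: continuous_subspaceT.
  - split.
    + by move=> x _; have [] := dF x.
    + apply: cvg_at_right_filter; apply: differentiable_continuous.
      by apply/derivable1_diffP; have [] := dF (- n.+1%:R).
    + apply: cvg_at_left_filter; apply: differentiable_continuous.
      by apply/derivable1_diffP; have [] := dF n.+1%:R.
  - by move=> x _; rewrite derive1E; have [_ ->] := dF x.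
have [//||||//|_ _ H] := @dominated_convergence _ _ _ mu setT measurableT
  (fun n => ((EFin \o G) \_ (D n))) (EFin \o G) (fun x => `|G x|%:E).
- move=> n; have mD : measurable (D n) by exact: measurable_itv.
  apply/(measurable_restrictT (EFin \o G) mD); apply: measurable_funTS.
  exact/measurable_EFinP.
- exact/measurable_EFinP.
- apply/aeW => x _ /=; apply: cvg_near_cst; near=> n; rewrite /= patchE ifT//.
  rewrite inE /D /= in_itv/= -ler_norml.
  have xn : `|x| <= n%:R by near: n; exact: nbhs_infty_ger.
  by rewrite (le_trans xn)// ler_nat.
- exact: (integrable_norm iG).
- apply/aeW => x n _ /=; rewrite patchE; case: ifP => // _.
  by rewrite abse0 lee_fin.
move: H => /=; under eq_cvg do rewrite I.
move=> H; have H' : (F n.+1%:R - F (- n.+1%:R))%:E @[n --> \oo] --> (0%:E : \bar R).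
  apply/fine_cvgP; split; first by near=> n.
  rewrite /comp /= -(subrr 0); apply: cvgB.
    by rewrite (cvg_shiftS (fun n => F n%:R)).
  by rewrite (cvg_shiftS (fun n => F (- n%:R))).
exact: (cvg_unique (@ereal_hausdorff R) H H').
Unshelve. all: by end_near. Qed.

Lemma continuous_normal_pdf0 : continuous pdf.
Proof. by apply: continuous_normal_pdf; rewrite gt_eqF. Qed.

Lemma normal_prob_integralE (f : R -> \bar R) : measurable_fun setT f ->
  (forall x, 0 <= f x)%E ->
  (\int[normal_prob 0%R s]_x f x = \int[mu]_x (f x * (pdf x)%:E))%E.
Proof.
move=> mf f0; apply: integral_density => //.
- exact: measurable_normal_pdf.
- by move=> x; exact: normal_pdf_ge0.
Qed.

Lemma normal_moment4 : (\int[normal_prob 0%R s]_x (x ^+ 4)%:E <=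
  (32 * Num.sqrt 2 * s ^+ 4)%:E)%E.
Proof.
have s2 : 0 < s * Num.sqrt 2 by rewrite mulr_gt0// sqrtr_gt0.
rewrite normal_prob_integralE//; last 2 first.
- exact/measurable_EFinP/measurable_funX.
- by move=> x; rewrite lee_fin exprn_even_ge0.
apply: (@le_trans _ _ (\int[mu]_x ((32 * s ^+ 4 * Num.sqrt 2)%:E *
   (normal_pdf 0 (s * Num.sqrt 2) x)%:E))%E).
  apply: ge0_le_integral => //.
  - by move=> x _; rewrite mule_ge0 ?lee_fin ?exprn_even_ge0// normal_pdf_ge0.
  - apply: emeasurable_funM; apply/measurable_EFinP; first exact: measurable_funX.
    exact: measurable_normal_pdf.
  - apply: emeasurable_funM; apply/measurable_EFinP; first exact: measurable_cst.
    exact: measurable_normal_pdf.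
  - by move=> x _; rewrite -!EFinM lee_fin pow4_normal_le.
have c0 : 0 <= 32 * s ^+ 4 * Num.sqrt 2 :> R.
  have r0 : 0 <= Num.sqrt 2 :> R := sqrtr_ge0 _.
  have s4 : 0 <= s ^+ 4 by rewrite exprn_even_ge0.
  by apply: mulr_ge0 => //; apply: mulr_ge0.
rewrite ge0_integralZl_EFin//.
- by rewrite [X in (_ * X)%E]integral_normal_pdf mule1 lee_fin le_eqVlt; apply/orP; left; apply/eqP; ring.
- by move=> x _; rewrite lee_fin normal_pdf_ge0.
- apply/measurable_EFinP; exact: measurable_normal_pdf.
Qed.

Let normal_pow4_bound : exists K : R, forall x, `|x| ^+ 4 * pdf x <= K.
Proof.
exists (32 * s ^+ 4 * Num.sqrt 2 * normal_peak (s * Num.sqrt 2)) => x.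
have s2 : 0 < s * Num.sqrt 2 by rewrite mulr_gt0// sqrtr_gt0.
rewrite -normrX ger0_norm ?exprn_even_ge0//.
apply: (le_trans (pow4_normal_le x)); rewrite ler_wpM2l//.
  have r0 : 0 <= Num.sqrt 2 :> R := sqrtr_ge0 _.
  have s4 : 0 <= s ^+ 4 by rewrite exprn_even_ge0.
  by apply: mulr_ge0 => //; apply: mulr_ge0.
by apply: normal_pdf_ub; rewrite gt_eqF.
Qed.

(** [e] will be 1 or -1, one for each end of the line. The bound on |x|^4 pdf leaves at least a
    factor n to spare over a power k <= 1. *)
Let normal_pow_cvg (k : nat) (e c : R) : (k <= 1)%N ->
  `|e| = 1 -> c * ((e * n%:R) ^+ k * pdf (e * n%:R)) @[n --> \oo] --> (0 : R).
Proof.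
move=> k1 e1; rewrite -[X in _ --> X](mulr0 c).
apply: cvgM; first exact: cvg_cst.
have [K HK] := normal_pow4_bound.
have K0 : 0 <= K by apply: le_trans (HK 0); rewrite mulr_ge0 ?exprn_ge0// normal_pdf_ge0.
apply/cvgr0Pnorm_lt => r r0; near=> n.
have n1 : (1 : R) <= n%:R by near: n; exact: nbhs_infty_ger.
have nK : K / r < n%:R by near: n; exact: nbhs_infty_gtr.
have n0 : (0 : R) < n%:R by apply: lt_le_trans n1.
rewrite normrM normrX normrM e1 mul1r normr_nat ger0_norm ?normal_pdf_ge0//.
have := HK (e * n%:R); rewrite normrM e1 mul1r normr_nat => H.
have p0 := normal_pdf_ge0 0 s (e * n%:R); set p := normal_pdf _ _ _ in H p0 *.
have : n%:R ^+ k * p * n%:R <= K.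
  apply: le_trans H; rewrite mulrAC -exprSr ler_wpM2r// ler_weXn2l//.
  by case: (k) k1 => [|[|]].
rewrite -ler_pdivlMr// => /le_lt_trans; apply.
by rewrite ltr_pdivrMr// mulrC -ltr_pdivrMr.
Unshelve. all: by end_near. Qed.

Let integrable_normal_pow (k : nat) : (k <= 4)%N ->
  mu.-integrable setT (EFin \o (fun x : R => x ^+ k * pdf x)).
Proof.
move=> k4; have mm : measurable_fun setT (fun x : R => x ^+ k * pdf x).
  apply: measurable_funM; last exact: measurable_normal_pdf.
  exact: measurable_funX.
have i1 : intg mu pdf by exact: integrable_normal_pdf.
have s2 : 0 < s * Num.sqrt 2 by rewrite mulr_gt0// sqrtr_gt0.
have i2 : intg mu (normal_pdf 0 (s * Num.sqrt 2)) by exact: integrable_normal_pdf.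
have ii := intgD i1 (intgZ (32 * s ^+ 4 * Num.sqrt 2) i2).
apply: (@intg_dom _ _ _ mu (fun x => x ^+ k * pdf x) _ mm ii) => x; rewrite normrM [X in _ * X]ger0_norm ?normal_pdf_ge0//.
apply: (@le_trans _ _ ((1 + `|x| ^+ 4) * pdf x)).
  rewrite ler_wpM2r ?normal_pdf_ge0// normrX.
  have [x1|x1] := lerP `|x| 1.
    by rewrite (@le_trans _ _ 1)// ?exprn_ile1// lerDl exprn_ge0.
  by rewrite (le_trans (ler_weXn2l _ k4)) ?(ltW x1)// lerDr.
rewrite mulrDl mul1r lerD2l -normrX ger0_norm ?exprn_even_ge0//.
exact: pow4_normal_le.
Qed.

Lemma normal_moment1 : (\int[mu]_x (x * pdf x)%:E = 0)%E.
Proof.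
have H := @derivable_integral_eq0 (fun x => - s ^+ 2 * pdf x) (fun x => x * pdf x).
apply: H.
- by move=> x; apply: cvgM; [exact: cvg_id|exact: continuous_normal_pdf0].
- exact: (integrable_normal_pow (isT : (1 <= 4)%N)).
- move=> x; have H1 := is_deriveM (is_derive_cst (- s ^+ 2) x (1 : R)) (is_derive_normal_pdf x).
  by apply: (is_derive_eq H1); rewrite /GRing.scale/=; field; rewrite gt_eqF.
- have := normal_pow_cvg (- s ^+ 2) (isT : (0 <= 1)%N) (normr1 R).
  by under eq_fun do rewrite expr0 !mul1r.
- have := normal_pow_cvg (- s ^+ 2) (isT : (0 <= 1)%N) (normrN1 R).
  by under eq_fun do rewrite expr0 mul1r mulN1r.
Qed.

Lemma normal_moment2 : (\int[normal_prob 0%R s]_x (x ^+ 2)%:E = (s ^+ 2)%:E)%E.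
Proof.
rewrite normal_prob_integralE//; last 2 first.
- exact/measurable_EFinP/measurable_funX.
- by move=> x; rewrite lee_fin sqr_ge0.
have i1 : intg mu pdf by exact: integrable_normal_pdf.
have i2 : intg mu (fun x => x ^+ 2 * pdf x) by exact: (integrable_normal_pow (isT : (2 <= 4)%N)).
have H : (\int[mu]_x (x ^+ 2 * pdf x - s ^+ 2 * pdf x)%:E = 0)%E.
  have H := @derivable_integral_eq0 (fun x => - s ^+ 2 * (x * pdf x)) (fun x => x ^+ 2 * pdf x - s ^+ 2 * pdf x).
  apply: H.
  - move=> x; apply: cvgB; apply: cvgM; try exact: continuous_normal_pdf0.
      exact: exprn_continuous.
    exact: cvg_cst.
  - by apply: intgB => //; exact: intgZ.
  - move=> x; have H1 := is_deriveM (is_derive_cst (- s ^+ 2) x (1 : R)) (is_deriveM (is_derive_id x (1 : R)) (is_derive_normal_pdf x)).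
    by apply: (is_derive_eq H1); rewrite /GRing.scale/=; field; rewrite gt_eqF.
  - have := normal_pow_cvg (- s ^+ 2) (isT : (1 <= 1)%N) (normr1 R).
    by under eq_fun do rewrite expr1 !mul1r.
  - have := normal_pow_cvg (- s ^+ 2) (isT : (1 <= 1)%N) (normrN1 R).
    by under eq_fun do rewrite expr1 mulN1r.
have E : Ex mu (fun x => x ^+ 2 * pdf x) = s ^+ 2 * Ex mu pdf.
  rewrite -ExZ//; apply/eqP; rewrite -subr_eq0 -ExB//; last exact: intgZ.
  by rewrite /Ex /Rintegral H.
under eq_integral do rewrite -EFinM.
rewrite ExE// E /Ex /Rintegral integral_normal_pdf/= mulr1//.
Qed.

End gaussian_moments.

(** * Cadlag functions *)

Section cadlag_theory.
Context {R : realType}.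
Variable T : R.
Implicit Types (f g : R -> R) (c t : R).

Lemma cadlag_cst c : cadlag T (fun=> c).
Proof. by split=> [t _|t _]; [exact: cvg_cst|exact: is_cvg_cst]. Qed.

Lemma cadlagD f g : cadlag T f -> cadlag T g -> cadlag T (fun t => f t + g t).
Proof.
move=> [f1 f2] [g1 g2]; split=> t tT; first exact: cvgD (f1 _ tT) (g1 _ tT).
exact: is_cvgD (f2 _ tT) (g2 _ tT).
Qed.

Lemma cadlagZ c f : cadlag T f -> cadlag T (fun t => c * f t).
Proof.
move=> [f1 f2]; split=> t tT; first exact: cvgMr (f1 _ tT).
by apply: is_cvgMr; exact: f2.
Qed.

Lemma cadlagB f g : cadlag T f -> cadlag T g -> cadlag T (fun t => f t - g t).
Proof.
move=> cf cg; have := cadlagD cf (cadlagZ (-1) cg).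
by under eq_fun do rewrite mulN1r.
Qed.

Lemma cadlag_sum (I : Type) (s : seq I) (f : I -> R -> R) :
  (forall i, cadlag T (f i)) -> cadlag T (fun t => \sum_(i <- s) f i t).
Proof.
move=> cf; elim: s => [|i s ih].
  by under eq_fun do rewrite big_nil; exact: cadlag_cst.
by under eq_fun do rewrite big_cons; exact: cadlagD.
Qed.

Lemma cadlag_min f c : cadlag T f -> cadlag T (fun t => f (Num.min c t)).
Proof.
move=> [f1 f2]; split=> t /andP[t0 tT].
  have [tc|ct] := ltP t c.
    apply: cvg_trans (f1 t _); last by rewrite t0.
    apply: near_eq_cvg; near=> x; have xc : x < c by near: x; exact: nbhs_right_lt.
    by rewrite min_r// ltW.
  apply: cvg_near_cst; near=> x; have tx : t < x by near: x; exact: nbhs_right_gt.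
  by rewrite min_l// (le_trans ct)// ltW.
have [tc|ct] := leP t c.
  have /cvg_ex[l fl] : cvg (f x @[x --> t^'-]) by apply: f2; rewrite t0.
  apply/cvg_ex; exists l; apply: cvg_trans fl.
  apply: near_eq_cvg; near=> x; have xt : x < t by near: x; exact: nbhs_left_lt.
  by rewrite min_r// (le_trans _ tc)// ltW.
apply/cvg_ex; exists (f c); apply: cvg_near_cst; near=> x; have cx : c < x by near: x; exact: nbhs_left_gt.
by rewrite min_l// ltW.
Unshelve. all: by end_near. Qed.

Lemma cadlag_eq f g : {in `[0, T], f =1 g} -> cadlag T f -> cadlag T g.
Proof.
move=> fg [f1 f2]; split=> t /andP[t0 tT].
  rewrite -fg; last by rewrite in_itv/= t0 ltW.
  apply: cvg_trans (f1 t _); last by rewrite t0.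
  apply: near_eq_cvg; near=> x; apply: fg; rewrite in_itv/=; apply/andP; split.
    by rewrite (le_trans t0)// ltW//; near: x; exact: nbhs_right_gt.
  by near: x; exact: nbhs_right_ltW.
have /cvg_ex[l fl] : cvg (f x @[x --> t^'-]) by apply: f2; rewrite t0.
apply/cvg_ex; exists l; apply: cvg_trans fl.
apply: near_eq_cvg; near=> x; apply: fg; rewrite in_itv/=; apply/andP; split.
  by apply/ltW; near: x; exact: nbhs_left_gt.
by rewrite (le_trans _ tT)// ltW//; near: x; exact: nbhs_left_lt.
Unshelve. all: by end_near. Qed.

(** By monotonicity, right continuity at t follows from one sequence decreasing to t, which is what
    continuity from above of a measure provides. Left limits exist because the values before t are
    bounded by the value at t. *)
Lemma cadlag_monotone f : {homo f : x y / x <= y} ->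
  (forall t, 0 <= t < T -> f (t + (T - t) / n.+1%:R) @[n --> \oo] --> f t) ->
  cadlag T f.
Proof.
move=> ndf fr; split=> t /andP[t0 tT].
  apply/cvgrPdist_lt => e e0.
  have /cvgrPdist_lt/(_ e e0)[n _ /(_ n (leqnn n)) /=] : f (t + (T - t) / n.+1%:R) @[n --> \oo] --> f t by apply: fr; rewrite t0.
  have d0 : 0 < (T - t) / n.+1%:R by rewrite divr_gt0// subr_gt0.
  move=> H; near=> x.
  have tx : t <= x by apply/ltW; near: x; exact: nbhs_right_gt.
  have xn : x <= t + (T - t) / n.+1%:R by near: x; apply: nbhs_right_ltW; rewrite ltrDl.
  have := ndf _ _ tx; have := ndf _ _ xn => h1 h2.
  apply: le_lt_trans H; rewrite !ler0_norm ?subr_le0// ?(le_trans h2)//.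
  by rewrite !opprB lerB.
apply: nondecreasing_at_left_is_cvgr.
  by near=> x; move=> y z _ _; exact: ndf.
near=> x; exists (f t) => _ [y /= + <-]; rewrite in_itv/= => /andP[_ /ltW yt].
exact: ndf.
Unshelve. all: by end_near. Qed.

Lemma cadlag_uniform (f_ : nat -> R -> R) f (e : nat -> R) :
  (forall k, cadlag T (f_ k)) ->
  (forall k, {in `[0, T], forall t, `|f t - f_ k t| <= e k}) ->
  e @ \oo --> 0 -> cadlag T f.
Proof.
move=> cf fe e0; split=> t /andP[t0 tT].
  apply/cvgrPdist_lt => d d0; have d3 : 0 < d / 3 by lra.
  have /cvgrPdist_lt/(_ _ d3)[k _ /(_ k (leqnn k)) /=] := e0.
  rewrite sub0r normrN => ek; have {}ek := le_lt_trans (ler_norm _) ek.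
  have [/(_ t)] := cf k; rewrite t0 tT => /(_ isT)/cvgrPdist_lt/(_ _ d3) H _.
  have ft : `|f t - f_ k t| < d / 3.
    by apply: le_lt_trans ek; apply: fe; rewrite in_itv/= t0 ltW.
  near=> x.
  have h1 : `|f x - f_ k x| < d / 3.
    apply: le_lt_trans ek; apply: fe; rewrite in_itv/=; apply/andP; split.
      by rewrite (le_trans t0)// ltW//; near: x; exact: nbhs_right_gt.
    by near: x; exact: nbhs_right_ltW.
  have h2 : `|f_ k t - f_ k x| < d / 3 by near: x.
  move: ft h1 h2; rewrite !ltr_norml => /andP[? ?] /andP[? ?] /andP[? ?]; lra.
apply/cauchy_cvgP/cauchyP => d d0; have d2 : 0 < d / 2 by lra.
have /cvgrPdist_lt/(_ _ d2)[k _ /(_ k (leqnn k)) /=] := e0.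
rewrite sub0r normrN => ek; have {}ek := le_lt_trans (ler_norm _) ek.
have [_ /(_ t)] := cf k; rewrite t0 tT => /(_ isT)/cvg_ex[l /cvgrPdist_lt/(_ _ d2) H].
exists l; near=> x; rewrite /ball/=.
have h1 : `|f x - f_ k x| < d / 2.
  apply: le_lt_trans ek; apply: fe; rewrite in_itv/=; apply/andP; split.
    by apply/ltW; near: x; exact: nbhs_left_gt.
  by rewrite (le_trans _ tT)// ltW//; near: x; exact: nbhs_left_lt.
have h2 : `|l - f_ k x| < d / 2 by near: x.
by move: h1 h2; rewrite !ltr_norml => /andP[? ?] /andP[? ?]; lra.
Unshelve. all: by end_near. Qed.

Lemma cadlag_id : cadlag T id.
Proof.
split=> t _; first exact: (cvg_at_right_filter cvg_id).
by apply/cvg_ex; exists t; exact: (cvg_at_left_filter cvg_id).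
Qed.

Definition dyad (n i : nat) : R := i%:R * (T / 2 ^+ n).

Lemma dyadic_right t c : 0 <= t < T -> 0 < c ->
  exists n i, [/\ (i <= 2 ^ n)%N, t < dyad n i & dyad n i < t + c].
Proof.
move=> /andP[t0 tT] c0; have T0 : 0 < T := le_lt_trans t0 tT.
(* The mesh is taken below T - t as well, so that the next grid point does not leave [0, T]. *)
pose c' := Num.min c (T - t); have c'0 : 0 < c' by rewrite lt_min c0 subr_gt0.
have [n _ /(_ n (leqnn n))/= nc] : \forall n \near \oo, `|(T / 2 ^+ n) - 0| < c'.
  have : T * (2^-1) ^+ n @[n --> \oo] --> T * 0.
    by apply: cvgMr; apply: cvg_expr; rewrite ger0_norm ?invr_ge0// invf_lt1//; lra.
  rewrite mulr0 => /cvgrPdist_lt/(_ _ c'0); apply: filterS => n.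
  by rewrite distrC exprVn.
have h0 : 0 < T / 2 ^+ n by rewrite divr_gt0// exprn_gt0.
rewrite subr0 ger0_norm ?ltW// in nc; move: nc; rewrite lt_min => /andP[nc nT].
have q0 : 0 <= t / (T / 2 ^+ n) by rewrite divr_ge0// ltW.
have /andP[i1 i2] := truncn_itv q0; set i := Num.truncn _ in i1 i2.
have l1 : i%:R * (T / 2 ^+ n) <= t by rewrite -ler_pdivlMr.
have l2 : t < i.+1%:R * (T / 2 ^+ n) by rewrite -ltr_pdivrMr.
have l3 : dyad n i.+1 <= t + T / 2 ^+ n by rewrite /dyad -natr1 mulrDl mul1r lerD2r.
exists n, i.+1; split=> //; last by rewrite (le_lt_trans l3)// ltrD2l.
have : i.+1%:R * (T / 2 ^+ n) < (2 ^ n)%:R * (T / 2 ^+ n).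
  rewrite (le_lt_trans l3)// natrX [ltRHS]mulrC divfK ?gt_eqF ?exprn_gt0//.
  by rewrite -ltrBrDl.
by rewrite ltr_pM2r// ltr_nat => /ltnW.
Qed.

(** Right continuity transports the bound from grid points just after t. The endpoint T, which
    cannot be approached from the right, is itself a grid point. *)
Lemma cadlag_dyadic_bound f c : 0 < T -> cadlag T f ->
  (forall n i, (i <= 2 ^ n)%N -> `|f (dyad n i)| <= c) ->
  forall t, 0 <= t <= T -> `|f t| <= c.
Proof.
move=> T0 [fr _] H t /andP[t0]; rewrite le_eqVlt => /predU1P[->|tT].
  by have := H 0%N 1%N isT; rewrite /dyad expr0 divr1 mul1r.
rewrite leNgt; apply/negP => ct.
have /cvgrPdist_lt/(_ (`|f t| - c)) : f x @[x --> t^'+] --> f t by apply: fr; rewrite t0.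
rewrite subr_gt0 => /(_ ct)[e /= e0 He].
have [|n [i [ni i1 i2]]] := @dyadic_right t e _ e0; first by rewrite t0.
have := He (dyad n i); rewrite /= distrC => /(_ _ i1) K.
have : `|dyad n i - t| < e by rewrite ger0_norm ?subr_ge0 ?ltW// ltrBlDl.
move=> /K; have := H n i ni; have := lerB_dist (f t) (f (dyad n i)).
by rewrite distrC; lra.
Qed.

Lemma dyad_double n i : dyad n.+1 i.*2 = dyad n i.
Proof. by rewrite /dyad -muln2 natrM exprS; field; rewrite expf_neq0. Qed.

Lemma dyad_last n : dyad n (2 ^ n) = T.
Proof. by rewrite /dyad natrX mulrC divfK// expf_neq0. Qed.

Lemma dyad_mono n i j : 0 < T -> (i <= j)%N -> dyad n i <= dyad n j.
Proof. by move=> T0 ij; rewrite ler_wpM2r ?ler_nat// divr_ge0 ?exprn_ge0// ltW. Qed.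

Lemma dyad_itv n i : 0 < T -> (i <= 2 ^ n)%N -> 0 <= dyad n i <= T.
Proof.
move=> T0 iN; rewrite mulr_ge0 ?divr_ge0 ?exprn_ge0 ?(ltW T0)//=.
by rewrite -[leRHS](dyad_last n) dyad_mono.
Qed.

End cadlag_theory.

(** * A class of smooth test functions *)

Section smooth_class.
Context {R : realType}.
Implicit Types (phi dphi psi dpsi : R -> R) (K x y : R).

(* [dphi] is a derivative of [phi] with a quadratic Taylor remainder; unlike
   C^2, this class is visibly stable under convolution with any law. *)
Definition Sfun K phi dphi := [/\ measurable_fun setT phi,
  measurable_fun setT dphi, forall x, `|phi x| <= K, forall x, `|dphi x| <= K &
  forall x y, `|phi (x + y) - phi x - dphi x * y| <= K * y ^+ 2].

Lemma Sfun_ge0 K phi dphi : Sfun K phi dphi -> 0 <= K.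
Proof. by case=> _ _ /(_ 0) h _ _; exact: le_trans h. Qed.

(** For |y| <= 1 by the Taylor bound, where y^2 <= |y|; for |y| > 1 by boundedness alone. *)
Lemma Sfun_lip K phi dphi x y : Sfun K phi dphi ->
  `|phi (x + y) - phi x| <= 2 * K * `|y|.
Proof.
move=> S; have K0 := Sfun_ge0 S; case: S => _ _ b db H.
have [y1|y1] := leP `|y| 1.
  have h1 := H x y; have h2 := db x.
  have -> : phi (x + y) - phi x = (phi (x + y) - phi x - dphi x * y) + dphi x * y by ring.
  apply: (le_trans (ler_normD _ _)); rewrite normrM.
  have h3 : `|dphi x| * `|y| <= K * `|y| by rewrite ler_wpM2r.
  have h4 : K * y ^+ 2 <= K * `|y|.
    by rewrite ler_wpM2l// -real_normK ?num_real// expr2 ler_piMl.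
  by have := le_trans h1 h4; lra.
apply: (le_trans (ler_normB _ _)); have := b (x + y); have := b x.
have : 2 * K <= 2 * K * `|y| by rewrite ler_peMr ?mulr_ge0// ltW.
lra.
Qed.

Lemma Sfun_cst K : 0 <= K -> Sfun K (fun=> K) (fun=> 0).
Proof.
move=> K0; split=> // [x|x|x y]; rewrite ?normr0 ?(ger0_norm K0)//.
by rewrite subrr mul0r subr0 normr0 mulr_ge0// sqr_ge0.
Qed.

(** The Taylor remainder of the product splits into three terms, bounded by K K' y^2, 2 K K' y^2 and
    K K' y^2, whence the factor 4. *)
Lemma SfunM K phi dphi K' psi dpsi : Sfun K phi dphi -> Sfun K' psi dpsi ->
  Sfun (4 * K * K') (fun x => phi x * psi x) (fun x => dphi x * psi x + phi x * dpsi x).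
Proof.
move=> S S'; have K0 := Sfun_ge0 S; have K0' := Sfun_ge0 S'.
have L x y := Sfun_lip x y S; case: S S' => m1 m2 b db H [m1' m2' b' db' H'].
have KK : 0 <= K * K' by rewrite mulr_ge0.
have bb (f g : R -> R) : (forall x, `|f x| <= K) -> (forall x, `|g x| <= K') -> forall x z, `|f x * g z| <= K * K'.
  by move=> fb gb x z; rewrite normrM ler_pM.
split.
- exact: measurable_funM.
- by apply: measurable_funD; exact: measurable_funM.
- by move=> x; apply: (le_trans (bb _ _ b b' x x)); lra.
- move=> x; apply: (le_trans (ler_normD _ _)).
  by have := bb _ _ db b' x x; have := bb _ _ b db' x x; lra.
move=> x y.
have -> : phi (x + y) * psi (x + y) - phi x * psi x - (dphi x * psi x + phi x * dpsi x) * y =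
   phi (x + y) * (psi (x + y) - psi x - dpsi x * y) + (dpsi x * y) * (phi (x + y) - phi x) +
   psi x * (phi (x + y) - phi x - dphi x * y) by ring.
apply: (le_trans (ler_normD _ _)); apply: (le_trans (lerD (ler_normD _ _) (lexx _))).
have y2 : `|y| * `|y| = y ^+ 2 by rewrite -expr2 real_normK ?num_real.
have h1 : `|phi (x + y) * (psi (x + y) - psi x - dpsi x * y)| <= K * (K' * y ^+ 2).
  by rewrite normrM ler_pM.
have h2 : `|dpsi x * y * (phi (x + y) - phi x)| <= (K' * `|y|) * (2 * K * `|y|).
  by rewrite !normrM ler_pM// ?mulr_ge0// ler_wpM2r.
have h3 : `|psi x * (phi (x + y) - phi x - dphi x * y)| <= K' * (K * y ^+ 2).
  by rewrite normrM ler_pM.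
have e2 : (K' * `|y|) * (2 * K * `|y|) = 2 * K * K' * y ^+ 2 by rewrite -y2; ring.
rewrite e2 in h2; lra.
Qed.

Definition pos (x : R) : R := Num.max x 0.
(** Equal to 1 on the negative half-line and decreasing to 0 at infinity, with Lipschitz derivative
    [dcut]; [cut] of m (x - a) is a differentiable substitute for the indicator of ]-oo, a]. *)
Definition cut (x : R) : R := (1 + pos x ^+ 2)^-1.
Definition dcut (x : R) : R := - (2 * pos x / (1 + pos x ^+ 2) ^+ 2).

Lemma pos_ge0 x : 0 <= pos x.
Proof. by rewrite /pos le_max lexx orbT. Qed.

Lemma pos_diff x y : `|pos (x + y) - pos x| <= `|y|.
Proof.
rewrite /pos ler_norml; have := ler_norm y; have := ler_norm (- y); rewrite normrN.
by case: (leP x 0) => x0; case: (leP (x + y) 0) => xy ? ?; apply/andP; split; lra.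
Qed.

Lemma pos_sqr_diff x y : `|pos (x + y) ^+ 2 - pos x ^+ 2 - 2 * pos x * y| <= y ^+ 2.
Proof.
rewrite /pos ler_norml.
by case: (leP x 0) => x0; case: (leP (x + y) 0) => xy; apply/andP; split; nra.
Qed.

Lemma Sfun_cut : Sfun 4 cut dcut.
Proof.
have mp : measurable_fun setT pos by exact: measurable_maxr.
have p0 x := pos_ge0 x.
have q0 x : 0 < 1 + pos x ^+ 2 by rewrite ltr_wpDr// sqr_ge0.
have q1 x : 1 <= 1 + pos x ^+ 2 by rewrite lerDl sqr_ge0.
have mc : measurable_fun setT cut.
  rewrite (_ : cut = (fun x => x `^ (-1)) \o (fun x => 1 + pos x ^+ 2)); last first.
    by apply/funext => x /=; rewrite powR_inv1// ltW.
  apply: measurableT_comp; first exact: measurable_powR.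
  by apply: measurable_funD => //; exact: measurable_funX.
have c1 x : 0 <= cut x <= 1 by rewrite /cut invr_ge0 ltW//= invf_le1.
split.
- exact: mc.
- rewrite (_ : dcut = fun x => - (2 * pos x * cut x ^+ 2)).
    apply: measurable_funN; apply: measurable_funM; last exact: measurable_funX.
    exact: measurable_funM.
  by apply/funext => x; rewrite /dcut /cut exprVn.
- by move=> x; have /andP[? ?] := c1 x; rewrite ger0_norm//; lra.
- move=> x; rewrite /dcut normrN ger0_norm; last by rewrite divr_ge0 ?sqr_ge0// mulr_ge0.
  rewrite ler_pdivrMr ?exprn_gt0//; have := p0 x; set a := pos x => a0.
  have : 0 <= a ^+ 2 by exact: sqr_ge0.
  nra.
move=> x y; rewrite /cut /dcut; have qx := q0 x; have qy := q0 (x + y).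
have := pos_diff x y; have := pos_sqr_diff x y; move: qx qy (p0 x) (p0 (x + y)).
set a := pos x; set b := pos (x + y) => qx qy a0 b0 hq hd.
(* Over the common denominator the remainder consists of the defect of the squared positive part, at
   most y^2 in size, and of a product of two first-order increments. *)
have e : (1 + b ^+ 2)^-1 - (1 + a ^+ 2)^-1 - - (2 * a / (1 + a ^+ 2) ^+ 2) * y =
  (- (1 + a ^+ 2) * (b ^+ 2 - a ^+ 2 - 2 * a * y) + 2 * a * y * ((b - a) * (a + b))) /
  ((1 + a ^+ 2) ^+ 2 * (1 + b ^+ 2)).
  by field; rewrite !gt_eqF.
have den : 0 < (1 + a ^+ 2) ^+ 2 * (1 + b ^+ 2) by rewrite mulr_gt0// exprn_gt0.
rewrite e normrM normfV (gtr0_norm den) ler_pdivrMr//.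
apply: (le_trans (ler_normD _ _)).
have y2 : `|y| * `|y| = y ^+ 2 by rewrite -expr2 real_normK ?num_real.
have h1 : `|- (1 + a ^+ 2) * (b ^+ 2 - a ^+ 2 - 2 * a * y)| <= (1 + a ^+ 2) * y ^+ 2.
  by rewrite normrM normrN (gtr0_norm qx) ler_wpM2l// ltW.
have h2 : `|2 * a * y * ((b - a) * (a + b))| <= 2 * a * (a + b) * y ^+ 2.
  rewrite !normrM (ger0_norm a0) (ger0_norm (addr_ge0 a0 b0)) ger0_norm//.
  have -> : 2 * a * (a + b) * y ^+ 2 = 2 * a * `|y| * (`|y| * (a + b)) by rewrite -y2; ring.
  by rewrite ler_wpM2l ?mulr_ge0// ler_wpM2r// addr_ge0.
apply: (le_trans (lerD h1 h2)).
rewrite -mulrDl (_ : 4 * y ^+ 2 * _ = 4 * ((1 + a ^+ 2) ^+ 2 * (1 + b ^+ 2)) * y ^+ 2); last by ring.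
rewrite ler_wpM2r ?sqr_ge0//.
have k1 : (1 + a ^+ 2) * (1 + b ^+ 2) <= (1 + a ^+ 2) ^+ 2 * (1 + b ^+ 2).
  rewrite expr2 -mulrA ler_peMl//; last by rewrite lerDl sqr_ge0.
  by rewrite mulr_ge0// ltW.
have k2 : 1 + a ^+ 2 + b ^+ 2 <= (1 + a ^+ 2) * (1 + b ^+ 2).
  by have := mulr_ge0 (sqr_ge0 a) (sqr_ge0 b); lra.
have k3 : 2 * (a * b) <= a ^+ 2 + b ^+ 2 by have := sqr_ge0 (a - b); nra.
have k4 : 2 * a * (a + b) = 2 * a ^+ 2 + 2 * (a * b) by ring.
have := sqr_ge0 b; have := sqr_ge0 a; lra.
Qed.

(** The quadratic remainder scales by m^2; since m >= 1, the same constant also covers the function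
    and its first derivative. *)
Lemma Sfun_affine K phi dphi (m a : R) : 1 <= m -> Sfun K phi dphi ->
  Sfun (K * m ^+ 2) (fun x => phi (m * (x - a))) (fun x => m * dphi (m * (x - a))).
Proof.
move=> m1 S; have K0 := Sfun_ge0 S; case: S => p1 p2 b db H.
have m0 : 0 <= m by exact: le_trans m1.
have mm : m <= m ^+ 2 by rewrite expr2 ler_peMl.
have ma : measurable_fun setT (fun x : R => m * (x - a)).
  by apply: measurable_funM => //; exact: measurable_funB.
split.
- exact: measurableT_comp p1 ma.
- by apply: measurable_funM => //; exact: measurableT_comp p2 ma.
- by move=> x; apply: (le_trans (b _)); rewrite ler_peMr// (le_trans m1).
- by move=> x; rewrite normrM (ger0_norm m0) mulrC ler_pM.
- move=> x y; have := H (m * (x - a)) (m * y).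
  rewrite (_ : m * (x - a) + m * y = m * (x + y - a)); last by ring.
  have -> : dphi (m * (x - a)) * (m * y) = m * dphi (m * (x - a)) * y by ring.
  by rewrite exprMn mulrA.
Qed.

Lemma cut_bound x : `|cut x| <= 1.
Proof.
have q0 : 0 < 1 + pos x ^+ 2 by rewrite ltr_wpDr// sqr_ge0.
have q1 : 0 <= (1 + pos x ^+ 2)^-1 by rewrite invr_ge0 ltW.
by rewrite /cut (ger0_norm q1) invf_le1// lerDl sqr_ge0.
Qed.

(** For x > a the value at z = m (x - a) is at most 1 / z, because z <= 1 + z^2. *)
Lemma cut_cvg a x : cut (m.+1%:R * (x - a)) @[m --> \oo] --> (\1_`]-oo, a]%classic x : R).
Proof.
rewrite indicE; have [xa|ax] := leP x a.
  rewrite mem_set; last by rewrite /= in_itv/=.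
  apply: cvg_near_cst; apply: nearW => m.
  by rewrite /cut /pos max_r ?expr0n ?addr0 ?invr1// mulr_ge0_le0// subr_le0.
rewrite memNset; last by rewrite /= in_itv/= leNgt ax.
have d0 : 0 < x - a by rewrite subr_gt0.
have h : harmonic m * (x - a)^-1 @[m --> \oo] --> (0 : R).
  by rewrite -(mul0r (x - a)^-1); apply: cvgMl; exact: cvg_harmonic.
apply: (squeeze_cvgr _ (cvg_cst 0) h); apply: nearW => m.
have m0 : 0 < m.+1%:R * (x - a) by rewrite mulr_gt0// ltr0n.
rewrite /cut /pos (max_l (ltW m0)) /harmonic -invfM; set z := _ * _ in m0 *.
have z1 : 0 < 1 + z ^+ 2 by rewrite ltr_wpDr// sqr_ge0.
by rewrite invr_ge0 (ltW z1)/= lef_pV2 ?posrE//; have := sqr_ge0 (z - 1); nra.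
Qed.

End smooth_class.

(** * The Poisson random measure *)

Section noise.
Context {R : realType} {d : measure_display} {Omega : measurableType d}.
Variables (P : probability Omega R) (T : R) (F : R -> set (set Omega)).
Variable B : R -> Omega -> R.
Variable nu : {sigma_finite_measure set (measurableTypeR R) -> \bar R}.
Variable N : R.-ker Omega ~> (measurableTypeR R * measurableTypeR R)%type.
Hypothesis mB : forall t, measurable_fun setT (B t).
Hypothesis T_gt0 : 0 < T.
Hypothesis filtF : filtration F.
Hypothesis usualF : usual_conditions P F.
Hypothesis FE : forall t, 0 <= t -> F t = augmented_filtration P T N B t.
Hypothesis BM : brownian_motion P B.
Hypothesis PRM : poisson_random_measure P T nu N.
Hypothesis BN : independent_algebras P (generated_by `[0, +oo[ B)
    (generated_by (jump_sets T) (fun E w => N w E)).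

Local Notation leb2 := (lebesgue_measure \x nu)%E.
Local Notation RR := (measurableTypeR R * measurableTypeR R)%type.

Lemma negl_measurable : P.-negligible `<=` measurable.
Proof. by case: usualF. Qed.

Lemma F_sigma t : 0 <= t -> sigma_algebra setT (F t).
Proof. by move=> t0; case: filtF => /(_ t t0)[]. Qed.

Lemma F_meas t : 0 <= t -> F t `<=` measurable.
Proof. by move=> t0; case: filtF => /(_ t t0)[]. Qed.

Lemma F_mono s t : 0 <= s -> s <= t -> F s `<=` F t.
Proof. by case: filtF => _; exact. Qed.

Lemma F_negl t : 0 <= t -> P.-negligible `<=` F t.
Proof.
by move=> t0 A nA; apply: (F_mono (lexx 0) t0); case: usualF => _ + _; exact.
Qed.

Lemma mN E : measurable E -> measurable_fun setT (fun w => N w E).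
Proof. exact: measurable_kernel. Qed.

(** [fine] turns an infinite count into 0; on sets of finite intensity this concerns a null event
    only. *)
Definition cnt (E : set RR) (w : Omega) : R := fine (N w E).

Definition int_fin (E : set RR) := jump_sets T E /\ (leb2 E < +oo)%E.

Definition intens (E : set RR) : R := fine (leb2 E).

Lemma intensE E : int_fin E -> leb2 E = (intens E)%:E.
Proof.
by move=> [_ Eoo]; rewrite fineK// ge0_fin_numE.
Qed.

Lemma intens_ge0 E : 0 <= intens E.
Proof. by rewrite fine_ge0. Qed.

Lemma int_finS E E' : int_fin E -> measurable E' -> E' `<=` E -> int_fin E'.
Proof.
move=> [[mE EJ] Eoo] mE' E'E; split; first by split=> // x /E'E; exact: EJ.
by apply: le_lt_trans Eoo; apply: le_measure => //; rewrite inE.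
Qed.

Lemma N_atom E (k : nat) : int_fin E ->
  P [set w | N w E = k%:R%:E] = poisson_prob (intens E) 0 [set k].
Proof.
by move=> Ef; case: PRM => + _; apply; [case: Ef|exact: intensE].
Qed.

Lemma mN_atom E (y : \bar R) : measurable E -> measurable [set w | N w E = y].
Proof.
by move=> mE; rewrite -[X in measurable X]setTI; exact: (mN mE measurableT (emeasurable_set1 y)).
Qed.

Lemma atoms_triv E : trivIset setT (fun k : nat => [set w | N w E = k%:R%:E]).
Proof.
move=> i j _ _ [w [/= -> /eqP]]; rewrite eqe eqr_nat => /eqP; exact.
Qed.

Lemma atoms_cover E : int_fin E ->
  P (\bigcup_(k : nat) [set w | N w E = k%:R%:E]) = 1%E.
Proof.
move=> Ef; have mE : measurable E by case: Ef => -[].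
have mA k : measurable [set w | N w E = k%:R%:E] by exact: mN_atom.
have tA := @atoms_triv E.
rewrite measure_bigcup//=.
rewrite -(poisson_total (intens E)) eseries_mkcond/=.
by apply: eq_eseriesr => k _; rewrite in_setT N_atom.
Qed.

(** As a kernel, N may take any value in [0, +oo]; integrality comes from the law, whose masses at
    the integers already add up to 1. *)
Lemma N_ae_nat E : int_fin E -> {ae P, forall w, exists k : nat, N w E = k%:R%:E}.
Proof.
move=> Ef; have mE : measurable E by case: Ef => -[].
pose A := \bigcup_(k : nat) [set w | N w E = k%:R%:E].
have mA : measurable A by apply: bigcupT_measurable => k; exact: mN_atom.
exists (~` A); split; first exact: measurableC.
  by rewrite probability_setC// atoms_cover// subee.
by move=> w /= nk [k _ Nk]; apply: nk; exists k.
Qed.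

Lemma N_law E (G : \bar R -> \bar R) : int_fin E -> measurable_fun setT G ->
  (forall y, 0 <= y -> 0 <= G y)%E ->
  (\int[P]_w G (N w E) =
   \sum_(0 <= k <oo) (G k%:R%:E * poisson_prob (intens E) 0 [set k]))%E.
Proof.
move=> Ef mG G0; have mE : measurable E by case: Ef => -[].
pose A k := [set w | N w E = k%:R%:E].
have mA k : measurable (A k) by exact: mN_atom.
have mGN : measurable_fun setT (fun w => G (N w E)).
  by apply: measurableT_comp => //; exact: mN.
have -> : (\int[P]_w G (N w E) = \int[P]_(w in \bigcup_k A k) G (N w E))%E.
  rewrite [RHS]integral_mkcond; apply: ae_eq_integral => //.
    apply/(measurable_restrictT _ _).1; first exact: bigcupT_measurable.
    exact: measurable_funTS.
  have := N_ae_nat Ef; apply: filterS => w [k Nk] _.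
  by rewrite patchE ifT// inE; exists k.
rewrite ge0_integral_bigcup//.
- apply: eq_eseriesr => k _.
  rewrite (@eq_integral _ _ _ P (A k) (cst (G k%:R%:E))); last first.
    by move=> w; rewrite inE /= => ->.
  rewrite integral_cst//; congr (_ * _)%E; exact: N_atom.
- by apply: measurable_funTS.
- by move=> w _; exact: G0.
- exact: atoms_triv.
Qed.

Lemma cnt_ge0 E w : 0 <= cnt E w.
Proof. exact: fine_ge0. Qed.

Lemma m_cnt E : measurable E -> measurable_fun setT (cnt E).
Proof. by move=> mE; apply: measurableT_comp => //; exact: mN. Qed.

Lemma cnt_ae_nat E : int_fin E ->
  {ae P, forall w, exists k : nat, N w E = k%:R%:E /\ cnt E w = k%:R}.
Proof.
by move=> Ef; have := N_ae_nat Ef; apply: filterS => w [k Nk]; exists k; rewrite /cnt Nk.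
Qed.

Lemma intg_cnt E : int_fin E -> intg P (cnt E) /\ Ex P (cnt E) = intens E.
Proof.
move=> Ef; have mE : measurable E by case: Ef => -[].
have I : (\int[P]_w (cnt E w)%:E = (intens E)%:E)%E.
  rewrite (@N_law E (EFin \o fine))//=; last 2 first.
  - exact/measurable_EFinP.
  - by move=> y y0; rewrite lee_fin fine_ge0.
  by rewrite poisson_mean ?intens_ge0.
have ci : intg P (cnt E).
  by apply: intg_lty; [exact: m_cnt|move=> w; exact: cnt_ge0|rewrite I ltry].
by split=> //; rewrite /Ex /Rintegral I.
Qed.

(** The absolute value makes the integrand nonnegative at every nonnegative count, as [N_law]
    requires; c (c - 1) is negative between 0 and 1. *)
Lemma cnt2_law E : int_fin E ->
  (\int[P]_w (cnt E w * `|cnt E w - 1|)%:E = ((intens E) ^+ 2)%:E)%E.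
Proof.
move=> Ef; rewrite (@N_law E (fun y => (fine y * `|fine y - 1|)%:E))//=.
- rewrite -poisson_mean2 ?intens_ge0//; apply: eq_eseriesr => -[|k] _.
    by rewrite !mul0r.
  by rewrite -natr1 addrK normr_nat.
- apply/measurable_EFinP/measurable_funM => //.
  by apply: measurableT_comp => //; exact: measurable_funB.
- by move=> y y0; rewrite lee_fin mulr_ge0// fine_ge0.
Qed.

Lemma ae_cnt_abs E : int_fin E ->
  {ae P, forall w, cnt E w * `|cnt E w - 1| = cnt E w * (cnt E w - 1)}.
Proof.
move=> Ef; have := cnt_ae_nat Ef; apply: filterS => w [[|k] [_ ->]].
  by rewrite !mul0r.
by rewrite -natr1 addrK normr_nat.
Qed.

Lemma intg_cnt2 E : int_fin E ->
  intg P (fun w => cnt E w * (cnt E w - 1)) /\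
  Ex P (fun w => cnt E w * (cnt E w - 1)) = intens E ^+ 2.
Proof.
move=> Ef; have mE : measurable E by case: Ef => -[].
have mc := m_cnt mE.
have m1 : measurable_fun setT (fun w => cnt E w * `|cnt E w - 1|).
  by apply: measurable_funM => //; apply: measurableT_comp => //; exact: measurable_funB.
have m2 : measurable_fun setT (fun w => cnt E w * (cnt E w - 1)).
  by apply: measurable_funM => //; exact: measurable_funB.
have i1 : intg P (fun w => cnt E w * `|cnt E w - 1|).
  apply: intg_lty => //; last by rewrite cnt2_law// ltry.
  by move=> w; rewrite mulr_ge0// cnt_ge0.
split; first exact: ae_intg (ae_cnt_abs Ef) i1.
by rewrite -(Ex_ae m1 m2 (ae_cnt_abs Ef)) /Ex /Rintegral cnt2_law.
Qed.

Definition cmp E w := cnt E w - intens E.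

Lemma sqint_cnt E : int_fin E -> sqint P (cnt E).
Proof.
move=> Ef; have mE : measurable E by case: Ef => -[].
have [i1 _] := intg_cnt Ef; have [i2 _] := intg_cnt2 Ef.
apply/sqintP; split; first exact: m_cnt.
by apply: intg_ext (intgD i2 i1) => w; ring.
Qed.

Lemma sqint_cmp E : int_fin E -> sqint P (cmp E).
Proof. by move=> Ef; apply: sqintB; [exact: sqint_cnt|exact: sqint_cst]. Qed.

Lemma Ex_cmp E : int_fin E -> Ex P (cmp E) = 0.
Proof.
move=> Ef; have [i1 e1] := intg_cnt Ef.
by rewrite /cmp ExB//; [rewrite e1 Ex_cst subrr|exact: intg_cst].
Qed.

Lemma sqn_cmp E : int_fin E -> sqn P (cmp E) = intens E.
Proof.
move=> Ef; have [i1 e1] := intg_cnt Ef; have [i2 e2] := intg_cnt2 Ef.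
rewrite /sqn /cmp (@Ex_ext _ _ _ _ _ (fun w => cnt E w * (cnt E w - 1) +
  ((1 - 2 * intens E) * cnt E w + intens E ^+ 2))); last by move=> w; ring.
rewrite ExD//; last by apply: intgD; [exact: intgZ|exact: intg_cst].
rewrite [X in _ + X]ExD; [|exact: intgZ|exact: intg_cst].
rewrite ExZ//.
by rewrite e1 e2 Ex_cst; ring.
Qed.

(** Only almost sure, because [fine] is additive on finite values. *)
Lemma cntU E E' : int_fin E -> int_fin E' -> E `&` E' = set0 ->
  {ae P, forall w, cnt (E `|` E') w = cnt E w + cnt E' w}.
Proof.
move=> Ef Ef' EE'; have mE : measurable E by case: Ef => -[].
have mE' : measurable E' by case: Ef' => -[].
have := cnt_ae_nat Ef; have := cnt_ae_nat Ef'; apply: filterS2 => w [k [k1 k2]] [l [l1 l2]].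
by rewrite k2 l2 /cnt measureU//= k1 l1.
Qed.

Lemma intensU E E' : int_fin E -> int_fin E' -> E `&` E' = set0 ->
  intens (E `|` E') = intens E + intens E'.
Proof.
move=> Ef Ef' EE'; have mE : measurable E by case: Ef => -[].
have mE' : measurable E' by case: Ef' => -[].
rewrite /intens measureU// fineD// ge0_fin_numE//; [by case: Ef|by case: Ef'].
Qed.

Lemma cnt_indep E E' : jump_sets T E -> jump_sets T E' -> E `&` E' = set0 ->
  forall C C' : set (\bar R), measurable C -> measurable C' ->
  P ((fun w => N w E) @^-1` C `&` (fun w => N w E') @^-1` C') =
  (P ((fun w => N w E) @^-1` C) * P ((fun w => N w E') @^-1` C'))%E.
Proof.
move=> JE JE' EE' C C' mC mC'; case: PRM => _ PI.
pose EE (i : 'I_2) := if i == ord0 then E else E'.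
pose CC (i : 'I_2) := if i == ord0 then C else C'.
have := PI 2%N EE _ _ CC _.
rewrite big_ord_recl big_ord_recl big_ord0 mule1 /EE /CC/= => <-.
- congr (P _); apply/seteqP; split=> w.
    by move=> [? ?] i _; case: ifPn.
  by move=> H; split; [exact: (H ord0 Logic.I)|exact: (H (lift ord0 ord0) Logic.I)].
- by move=> i; case: ifPn.
- move=> i j _ _; case: ifPn => [/eqP ->|i0]; case: ifPn => [/eqP ->|j0] // [x [xE xE']].
  + by exfalso; have : (E `&` E') x by []; rewrite EE'.
  + by exfalso; have : (E `&` E') x by []; rewrite EE'.
  + move: i0 j0; rewrite -!lt0n => i0 j0; apply/val_inj.
    by case: i i0 => -[|[|]]//; case: j j0 => -[|[|]].
- by move=> i; case: ifPn.
Qed.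

(** * Void events and the pi-systems built from them *)

Definition void (E : set RR) := [set w | N w E = 0%E].

Lemma voidU E E' : measurable E -> measurable E' ->
  void (E `|` E') = void E `&` void E'.
Proof.
move=> mE mE'; apply/seteqP; split=> w.
  rewrite /void/= => H; split; apply/eqP; rewrite eq_le measure_ge0 andbT -H.
    by apply: le_measure; rewrite ?inE//; exact: measurableU.
  by apply: le_measure; rewrite ?inE//; exact: measurableU.
rewrite /void/= => -[H H']; apply/eqP; rewrite eq_le measure_ge0 andbT.
apply: (@le_trans _ _ (N w E + N w E')%E); first exact: measureU2.
by rewrite H H' adde0.
Qed.

Lemma mvoid E : measurable E -> measurable (void E).
Proof. exact: mN_atom. Qed.

(* A pi-system: void events determine the random measure, so together with [G]
   they generate everything that [G] and the jumps in [J] determine. *)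
Definition vclass (G : set (set Omega)) (J : set (set RR)) : set (set Omega) :=
  [set A | exists D E, [/\ G D, J E &
     {ae P, forall w, A w <-> (D w /\ void E w)}]].

Lemma vclass_measurable G J : G `<=` measurable -> J `<=` jump_sets T ->
  vclass G J `<=` measurable.
Proof.
move=> Gm Jj A [D [E [GD JE AE]]].
apply: (@ae_eq_salg _ _ _ _ _ (@sigma_algebra_measurable _ _) negl_measurable (D `&` void E)).
  by apply: measurableI; [exact: Gm|apply: mvoid; case: (Jj _ JE)].
by apply: filterS AE => w; exact: iff_sym.
Qed.

Lemma vclassI G J : setI_closed G -> (forall E E', J E -> J E' -> J (E `|` E')) ->
  J `<=` jump_sets T -> setI_closed (vclass G J).
Proof.
move=> GI JU Jj A A' [D [E [GD JE AE]]] [D' [E' [GD' JE' AE']]].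
exists (D `&` D'), (E `|` E'); split; [exact: GI|exact: JU|].
rewrite voidU; [|by case: (Jj _ JE)|by case: (Jj _ JE')].
by apply: filterS2 AE AE' => w H H'; split=> [[/H[? ?] /H'[? ?]]|[[? ?] [? ?]]]; split=> //;
  [apply/H|apply/H'].
Qed.

Lemma vclass_sub G J D : G D -> J set0 -> vclass G J D.
Proof.
move=> GD J0; exists D, set0; split=> //; apply/aeW => w.
by split=> [Dw|[]//]; split=> //; rewrite /void/= measure0.
Qed.

Lemma vclass_void G J E : G setT -> J E -> vclass G J (void E).
Proof. by move=> GT JE; exists setT, E; split=> //; apply/aeW => w; split=> // -[]. Qed.

Lemma vclass_negl G J : G set0 -> J set0 -> P.-negligible `<=` vclass G J.
Proof.
move=> G0 J0 A [Z [mZ PZ AZ]]; exists set0, set0; split=> //.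
exists Z; split=> // w /= H; apply: AZ; apply: contrapT => nA; apply: H.
by split=> // -[].
Qed.

Definition sigB := generated_by `[0, +oo[ B.

Lemma sigB_sigma : sigma_algebra setT sigB.
Proof. exact: smallest_sigma_algebra. Qed.

Lemma generated_measurable (J : set R) : generated_by J B `<=` measurable.
Proof.
apply: smallest_sub; first exact: sigma_algebra_measurable.
move=> A [t _ [C mC <-]]; exact: mB.
Qed.

Lemma void_sigN E : jump_sets T E ->
  generated_by (jump_sets T) (fun E w => N w E) (void E).
Proof.
move=> JE; apply: sub_sigma_algebra; exists E => //; exists [set 0%E].
  exact: emeasurable_set1.
by rewrite setTI.
Qed.

(** On the pi-systems the probability factorises in three moves: the two void events merge into the
    void event of the union, [BN] separates that event from the Brownian ones, and then independence
    of G1 and G2 and of the counts on disjoint sets concludes. *)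
Lemma indep_vclass (G1 G2 : set (set Omega)) (J1 J2 : set (set RR)) :
  setI_closed G1 -> setI_closed G2 -> G1 `<=` sigB -> G2 `<=` sigB ->
  independent_algebras P G1 G2 ->
  J1 `<=` jump_sets T -> J2 `<=` jump_sets T ->
  (forall E E', J1 E -> J1 E' -> J1 (E `|` E')) ->
  (forall E E', J2 E -> J2 E' -> J2 (E `|` E')) ->
  (forall E E', J1 E -> J2 E' -> E `&` E' = set0) ->
  independent_algebras P <<s vclass G1 J1 >> <<s vclass G2 J2 >>.
Proof.
move=> G1I G2I G1B G2B G12 J1j J2j J1U J2U J12.
have Bm : sigB `<=` measurable := @generated_measurable _.
have G1m : G1 `<=` measurable by apply: subset_trans Bm.
have G2m : G2 `<=` measurable by apply: subset_trans Bm.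
apply: pi_indep; [exact: vclassI|exact: vclassI|exact: vclass_measurable|exact: vclass_measurable|].
move=> A C Av Cv; have mA := vclass_measurable G1m J1j Av; have mC := vclass_measurable G2m J2j Cv.
case: Av Cv => [D [E [GD JE AE]]] [D' [E' [GD' JE' CE]]].
have jE := J1j _ JE; have jE' := J2j _ JE'.
have mE : measurable E by case: jE.
have mE' : measurable E' by case: jE'.
have mD := G1m _ GD; have mD' := G2m _ GD'.
have mV := mvoid mE; have mV' := mvoid mE'.
have -> : P (A `&` C) = P ((D `&` D') `&` (void (E `|` E'))).
  apply: ae_eq_prob.
  - exact: measurableI.
  - by apply: measurableI; [exact: measurableI|apply: mvoid; exact: measurableU].
  - rewrite voidU//; apply: filterS2 AE CE => w H H'.
    by split=> [[/H[? ?] /H'[? ?]]|[[? ?] [? ?]]]; split=> //; [apply/H|apply/H'].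
have -> : P A = P (D `&` void E) by apply: ae_eq_prob => //; exact: measurableI.
have -> : P C = P (D' `&` void E') by apply: ae_eq_prob => //; exact: measurableI.
have jU : jump_sets T (E `|` E').
  by split; [exact: measurableU|rewrite subUset; split; [case: jE|case: jE']].
rewrite (BN (salgI sigB_sigma (G1B _ GD) (G2B _ GD')) (void_sigN jU)).
rewrite (BN (G1B _ GD) (void_sigN jE)) (BN (G2B _ GD') (void_sigN jE')).
rewrite (G12 _ _ GD GD') voidU//.
have -> : P (void E `&` void E') = (P (void E) * P (void E'))%E.
  exact: (cnt_indep jE jE' (J12 _ _ JE JE') (emeasurable_set1 0%E) (emeasurable_set1 0%E)).
by rewrite muleACA.
Qed.

Definition strip (a b : R) : set RR := `]a, b]%classic `*` setT.

Lemma mstrip a b : measurable (strip a b).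
Proof. by apply: measurableX. Qed.

Lemma leb2X a b (A : set (measurableTypeR R)) : a <= b -> measurable A ->
  (nu A < +oo)%E -> leb2 (`]a, b]%classic `*` A) = ((b - a) * fine (nu A))%:E.
Proof.
move=> ab mA Aoo; rewrite product_measure1E//= lebesgue_measure_itv/= lte_fin.
have nA : nu A = (fine (nu A))%:E by rewrite fineK// ge0_fin_numE.
case: ltP => [_|ba]; first by rewrite [X in (_ * X)%E]nA -EFinB -EFinM.
by rewrite mul0e (le_anti (_ : a <= b <= a)) ?subrr ?mul0r// ab.
Qed.

Lemma int_fin_box a b (A : set (measurableTypeR R)) : 0 <= a -> b <= T ->
  measurable A -> A `<=` Rnz R -> (nu A < +oo)%E ->
  int_fin (`]a, b]%classic `*` A).
Proof.
move=> a0 bT mA AR Aoo; split.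
  split; first exact: measurableX.
  move=> [x y] [/=]; rewrite in_itv/= => /andP[ax xb] /AR Ry; split=> //=.
  by rewrite in_itv/= (le_trans xb bT) andbT (le_trans a0)// ltW.
have [ab|ba] := leP a b; first by rewrite leb2X// ltry.
by rewrite set_itv_ge ?set0X ?measure0// bnd_simp -leNgt ltW.
Qed.

Lemma intens_box a b (A : set (measurableTypeR R)) : a <= b ->
  measurable A -> (nu A < +oo)%E ->
  intens (`]a, b]%classic `*` A) = (b - a) * fine (nu A).
Proof. by move=> ab mA Aoo; rewrite /intens leb2X. Qed.

Lemma int_fin_bounded E (A : set (measurableTypeR R)) : jump_sets T E ->
  E `<=` `[0, T]%classic `*` A -> measurable A -> (nu A < +oo)%E -> int_fin E.
Proof.
move=> jE EA mA Aoo; split=> //.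
have mE : measurable E by case: jE.
apply: (@le_lt_trans _ _ (leb2 (`[0, T]%classic `*` A))).
  by apply: le_measure; rewrite ?inE//; exact: measurableX.
rewrite product_measure1E//= lebesgue_measure_itv/= lte_fin T_gt0.
by rewrite -EFinD oppr0 addr0 lte_mul_pinfty// lee_fin ltW.
Qed.

(** The slices are half-open and miss time 0, where E has intensity 0 and hence almost surely no
    point. Taking 8^n of them makes the errors in [jump_measurable1] decay at the rate expected by
    [ae_geometric_bound]. *)
Lemma cnt_slices E (A : set (measurableTypeR R)) n : jump_sets T E ->
  E `<=` `[0, T]%classic `*` A -> measurable A -> (nu A < +oo)%E ->
  {ae P, forall w, cnt E w = \sum_(0 <= i < 8 ^ n)
    cnt (E `&` strip (i%:R * (T / (8 ^ n)%:R)) (i.+1%:R * (T / (8 ^ n)%:R))) w}.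
Proof.
move=> jE EA mA Aoo; have Ef := int_fin_bounded jE EA mA Aoo.
have mE : measurable E by case: jE.
set h := T / (8 ^ n)%:R; have h0 : 0 < h by rewrite divr_gt0// ltr0n expn_gt0.
pose G k : set RR := E `&` (`[0, k%:R * h]%classic `*` setT).
have mG k : measurable (G k) by apply: measurableI => //; exact: measurableX.
have Gf k : int_fin (G k) by apply: (int_finS Ef) => // x [].
have mS k : measurable (E `&` strip (k%:R * h) (k.+1%:R * h)).
  by apply: measurableI => //; exact: mstrip.
have Sf k : int_fin (E `&` strip (k%:R * h) (k.+1%:R * h)).
  by apply: (int_finS Ef) => // x [].
have H k : {ae P, forall w, cnt (G k) w =
    \sum_(0 <= i < k) cnt (E `&` strip (i%:R * h) (i.+1%:R * h)) w}.
  elim: k => [|k ih].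
    have G0 : Ex P (cnt (G 0%N)) = 0.
      rewrite (intg_cnt (Gf 0%N)).2; apply/eqP; rewrite eq_le intens_ge0 andbT.
      rewrite -lee_fin -intensE//; apply: (@le_trans _ _ (leb2 ([set 0] `*` A))).
        apply: le_measure; rewrite ?inE//; first exact: measurableX.
        move=> [x y] [/EA[_ Ay] [/=]]; rewrite mul0r in_itv/= => /andP[x0 x0'] _.
        by split=> //=; apply/eqP; rewrite eq_le x0' x0.
      by rewrite product_measure1E//= lebesgue_measure_set1 mul0e.
    have := Ex_eq0_ae (intg_cnt (Gf 0%N)).1 (cnt_ge0 _) G0.
    by apply: filterS => w ->; rewrite big_geq.
  have GS : G k.+1 = G k `|` (E `&` strip (k%:R * h) (k.+1%:R * h)).
    apply/seteqP; split=> -[x y].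
      move=> [Exy [/=]]; rewrite in_itv/= => /andP[x0 xk] _.
      have [xk'|xk'] := leP x (k%:R * h); [left|right]; split=> //; split=> //=.
        by rewrite in_itv/= x0 xk'.
      by rewrite in_itv/= xk' xk.
    move=> [[Exy [/=]]|[Exy [/=]]]; rewrite in_itv/= => /andP[x0 xk] _; split=> //; split=> //=.
      by rewrite in_itv/= x0 (le_trans xk)// ler_wpM2r ?ler_nat// ltW.
    rewrite in_itv/= xk andbT (le_trans _ (ltW x0))// mulr_ge0// ltW//.
  have dj : G k `&` (E `&` strip (k%:R * h) (k.+1%:R * h)) = set0.
    apply/seteqP; split=> // -[x y] [[_ [/=]]]; rewrite in_itv/= => /andP[_ xk] _.
    by move=> [_ [/=]]; rewrite in_itv/= ltNge xk.
  have := cntU (Gf k) (Sf k) dj; apply: filterS2 ih => w ih.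
  by rewrite -GS big_nat_recr//= -ih.
have := H (8 ^ n)%N; apply: filterS => w <-; congr (cnt _ w).
rewrite /G (_ : (8 ^ n)%:R * h = T); last by rewrite /h mulrC divfK// gt_eqF// ltr0n expn_gt0.
by apply/seteqP; split=> [x Ex|x []//]; split=> //; have [? ?] := EA _ Ex; split.
Qed.

(* N E is the limit of the number of non-void slices of E: the expected number of
   points sharing a slice is of the order of the mesh. *)
Lemma jump_measurable1 (G : set (set Omega)) E (A : set (measurableTypeR R)) :
  sigma_algebra setT G -> P.-negligible `<=` G ->
  jump_sets T E -> E `<=` `[0, T]%classic `*` A -> measurable A ->
  (nu A < +oo)%E ->
  (forall n i, (i < 8 ^ n)%N ->
    G (void (E `&` strip (i%:R * (T / (8 ^ n)%:R)) (i.+1%:R * (T / (8 ^ n)%:R))))) ->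
  measurable_wrt G (cnt E).
Proof.
move=> sG nG jE EA mA Aoo GV; have Ef := int_fin_bounded jE EA mA Aoo.
have mE : measurable E by case: jE.
pose h n : R := T / (8 ^ n)%:R.
have h0 n : 0 < h n by rewrite divr_gt0// ltr0n expn_gt0.
pose Ei n i := E `&` strip (i%:R * h n) (i.+1%:R * h n).
have mEi n i : measurable (Ei n i) by apply: measurableI => //; exact: mstrip.
have Eif n i : int_fin (Ei n i) by apply: (int_finS Ef) => // x [].
pose V n w : R := \sum_(i < 8 ^ n) (1 - \1_(void (Ei n i)) w).
have GVn n : measurable_wrt G (V n).
  apply: mwrt_sum => // i; apply: mwrtB => //; first exact: mwrt_cst.
  by apply: mwrt_indic => //; apply: GV.
pose K := (T * fine (nu A)) ^+ 2; have K0 : 0 <= K := sqr_ge0 _.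
have K1 : 0 < K + 1 by rewrite ltr_wpDl.
have mi n i : intens (Ei n i) <= h n * fine (nu A).
  have [/= ab ab'] : i%:R * h n <= i.+1%:R * h n /\ i.+1%:R * h n - i%:R * h n = h n.
    by rewrite ler_wpM2r ?ler_nat ?ltW//; split=> //; rewrite -natr1; ring.
  rewrite -[in leRHS]ab' -lee_fin -intensE// -leb2X//.
  apply: le_measure; rewrite ?inE//; first exact: measurableX.
  by move=> [x y] [/EA[_ Ay] [xs _]]; split.
have mV n : measurable_fun setT (V n).
  apply: measurable_sum => i; apply: measurable_funB => //.
  by apply: measurable_indic; exact: mvoid.
have mc := m_cnt mE.
have mW n : measurable_fun setT (fun w => `|cnt E w - V n w|).
  by apply: measurableT_comp => //; exact: measurable_funB.
(* A slice with k points contributes the error k - 1 if k > 0 and 0 if k = 0, in both cases at most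
   k (k - 1). *)
have WV n : {ae P, forall w, `|cnt E w - V n w| <=
    \sum_(i < 8 ^ n) (cnt (Ei n i) w * (cnt (Ei n i) w - 1))}.
  have ac : {ae P, forall w, forall i, exists k : nat, N w (Ei n i) = k%:R%:E /\ cnt (Ei n i) w = k%:R}.
    by apply/ae_foralln => i; exact: cnt_ae_nat.
  apply: filterS2 (cnt_slices n jE EA mA Aoo) ac => w -> ac.
  rewrite big_mkord -sumrB; apply: (le_trans (ler_norm_sum _ _ _)).
  apply: ler_sum => i _; have [k [Nk ->]] := ac i.
  rewrite indicE; case: k Nk => [|k] Nk.
    by rewrite mem_set//= subrr subr0 normr0 mul0r.
  rewrite memNset/=; last by rewrite /void/= Nk => /eqP; rewrite eqe pnatr_eq0.
  rewrite subr0 -natr1 addrK normr_nat -[leLHS]mul1r ler_wpM2r//.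
  by rewrite lerDr.
have isum n : intg P (fun w => \sum_(i < 8 ^ n) (cnt (Ei n i) w * (cnt (Ei n i) w - 1))).
  by apply: intg_sum => i; exact: (intg_cnt2 (Eif n i)).1.
(* There are 8^n slices, each of expected error at most the square of T nu(A) / 8^n, which gives K
   8^-n in total; the factor 1 / (K + 1) normalises this to 8^-n. *)
have IW n : (\int[P]_w ((K + 1)^-1 * `|cnt E w - V n w|)%:E <= (8 ^- n)%:E)%E.
  have -> : (\int[P]_w ((K + 1)^-1 * `|cnt E w - V n w|)%:E =
     (K + 1)^-1%:E * \int[P]_w `|cnt E w - V n w|%:E)%E.
    under eq_integral do rewrite EFinM.
    by rewrite ge0_integralZl_EFin// ?invr_ge0 ?ltW//; apply/measurable_EFinP.
  apply: (@le_trans _ _ ((K + 1)^-1%:E * (K * 8 ^- n)%:E)%E); last first.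
    rewrite -EFinM lee_fin mulrA ler_piMl ?invr_ge0 ?exprn_ge0//.
    by rewrite mulrC ler_pdivrMr// mul1r lerDl.
  rewrite lee_pmul2l ?lte_fin ?invr_gt0//.
  apply: (@le_trans _ _ (\int[P]_w (\sum_(i < 8 ^ n) (cnt (Ei n i) w * (cnt (Ei n i) w - 1)))%:E)%E).
    apply: (@le_trans _ _ (\int[P]_w `|(\sum_(i < 8 ^ n) (cnt (Ei n i) w * (cnt (Ei n i) w - 1)))|%:E)%E).
      apply: ae_ge0_le_integral => //.
      - exact/measurable_EFinP.
      - by apply/measurable_EFinP; apply: measurableT_comp => //; exact: intg_meas (isum n).
      - by apply: filterS (WV n) => w H _; rewrite lee_fin (le_trans H)// ler_norm.
    rewrite le_eqVlt; apply/orP; left; apply/eqP; apply: ae_eq_integral => //.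
    - by apply/measurable_EFinP; apply: measurableT_comp => //; exact: intg_meas (isum n).
    - by apply/measurable_EFinP; exact: intg_meas (isum n).
    - by apply: filterS (WV n) => w H _; rewrite ger0_norm// (le_trans _ H).
  rewrite ExE// lee_fin Ex_sum; last by move=> i; exact: (intg_cnt2 (Eif n i)).1.
  apply: (@le_trans _ _ (\sum_(i < 8 ^ n) (h n * fine (nu A)) ^+ 2)).
    apply: ler_sum => i _; rewrite (intg_cnt2 (Eif n i)).2.
    by rewrite lerXn2r ?nnegrE ?intens_ge0// (le_trans (intens_ge0 _) (mi n i)).
  rewrite sumr_const card_ord -[X in X <= _]mulr_natr /h /K natrX.
  by rewrite le_eqVlt; apply/orP; left; apply/eqP; field; rewrite expf_neq0.
have cV : {ae P, forall w, V ^~ w @ \oo --> cnt E w}.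
  have m1 n : measurable_fun setT (fun w => ((K + 1)^-1 * `|cnt E w - V n w|)%:E).
    by apply/measurable_EFinP; exact: measurable_funM.
  have m2 n w : (0 <= ((K + 1)^-1 * `|cnt E w - V n w|)%:E)%E.
    by rewrite lee_fin mulr_ge0// invr_ge0 ltW.
  have := ae_geometric_bound m1 m2 IW; apply: filterS => w [C HC].
  have c0 : (K + 1) * C * 4 ^- n @[n --> \oo] --> (0 : R).
    rewrite -(mulr0 ((K + 1) * C)); apply: cvgM; first exact: cvg_cst.
    under eq_fun do rewrite -exprVn; apply: cvg_expr.
    by rewrite ger0_norm ?invr_ge0// invf_lt1//; lra.
  apply: cvg_sub0 (cvg_cst (cnt E w)).
  apply/norm_cvg0P; apply: (squeeze_cvgr _ (cvg_cst 0) c0).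
  near=> n; rewrite /= normr_ge0/= distrC -mulrA -ler_pdivrMl//.
  by have := HC n; rewrite lee_fin.
exact: (ae_cvg_mwrt sG nG GVn cV).
Unshelve. all: by end_near. Qed.

(** * Independence of past and future *)

(** [J] is stable under measurable subsets, so it contains the time slices of its members and their
    traces on marks of finite [nu]-measure; sigma-finiteness then recovers E as an increasing
    limit. *)
Lemma jump_measurable (G : set (set Omega)) (J : set (set RR)) :
  sigma_algebra setT G -> P.-negligible `<=` G -> J `<=` jump_sets T ->
  (forall E E', J E -> measurable E' -> E' `<=` E -> J E') ->
  (forall E, J E -> G (void E)) ->
  forall E, J E -> forall C : set (\bar R), measurable C ->
  G ((fun w => N w E) @^-1` C).
Proof.
move=> sG nG Jj JS GV E JE C mC; have jE := Jj _ JE; have mE : measurable E by case: jE.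
have /sigma_finiteP [A [A_T A_nd A_oo]] := sigma_finiteT nu.
pose En n : set RR := E `&` (setT `*` A n).
have mEn n : measurable (En n).
  by apply: measurableI => //; apply: measurableX => //; case: (A_oo n).
have JEn n : J (En n) by apply: (JS E) => // x [].
have cG n : measurable_wrt G (cnt (En n)).
  apply: (@jump_measurable1 _ _ (A n)) => //.
  - exact: Jj.
  - by move=> [x y] [Exy [_ Ay]]; split=> //; case: jE => _ /(_ _ Exy)[].
  - by case: (A_oo n).
  - by case: (A_oo n).
  - move=> m i im; apply: GV; apply: (JS _ _ (JEn n)) => [|x []//].
    by apply: measurableI => //; exact: mstrip.
have Efn n : int_fin (En n).
  apply: (@int_fin_bounded _ (A n)).
  - exact: Jj.
  - by move=> [x y] [Exy [_ Ay]]; split=> //; case: jE => _ /(_ _ Exy)[].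
  - by case: (A_oo n).
  - by case: (A_oo n).
have mG n : measurable_fun (setT : set (g_sigma_algebraType G)) (fun w => N w (En n)).
  move=> _ D mD; rewrite setTI mwrt_id//.
  apply: (ae_eq_salg sG nG (cG n (EFin @^-1` D) _)).
    by rewrite -[X in measurable X]setTI; exact: EFin_measurable.
  by apply: filterS (cnt_ae_nat (Efn n)) => w [k [H1 H2]]; rewrite /preimage/= H1 H2.
have : measurable_fun (setT : set (g_sigma_algebraType G)) (fun w => N w E).
  apply: (@emeasurable_fun_cvg _ (g_sigma_algebraType G) R setT (fun n w => N w (En n))) => //.
  move=> w _; rewrite [in X in _ --> X](_ : E = \bigcup_n En n); last first.
    by rewrite /En -setI_bigcupr -setX_bigcupr -A_T setXTT setIT.
  apply: nondecreasing_cvg_mu => //; first exact: bigcupT_measurable.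
  move=> m n mn; apply/subsetPset => -[x y] [Exy [_ Ay]]; split=> //; split=> //.
  by have /subsetPset := A_nd _ _ mn; apply.
by move=> /(_ measurableT C mC); rewrite setTI mwrt_id.
Qed.

Lemma jump_sets_mono (s t : R) : s <= t -> jump_sets s `<=` jump_sets t.
Proof.
move=> st E [mE EJ]; split=> // x /EJ[/= xs ?]; split=> //=.
by move: xs; rewrite !in_itv/= => /andP[-> /le_trans ->].
Qed.

Lemma jump_sets_min (s : R) : jump_sets (Num.min s T) `<=` jump_sets T.
Proof. by apply: jump_sets_mono; rewrite ge_min lexx orbT. Qed.

Lemma jump_setsU (s : R) E E' : jump_sets s E -> jump_sets s E' -> jump_sets s (E `|` E').
Proof. by move=> [? ?] [? ?]; split; [exact: measurableU|rewrite subUset]. Qed.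

Lemma jump_sets0 (s : R) : jump_sets s set0.
Proof. by split. Qed.

(** [G] carries the information on B and may be larger than that of B up to s. Null sets enter
    through the almost sure equality in [vclass]. *)
Definition past (G : set (set Omega)) s := <<s vclass G (jump_sets (Num.min s T)) >>.

Lemma past_sub G s : sigma_algebra setT G -> G `<=` past G s.
Proof. by move=> sG A GA; apply: sub_sigma_algebra; apply: vclass_sub => //; exact: jump_sets0. Qed.

Lemma past_negl G s : sigma_algebra setT G -> P.-negligible `<=` past G s.
Proof.
move=> [G0 _ _] A nA; apply: sub_sigma_algebra; exact: vclass_negl.
Qed.

Lemma past_jump G s E : sigma_algebra setT G -> jump_sets (Num.min s T) E ->
  forall C : set (\bar R), measurable C -> past G s ((fun w => N w E) @^-1` C).
Proof.
move=> sG JE C mC; apply: (@jump_measurable _ (jump_sets (Num.min s T))) => //.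
- exact: smallest_sigma_algebra.
- exact: past_negl.
- exact: jump_sets_min.
- by move=> D D' [mD DJ] mD' D'D; split=> // x /D'D /DJ.
- move=> D JD; apply: sub_sigma_algebra; apply: vclass_void => //; exact: salgT.
Qed.

(** Checked on the three kinds of generators of [F s]: Brownian events by hypothesis, counts by
    [past_jump], null sets by [past_negl]. *)
Lemma F_past G s : 0 <= s -> sigma_algebra setT G -> generated_by `[0, s] B `<=` G ->
  F s `<=` past G s.
Proof.
move=> s0 sG BG; rewrite FE//; apply: smallest_sub; first exact: smallest_sigma_algebra.
move=> A [[GA|]|nA]; [by apply: past_sub => //; exact: BG| |exact: past_negl].
move: A; apply: smallest_sub; first exact: smallest_sigma_algebra.
move=> A [E JE [C mC <-]]; rewrite setTI; exact: past_jump.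
Qed.

Definition dB s t w := B t w - B s w.

Lemma m_dB s t : measurable_fun setT (dB s t).
Proof. exact: measurable_funB. Qed.

Lemma B_wrt s (J : set R) : J s -> measurable_wrt (generated_by J B) (B s).
Proof.
move=> Js C mC; apply: sub_sigma_algebra; exists s => //.
by exists C => //; rewrite setTI.
Qed.

Lemma gB_sigma (J : set R) : sigma_algebra setT (generated_by J B).
Proof. exact: smallest_sigma_algebra. Qed.

Lemma dB_wrt s t : 0 <= s -> 0 <= t -> measurable_wrt sigB (dB s t).
Proof.
move=> s0 t0; apply: mwrtB; first exact: sigB_sigma.
  by apply: B_wrt; rewrite /= in_itv/= t0.
by apply: B_wrt; rewrite /= in_itv/= s0.
Qed.

Lemma gB_sub (J : set R) : J `<=` `[0, +oo[%classic -> generated_by J B `<=` sigB.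
Proof.
move=> JJ; apply: sub_sigma_algebra2 => A [t Jt At]; exists t => //; exact: JJ.
Qed.

Lemma itv0_sub (s : R) : `[0, s]%classic `<=` `[0 : R, +oo[%classic.
Proof. by move=> x; rewrite /= !in_itv/= => /andP[->]. Qed.

Lemma gp_sigma (U : Omega -> R) : sigma_algebra setT (g_sigma_algebra_preimage U).
Proof.
exact: (sigma_algebra_preimage (@setT Omega) U (@sigma_algebra_measurable _ R)).
Qed.

(** In [indep_vclass] the future receives the single jump set [set0], so that its side consists of
    the Brownian increment up to null sets. *)
Lemma F_indep_dB s t : 0 <= s -> s < t ->
  independent_algebras P (F s) (g_sigma_algebra_preimage (dB s t)).
Proof.
move=> s0 st; have [_ _ BI _] := BM.
have H : independent_algebras P (past (generated_by `[0, s] B) s)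
    <<s vclass (g_sigma_algebra_preimage (dB s t)) [set set0] >>.
  apply: indep_vclass.
  - by move=> A C GA GC; exact: (salgI (gB_sigma _) GA GC).
  - by move=> A C GA GC; exact: (salgI (gp_sigma _) GA GC).
  - by apply: gB_sub; exact: itv0_sub.
  - move=> A [C mC <-]; rewrite setTI; apply: dB_wrt => //; exact: ltW (le_lt_trans s0 st).
  - exact: BI.
  - exact: jump_sets_min.
  - by move=> _ ->; exact: jump_sets0.
  - exact: jump_setsU.
  - by move=> _ _ -> ->; rewrite setU0.
  - by move=> E _ _ ->; rewrite setI0.
move=> A C FA GC; apply: H; first exact: F_past (gB_sigma _) _ _ FA.
by apply: sub_sigma_algebra; exact: vclass_sub.
Qed.

Definition jumps_after (s : R) := [set E | jump_sets T E /\ E `<=` `]s, T]%classic `*` Rnz R].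

Definition after s := <<s vclass [set set0; setT] (jumps_after s) >>.

Lemma triv_sigma : sigma_algebra setT [set (set0 : set Omega); setT].
Proof.
split; [by left| |].
  by move=> A [->|->]; [right; rewrite setD0|left; rewrite setDT].
move=> A An; have [[n An']|nA] := pselect (exists n, A n = setT).
  by right; apply/seteqP; split=> // x _; exists n => //; rewrite An'.
left; apply/seteqP; split=> // x [n _]; have [->//|An'] := An n.
by exfalso; apply: nA; exists n.
Qed.

(** The whole Brownian path, including times after s, together with the jumps up to s. As it is
    still independent of the later jumps, functions of B beyond s can stay on the side of the past
    when a jump term is averaged. *)
Definition fullpast s := past sigB s.

Lemma fullpast_sigma s : sigma_algebra setT (fullpast s).
Proof. exact: smallest_sigma_algebra. Qed.

Lemma after_sigma s : sigma_algebra setT (after s).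
Proof. exact: smallest_sigma_algebra. Qed.

Lemma F_fullpast s : 0 <= s -> F s `<=` fullpast s.
Proof. by move=> s0; apply: F_past => //; [exact: sigB_sigma|apply: gB_sub; exact: itv0_sub]. Qed.

Lemma sigB_fullpast s : sigB `<=` fullpast s.
Proof. exact: past_sub sigB_sigma. Qed.

Lemma fullpast_indep s : 0 <= s -> independent_algebras P (fullpast s) (after s).
Proof.
move=> s0; apply: indep_vclass.
- by move=> A C GA GC; exact: (salgI sigB_sigma GA GC).
- by move=> A C GA GC; exact: (salgI triv_sigma GA GC).
- by [].
- by move=> A [->|->]; [case: sigB_sigma|exact: salgT sigB_sigma].
- move=> A C BA [->|->]; first by rewrite setI0 measure0 mule0.
  by rewrite setIT probability_setT mule1.
- exact: jump_sets_min.
- by move=> E [].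
- exact: jump_setsU.
- move=> E E' [? ?] [? ?]; split; first exact: jump_setsU.
  by rewrite subUset.
- move=> E E' [_ Es] [_ E's]; apply/seteqP; split=> // -[x y] [/Es[/= + _] /E's[/= + _]].
  rewrite !in_itv/= => /andP[_ +] /andP[+ _].
  by rewrite le_min => /andP[xs _]; rewrite ltNge xs.
Qed.

Lemma after_cnt s E : jumps_after s E -> measurable_wrt (after s) (cnt E).
Proof.
move=> JE; have H : forall C : set (\bar R), measurable C -> after s ((fun w => N w E) @^-1` C).
  apply: (@jump_measurable _ (jumps_after s)) => //.
  - exact: after_sigma.
  - move=> A nA; apply: sub_sigma_algebra; apply: vclass_negl => //; first by left.
  - by move=> D [].
  - move=> D D' [[mD DJ] Ds] mD' D'D; split; first by split=> // x /D'D /DJ.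
    by move=> x /D'D /Ds.
  - by move=> D JD; apply: sub_sigma_algebra; apply: vclass_void => //; right.
move=> C mC; have := H (fine @^-1` C) _; apply.
by rewrite -[X in measurable X]setTI; exact: (fine_measurable measurableT).
Qed.

(** * Laws, moments and covariances of the increments of the two noises *)

Lemma indep_wrt (G1 G2 : set (set Omega)) (U V : Omega -> R) :
  independent_algebras P G1 G2 -> measurable_wrt G1 U -> measurable_wrt G2 V ->
  indep_maps P U V.
Proof. by move=> G12 mU mV A C mA mC; apply: G12; [exact: mU|exact: mV]. Qed.

Lemma Ex_dB_law s t (f : R -> R) : 0 <= s -> s < t -> measurable_fun setT f ->
  (forall x, 0 <= f x) ->
  (\int[P]_w (f (dB s t w))%:E =
   \int[normal_prob 0%R (Num.sqrt (t - s))]_x (f x)%:E)%E.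
Proof.
move=> s0 st mf f0; have [_ _ _ BL] := BM.
have mU : measurable_fun setT (dB s t : Omega -> measurableTypeR R) := @m_dB s t.
pose U : {mfun Omega >-> measurableTypeR R} := @mfun_Sub _ _ Omega (measurableTypeR R) _ (mem_set mU).
transitivity (\int[distribution P U]_x (f x)%:E)%E.
  have mf' : measurable_fun (setT : set (measurableTypeR R)) (fun x => (f x)%:E).
    by apply: measurableT_comp; [exact: EFin_measurable|exact: mf].
  have H := ge0_integral_pushforward mU P measurableT mf'.
  by rewrite [RHS]H// => x _; rewrite lee_fin.
apply: (@eq_measure_integral _ (measurableTypeR R) R setT (normal_prob 0 (Num.sqrt (t - s))) (distribution P U)).
by move=> A mA _; exact: (esym (esym (BL s t s0 st A mA))).
Qed.

Lemma sqint_dB s t : 0 <= s -> s < t ->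
  sqint P (dB s t) /\ sqn P (dB s t) = t - s.
Proof.
move=> s0 st; have ts : 0 < Num.sqrt (t - s) by rewrite sqrtr_gt0 subr_gt0.
have H : (\int[P]_w ((dB s t w) ^+ 2)%:E = (t - s)%:E)%E.
  rewrite (@Ex_dB_law s t (fun x => x ^+ 2))//.
  - by rewrite normal_moment2// sqr_sqrtr// subr_ge0 ltW.
  - by move=> x; exact: sqr_ge0.
split; first by split; [exact: m_dB|rewrite H ltry].
by rewrite /sqn /Ex /Rintegral H.
Qed.

Lemma dB_moment4 s t : 0 <= s -> s < t ->
  intg P (fun w => dB s t w ^+ 4) /\
  Ex P (fun w => dB s t w ^+ 4) <= 32 * Num.sqrt 2 * (t - s) ^+ 2.
Proof.
move=> s0 st; have ts : 0 < Num.sqrt (t - s) by rewrite sqrtr_gt0 subr_gt0.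
have H : (\int[P]_w ((dB s t w) ^+ 4)%:E <= (32 * Num.sqrt 2 * (t - s) ^+ 2)%:E)%E.
  rewrite (@Ex_dB_law s t (fun x => x ^+ 4))//.
  - apply: (le_trans (normal_moment4 ts)); rewrite lee_fin.
    by rewrite (_ : 4 = 2 * 2)%N// exprM sqr_sqrtr// subr_ge0 ltW.
  - by move=> x; rewrite exprn_even_ge0.
have ii : intg P (fun w => dB s t w ^+ 4).
  apply: intg_lty.
  - by apply: measurable_funX; exact: m_dB.
  - by move=> w; rewrite exprn_even_ge0.
  - by apply: le_lt_trans H _; rewrite ltry.
by split=> //; rewrite -lee_fin -ExE.
Qed.

(** The law is used through its density for nonnegative integrands, so positive and negative parts
    are integrated separately; their difference is the vanishing first moment. *)
Lemma Ex_dB s t : 0 <= s -> s < t -> Ex P (dB s t) = 0.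
Proof.
move=> s0 st; have ts : 0 < Num.sqrt (t - s) by rewrite sqrtr_gt0 subr_gt0.
have si := sqint_intg (sqint_dB s0 st).1.
pose pdf := normal_pdf 0 (Num.sqrt (t - s)).
have mpdf : measurable_fun setT pdf by exact: measurable_normal_pdf.
have part (h : R -> R) : measurable_fun setT h -> (forall x, 0 <= h x <= `|x|) ->
    Ex P (fun w => h (dB s t w)) = Ex lebesgue_measure (fun x => h x * pdf x) /\
    intg P (fun w => h (dB s t w)) /\ intg lebesgue_measure (fun x => h x * pdf x).
  move=> mh h0; have h00 x : 0 <= h x by case/andP: (h0 x).
  have hi : intg P (fun w => h (dB s t w)).
    apply: (@intg_dom _ _ _ P _ (fun w => `|dB s t w|)).
    - by apply: measurableT_comp => //; exact: m_dB.
    - exact: (integrable_norm si).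
    - by move=> w; case/andP: (h0 (dB s t w)) => ? ?; rewrite ger0_norm.
  have E : (\int[P]_w (h (dB s t w))%:E = \int[lebesgue_measure]_x (h x * pdf x)%:E)%E.
    rewrite Ex_dB_law// normal_prob_integralE//; last exact/measurable_EFinP.
  split; first by rewrite /Ex /Rintegral E.
  split=> //; apply: intg_lty.
  - exact: measurable_funM.
  - by move=> x; rewrite mulr_ge0// normal_pdf_ge0.
  - by rewrite -E ExE// ltry.
have mm : measurable_fun setT (fun x : R => Num.max x 0) by exact: measurable_maxr.
have mm' : measurable_fun setT (fun x : R => Num.max (- x) 0).
  by apply: measurable_maxr => //; exact: measurable_funN.
have [|p1 [p2 p3]] := part (fun x => Num.max x 0) mm.
  by move=> x; rewrite le_max lexx orbT/= ge_max normr_ge0 ler_norm.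
have [|n1 [n2 n3]] := part (fun x => Num.max (- x) 0) mm'.
  by move=> x; rewrite le_max lexx orbT/= ge_max normr_ge0 -normrN ler_norm.
have gE x : x = Num.max x 0 - Num.max (- x) 0 :> R.
  by case: (lerP x 0) => x0; [rewrite (max_l _) ?oppr_ge0// opprK add0r|rewrite (max_r _) ?oppr_le0 ?subr0 ?ltW].
rewrite (Ex_ext P (fun w => gE (dB s t w))) ExB// p1 n1 -ExB//.
rewrite /Ex /Rintegral (_ : (\int[_]_x _)%E = 0%E)//.
rewrite -(normal_moment1 ts); apply: eq_integral => x _.
by rewrite -mulrBl -gE.
Qed.

(* [Z None] is the Brownian motion and [Z (Some C)] the compensated Poisson process
   Ntilde(]0, t] x C), so that both noises are treated at once. *)
Definition Z (i : option (set (measurableTypeR R))) (t : R) (w : Omega) : R :=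
  if i is Some C then cmp (`]0, t]%classic `*` C) w else B t w.

Definition goodmark (i : option (set (measurableTypeR R))) :=
  if i is Some C then [/\ measurable C, C `<=` Rnz R & (nu C < +oo)%E] else True.

(* The rate of the predictable covariation of [Z i] and [Z j]. *)
Definition covar (i j : option (set (measurableTypeR R))) : R :=
  match i, j with
  | None, None => 1
  | Some C, Some C' => fine (nu (C `&` C'))
  | _, _ => 0
  end.

Definition dZ i s t w := Z i t w - Z i s w.

Lemma F0T_wrt_cmp C t : goodmark (Some C) -> 0 <= t <= T ->
  measurable_wrt (F t) (Z (Some C) t).
Proof.
move=> [mC CR Coo] /andP[t0 tT] D mD; rewrite FE// /augmented_filtration.
apply: sub_sigma_algebra; left; right; apply: sub_sigma_algebra.
exists (`]0, t]%classic `*` C).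
  rewrite min_l//; split; first exact: measurableX.
  move=> [x y] [/= + /CR]; rewrite !in_itv/= => /andP[/ltW -> ->].
  by [].
exists ((fun y => fine y - intens (`]0, t]%classic `*` C)) @^-1` D).
  have mf : measurable_fun setT (fun y : \bar R => fine y - intens (`]0, t]%classic `*` C)).
    by apply: measurable_funB.
  by have := mf measurableT D mD; rewrite setTI.
by rewrite setTI.
Qed.

Lemma Z_adapted i t : goodmark i -> 0 <= t <= T -> measurable_wrt (F t) (Z i t).
Proof.
case: i => [C|] gi tT; first exact: F0T_wrt_cmp.
move=> D mD; case/andP: tT => t0 tT; rewrite FE//; apply: sub_sigma_algebra; left; left.
by apply: B_wrt => //=; rewrite in_itv/= t0 lexx.
Qed.

Lemma mZ i t : goodmark i -> 0 <= t <= T -> measurable_fun setT (Z i t).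
Proof.
move=> gi tT; apply: mwrt_measurable (Z_adapted gi tT).
by apply: F_meas; case/andP: tT.
Qed.

Lemma m_dZ i s t : goodmark i -> 0 <= s <= T -> 0 <= t <= T ->
  measurable_fun setT (dZ i s t).
Proof. by move=> gi sT tT; apply: measurable_funB; exact: mZ. Qed.

Lemma box_split (a b c : R) (C : set (measurableTypeR R)) : a <= b -> b <= c ->
  `]a, c]%classic `*` C = (`]a, b]%classic `*` C) `|` (`]b, c]%classic `*` C).
Proof.
move=> ab bc; apply/seteqP; split=> -[x y].
  move=> [/=]; rewrite in_itv/= => /andP[ax xc] Cy.
  by have [xb|bx] := leP x b; [left|right]; split=> //=; rewrite in_itv/= ?ax ?xb ?bx ?xc.
move=> [[/=]|[/=]]; rewrite in_itv/= => /andP[ax xc] Cy; split=> //=; rewrite in_itv/=.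
  by rewrite ax (le_trans xc).
by rewrite xc (le_lt_trans ab ax).
Qed.

Lemma box_dj (a b c : R) (C C' : set (measurableTypeR R)) :
  (`]a, b]%classic `*` C) `&` (`]b, c]%classic `*` C') = set0.
Proof.
apply/seteqP; split=> // -[x y] [[/= + _] [/= + _]].
by rewrite !in_itv/= => /andP[_ xb] /andP[+ _]; rewrite ltNge xb.
Qed.

Lemma dZ_cmp C s t : goodmark (Some C) -> 0 <= s -> s <= t -> t <= T ->
  {ae P, forall w, dZ (Some C) s t w = cmp (`]s, t]%classic `*` C) w}.
Proof.
move=> [mC CR Coo] s0 st tT; have t0 := le_trans s0 st; have sT := le_trans st tT.
have f1 : int_fin (`]0, s]%classic `*` C) by exact: int_fin_box.
have f2 : int_fin (`]s, t]%classic `*` C) by exact: int_fin_box.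
have := cntU f1 f2 (box_dj _ _ _ _ _); apply: filterS => w.
rewrite /dZ /= -box_split// /cmp => ->.
rewrite (@box_split 0 s t)// intensU//; last exact: box_dj.
by ring.
Qed.

Lemma jumps_after_box C s t : goodmark (Some C) -> 0 <= s -> t <= T ->
  jumps_after s (`]s, t]%classic `*` C).
Proof.
move=> [mC CR Coo] s0 tT; split; first by have [] := int_fin_box s0 tT mC CR Coo.
move=> [x y] [/= + /CR Ry]; rewrite !in_itv/= => /andP[-> xt].
by rewrite (le_trans xt tT).
Qed.

Lemma sqint_dZ i s t : goodmark i -> 0 <= s -> s <= t -> t <= T ->
  sqint P (dZ i s t).
Proof.
move=> gi s0 st tT; have t0 := le_trans s0 st; have sT := le_trans st tT.
move: st; rewrite le_eqVlt => /predU1P[->|st].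
  by apply: sqint_ext (sqint0 P) => w; rewrite /dZ subrr.
case: i gi => [C|] gi; last exact: (sqint_dB s0 st).1.
have fb : int_fin (`]s, t]%classic `*` C) by case: gi => *; exact: int_fin_box.
apply: (ae_sqint _ _ (sqint_cmp fb)).
  by apply: m_dZ => //; rewrite ?s0 ?t0.
by apply: filterS (dZ_cmp gi s0 (ltW st) tT) => w ->.
Qed.

Lemma after_cmp C s t : goodmark (Some C) -> 0 <= s -> t <= T ->
  measurable_wrt (after s) (cmp (`]s, t]%classic `*` C)).
Proof.
move=> gC s0 tT; apply: mwrtB; first exact: after_sigma.
  by apply: after_cnt; exact: jumps_after_box.
by apply: mwrt_cst; exact: after_sigma.
Qed.

(** For jumps, [H] is independent of the later counts through [fullpast]; for B, through
    [F_indep_dB]. Independence yields integrability of the product from that of H. The case s = t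
    stands apart because the Gaussian law is given for s < t. *)
Lemma martingale_dZ i s t (H : Omega -> R) : goodmark i ->
  0 <= s -> s <= t -> t <= T -> measurable_wrt (F s) H -> intg P H ->
  intg P (fun w => H w * dZ i s t w) /\ Ex P (fun w => H w * dZ i s t w) = 0.
Proof.
move=> gi s0 st tT FH Hi; have t0 := le_trans s0 st; have sT := le_trans st tT.
have mH := intg_meas Hi.
move: st; rewrite le_eqVlt => /predU1P[->|st].
  split; first by apply: intg_ext (intg0 P) => w; rewrite /dZ subrr mulr0.
  by rewrite -[RHS](Ex0 P); apply: Ex_ext => w; rewrite /dZ subrr mulr0.
case: i gi => [C|] gi.
  have fb : int_fin (`]s, t]%classic `*` C) by case: gi => *; exact: int_fin_box.
  have ind : indep_maps P H (cmp (`]s, t]%classic `*` C)).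
    apply: (indep_wrt (fullpast_indep s0)); last exact: after_cmp.
    exact: mwrt_sub (F_fullpast s0) FH.
  have [i1 e1] := Ex_indep ind Hi (sqint_intg (sqint_cmp fb)).
  have ae1 : {ae P, forall w, H w * cmp (`]s, t]%classic `*` C) w = H w * dZ (Some C) s t w}.
    by apply: filterS (dZ_cmp gi s0 (ltW st) tT) => w ->.
  have m1 : measurable_fun setT (fun w => H w * dZ (Some C) s t w).
    by apply: measurable_funM => //; apply: m_dZ => //; rewrite ?s0 ?t0.
  split; first exact: (ae_intg (intg_meas i1) m1 ae1 i1).
  by rewrite -(Ex_ae (intg_meas i1) m1 ae1) e1 Ex_cmp// mulr0.
have ind : indep_maps P H (dB s t).
  by apply: (indep_wrt (F_indep_dB s0 st)) => // D mD; exists D => //; rewrite setTI.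
have [i1 e1] := Ex_indep ind Hi (sqint_intg (sqint_dB s0 st).1).
by split=> //; rewrite e1 Ex_dB// mulr0.
Qed.

(** Split E and E' into their intersection and two disjoint remainders: compensated counts of
    disjoint sets are independent and centred, so only the variance of the intersection survives. *)
Lemma intens_cov E E' : int_fin E -> int_fin E' ->
  Ex P (fun w => cmp E w * cmp E' w) = intens (E `&` E').
Proof.
move=> Ef E'f; have mE : measurable E by case: Ef => -[].
have mE' : measurable E' by case: E'f => -[].
pose A := E `&` E'; pose D := E `\` E'; pose D' := E' `\` E.
have mA : measurable A by exact: measurableI.
have mD : measurable D by exact: measurableD.
have mD' : measurable D' by exact: measurableD.
have Af : int_fin A by apply: (int_finS Ef) => // x [].
have Df : int_fin D by apply: (int_finS Ef) => // x [].
have D'f : int_fin D' by apply: (int_finS E'f) => // x [].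
have EU : E = A `|` D by rewrite /A /D setUIDK.
have E'U : E' = A `|` D' by rewrite /A /D' setIC setUIDK.
have AD : A `&` D = set0 by apply/seteqP; split=> // x [[_ ?] [_]].
have AD' : A `&` D' = set0 by apply/seteqP; split=> // x [[? _] [_]].
have DD' : D `&` D' = set0 by apply/seteqP; split=> // x [[? _] [_]].
have cmpI K K' : int_fin K -> int_fin K' -> K `&` K' = set0 ->
    Ex P (fun w => cmp K w * cmp K' w) = 0.
  move=> Kf K'f KK'; have mK : measurable K by case: Kf => -[].
  have mK' : measurable K' by case: K'f => -[].
  have ind : indep_maps P (cmp K) (cmp K').
    move=> G G' mG mG'.
    have mf (c : R) (G0 : set R) : measurable G0 -> measurable ((fun y : \bar R => fine y - c) @^-1` G0).
      move=> mG0; have mf : measurable_fun setT (fun y : \bar R => fine y - c) by apply: measurable_funB.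
      by have := mf measurableT G0 mG0; rewrite setTI.
    by have := cnt_indep Kf.1 K'f.1 KK' (mf (intens K) G mG) (mf (intens K') G' mG').
  have [_ ->] := Ex_indep ind (sqint_intg (sqint_cmp Kf)) (sqint_intg (sqint_cmp K'f)).
  by rewrite Ex_cmp// mul0r.
have s1 := sqint_cmp Af; have s2 := sqint_cmp Df; have s3 := sqint_cmp D'f.
have i1 := sqintM s1 s1; have i2 := sqintM s1 s3; have i3 := sqintM s2 s1; have i4 := sqintM s2 s3.
transitivity (Ex P (fun w => (cmp A w * cmp A w + cmp A w * cmp D' w) +
    (cmp D w * cmp A w + cmp D w * cmp D' w))).
  apply: Ex_ae.
  - by apply: measurable_funM; [exact: (sqint_cmp Ef).1|exact: (sqint_cmp E'f).1].
  - by apply: (@intg_meas _ _ _ P); apply: intgD; exact: intgD.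
  - apply: filterS2 (cntU Af Df AD) (cntU Af D'f AD') => w; rewrite -EU -E'U => h h'.
    rewrite /cmp h h' [intens E](_ : _ = intens A + intens D); last by rewrite -intensU// -EU.
    rewrite [intens E'](_ : _ = intens A + intens D'); last by rewrite -intensU// -E'U.
    ring.
rewrite !ExD//; [|exact: intgD|exact: intgD].
rewrite (cmpI A D')// (cmpI D A)//; last by rewrite setIC.
rewrite (cmpI D D')//.
rewrite !addr0 -(sqn_cmp Af); apply: Ex_ext => w; ring.
Qed.

Lemma covariance_dZ i j s t (H : Omega -> R) c : goodmark i -> goodmark j ->
  0 <= s -> s <= t -> t <= T -> measurable_wrt (F s) H -> (forall w, `|H w| <= c) ->
  Ex P (fun w => H w * (dZ i s t w * dZ j s t w)) = Ex P H * ((t - s) * covar i j).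
Proof.
move=> gi gj s0 st tT FH Hc; have t0 := le_trans s0 st; have sT := le_trans st tT.
have mH : measurable_fun setT H by apply: mwrt_measurable FH; exact: F_meas.
have sH : sqint P H := bounded_sqint P mH Hc; have Hi := sqint_intg sH.
move: st; rewrite le_eqVlt => /predU1P[->|st].
  rewrite subrr mul0r mulr0 -[RHS](Ex0 P); apply: Ex_ext => w.
  by rewrite /dZ subrr mul0r mulr0.
(* Mixed case: H times the Brownian increment is known to [fullpast s], so the centred jump
   increment averages to 0. *)
have key C : goodmark (Some C) ->
  Ex P (fun w => H w * (dZ None s t w * dZ (Some C) s t w)) = 0.
  move=> gC; have fb : int_fin (`]s, t]%classic `*` C) by case: gC => *; exact: int_fin_box.
  have FK : measurable_wrt (fullpast s) (fun w => H w * dB s t w).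
    apply: mwrtM; first exact: fullpast_sigma.
      exact: mwrt_sub (F_fullpast s0) FH.
    by apply: mwrt_sub (@sigB_fullpast s) _; exact: dB_wrt.
  have iK : intg P (fun w => H w * dB s t w) := sqintM sH (sqint_dB s0 st).1.
  have ind := indep_wrt (fullpast_indep s0) FK (after_cmp gC s0 tT).
  have [i1 e1] := Ex_indep ind iK (sqint_intg (sqint_cmp fb)).
  rewrite -(mulr0 (Ex P (fun w => H w * dB s t w))) -[X in _ = _ * X](Ex_cmp fb) -e1.
  apply: Ex_ae.
  - apply: measurable_funM => //; apply: measurable_funM; apply: m_dZ => //; by rewrite ?s0 ?t0.
  - exact: intg_meas i1.
  - by apply: filterS (dZ_cmp gC s0 (ltW st) tT) => w ->; rewrite mulrA.
case: i gi => [C|] gi; case: j gj => [C'|] gj.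
- have fb : int_fin (`]s, t]%classic `*` C) by case: gi => *; exact: int_fin_box.
  have fb' : int_fin (`]s, t]%classic `*` C') by case: gj => *; exact: int_fin_box.
  have ind : indep_maps P H (fun w => cmp (`]s, t]%classic `*` C) w * cmp (`]s, t]%classic `*` C') w).
    apply: (indep_wrt (fullpast_indep s0)); first exact: mwrt_sub (F_fullpast s0) FH.
    by apply: mwrtM; [exact: after_sigma|exact: after_cmp|exact: after_cmp].
  have [i1 e1] := Ex_indep ind Hi (sqintM (sqint_cmp fb) (sqint_cmp fb')).
  transitivity (Ex P (fun w => H w * (cmp (`]s, t]%classic `*` C) w * cmp (`]s, t]%classic `*` C') w))).
    apply: Ex_ae.
    - apply: measurable_funM => //; apply: measurable_funM; apply: m_dZ => //; by rewrite ?s0 ?t0.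
    - exact: intg_meas i1.
    - by apply: filterS2 (dZ_cmp gi s0 (ltW st) tT) (dZ_cmp gj s0 (ltW st) tT) => w -> ->.
  rewrite e1 intens_cov//; congr (_ * _).
  rewrite -setXI setIid intens_box ?ltW//; first by case: gi => ? _ _; case: gj => ? _ _; exact: measurableI.
  case: gi => mC _ Coo; case: gj => mC' _ _; apply: le_lt_trans Coo.
  by apply: le_measure; rewrite ?inE//; exact: measurableI.
- rewrite mulr0 mulr0 -(key C gi); apply: Ex_ext => w; ring.
- by rewrite mulr0 mulr0 key.
- have ind : indep_maps P H (fun w => dB s t w ^+ 2).
    apply: (indep_wrt (F_indep_dB s0 st)) => // D mD; exists ((fun x : R => x ^+ 2) @^-1` D).
      have m2 : measurable_fun setT (fun x : R => x ^+ 2) by exact: measurable_funX.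
      by have := m2 measurableT D mD; rewrite setTI.
    by rewrite setTI.
  have [sB eB] := sqint_dB s0 st.
  have [i1 e1] := Ex_indep ind Hi (((sqintP P _).1 sB).2).
  rewrite /covar mulr1 -eB -e1; apply: Ex_ext => w; rewrite /dZ /= -/(dB s t w); ring.
Qed.

(** * Elementary stochastic integrals and the isometry *)

Definition elt := (step T F + marked_step T F nu)%type.

Definition sb (a : elt) : step T F :=
  match a with inl a => a | inr b => marked_step_base b end.

Definition mk (a : elt) : option (set (measurableTypeR R)) :=
  if a is inr b then Some (step_marks b) else None.

Definition lo (a : elt) := step_lo (sb a).
Definition hi (a : elt) := step_hi (sb a).
Definition hgt (a : elt) := step_height (sb a).

Lemma goodmark_mk a : goodmark (mk a).
Proof.
case: a => [a|b] //=; split; [exact: step_marks_measurable|exact: step_marks_nz|exact: step_marks_finite].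
Qed.

Lemma lo_ge0 a : 0 <= lo a. Proof. exact: step_lo_ge0. Qed.
Lemma lo_le_hi a : lo a <= hi a. Proof. exact: step_lo_le_hi. Qed.
Lemma hi_leT a : hi a <= T. Proof. exact: step_hi_leT. Qed.
Lemma lo_leT a : lo a <= T. Proof. exact: le_trans (lo_le_hi a) (hi_leT a). Qed.
Lemma hi_ge0 a : 0 <= hi a. Proof. exact: le_trans (lo_ge0 a) (lo_le_hi a). Qed.
Lemma hgt_wrt a : measurable_wrt (F (lo a)) (hgt a).
Proof. exact: step_measurable. Qed.
Lemma hgt_bound a : exists c, forall w, `|hgt a w| <= c.
Proof. exact: step_bounded. Qed.
Lemma m_hgt a : measurable_fun setT (hgt a).
Proof. by apply: mwrt_measurable (hgt_wrt a); apply: F_meas; exact: lo_ge0. Qed.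
Lemma sqint_hgt a : sqint P (hgt a).
Proof. by have [c hc] := hgt_bound a; exact: bounded_sqint (m_hgt a) hc. Qed.

Definition ev (a : elt) t w :=
  hgt a w * dZ (mk a) (Num.min (lo a) t) (Num.min (hi a) t) w.

Lemma mwrt_mono s t (X : Omega -> R) : 0 <= s -> s <= t ->
  measurable_wrt (F s) X -> measurable_wrt (F t) X.
Proof. by move=> s0 st; apply: mwrt_sub; exact: F_mono. Qed.

Lemma ev_lo a t w : t <= lo a -> ev a t w = 0.
Proof.
move=> ta; rewrite /ev (min_r ta) min_r ?(le_trans ta (lo_le_hi a))//.
by rewrite /dZ subrr mulr0.
Qed.

Lemma dZ_wrt i s t u : goodmark i -> 0 <= s -> s <= u -> 0 <= t -> t <= u -> u <= T ->
  measurable_wrt (F u) (dZ i s t).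
Proof.
move=> gi s0 su t0 tu uT; apply: mwrtB; first exact: F_sigma (le_trans s0 su).
  by apply: (mwrt_mono t0 tu); apply: Z_adapted => //; rewrite t0 (le_trans tu).
by apply: (mwrt_mono s0 su); apply: Z_adapted => //; rewrite s0 (le_trans su).
Qed.

Lemma ev_adapted a t : 0 <= t <= T -> measurable_wrt (F t) (ev a t).
Proof.
move=> /andP[t0 tT]; have sF := F_sigma t0.
have [ta|/ltW ta] := leP t (lo a).
  rewrite (_ : ev a t = fun=> 0); first exact: mwrt_cst.
  by apply/funext => w; exact: ev_lo.
apply: mwrtM => //; first by apply: mwrt_mono ta (hgt_wrt a); exact: lo_ge0.
apply: dZ_wrt => //; first exact: goodmark_mk.
- by rewrite le_min lo_ge0.
- by rewrite ge_min lexx orbT.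
- by rewrite le_min hi_ge0.
- by rewrite ge_min lexx orbT.
Qed.

Lemma sqint_hdZ i s t (H : Omega -> R) c : goodmark i -> 0 <= s -> s <= t -> t <= T ->
  measurable_wrt (F s) H -> (forall w, `|H w| <= c) ->
  sqint P (fun w => H w * dZ i s t w).
Proof.
move=> gi s0 st tT FH Hc.
have mH : measurable_fun setT H by apply: mwrt_measurable FH; exact: F_meas.
exact: sqintMb (sqint_dZ gi s0 st tT) mH Hc.
Qed.

Lemma sqint_ev a t : 0 <= t <= T -> sqint P (ev a t).
Proof.
move=> /andP[t0 tT]; have [c hc] := hgt_bound a.
have [ta|/ltW ta] := leP t (lo a).
  by apply: sqint_ext (sqint0 P) => w; rewrite ev_lo.
rewrite /ev (min_l ta); apply: sqint_hdZ (hgt_wrt a) hc.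
- exact: goodmark_mk.
- exact: lo_ge0.
- by rewrite le_min lo_le_hi.
- by rewrite ge_min hi_leT.
Qed.

(** Square-integrable martingales, the martingale property being expressed as orthogonality of
    increments to square-integrable variables of the past. This form passes directly to L2
    limits. *)
Definition mart2 (M : R -> Omega -> R) :=
  [/\ forall t, 0 <= t <= T -> measurable_wrt (F t) (M t),
      forall t, 0 <= t <= T -> sqint P (M t) &
      forall s t (H : Omega -> R), 0 <= s -> s <= t -> t <= T ->
        measurable_wrt (F s) H -> sqint P H ->
        Ex P (fun w => H w * (M t w - M s w)) = 0].

Lemma ev_mart a s t (H : Omega -> R) : 0 <= s -> s <= t -> t <= T ->
  measurable_wrt (F s) H -> sqint P H ->
  Ex P (fun w => H w * (ev a t w - ev a s w)) = 0.
Proof.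
move=> s0 st tT FH sH; have t0 := le_trans s0 st; have sT := le_trans st tT.
have [c hc] := hgt_bound a.
(* The increment over [s, t] is either 0 or [hgt a] times the noise over some [u, v] that starts
   after both s and [lo a], when [hgt a] and H are already known. *)
have key u v : s <= u -> lo a <= u -> u <= v -> v <= T ->
    (forall w, ev a t w - ev a s w = hgt a w * dZ (mk a) u v w) ->
    Ex P (fun w => H w * (ev a t w - ev a s w)) = 0.
  move=> su au uv vT E; have u0 := le_trans s0 su.
  have FHh : measurable_wrt (F u) (fun w => hgt a w * H w).
    apply: mwrtM; [exact: F_sigma| |exact: mwrt_mono FH].
    by apply: mwrt_mono (hgt_wrt a) => //; exact: lo_ge0.
  have iHh : intg P (fun w => hgt a w * H w).
    exact: sqintM (sqint_hgt a) sH.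
  have [_ <-] := martingale_dZ (goodmark_mk a) u0 uv vT FHh iHh.
  by apply: Ex_ext => w; rewrite E; ring.
have zero : (forall w, ev a t w = ev a s w) -> Ex P (fun w => H w * (ev a t w - ev a s w)) = 0.
  by move=> E; rewrite -[RHS](Ex0 P); apply: Ex_ext => w; rewrite E subrr mulr0.
have [sa|/ltW as_] := leP s (lo a).
  have [ta|/ltW at_] := leP t (lo a).
    by apply: zero => w; rewrite !ev_lo.
  apply: (key (lo a) (Num.min (hi a) t)) => //.
  - by rewrite le_min lo_le_hi.
  - by rewrite ge_min hi_leT.
  - by move=> w; rewrite (ev_lo _ sa) subr0 /ev (min_l at_).
have at_ := le_trans as_ st.
have [hs|/ltW sh] := leP (hi a) s.
  apply: zero => w; rewrite /ev (min_l at_) (min_l as_) (min_l hs) min_l//.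
  exact: le_trans hs st.
apply: (key s (Num.min (hi a) t)) => //.
- by rewrite le_min sh.
- by rewrite ge_min hi_leT.
- by move=> w; rewrite /ev (min_l at_) (min_l as_) (min_r sh) /dZ; ring.
Qed.

Definition gint (G : seq elt) t w := \sum_(a <- G) ev a t w.

Lemma sqint_gint G t : 0 <= t <= T -> sqint P (gint G t).
Proof. by move=> tT; apply: sqint_sum => a; exact: sqint_ev. Qed.

Lemma mart2_gint G : mart2 (gint G).
Proof.
split=> [t tT|t tT|s t H s0 st tT FH sH].
- apply: mwrt_sum; first by apply: F_sigma; case/andP: tT.
  by move=> a; exact: ev_adapted.
- exact: sqint_gint.
- have t0 := le_trans s0 st; have sT := le_trans st tT.
  rewrite (@Ex_ext _ _ _ _ _ (fun w => \sum_(a <- G) H w * (ev a t w - ev a s w))).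
    rewrite Ex_sum; first by apply: big1 => a _; exact: ev_mart.
    move=> a; apply: sqintM => //; apply: sqintB; apply: sqint_ev.
      by rewrite t0.
    by rewrite s0.
  by move=> w; rewrite -mulr_sumr sumrB.
Qed.

(** [H] may depend on everything up to u, in particular on the first interval; the second increment
    alone produces the 0. *)
Lemma Ex_ev_disjoint a b s t u v (H : Omega -> R) c : 0 <= s -> s <= t -> t <= u ->
  u <= v -> v <= T -> measurable_wrt (F u) H -> (forall w, `|H w| <= c) ->
  intg P (fun w => H w * (dZ (mk a) s t w * dZ (mk b) u v w)) /\
  Ex P (fun w => H w * (dZ (mk a) s t w * dZ (mk b) u v w)) = 0.
Proof.
move=> s0 st tu uv vT FH Hc.
have t0 := le_trans s0 st; have u0 := le_trans t0 tu; have uT := le_trans uv vT.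
have tT := le_trans tu uT; have sT := le_trans st tT.
have FK : measurable_wrt (F u) (fun w => H w * dZ (mk a) s t w).
  apply: mwrtM => //; first exact: F_sigma.
  by apply: dZ_wrt => //; [exact: goodmark_mk|exact: le_trans tu].
have mH : measurable_fun setT H by apply: mwrt_measurable FH; exact: F_meas.
have iK : intg P (fun w => H w * dZ (mk a) s t w).
  apply: sqint_intg; apply: sqintMb Hc => //; apply: sqint_dZ => //; exact: goodmark_mk.
have [i1 e1] := martingale_dZ (goodmark_mk b) u0 uv vT FK iK.
split; first by apply: intg_ext i1 => w; rewrite mulrA.
by rewrite -e1; apply: Ex_ext => w; rewrite mulrA.
Qed.

Definition overlap (a b : elt) : R :=
  Num.max (Num.min (hi a) (hi b) - Num.max (lo a) (lo b)) 0.

Lemma ev_T a w : ev a T w = hgt a w * dZ (mk a) (lo a) (hi a) w.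
Proof. by rewrite /ev (min_l (hi_leT a)) (min_l (lo_leT a)). Qed.

(** Both increments are cut at the larger left end m and the smaller right end M. Of the nine
    products, the middle one gives the overlap times the covariation rate, six vanish by
    disjointness of the intervals, and the two outer diagonal ones vanish identically because one
    factor is over an empty interval. *)
Lemma Ex_ev_ev a b : Ex P (fun w => ev a T w * ev b T w) =
  Ex P (fun w => hgt a w * hgt b w) * (overlap a b * covar (mk a) (mk b)).
Proof.
have [c hc] := hgt_bound a; have [c' hc'] := hgt_bound b.
have Hc w : `|hgt a w * hgt b w| <= c * c' by rewrite normrM ler_pM.
pose H w := hgt a w * hgt b w.
have FH u : lo a <= u -> lo b <= u -> measurable_wrt (F u) H.
  move=> au bu; apply: mwrtM; first exact: F_sigma (le_trans (lo_ge0 a) au).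
    by apply: mwrt_mono (hgt_wrt a) => //; exact: lo_ge0.
  by apply: mwrt_mono (hgt_wrt b) => //; exact: lo_ge0.
pose m := Num.max (lo a) (lo b); pose M := Num.min (hi a) (hi b).
have E0 w : ev a T w * ev b T w =
    H w * (dZ (mk a) (lo a) (hi a) w * dZ (mk b) (lo b) (hi b) w).
  by rewrite !ev_T /H; ring.
rewrite (Ex_ext P E0) /overlap -/m -/M.
have am : lo a <= m by rewrite le_max lexx.
have bm : lo b <= m by rewrite le_max lexx orbT.
have Ma : M <= hi a by rewrite ge_min lexx.
have Mb : M <= hi b by rewrite ge_min lexx orbT.
have m0 : 0 <= m := le_trans (lo_ge0 a) am.
have MT : M <= T := le_trans Ma (hi_leT a).
have swp (X Y : Omega -> R) : Ex P (fun w => H w * (X w * Y w)) = Ex P (fun w => H w * (Y w * X w)).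
  by apply: Ex_ext => w; rewrite (mulrC (X w)).
(* Without overlap, either the intervals are disjoint or one of them is empty; the last line of this
   branch excludes anything else. *)
have [Mm|mM] := leP M m.
  rewrite max_r ?subr_le0// mul0r mulr0.
  have [ab|ba] := leP (hi a) (lo b).
    have [_ ->//] := Ex_ev_disjoint a b (lo_ge0 a) (lo_le_hi a) ab (lo_le_hi b) (hi_leT b) (FH _ (le_trans (lo_le_hi a) ab) (lexx _)) Hc.
  have [ba'|ab'] := leP (hi b) (lo a).
    rewrite swp.
    have [_ ->//] := Ex_ev_disjoint b a (lo_ge0 b) (lo_le_hi b) ba' (lo_le_hi a) (hi_leT a) (FH _ (lexx _) (le_trans (lo_le_hi b) ba')) Hc.
  have zero i s (X : Omega -> R) : Ex P (fun w => H w * (dZ i s s w * X w)) = 0.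
    by rewrite -[RHS](Ex0 P); apply: Ex_ext => w; rewrite /dZ subrr mul0r mulr0.
  have [|la] := eqVneq (lo a) (hi a); first by move=> <-; exact: zero.
  have [|lb] := eqVneq (lo b) (hi b); first by move=> <-; rewrite swp; exact: zero.
  have la' : lo a < hi a by rewrite lt_neqAle la lo_le_hi.
  have lb' : lo b < hi b by rewrite lt_neqAle lb lo_le_hi.
  by move: Mm; rewrite leNgt /m /M lt_min !gt_max la' lb' ba ab'.
rewrite max_l ?subr_ge0 ?ltW//.
have mMl := ltW mM.
have mT := le_trans mMl MT; have M0 := le_trans m0 mMl.
have dsplit i s1 s2 s3 w : dZ i s1 s3 w = dZ i s1 s2 w + dZ i s2 s3 w.
  by rewrite /dZ; ring.
pose A1 := dZ (mk a) (lo a) m; pose A2 := dZ (mk a) m M; pose A3 := dZ (mk a) M (hi a).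
pose B1 := dZ (mk b) (lo b) m; pose B2 := dZ (mk b) m M; pose B3 := dZ (mk b) M (hi b).
have z1 w : A1 w * B1 w = 0.
  rewrite /A1 /B1 /m; case: (leP (lo a) (lo b)) => _; first by rewrite /dZ (subrr (Z _ (lo b) _)) mulr0.
  by rewrite /dZ subrr mul0r.
have z3 w : A3 w * B3 w = 0.
  rewrite /A3 /B3 /M; case: (leP (hi a) (hi b)) => _; first by rewrite /dZ subrr mul0r.
  by rewrite /dZ (subrr (Z _ (hi b) _)) mulr0.
have FHm := FH m am bm; have FHM := FH M (le_trans am mMl) (le_trans bm mMl).
have [i12 e12] := Ex_ev_disjoint a b (lo_ge0 a) am (lexx m) mMl MT FHm Hc.
have [i13 e13] := Ex_ev_disjoint a b (lo_ge0 a) am mMl Mb (hi_leT b) FHM Hc.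
have [i23 e23] := Ex_ev_disjoint a b m0 mMl (lexx M) Mb (hi_leT b) FHM Hc.
have [i21 e21] := Ex_ev_disjoint b a (lo_ge0 b) bm (lexx m) mMl MT FHm Hc.
have [i31 e31] := Ex_ev_disjoint b a (lo_ge0 b) bm mMl Ma (hi_leT a) FHM Hc.
have [i32 e32] := Ex_ev_disjoint b a m0 mMl (lexx M) Ma (hi_leT a) FHM Hc.
have e22 := covariance_dZ (goodmark_mk a) (goodmark_mk b) m0 mMl MT FHm Hc.
have i22 : intg P (fun w => H w * (A2 w * B2 w)).
  have mH : measurable_fun setT H by apply: mwrt_measurable FHm; exact: F_meas.
  have sA := sqint_dZ (goodmark_mk a) m0 mMl MT.
  have sB := sqint_dZ (goodmark_mk b) m0 mMl MT.
  by apply: intg_ext (sqintM (sqintMb sA mH Hc) sB) => w; rewrite mulrA.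
transitivity (Ex P (fun w => H w * (A2 w * B2 w) + (H w * (A1 w * B2 w) + (H w * (A1 w * B3 w) + (H w * (A2 w * B3 w) +
   (H w * (B1 w * A2 w) + (H w * (B1 w * A3 w) + H w * (B2 w * A3 w)))))))).
  apply: Ex_ext => w; rewrite (dsplit (mk a) (lo a) m (hi a)) (dsplit (mk a) m M (hi a)).
  rewrite (dsplit (mk b) (lo b) m (hi b)) (dsplit (mk b) m M (hi b)) -/A1 -/A2 -/A3 -/B1 -/B2 -/B3.
  rewrite -[RHS]addr0 -[X in _ = _ + X](mulr0 (H w)) -(z1 w).
  by rewrite -[RHS]addr0 -[X in _ = _ + X](mulr0 (H w)) -(z3 w); ring.
have j1 := intgD i31 i32; have j2 := intgD i21 j1; have j3 := intgD i23 j2.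
have j4 := intgD i13 j3; have j5 := intgD i12 j4.
rewrite (ExD i22 j5) (ExD i12 j4) (ExD i13 j3) (ExD i23 j2) (ExD i21 j1) (ExD i31 i32).
by rewrite e12 e13 e23 e21 e31 e32 e22 !addr0.
Qed.

(* The library also makes products of subprobabilities sigma-finite, which
   hides its instance for products of sigma-finite measures. *)
Lemma product_sigma_finite (d1 d2 : measure_display) (T1 : measurableType d1)
    (T2 : measurableType d2) (m1 : {sigma_finite_measure set T1 -> \bar R})
    (m2 : {sigma_finite_measure set T2 -> \bar R}) :
  sigma_finite setT (m1 \x m2)%E.
Proof.
have /sigma_finiteP[U [TU ndU Uoo]] := sigma_finiteT m1.
have /sigma_finiteP[V [TV ndV Voo]] := sigma_finiteT m2.
exists (fun n => U n `*` V n).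
  rewrite -setXTT TU TV predeqE => -[x y]; split.
    move=> [/= [n _ Unx] [k _ Vky]]; exists (maxn n k) => //; split.
    - by move: x Unx; exact/subsetPset/ndU/leq_maxl.
    - by move: y Vky; exact/subsetPset/ndV/leq_maxr.
  by move=> [n _ []/= ? ?]; split; exists n.
move=> k; have [? ?] := Uoo k; have [? ?] := Voo k.
split; first exact: measurableX.
by rewrite product_measure1E// lte_mul_pinfty// ge0_fin_numE.
Qed.

Definition leb2a : set RR -> \bar R := leb2.

HB.instance Definition _ := Measure.copy leb2a (leb2 : {measure set RR -> \bar R}).

HB.instance Definition _ := Measure_isSigmaFinite.Build _ _ _ leb2a
  (product_sigma_finite lebesgue_measure nu).

Definition leb2s : {sigma_finite_measure set RR -> \bar R} := leb2a.

Local Notation leb := (lebesgue_measure : {measure set (measurableTypeR R) -> \bar R}).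
Local Notation mu1 := (lebesgue_measure \x P)%E.
Local Notation mu2 := (leb2 \x P)%E.
Local Notation X1 := (measurableTypeR R * Omega)%type.
Local Notation X2 := (RR * Omega)%type.

(* [f1] and [f2] are the dB- and dNtilde-parts of an elementary integrand. *)
Definition f1 (a : elt) (x : X1) : R :=
  if a is inl _ then \1_`]lo a, hi a]%classic x.1 * hgt a x.2 else 0.

Definition box (a : elt) : set RR :=
  if a is inr b then `]lo a, hi a]%classic `*` step_marks b else set0.

Definition f2 (a : elt) (x : X2) : R := \1_(box a) x.1 * hgt a x.2.

Lemma mbox a : measurable (box a).
Proof.
by case: a => [a|b] //=; apply: measurableX => //; exact: step_marks_measurable.
Qed.

Lemma int_fin_mbox a : int_fin (box a).
Proof.
case: a => [a|b] /=; first by split; [exact: jump_sets0|rewrite measure0].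
have [mC CR Coo] := goodmark_mk (inr b).
by apply: int_fin_box => //; [exact: step_lo_ge0|exact: step_hi_leT].
Qed.

Lemma Ex_prod (d1 d2 : measure_display) (T1 : measurableType d1) (T2 : measurableType d2)
   (m1 : {sigma_finite_measure set T1 -> \bar R}) (m2 : {sigma_finite_measure set T2 -> \bar R})
   (g : T1 -> R) (h : T2 -> R) : intg m1 g -> intg m2 h ->
   intg (m1 \x m2)%E (fun x => g x.1 * h x.2) /\
   Ex (m1 \x m2)%E (fun x => g x.1 * h x.2) = Ex m1 g * Ex m2 h.
Proof.
move=> ig ih; have mg := intg_meas ig; have mh := intg_meas ih.
have mgh : measurable_fun setT (fun x : T1 * T2 => g x.1 * h x.2).
  by apply: measurable_funM; apply: measurableT_comp.
have i1 : intg (m1 \x m2)%E (fun x => g x.1 * h x.2).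
  apply/integrableP; split; first exact/measurable_EFinP.
  rewrite fubini_tonelli1//=.
  have E x : (\int[m2]_y `|(g x * h y)%:E| = `|g x|%:E * \int[m2]_y `|(h y)%:E|)%E.
    rewrite -ge0_integralZl_EFin//; last first.
      by apply: measurableT_comp => //; exact/measurable_EFinP.
    by apply: eq_integral => y _; rewrite -EFinM /= normrM.
  rewrite /fubini_F; under eq_integral do rewrite E.
  have /integrableP[_ hoo] := ih; have /integrableP[_ goo] := ig.
  rewrite (_ : (\int[m2]_y _ = (fine (\int[m2]_y `|(h y)%:E|))%:E)%E); last first.
    by rewrite fineK// ge0_fin_numE// integral_ge0.
  rewrite ge0_integralZr//; last by rewrite lee_fin fine_ge0// integral_ge0.
    apply: lte_mul_pinfty => //; first exact: integral_ge0.
      by rewrite ge0_fin_numE//; exact: integral_ge0.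
    by rewrite ltry.
    by apply/measurable_EFinP; apply: measurableT_comp.
  by apply/measurable_EFinP; apply: measurableT_comp.
split=> //; rewrite {1}/Ex /Rintegral -integral12_prod_meas1//= /fubini_F /=.
have E x : (\int[m2]_y (g x * h y)%:E = (Ex m2 h * g x)%:E)%E.
  under eq_integral do rewrite EFinM.
  by rewrite integralZl// ExE// -EFinM mulrC.
under eq_integral do rewrite E.
rewrite mulrC -(ExZ _ ig) //.
Qed.

Lemma sqint_prod (d1 d2 : measure_display) (T1 : measurableType d1) (T2 : measurableType d2)
   (m1 : {sigma_finite_measure set T1 -> \bar R}) (m2 : {sigma_finite_measure set T2 -> \bar R})
   (g : T1 -> R) (h : T2 -> R) : sqint m1 g -> sqint m2 h ->
   sqint (m1 \x m2)%E (fun x => g x.1 * h x.2).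
Proof.
move=> /sqintP[mg ig] /sqintP[mh ih]; apply/sqintP; split.
  by apply: measurable_funM; apply: measurableT_comp.
by apply: intg_ext (Ex_prod ig ih).1 => x; rewrite exprMn.
Qed.

Lemma indic_intg (d1 : measure_display) (T1 : measurableType d1)
  (m1 : {measure set T1 -> \bar R}) (A : set T1) : measurable A -> (m1 A < +oo)%E ->
  [/\ intg m1 (\1_A : T1 -> R), sqint m1 (\1_A : T1 -> R) & Ex m1 (\1_A : T1 -> R) = fine (m1 A)].
Proof.
move=> mA Aoo; have I : (\int[m1]_x (\1_A x : R)%:E = m1 A)%E by rewrite integral_indic// setIT.
have i1 : intg m1 (\1_A : T1 -> R).
  by apply: intg_lty; [exact: measurable_indic|by move=> x; rewrite indicE|rewrite I].
split=> //; last by rewrite /Ex /Rintegral I.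
apply/sqintP; split; first exact: measurable_indic.
by apply: intg_ext i1 => x; rewrite indicE; case: (_ \in _); rewrite ?expr1n// expr0n.
Qed.

Lemma overlap_setI a b : `]lo a, hi a]%classic `&` `]lo b, hi b]%classic =
  `]Num.max (lo a) (lo b), Num.min (hi a) (hi b)]%classic :> set R.
Proof.
apply/seteqP; split=> x; rewrite /= !in_itv/= gt_max le_min.
  by move=> [/andP[-> ->] /andP[-> ->]].
by move=> /andP[/andP[-> ->] /andP[-> ->]].
Qed.

Lemma leb_overlap a b : (lebesgue_measure (`]lo a, hi a]%classic `&` `]lo b, hi b]%classic) = (overlap a b)%:E)%E.
Proof.
rewrite overlap_setI lebesgue_measure_itv/= lte_fin /overlap -EFinB.
case: ifPn => [H|]; first by rewrite [Num.max _ 0]max_l// subr_ge0 ltW.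
by rewrite -leNgt => H; rewrite [Num.max _ 0]max_r// subr_le0.
Qed.

Lemma leb2_overlap a b : (leb2 (box a `&` box b) =
  (if a is inr _ then if b is inr _ then overlap a b * covar (mk a) (mk b) else 0 else 0)%:E)%E.
Proof.
case: a => [a|a]; first by rewrite set0I measure0.
case: b => [b|b]; first by rewrite setI0 measure0.
rewrite /box -setXI product_measure1E//=; last 2 first.
- exact: measurableI.
- by apply: measurableI; exact: step_marks_measurable.
rewrite (leb_overlap (inr a) (inr b)) EFinM fineK// ge0_fin_numE//.
apply: le_lt_trans (step_marks_finite a).
by apply: le_measure; rewrite ?inE//; [apply: measurableI; exact: step_marks_measurable|exact: step_marks_measurable].
Qed.

Lemma leb_itv_lty (a b : R) : (lebesgue_measure (`]a, b]%classic : set R) < +oo)%E.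
Proof. by rewrite lebesgue_measure_itv/=; case: ifP => _; rewrite ?ltry// -EFinB ltry. Qed.

Lemma sqint_f1 a : sqint mu1 (f1 a).
Proof.
case: a => [a|b] /=; last exact: sqint0.
have mI : measurable (`]lo (inl a), hi (inl a)]%classic : set (measurableTypeR R)) by [].
have [_ s1 _] := indic_intg (m1 := leb) mI (leb_itv_lty _ _).
exact: (sqint_prod s1 (sqint_hgt (inl a))).
Qed.

Lemma sqint_f2 a : sqint mu2 (f2 a).
Proof.
have [_ s1 _] := indic_intg (m1 := leb2) (mbox a) (int_fin_mbox a).2.
exact: (sqint_prod (m1 := leb2s) s1 (sqint_hgt a)).
Qed.

(** The covariance formula read as an inner product, overlaps being measures of intersections. Mixed
    pairs give 0 on both sides: by [covar] on the left, and on the right because one factor vanishes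
    in each integral. *)
Lemma isometry_elt a b : Ex P (fun w => ev a T w * ev b T w) =
  Ex mu1 (fun x => f1 a x * f1 b x) + Ex mu2 (fun x => f2 a x * f2 b x).
Proof.
have iH : intg P (fun w => hgt a w * hgt b w) := sqintM (sqint_hgt a) (sqint_hgt b).
have -> : Ex mu2 (fun x => f2 a x * f2 b x) = fine (leb2 (box a `&` box b)) * Ex P (fun w => hgt a w * hgt b w).
  have mI := measurableI _ _ (mbox a) (mbox b).
  have [|i1 _ <-] := indic_intg (m1 := leb2) mI.
    apply: le_lt_trans (int_fin_mbox a).2.
    by apply: le_measure; rewrite ?inE//; exact: mbox.
  have [_ <-] := Ex_prod (m1 := leb2s) i1 iH.
  by apply: Ex_ext => x; rewrite /f2 indicI /=; ring.
have -> : Ex mu1 (fun x => f1 a x * f1 b x) =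
    (if a is inl _ then if b is inl _ then overlap a b else 0 else 0) * Ex P (fun w => hgt a w * hgt b w).
  case: a iH => [a|a] iH; last first.
    by rewrite mul0r -[RHS](Ex0 mu1); apply: Ex_ext => x; rewrite mul0r.
  case: b iH => [b|b] iH; last first.
    by rewrite mul0r -[RHS](Ex0 mu1); apply: Ex_ext => x; rewrite mulr0.
  have mI : measurable (`]lo (inl a), hi (inl a)]%classic `&` `]lo (inl b), hi (inl b)]%classic : set (measurableTypeR R)).
    exact: measurableI.
  have [|i1 _ e1] := indic_intg (m1 := lebesgue_measure) mI.
    by apply: le_lt_trans (ltry (overlap (inl a) (inl b))); rewrite le_eqVlt; apply/orP; left; apply/eqP; exact: leb_overlap.
  have -> : overlap (inl a) (inl b) = Ex lebesgue_measure (\1_(`]lo (inl a), hi (inl a)]%classic `&` `]lo (inl b), hi (inl b)]%classic) : measurableTypeR R -> R).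
    by rewrite e1; exact: (congr1 fine (esym (leb_overlap _ _))).
  have [_ <-] := Ex_prod i1 iH.
  by apply: Ex_ext => x; rewrite /f1 indicI /=; ring.
rewrite Ex_ev_ev leb2_overlap /=.
by case: a iH => [a|a] _; case: b => [b|b] /=; ring.
Qed.

Definition F1 (G : seq elt) x := \sum_(a <- G) f1 a x.
Definition F2 (G : seq elt) x := \sum_(a <- G) f2 a x.

Lemma sqint_F1 G : sqint mu1 (F1 G).
Proof. by apply: sqint_sum => a; exact: sqint_f1. Qed.

Lemma sqint_F2 G : sqint mu2 (F2 G).
Proof. by apply: sqint_sum => a; exact: sqint_f2. Qed.

Lemma Ex_sum_mul (d1 : measure_display) (T1 : measurableType d1) (m1 : {measure set T1 -> \bar R})
   (I : Type) (s t : seq I) (f : I -> T1 -> R) : (forall i, sqint m1 (f i)) ->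
   Ex m1 (fun x => (\sum_(i <- s) f i x) * (\sum_(i <- t) f i x)) =
   \sum_(i <- s) \sum_(j <- t) Ex m1 (fun x => f i x * f j x).
Proof.
move=> sf; rewrite (@Ex_ext _ _ _ _ _ (fun x => \sum_(i <- s) \sum_(j <- t) f i x * f j x)).
  rewrite Ex_sum; first by apply: eq_bigr => i _; rewrite Ex_sum// => j; exact: sqintM.
  by move=> i; apply: intg_sum => j; exact: sqintM.
by move=> x; rewrite mulr_suml; apply: eq_bigr => i _; rewrite mulr_sumr.
Qed.

Lemma isometry G H : Ex P (fun w => gint G T w * gint H T w) =
  Ex mu1 (fun x => F1 G x * F1 H x) + Ex mu2 (fun x => F2 G x * F2 H x).
Proof.
rewrite (Ex_sum_mul G H sqint_f1) (Ex_sum_mul G H sqint_f2).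
rewrite -big_split/=.
transitivity (\sum_(a <- G) \sum_(b <- H) Ex P (fun w => ev a T w * ev b T w)).
  apply: (@Ex_sum_mul _ _ P _ G H (fun a => ev a T)) => a; apply: sqint_ev.
  by rewrite lexx ltW.
apply: eq_bigr => a _; rewrite -big_split/=; apply: eq_bigr => b _.
exact: isometry_elt.
Qed.

Lemma isometry_sqn G : sqn P (gint G T) = sqn mu1 (F1 G) + sqn mu2 (F2 G).
Proof. exact: isometry. Qed.

(** Changing the sign of the height makes differences of elementary integrands elementary, so that
    the isometry also measures distances. *)
Definition negs (a : step T F) : step T F.
Proof.
refine (@Step R d Omega T F (step_lo a) (step_hi a) (fun w => - step_height a w)
  (step_lo_ge0 a) (step_lo_le_hi a) (step_hi_leT a) _ _).
  have := mwrtB (F_sigma (step_lo_ge0 a)) (mwrt_cst (F_sigma (step_lo_ge0 a)) 0) (step_measurable a).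
  by under eq_fun do rewrite sub0r.
by have [K HK] := step_bounded a; exists K => w; rewrite normrN.
Defined.

Definition negm (b : marked_step T F nu) : marked_step T F nu :=
  @MarkedStep R d Omega T F nu (negs b) (step_marks b) (@step_marks_measurable _ _ _ _ _ _ b)
    (@step_marks_nz _ _ _ _ _ _ b) (step_marks_finite b).

Definition nege (a : elt) : elt :=
  match a with inl a => inl (negs a) | inr b => inr (negm b) end.

Lemma gint_cat G H t w : gint (G ++ H) t w = gint G t w + gint H t w.
Proof. by rewrite /gint big_cat. Qed.
Lemma F1_cat G H x : F1 (G ++ H) x = F1 G x + F1 H x.
Proof. by rewrite /F1 big_cat. Qed.
Lemma F2_cat G H x : F2 (G ++ H) x = F2 G x + F2 H x.
Proof. by rewrite /F2 big_cat. Qed.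

Lemma ev_neg a t w : ev (nege a) t w = - ev a t w.
Proof. by case: a => [a|b]; rewrite /ev /= mulNr. Qed.
Lemma f1_neg a x : f1 (nege a) x = - f1 a x.
Proof. by case: a => [a|b]; rewrite /f1 /= ?oppr0// mulrN. Qed.
Lemma f2_neg a x : f2 (nege a) x = - f2 a x.
Proof. by case: a => [a|b]; rewrite /f2 /= mulrN. Qed.

Definition subG G H : seq elt := G ++ map nege H.

Lemma gint_sub G H t w : gint (subG G H) t w = gint G t w - gint H t w.
Proof.
rewrite gint_cat /gint big_map -sumrN; congr (_ + _).
by apply: eq_bigr => a _; exact: ev_neg.
Qed.
Lemma F1_sub G H x : F1 (subG G H) x = F1 G x - F1 H x.
Proof.
rewrite F1_cat /F1 big_map -sumrN; congr (_ + _).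
by apply: eq_bigr => a _; exact: f1_neg.
Qed.
Lemma F2_sub G H x : F2 (subG G H) x = F2 G x - F2 H x.
Proof.
rewrite F2_cat /F2 big_map -sumrN; congr (_ + _).
by apply: eq_bigr => a _; exact: f2_neg.
Qed.

Lemma isometry_dist G H : sqn P (fun w => gint G T w - gint H T w) =
  sqn mu1 (fun x => F1 G x - F1 H x) + sqn mu2 (fun x => F2 G x - F2 H x).
Proof.
rewrite -(sqn_ext _ (F1_sub G H)) -(sqn_ext _ (F2_sub G H)) -isometry_sqn.
by apply: sqn_ext => w; rewrite gint_sub.
Qed.

(** * Predictable integrands *)

Lemma trace_sigma (X : Type) (D : set X) (S : set (set X)) : sigma_algebra D S ->
  sigma_algebra setT [set A | S (A `&` D)].
Proof.
move=> [S0 SC SU]; split=> /=.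
- by rewrite set0I.
- move=> A SA; rewrite (_ : _ `&` _ = D `\` (A `&` D)); first exact: SC.
  apply/seteqP; split=> x; first by move=> [[_ nA] Dx]; split=> // -[].
  by move=> [Dx nA]; split=> //; split=> // Ax; exact: nA.
- by move=> A SA; rewrite setI_bigcupl; exact: SU.
Qed.

Lemma measurable_trace (d1 : measure_display) (X : measurableType d1) (D : set X) :
  measurable D -> sigma_algebra D (@measurable _ X).
Proof.
by move=> mD; split=> // [A mA|A mA]; [exact: measurableD|exact: bigcupT_measurable].
Qed.

Lemma measurable_cut (d1 : measure_display) (X : measurableType d1) (D : set X) (f : X -> R) :
  measurable D -> (forall C : set R, measurable C -> measurable (f @^-1` C `&` D)) ->
  measurable_fun setT (fun x => f x * \1_D x).
Proof.
move=> mD mf; rewrite (_ : (fun x => _) = f \_ D).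
  by apply/(measurable_restrictT f mD) => _ C mC; rewrite setIC; exact: mf.
apply/funext => x; rewrite patchE indicE; case: ifPn => _; rewrite ?mulr1//.
by rewrite mulr0.
Qed.

Definition D1 : set X1 := `[0, T]%classic `*` setT.
Definition D2 : set X2 := `[0, T]%classic `*` Rnz R `*` setT.
(* The traces of the predictable sigma-algebras on [0, T] are turned into
   sigma-algebras on the whole space, and integrands are cut off by [cut1], [cut2]. *)
Definition pred1 : set (set X1) := [set A | predictable_sets T F (A `&` D1)].
Definition pred2 : set (set X2) := [set A | predictable_marked_sets T F (A `&` D2)].

Lemma pred1_sigma : sigma_algebra setT pred1.
Proof. by apply: trace_sigma; exact: smallest_sigma_algebra. Qed.

Lemma pred2_sigma : sigma_algebra setT pred2.
Proof. by apply: trace_sigma; exact: smallest_sigma_algebra. Qed.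

Lemma mRnz : measurable (Rnz R : set (measurableTypeR R)).
Proof. by apply: measurableC; exact: measurable_set1. Qed.

Lemma mD1 : measurable D1.
Proof. by apply: measurableX. Qed.

Lemma mD2 : measurable D2.
Proof. by apply: measurableX => //; apply: measurableX => //; exact: mRnz. Qed.

Lemma predictable_sets_meas : predictable_sets T F `<=` (@measurable _ X1).
Proof.
apply: smallest_sub; first exact: measurable_trace mD1.
move=> A [[C FC ->]|[s [t [C [s0 st tT FC ->]]]]]; apply: measurableX => //.
- exact: (F_meas (lexx 0)).
- exact: (F_meas s0).
Qed.

Lemma predictable_marked_meas : predictable_marked_sets T F `<=` (@measurable _ X2).
Proof.
apply: smallest_sub; first exact: measurable_trace mD2.
move=> A [G [C [GP mC CR ->]]].
have mG := predictable_sets_meas GP.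
have m1 : measurable_fun setT (fun x : X2 => ((x.1.1, x.2) : X1)).
  by apply: measurable_fun_pair => //; apply: measurableT_comp => //; exact: measurable_fst.
have m2 : measurable_fun setT (fun x : X2 => x.1.2 : measurableTypeR R).
  by apply: measurableT_comp => //; exact: measurable_snd.
apply: measurableI.
  by have := m1 measurableT G mG; rewrite setTI.
by have := m2 measurableT C mC; rewrite setTI.
Qed.

Lemma mwrt_cut1 (f : X1 -> R) : measurable_wrt pred1 f ->
  measurable_fun setT (fun x => f x * \1_D1 x).
Proof.
move=> pf; apply: measurable_cut; first exact: mD1.
by move=> C mC; apply: predictable_sets_meas; exact: pf.
Qed.

Lemma mwrt_cut2 (f : X2 -> R) : measurable_wrt pred2 f ->
  measurable_fun setT (fun x => f x * \1_D2 x).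
Proof.
move=> pf; apply: measurable_cut; first exact: mD2.
by move=> C mC; apply: predictable_marked_meas; exact: pf.
Qed.

Lemma predictableP (q : R -> Omega -> R) :
  predictable T F q <-> measurable_wrt pred1 (fun x => q x.1 x.2).
Proof.
have E C : [set x : R * Omega | 0 <= x.1 <= T /\ C (q x.1 x.2)] =
    ((fun x : X1 => q x.1 x.2) @^-1` C) `&` D1.
  apply/seteqP; split=> x.
    by move=> [xT Cx]; split=> //; split=> //=; rewrite in_itv/=.
  by move=> [Cx [/=]]; rewrite in_itv/=.
split=> H C mC; last by rewrite E; exact: H.
by rewrite /pred1/= -E; exact: H.
Qed.

Lemma predictable_markedP (r : R -> R -> Omega -> R) :
  predictable_marked T F r <-> measurable_wrt pred2 (fun x => r x.1.1 x.1.2 x.2).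
Proof.
have E C : [set x : R * R * Omega | [/\ 0 <= x.1.1 <= T, Rnz R x.1.2 & C (r x.1.1 x.1.2 x.2)]] =
    ((fun x : X2 => r x.1.1 x.1.2 x.2) @^-1` C) `&` D2.
  apply/seteqP; split=> x.
    by move=> [xT Rx Cx]; split=> //; split=> //; split=> //=; rewrite in_itv/=.
  by move=> [Cx [[/= + Rx] _]]; rewrite in_itv/= => xT.
split=> H C mC; last by rewrite E; exact: H.
by rewrite /pred2/= -E; exact: H.
Qed.

Lemma pred_itv s t A : 0 <= s -> s <= t -> t <= T -> F s A ->
  predictable_sets T F (`]s, t]%classic `*` A).
Proof. by move=> s0 st tT FA; apply: sub_sigma_algebra; right; exists s, t, A. Qed.

Lemma itv_sub_T (s t : R) : 0 <= s -> t <= T -> `]s, t]%classic `<=` `[0, T]%classic.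
Proof.
move=> s0 tT x; rewrite /= !in_itv/= => /andP[sx xt].
by rewrite (le_trans s0 (ltW sx)) (le_trans xt tT).
Qed.

Lemma pred1_itv s t A : 0 <= s -> s <= t -> t <= T -> F s A ->
  pred1 (`]s, t]%classic `*` A).
Proof.
move=> s0 st tT FA; rewrite /pred1/= (_ : _ `&` _ = `]s, t]%classic `*` A); first exact: pred_itv.
by apply/seteqP; split=> [x []//|x [xs Ax]]; split=> //; split=> //; exact: itv_sub_T xs.
Qed.

Lemma pred2_box s t A C : 0 <= s -> s <= t -> t <= T -> F s A ->
  measurable C -> C `<=` Rnz R -> pred2 ((`]s, t]%classic `*` C) `*` A).
Proof.
move=> s0 st tT FA mC CR; apply: sub_sigma_algebra.
exists (`]s, t]%classic `*` A), C; split=> //; first exact: pred_itv.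
apply/seteqP; split=> [x [[[xs Cx] Ax] _]//|x [[xs Ax] Cx]].
by split=> //; split=> //; split=> //; [exact: itv_sub_T xs|exact: CR].
Qed.

(** The product vanishes off E, so the preimage of C contains the complement of E exactly when C
    contains 0; in that case the complement of C is used instead. *)
Lemma mwrt_indic_prod (X Y : Type) (d1 : measure_display) (Z0 : measurableType d1)
   (S : set (set Z0)) (E : set X) (h : Y -> R) (p : Z0 -> X) (p' : Z0 -> Y) :
  sigma_algebra setT S ->
  (forall C : set R, measurable C -> S [set z | E (p z) /\ C (h (p' z))]) ->
  measurable_wrt S (fun z => \1_E (p z) * h (p' z)).
Proof.
move=> sS H C mC; have [C0|C0] := pselect (C 0).
  rewrite (_ : _ @^-1` _ = ~` [set z | E (p z) /\ (~` C) (h (p' z))]).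
    by apply: (salgC sS); apply: H; exact: measurableC.
  apply/seteqP; split=> z /=.
    by rewrite indicE => + [Ez nC]; rewrite mem_set// mul1r.
  rewrite indicE; case: (pselect (E (p z))) => Ez; last by rewrite memNset// mul0r.
  by rewrite mem_set// mul1r => nC; apply: contrapT => ?; exact: nC.
rewrite (_ : _ @^-1` _ = [set z | E (p z) /\ C (h (p' z))]); first exact: H.
apply/seteqP; split=> z /=; rewrite indicE.
  case: (pselect (E (p z))) => Ez; last by rewrite memNset// mul0r.
  by rewrite mem_set// mul1r.
by move=> [Ez Cz]; rewrite mem_set// mul1r.
Qed.

Lemma pred_f1 a : measurable_wrt pred1 (f1 a).
Proof.
case: a => [a|b]; last exact: mwrt_cst pred1_sigma _.
apply: (mwrt_indic_prod pred1_sigma) => C mC.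
exact: (pred1_itv (lo_ge0 (inl a)) (lo_le_hi _) (hi_leT _) (hgt_wrt (inl a) mC)).
Qed.

Lemma pred_f2 a : measurable_wrt pred2 (f2 a).
Proof.
apply: (mwrt_indic_prod pred2_sigma) => C mC; case: a => [a|b].
  rewrite (_ : [set _ | _] = set0); first by case: pred2_sigma.
  by apply/seteqP; split=> // x [].
have [mM MR _] := goodmark_mk (inr b).
exact: (pred2_box (lo_ge0 (inr b)) (lo_le_hi _) (hi_leT _) (hgt_wrt (inr b) mC) mM MR).
Qed.

Lemma pred_F1 G : measurable_wrt pred1 (F1 G).
Proof. by apply: mwrt_sum; [exact: pred1_sigma|move=> a; exact: pred_f1]. Qed.

Lemma pred_F2 G : measurable_wrt pred2 (F2 G).
Proof. by apply: mwrt_sum; [exact: pred2_sigma|move=> a; exact: pred_f2]. Qed.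

Definition cut1 (q : R -> Omega -> R) (x : X1) : R := q x.1 x.2 * \1_D1 x.
Definition cut2 (r : R -> R -> Omega -> R) (x : X2) : R := r x.1.1 x.1.2 x.2 * \1_D2 x.

Lemma F1_D1 G x : F1 G x * \1_D1 x = F1 G x.
Proof.
rewrite /F1 mulr_suml; apply: eq_bigr => -[a|b] _; rewrite /f1 ?mul0r//.
rewrite !indicE; case: (pselect (`]lo (inl a), hi (inl a)]%classic x.1)) => xs.
  rewrite mem_set// mul1r mem_set ?mulr1//; split=> //.
  exact: itv_sub_T (lo_ge0 _) (hi_leT _) _ xs.
by rewrite memNset// !mul0r.
Qed.

Lemma F2_D2 G x : F2 G x * \1_D2 x = F2 G x.
Proof.
rewrite /F2 mulr_suml; apply: eq_bigr => a _; rewrite /f2 !indicE.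
case: (pselect (box a x.1)) => xs; last by rewrite memNset// !mul0r.
rewrite mem_set// mul1r mem_set ?mulr1//; case: a xs => [a|b]//= [xs Mx]; split=> //; split=> //.
  exact: itv_sub_T (lo_ge0 (inr b)) (hi_leT (inr b)) _ xs.
exact: step_marks_nz Mx.
Qed.

Lemma step_funE Q t w : step_fun Q t w = F1 (map inl Q) (t, w).
Proof. by rewrite /F1 big_map; apply: eq_bigr => a _; rewrite /f1/= mulrC. Qed.

Lemma marked_step_funE Q t z w : marked_step_fun Q t z w = F2 (map inr Q) (t, z, w).
Proof.
rewrite /F2 big_map; apply: eq_bigr => b _; rewrite /f2/= -mulrA mulrC; congr (_ * _).
rewrite !indicE; case: (pselect (`]step_lo b, step_hi b]%classic t)) => h1; last first.
  by rewrite memNset// mul0r memNset// => -[].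
rewrite mem_set// mul1r; case: (pselect (step_marks b z)) => h2.
  by rewrite !mem_set.
by rewrite !memNset// => -[].
Qed.

(** Predictability supplies the joint measurability with which Tonelli turns the iterated integral
    into a squared norm on the product space. *)
Lemma sqnormE q : predictable T F q ->
  (sqnorm P T q = \int[mu1]_x ((cut1 q x) ^+ 2)%:E)%E.
Proof.
move=> /predictableP pq; have mq := mwrt_cut1 pq.
have m2 : measurable_fun setT (fun x : X1 => ((cut1 q x) ^+ 2)%:E).
  by apply/measurable_EFinP; exact: measurable_funX.
have n2 (x : X1) : (0 <= ((cut1 q x) ^+ 2)%:E)%E by rewrite lee_fin sqr_ge0.
rewrite [RHS](@fubini_tonelli2 _ _ _ _ R lebesgue_measure P _ m2 n2).
apply: eq_integral => w _; rewrite [LHS]integral_mkcond.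
apply: (@eq_integral _ (measurableTypeR R)) => t _.
rewrite patchE /cut1 /= indicE; case: ifPn => tT.
  by rewrite mem_set ?mulr1//; split=> //; rewrite inE in tT.
rewrite memNset ?mulr0 ?expr0n// => -[/= tT' _].
by rewrite mem_set in tT.
Qed.

Lemma sqnorm_nuE r : predictable_marked T F r ->
  (sqnorm_nu P T nu r = \int[mu2]_x ((cut2 r x) ^+ 2)%:E)%E.
Proof.
move=> /predictable_markedP pr; have mr := mwrt_cut2 pr.
have mr2 : measurable_fun setT (fun x : X2 => ((cut2 r x) ^+ 2)%:E).
  by apply/measurable_EFinP; exact: measurable_funX.
have n2 (x : X2) : (0 <= ((cut2 r x) ^+ 2)%:E)%E by rewrite lee_fin sqr_ge0.
rewrite [RHS](@fubini_tonelli2 _ _ _ _ R leb2s P _ mr2 n2).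
apply: eq_integral => w _.
have mw : measurable_fun setT (fun y : RR => ((cut2 r (y, w)) ^+ 2)%:E).
  exact: (measurableT_comp mr2 (measurable_pair2 w)).
have n3 (y : RR) : (0 <= ((cut2 r (y, w)) ^+ 2)%:E)%E by exact: n2.
transitivity (\int[leb2]_y ((cut2 r (y, w)) ^+ 2)%:E)%E; last by [].
rewrite [RHS](@fubini_tonelli1 _ _ _ _ R lebesgue_measure nu _ mw n3).
rewrite [LHS]integral_mkcond.
apply: (@eq_integral _ (measurableTypeR R)) => t _; rewrite patchE /fubini_F /cut2/=.
case: ifPn => tT; last first.
  rewrite integral0_eq// => z _; rewrite indicE memNset ?mulr0 ?expr0n// => -[[/= tT' _] _].
  by rewrite mem_set in tT.
rewrite integral_mkcond; apply: eq_integral => z _; rewrite patchE /= indicE.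
case: ifPn => zR.
  have D2x : D2 (t, z, w).
    split=> //; split; first by move: tT; rewrite inE.
    by move: zR; rewrite inE.
  by rewrite mem_set// mulr1.
rewrite memNset ?mulr0 ?expr0n// => -[[/= _ zR'] _].
by rewrite mem_set in zR.
Qed.

Lemma L2P q : L2 P T F q <-> predictable T F q /\ sqint mu1 (cut1 q).
Proof.
split=> -[pq H]; split=> //; move: (pq) => /predictableP /mwrt_cut1 mq.
  by split=> //; rewrite -sqnormE.
by rewrite sqnormE//; case: H.
Qed.

Lemma L2nuP r : L2nu P T F nu r <-> predictable_marked T F r /\ sqint mu2 (cut2 r).
Proof.
split=> -[pr H]; split=> //; move: (pr) => /predictable_markedP /mwrt_cut2 mr.
  by split=> //; rewrite -sqnorm_nuE.
by rewrite sqnorm_nuE//; case: H.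
Qed.

Lemma step_integralE Q t w : step_integral B Q t w = gint (map inl Q) t w.
Proof. by rewrite /gint big_map; apply: eq_bigr. Qed.

Lemma marked_step_integralE Q t : 0 <= t <= T ->
  {ae P, forall w, marked_step_integral N Q t w = gint (map inr Q) t w}.
Proof.
move=> /andP[t0 tT]; elim: Q => [|b Q ih].
  by apply/aeW => w; rewrite /marked_step_integral /gint !big_nil.
set u := Num.min (step_lo b) t; set v := Num.min (step_hi b) t.
have u0 : 0 <= u by rewrite le_min step_lo_ge0.
have uv : u <= v by rewrite le_min2// step_lo_le_hi.
have vT : v <= T by rewrite ge_min step_hi_leT.
have := dZ_cmp (goodmark_mk (inr b)) u0 uv vT; apply: filterS2 ih => w ih H.
rewrite /marked_step_integral /gint map_cons !big_cons -/(gint _ _ _) -ih; congr (_ + _).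
by rewrite /ev /= H.
Qed.

(** Working form of the definition. The finiteness of the second moment of [M t] is not stated
    there; it is extracted from the convergence by [sq_cvgE]. *)
Lemma is_ito_integralP q M : is_ito_integral P T F B q M <->
  [/\ predictable T F q, sqint mu1 (cut1 q), cadlag_adapted T F M &
    exists Q : nat -> seq (step T F),
      sq_cvg mu1 (fun k => F1 (map inl (Q k))) (cut1 q) /\
      forall t, 0 <= t <= T -> sqint P (M t) /\ sq_cvg P (fun k => gint (map inl (Q k)) t) (M t)].
Proof.
have key q' (Q : nat -> seq (step T F)) : predictable T F q' -> sqint mu1 (cut1 q') ->
    (sqnorm P T (fun t w => q' t w - step_fun (Q k) t w) @[k --> \oo] --> 0%E) <->
    sq_cvg mu1 (fun k => F1 (map inl (Q k))) (cut1 q').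
  move=> pq sq.
  have E k : (sqnorm P T (fun t w => q' t w - step_fun (Q k) t w)%R =
      \int[mu1]_x ((cut1 q' x - F1 (map inl (Q k)) x) ^+ 2)%:E)%E.
    rewrite sqnormE; last first.
      apply/predictableP; apply: (mwrtB pred1_sigma); first exact/predictableP.
      rewrite (_ : (fun x => _) = F1 (map inl (Q k))); first exact: pred_F1.
      by apply/funext => -[t w]; rewrite step_funE.
    by apply: eq_integral => -[t w] _; rewrite /cut1 /= mulrBl step_funE F1_D1.
  under eq_fun do rewrite E.
  have H := sq_cvgE (fun k => sqint_F1 (map inl (Q k))) sq.1.
  by split=> [/H[]//|c]; apply/H.
have key2 M' (Q : nat -> seq (step T F)) t : cadlag_adapted T F M' -> 0 <= t <= T ->
    ((\int[P]_w ((M' t w - step_integral B (Q k) t w) ^+ 2)%:E)%E @[k --> \oo] --> 0%E) <->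
    sqint P (M' t) /\ sq_cvg P (fun k => gint (map inl (Q k)) t) (M' t).
  move=> [aM _] tT; have mM : measurable_fun setT (M' t).
    by apply: mwrt_measurable (aM _ tT); apply: F_meas; case/andP: tT.
  have H := sq_cvgE (fun k => sqint_gint (map inl (Q k)) tT) mM.
  rewrite -H.
  have -> : (fun k => (\int[P]_w ((M' t w - step_integral B (Q k) t w) ^+ 2)%:E)%E) =
    (fun k => (\int[P]_w ((M' t w - gint (map inl (Q k)) t w) ^+ 2)%:E)%E); last by [].
  by apply/funext => k; apply: eq_integral => w _; rewrite step_integralE.
split.
  move=> [/L2P[pq sq] cM [Q [c1 c2]]]; split=> //; exists Q; split; first exact/key.
  by move=> t tT; apply/key2 => //; exact: c2.
move=> [pq sq cM [Q [c1 c2]]]; split=> //; first exact/L2P.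
exists Q; split; first exact/key.
by move=> t tT; apply/key2 => //; exact: c2.
Qed.

Lemma is_poisson_integralP r M : is_poisson_integral P T F nu N r M <->
  [/\ predictable_marked T F r, sqint mu2 (cut2 r), cadlag_adapted T F M &
    exists Q : nat -> seq (marked_step T F nu),
      sq_cvg mu2 (fun k => F2 (map inr (Q k))) (cut2 r) /\
      forall t, 0 <= t <= T -> sqint P (M t) /\ sq_cvg P (fun k => gint (map inr (Q k)) t) (M t)].
Proof.
have key q' (Q : nat -> seq (marked_step T F nu)) : predictable_marked T F q' -> sqint mu2 (cut2 q') ->
    (sqnorm_nu P T nu (fun t z w => q' t z w - marked_step_fun (Q k) t z w) @[k --> \oo] --> 0%E) <->
    sq_cvg mu2 (fun k => F2 (map inr (Q k))) (cut2 q').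
  move=> pq sq.
  have E k : (sqnorm_nu P T nu (fun t z w => q' t z w - marked_step_fun (Q k) t z w)%R =
      \int[mu2]_x ((cut2 q' x - F2 (map inr (Q k)) x) ^+ 2)%:E)%E.
    rewrite sqnorm_nuE; last first.
      apply/predictable_markedP; apply: (mwrtB pred2_sigma); first exact/predictable_markedP.
      rewrite (_ : (fun x => _) = F2 (map inr (Q k))); first exact: pred_F2.
      by apply/funext => -[[t z] w]; rewrite marked_step_funE.
    by apply: eq_integral => -[[t z] w] _; rewrite /cut2 /= mulrBl marked_step_funE F2_D2.
  under eq_fun do rewrite E.
  have H := sq_cvgE (fun k => sqint_F2 (map inr (Q k))) sq.1.
  by split=> [/H[]//|c]; apply/H.
have key2 M' (Q : nat -> seq (marked_step T F nu)) t : cadlag_adapted T F M' -> 0 <= t <= T ->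
    ((\int[P]_w ((M' t w - marked_step_integral N (Q k) t w) ^+ 2)%:E)%E @[k --> \oo] --> 0%E) <->
    sqint P (M' t) /\ sq_cvg P (fun k => gint (map inr (Q k)) t) (M' t).
  move=> [aM _] tT; have mM : measurable_fun setT (M' t).
    by apply: mwrt_measurable (aM _ tT); apply: F_meas; case/andP: tT.
  have H := sq_cvgE (fun k => sqint_gint (map inr (Q k)) tT) mM.
  rewrite -H.
  have -> : (fun k => (\int[P]_w ((M' t w - marked_step_integral N (Q k) t w) ^+ 2)%:E)%E) =
    (fun k => (\int[P]_w ((M' t w - gint (map inr (Q k)) t w) ^+ 2)%:E)%E); last by [].
  apply/funext => k; apply: ae_eq_integral => //.
  - apply/measurable_EFinP/measurable_funX/measurable_funB => //.
    apply: measurable_sum => b; apply: measurable_funM; first exact: (m_hgt (inr b)).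
    apply: (sqint_cmp _).1; case: (goodmark_mk (inr b)) => mC CR Coo.
    apply: int_fin_box => //; first by rewrite le_min step_lo_ge0; case/andP: tT.
    by rewrite ge_min step_hi_leT.
  - apply/measurable_EFinP/measurable_funX/measurable_funB => //.
    exact: (sqint_gint _ tT).1.
  - by have := marked_step_integralE (Q k) tT; apply: filterS => w -> _.
split.
  move=> [/L2nuP[pq sq] cM [Q [c1 c2]]]; split=> //; exists Q; split; first exact/key.
  by move=> t tT; apply/key2 => //; exact: c2.
move=> [pq sq cM [Q [c1 c2]]]; split=> //; first exact/L2nuP.
exists Q; split; first exact/key.
by move=> t tT; apply/key2 => //; exact: c2.
Qed.

(** * Doob's inequality for square-integrable martingales *)

(** When the total count on ]0, T] is finite, the counting path is monotone and its right continuity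
    is continuity from above of the measure [N w]; the compensator is linear in time. For B the
    paths are almost surely continuous. *)
Lemma Z_cadlag i : goodmark i -> {ae P, forall w, cadlag T (Z i ^~ w)}.
Proof.
case: i => [C|] gi.
  have [mC CR Coo] := gi.
  have fb : int_fin (`]0, T]%classic `*` C) by exact: int_fin_box.
  apply: filterS (cnt_ae_nat fb) => w [k [Nk _]].
  have mE (s : R) : measurable (`]0, s]%classic `*` C : set RR) by exact: measurableX.
  have sub (s t : R) : s <= t -> `]0, s]%classic `*` C `<=` `]0, t]%classic `*` C.
    move=> st [x y] [/= + Cy]; rewrite !in_itv/= => /andP[x0 xs]; split=> //=.
    by rewrite x0 (le_trans xs).
  (* Stopping at T keeps all counts finite, so that f is monotone on the whole line. *)
  pose f (s : R) := fine (N w (`]0, Num.min s T]%classic `*` C)).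
  have Nfin (s : R) : s <= T -> N w (`]0, s]%classic `*` C) = (fine (N w (`]0, s]%classic `*` C)))%:E.
    move=> sT; rewrite fineK// ge0_fin_numE//; apply: le_lt_trans (ltry k%:R).
    by rewrite -Nk; apply: le_measure; rewrite ?inE//; exact: sub.
  have mT (s : R) : Num.min s T <= T by rewrite ge_min lexx orbT.
  have cf : cadlag T f.
    apply: cadlag_monotone => [x y xy|t /andP[t0 tT]].
      rewrite /f -lee_fin -!Nfin//; apply: le_measure; rewrite ?inE//; apply: sub.
      by rewrite le_min2.
    pose u n : R := t + (T - t) / n.+1%:R.
    have u_T n : u n <= T.
      rewrite /u -lerBrDl ler_pdivrMr ?ltr0n//; rewrite ler_peMr ?ler1n//.
      by rewrite subr_ge0 ltW.
    have u_t n : t <= u n by rewrite lerDl divr_ge0// subr_ge0 ltW.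
    have u_nd m n : (m <= n)%N -> u n <= u m.
      move=> mn; have tT0 : 0 <= T - t by rewrite subr_ge0 ltW.
      by rewrite lerD2l ler_wpM2l// lef_pV2 ?posrE ?ltr0n// ler_nat.
    have uc : u @ \oo --> t.
      rewrite -[X in _ --> X](addr0 t); apply: cvgD; first exact: cvg_cst.
      rewrite -(mulr0 (T - t)); apply: cvgMr.
      exact: (@cvg_harmonic R).
    have ->: (fun n => f (t + (T - t) / n.+1%:R)) = fine \o (fun n => N w (`]0, u n]%classic `*` C)).
      by apply/funext => n; rewrite /f /= (min_l (u_T n)).
    apply: fine_cvg; rewrite /f (min_l (ltW tT)) -Nfin ?(ltW tT)//.
    have -> : `]0, t]%classic `*` C = \bigcap_n (`]0, u n]%classic `*` C).
      apply/seteqP; split=> [x xt n _|[x y] H]; first exact: sub xt.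
      have [/= + Cy] := H 0%N Logic.I; rewrite in_itv/= => /andP[x0 _]; split=> //=.
      rewrite in_itv/= x0/= -(cvg_lim (@Rhausdorff R) uc); apply: limr_ge.
        by apply/cvg_ex; exists t.
      by apply: nearW => n; have [/= + _] := H n Logic.I; rewrite in_itv/= => /andP[].
    apply: nonincreasing_cvg_mu => //.
    - by rewrite Nfin// ltry.
    - exact: bigcapT_measurable.
    - by move=> m n mn; apply/subsetPset; apply: sub; exact: u_nd.
  have cg := cadlagB cf (cadlagZ (fine (nu C)) (cadlag_id T)).
  apply: cadlag_eq cg => s; rewrite in_itv/= => /andP[s0 sT].
  by rewrite /f /Z /cmp /cnt (min_l sT) intens_box// subr0 mulrC.
have [_ + _ _] := BM; apply: filterS => w /continuous_within_itvcyP[Bc B0].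
have cB (t : R) : 0 < t -> B ^~ w @ t --> B t w by move=> t0; apply: Bc; rewrite in_itv/= t0.
split=> t /andP[t0 tT].
  move: t0; rewrite le_eqVlt => /predU1P[<-|t0]; first exact: B0.
  exact: cvg_at_right_filter (cB t t0).
by apply/cvg_ex; exists (B t w); exact: cvg_at_left_filter (cB t t0).
Qed.

Lemma gint_cadlag G : {ae P, forall w, cadlag T (gint G ^~ w)}.
Proof.
have H a : {ae P, forall w, cadlag T (ev a ^~ w)}.
  apply: filterS (Z_cadlag (goodmark_mk a)) => w cZ.
  by apply: cadlagZ; apply: cadlagB; apply: (cadlag_min (f := Z (mk a) ^~ w)).
elim: G => [|a G ih].
  apply/aeW => w; apply: cadlag_eq (cadlag_cst T 0) => t _.
  by rewrite /gint big_nil.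
apply: filterS2 (H a) ih => w c1 c2.
by apply: cadlag_eq (cadlagD c1 c2) => t _; rewrite /gint big_cons.
Qed.

Lemma runmax_le (s : nat -> R) n c : (forall i, (i <= n)%N -> s i <= c) -> runmax s n <= c.
Proof.
elim: n => [|n ih] H /=; first exact: H.
by rewrite ge_max H// andbT ih// => i /leqW; exact: H.
Qed.

Definition sgm (x : R) : R := 1 - 2 * \1_`]-oo, 0[%classic x.

Lemma sgmE x : sgm x = if x < 0 then -1 else 1.
Proof.
rewrite /sgm indicE; case: ifPn => x0.
  by rewrite mem_set ?mulr1; [lra|rewrite /= in_itv/=].
by rewrite memNset ?mulr0 ?subr0//= in_itv/=; exact/negP.
Qed.

Lemma norm_sgm x : `|sgm x| <= 1.
Proof. by rewrite sgmE; case: ifP => _; rewrite ?normrN normr1. Qed.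

(** [sgm a] is a subgradient of the absolute value at a. Being a function of the earlier value, it
    reduces the submartingale property of |M| to the martingale property of M. *)
Lemma sgm_le (a b : R) : sgm a * (b - a) <= `|b| - `|a|.
Proof.
rewrite sgmE; case: ifPn => a0; have := ler_norm b; have := ler_norm (- b); rewrite normrN.
  by rewrite (ltr0_norm a0) => ? ?; lra.
by have a1 : 0 <= a by [rewrite leNgt]; rewrite (ger0_norm a1) => ? ?; lra.
Qed.

Lemma m_sgm : measurable_fun setT sgm.
Proof. by apply: measurable_funB => //; apply: measurable_funM => //; exact: measurable_indic. Qed.

Definition gmax (M : R -> Omega -> R) n j w :=
  runmax (fun i => `|M (dyad T n i) w|) j.

Lemma gmax_wrt M n j : mart2 M -> (j <= 2 ^ n)%N ->
  measurable_wrt (F (dyad T n j)) (gmax M n j) /\ sqint P (gmax M n j).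
Proof.
move=> [aM sM _]; elim: j => [|j ih] jn.
  have tT := dyad_itv T_gt0 jn; split; last by apply: sqint_norm; exact: sM.
  by case/andP: (tT) => t0 _; exact: (mwrt_comp (F_sigma t0) (@normr_measurable R setT) (aM _ tT)).
have [ih1 ih2] := ih (ltnW jn).
have tT := dyad_itv T_gt0 jn; have /andP[t0 _] := tT.
have /andP[s0 _] := dyad_itv T_gt0 (ltnW jn).
have aj : measurable_wrt (F (dyad T n j.+1)) (fun w => `|M (dyad T n j.+1) w|).
  exact: (mwrt_comp (F_sigma t0) (@normr_measurable R setT) (aM _ tT)).
split.
  apply: mwrt_max aj; first exact: F_sigma.
  by apply: mwrt_mono ih1 => //; exact: dyad_mono.
have sj := sqint_norm (sM _ tT).
apply: (sqint_dom _ (sqintD (sqint_norm ih2) sj)).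
  by apply: measurable_maxr; [exact: ih2.1|exact: sj.1].
move=> w; rewrite [leRHS]ger0_norm ?addr_ge0//.
have g0 : 0 <= gmax M n j w by exact: runmax_ge0.
rewrite ger0_norm; last by rewrite le_max normr_ge0 orbT.
by rewrite ge_max lerDr normr_ge0 andbT (ger0_norm g0) lerDl.
Qed.

Lemma mart2_increment M s t (H : Omega -> R) : mart2 M -> 0 <= s -> s <= t -> t <= T ->
  measurable_wrt (F s) H -> sqint P H -> intg P (fun w => H w * (M t w - M s w)).
Proof.
move=> [_ sM _] s0 st tT _ sH; apply: sqintM => //; apply: sqintB; apply: sM.
  by rewrite (le_trans s0).
by rewrite s0 (le_trans st).
Qed.

(** [doob_pathwise] in expectation: each summand of the discrete integral has nonnegative mean, as
    it dominates a martingale increment times a variable of the past. *)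
Lemma doob_grid M n : mart2 M -> sqn P (gmax M n (2 ^ n)) <= 4 * sqn P (M T).
Proof.
move=> mM; have [aM sM oM] := mM.
pose s i w := `|M (dyad T n i) w|.
have [_ sg] := gmax_wrt mM (leqnn (2 ^ n)).
have dT i : (i <= 2 ^ n)%N -> 0 <= dyad T n i <= T by exact: dyad_itv.
have ss i : (i <= 2 ^ n)%N -> sqint P (s i) by move=> ?; apply: sqint_norm; apply: sM; exact: dT.
have TT : 0 <= T <= T by rewrite lexx ltW.
pose X (i : 'I_(2 ^ n)) w := gmax M n i w * (s i.+1 w - s i w).
have iX i : intg P (X i).
  apply: sqintM; first exact: (gmax_wrt mM (ltnW (ltn_ord i))).2.
  by apply: sqintB; apply: ss => //; exact: ltnW.
have EX i : 0 <= Ex P (X i).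
  have li : (i <= 2 ^ n)%N by exact: ltnW.
  have [gi si] := gmax_wrt mM li.
  have /andP[t0 tT] := dT _ li; have /andP[t0' tT'] := dT _ (ltn_ord i).
  pose H w := sgm (M (dyad T n i) w) * gmax M n i w.
  have FH : measurable_wrt (F (dyad T n i)) H.
    apply: mwrtM => //; first exact: F_sigma.
    by apply: (mwrt_comp (F_sigma t0) m_sgm); apply: aM; rewrite t0.
  have sH : sqint P H.
    apply: (@sqintMb _ _ _ P _ (fun w => sgm (M (dyad T n i) w)) 1) => //.
      by apply: measurableT_comp; [exact: m_sgm|apply: (sM _ _).1; rewrite t0].
    by move=> w; exact: norm_sgm.
  have ii : dyad T n i <= dyad T n i.+1 by exact: dyad_mono.
  rewrite -(oM _ _ _ t0 ii tT' FH sH); apply: Ex_le => //.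
    exact: mart2_increment mM t0 ii tT' FH sH.
  move=> w; rewrite /H /X mulrAC mulrC ler_wpM2l//; first exact: runmax_ge0.
  exact: sgm_le.
have i0 : intg P (fun w => gmax M n (2 ^ n) w ^+ 2) := ((sqintP P _).1 sg).2.
have iS : intg P (fun w => \sum_(i < 2 ^ n) X i w) by exact: intg_sum.
have iT := ((sqintP P _).1 (sM _ TT)).2.
have H : Ex P (fun w => gmax M n (2 ^ n) w ^+ 2 + 4 * \sum_(i < 2 ^ n) X i w) <= 4 * sqn P (M T).
  rewrite /sqn -(ExZ 4 iT); apply: Ex_le.
  - by apply: intgD => //; exact: intgZ.
  - exact: intgZ.
  - move=> w; have := doob_pathwise (s ^~ w) (2 ^ n).
    by rewrite big_mkord /s dyad_last real_normK ?num_real.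
rewrite ExD// in H; last exact: intgZ.
rewrite ExZ// Ex_sum// in H; apply: le_trans H.
by rewrite lerDl mulr_ge0// sumr_ge0.
Qed.

Lemma gmax_nd M n w : gmax M n (2 ^ n) w <= gmax M n.+1 (2 ^ n.+1) w.
Proof.
apply: runmax_le => i iN; rewrite -dyad_double.
apply: (runmax_ge (fun i => `|M (dyad T n.+1 i) w|)).
by rewrite expnS mul2n leq_double.
Qed.

(** The majorant is the increasing limit of squared maxima over dyadic grids: it is measurable by
    construction, and it bounds the path at all times because cadlag functions are controlled by
    their dyadic values. *)
Lemma doob_sup M : mart2 M -> {ae P, forall w, cadlag T (M ^~ w)} ->
  exists a : Omega -> \bar R, [/\ measurable_fun setT a, forall w, (0 <= a w)%E,
    (\int[P]_w a w <= (4 * sqn P (M T))%:E)%E &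
    {ae P, forall w, forall t, 0 <= t <= T -> (((M t w) ^+ 2)%:E <= a w)%E}].
Proof.
move=> mM cM.
pose g n w := ((gmax M n (2 ^ n) w) ^+ 2)%:E.
have sg n := (gmax_wrt mM (leqnn (2 ^ n))).2.
have mg n : measurable_fun setT (g n).
  by apply/measurable_EFinP; apply: measurable_funX; exact: (sg n).1.
have g0 n w : (0 <= g n w)%E by rewrite lee_fin sqr_ge0.
have gnd w : nondecreasing_seq (g ^~ w).
  apply/nondecreasing_seqP => n; rewrite lee_fin lerXn2r ?nnegrE ?runmax_ge0//.
  exact: gmax_nd.
have gc w := ereal_nondecreasing_is_cvgn (gnd w).
exists (fun w => limn (g ^~ w)); split.
- by apply: (emeasurable_fun_cvg g) => // w _; exact: gc.
- by move=> w; apply: lime_ge => //; apply: nearW => n; exact: g0.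
- rewrite monotone_convergence//; apply: lime_le.
    apply: ereal_nondecreasing_is_cvgn => m n mn; apply: ge0_le_integral => // w _.
    exact: gnd.
  apply: nearW => n; have -> : (\int[P]_w g n w = (sqn P (gmax M n (2 ^ n)))%:E)%E.
    by rewrite -sqnE.
  by rewrite lee_fin; exact: doob_grid.
- apply: filterS cM => w cw t tT.
  case E : (limn (g ^~ w)) => [r| |].
  + have b n i : (i <= 2 ^ n)%N -> `|M (dyad T n i) w| <= Num.sqrt r.
      move=> iN; have gr : (g n w <= r%:E)%E.
        by rewrite -E; apply: lime_ge => //; exists n => // m nm; exact: gnd.
      have r0 : 0 <= r by rewrite -lee_fin (le_trans (g0 n w)).
      rewrite lee_fin in gr; apply: le_trans (_ : gmax M n (2 ^ n) w <= _).
        exact: (runmax_ge (fun i => `|M (dyad T n i) w|)).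
      have g1 : 0 <= gmax M n (2 ^ n) w by exact: runmax_ge0.
      by rewrite -(ger0_norm g1) -sqrtr_sqr ler_sqrt.
    have := cadlag_dyadic_bound T_gt0 cw b tT.
    have r0 : 0 <= r.
      rewrite -lee_fin -E; apply: lime_ge => //; apply: nearW => n; exact: g0.
    by rewrite lee_fin -(real_normK (num_real (M t w))) -[X in _ -> _ <= X](sqr_sqrtr r0) => h; rewrite lerXn2r ?nnegrE ?sqrtr_ge0.
  + exact: leey.
  + have : (0 <= limn (g ^~ w))%E by apply: lime_ge => //; apply: nearW => n; exact: g0.
    by rewrite E.
Qed.

(** * Limits of elementary integrals *)

Lemma T_itv : 0 <= T <= T. Proof. by rewrite lexx ltW. Qed.

Lemma mart2_lim (M_ : nat -> R -> Omega -> R) M : (forall k, mart2 (M_ k)) ->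
  adapted T F M -> (forall t, 0 <= t <= T -> sqint P (M t) /\ sq_cvg P (fun k => M_ k t) (M t)) ->
  mart2 M.
Proof.
move=> mM aM cM; split=> //; first by move=> t tT; exact: (cM t tT).1.
move=> s t H s0 st tT FH sH.
have sT : 0 <= s <= T by rewrite s0 (le_trans st).
have tT' : 0 <= t <= T by rewrite (le_trans s0 st).
have [sMs cs] := cM s sT; have [sMt ct] := cM t tT'.
have i1 := sqintM sH sMs; have i2 := sqintM sH sMt.
have k1 k : sqint P (M_ k s) by case: (mM k) => _ /(_ s sT).
have k2 k : sqint P (M_ k t) by case: (mM k) => _ /(_ t tT').
have h1 := sq_cvg_inner k1 sMs sH cs; have h2 := sq_cvg_inner k2 sMt sH ct.
have h3 : (fun k => Ex P (fun w => H w * M_ k t w) - Ex P (fun w => H w * M_ k s w)) @ \oo --> Ex P (fun w => H w * M t w) - Ex P (fun w => H w * M s w) by exact: cvgB.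
rewrite (@Ex_ext _ _ _ _ _ (fun w => H w * M t w - H w * M s w)); last by move=> w; ring.
rewrite ExB//.
have h4 : (fun k => Ex P (fun w => H w * M_ k t w) - Ex P (fun w => H w * M_ k s w)) = (fun=> 0).
  apply/funext => k; rewrite -ExB; [|exact: sqintM|exact: sqintM].
  have [_ _ oM] := mM k; rewrite -(oM s t H s0 st tT FH sH).
  by apply: Ex_ext => w; ring.
by rewrite h4 in h3; exact: (esym (cvg_unique (@Rhausdorff R) (cvg_cst 0) h3)).
Qed.

(** Pythagoras, increments being orthogonal to the past. In particular second moments are
    nondecreasing in time. *)
Lemma mart2_contraction M s t : mart2 M -> 0 <= s -> s <= t -> t <= T ->
  sqn P (M t) = sqn P (M s) + sqn P (fun w => M t w - M s w).
Proof.
move=> mM s0 st tT; have [aM sM oM] := mM.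
have sT : 0 <= s <= T by rewrite s0 (le_trans st).
have tT' : 0 <= t <= T by rewrite (le_trans s0 st).
have sd := sqintB (sM _ tT') (sM _ sT).
have -> : sqn P (M t) = sqn P (fun w => M s w + (M t w - M s w)).
  by apply: sqn_ext => w; ring.
by rewrite (sqnD (sM _ sT) sd) (oM _ _ _ s0 st tT (aM _ sT) (sM _ sT)) mulr0 addr0.
Qed.

Lemma mart2_sqn_le M t : mart2 M -> 0 <= t <= T -> sqn P (M t) <= sqn P (M T).
Proof.
move=> mM /andP[t0 tT]; rewrite (mart2_contraction mM t0 tT (lexx _)).
by rewrite lerDl sqn_ge0.
Qed.

(** The quotient by 4 cancels the constant of Doob's inequality, so the squared suprema of
    successive differences have means at most 8^-k; their almost sure decay 4^-k gives uniform
    convergence at rate 2^-k, under which cadlag paths are stable. *)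
Lemma martingale_limit (G : nat -> seq elt) :
  (forall k l, (k <= l)%N -> sqn P (fun w => gint (G l) T w - gint (G k) T w) <= 8 ^- k / 4) ->
  exists M, [/\ cadlag_adapted T F M, mart2 M &
    forall t, 0 <= t <= T -> sqint P (M t) /\ sq_cvg P (fun k => gint (G k) t) (M t)].
Proof.
move=> HG.
pose D k := subG (G k.+1) (G k).
have DE k t w : gint (D k) t w = gint (G k.+1) t w - gint (G k) t w by exact: gint_sub.
have /choice[a Ha] k := doob_sup (mart2_gint (D k)) (gint_cadlag (D k)).
have Ha3 k : (\int[P]_w a k w <= (8 ^- k)%:E)%E.
  have [_ _ h _] := Ha k; apply: (le_trans h); rewrite lee_fin.
  rewrite (sqn_ext _ (DE k T)); have := HG k k.+1 (leqnSn k).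
  by rewrite -[in X in _ -> X]ler_pdivlMl// mulrC.
have := ae_geometric_bound (fun k => let: And4 h _ _ _ := Ha k in h)
   (fun k => let: And4 _ h _ _ := Ha k in h) Ha3.
have ae1 : {ae P, forall w k, forall t, 0 <= t <= T -> (((gint (D k) t w) ^+ 2)%:E <= a k w)%E}.
  by apply/ae_foralln => k; case: (Ha k).
have ae2 : {ae P, forall w k, cadlag T (gint (G k) ^~ w)}.
  by apply/ae_foralln => k; exact: gint_cadlag.
move=> ae3.
pose good w := (forall k, cadlag T (gint (G k) ^~ w)) /\
  exists C : R, forall k t, 0 <= t <= T -> `|gint (G k.+1) t w - gint (G k) t w| <= C * 2 ^- k.
have aegood : {ae P, forall w, good w}.
  apply: filterS3 ae1 ae2 ae3 => w h1 h2 [C hC]; split=> //; exists (Num.sqrt C) => k t tT.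
  rewrite -DE; have := le_trans (h1 k t tT) (hC k); rewrite lee_fin => h.
  have C0 : 0 <= C.
    by have := le_trans (sqr_ge0 _) h; rewrite pmulr_lge0// invr_gt0 exprn_gt0.
  have p0 : 0 <= Num.sqrt C * 2 ^- k by rewrite mulr_ge0 ?sqrtr_ge0// invr_ge0 exprn_ge0.
  rewrite -[leRHS](ger0_norm p0) -!sqrtr_sqr ler_sqrt ?sqr_ge0//.
  by rewrite exprMn sqr_sqrtr// exprVn -exprM mulnC exprM (_ : 2 ^+ 2 = 4 :> R)//; ring.
(* Paths must be cadlag for every outcome, hence the value 0 off the good event; adaptedness
   survives because each [F t] contains the null sets. *)
pose M t w := if pselect (good w) then limn (fun k => gint (G k) t w) else 0.
have Mgood w : good w -> exists2 C : R, (forall k t, 0 <= t <= T -> `|M t w - gint (G k) t w| <= C * 2 ^- k)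
   & forall t, 0 <= t <= T -> gint (G k) t w @[k --> \oo] --> M t w.
  move=> gw; have [_ [C hC]] := gw; exists (2 * C) => [k t tT|t tT].
    have [_ ] := geometric_steps_cvg (fun k => hC k t tT).
    by rewrite /M; case: pselect => // _; exact.
  have [h _] := geometric_steps_cvg (fun k => hC k t tT).
  by rewrite /M; case: pselect.
have Mc w : cadlag T (M ^~ w).
  have [gw|ngw] := pselect (good w); last first.
    by apply: cadlag_eq (cadlag_cst T 0) => t _; rewrite /M; case: pselect.
  have [C hC _] := Mgood w gw; have [cG _] := gw.
  have hC2 k : {in `[0, T], forall t, `|M t w - gint (G k) t w| <= C * 2 ^- k}.
    by move=> t; rewrite in_itv/= => tT; exact: hC.
  apply: (cadlag_uniform cG hC2).
  rewrite -(mulr0 C); apply: cvgMr.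
  under eq_fun do rewrite -exprVn; apply: cvg_expr.
  by rewrite ger0_norm ?invr_ge0// invf_lt1//; lra.
have ac t : 0 <= t <= T -> {ae P, forall w, gint (G k) t w @[k --> \oo] --> M t w}.
  by move=> tT; apply: filterS aegood => w gw; have [C _] := Mgood w gw; exact.
have aM : adapted T F M.
  move=> t tT; have /andP[t0 _] := tT.
  apply: (ae_cvg_mwrt (F_sigma t0) (F_negl t0) _ (ac t tT)) => k.
  by case: (mart2_gint (G k)) => /(_ t tT).
have cvM t : 0 <= t <= T -> sqint P (M t) /\ sq_cvg P (fun k => gint (G k) t) (M t).
  move=> tT; have /andP[t0 _] := tT.
  have mM : measurable_fun setT (M t) := mwrt_measurable (F_meas t0) (aM t tT).
  have key k : sqint P (M t) /\ sqn P (fun w => M t w - gint (G k) t w) <= 8 ^- k / 4.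
    apply: (fatou_sqn (f_ := fun k => gint (G k) t)) => //.
    - by move=> l; exact: sqint_gint.
    - exact: ac.
    - move=> l kl; apply: le_trans (HG k l kl).
      rewrite -(sqn_ext _ (gint_sub (G l) (G k) t)) -(sqn_ext _ (gint_sub (G l) (G k) T)).
      exact: mart2_sqn_le (mart2_gint _) tT.
  split; first by case: (key 0%N).
  apply: (sq_cvg_le (fun k => (key k).2)).
  rewrite -(mul0r (4^-1)); apply: cvgMl.
  under eq_fun do rewrite -exprVn; apply: cvg_expr.
  by rewrite ger0_norm ?invr_ge0// invf_lt1//; lra.
exists M; split=> //.
by apply: (@mart2_lim (fun k => gint (G k))) => // k; exact: mart2_gint.
Qed.

(* [S] plays the predictable sigma-algebra and [D] the indicator of the time
   domain, outside of which nothing is known of the [S]-measurable functions. *)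
Lemma sq_complete (d1 : measure_display) (X : measurableType d1) (mu : {measure set X -> \bar R})
   (S : set (set X)) (f : nat -> X -> R) (D : X -> R) : sigma_algebra setT S ->
  measurable_fun setT D -> (forall x, D x = 0 \/ D x = 1) ->
  (forall g, measurable_wrt S g -> measurable_fun setT (fun x => g x * D x)) ->
  (forall k x, f k x * D x = f k x) ->
  (forall k, measurable_wrt S (f k)) -> (forall k, sqint mu (f k)) ->
  (forall k l, (k <= l)%N -> sqn mu (fun x => f l x - f k x) <= 8 ^- k) ->
  exists g, [/\ measurable_wrt S g, sqint mu (fun x => g x * D x) & sq_cvg mu f (fun x => g x * D x)].
Proof.
move=> sS mD D01 SD fD Sf sf Hf.
(* The upper limit is [S]-measurable whether or not the sequence converges at x. *)
pose g x := fine (limn_esup (fun k => (f k x)%:E)).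
have Sg : measurable_wrt S g.
  apply/(mwrtP sS).
  apply: (measurableT_comp (f := fine)) => //.
  apply: (@measurable_fun_limn_esup _ (g_sigma_algebraType S) R setT (fun k x => (f k x)%:E)) => k.
  by apply/measurable_EFinP; apply/(mwrtP sS).
have mg := SD _ Sg.
have m1 k : measurable_fun setT (fun x => ((f k.+1 x - f k x) ^+ 2)%:E).
  by apply/measurable_EFinP; apply: measurable_funX; apply: measurable_funB; exact: (sf _).1.
have n1 k x : (0 <= ((f k.+1 x - f k x) ^+ 2)%:E)%E by rewrite lee_fin sqr_ge0.
have b1 k : (\int[mu]_x ((f k.+1 x - f k x) ^+ 2)%:E <= (8 ^- k)%:E)%E.
  by rewrite sqnE ?lee_fin ?Hf//; exact: sqintB.
have ac : {ae mu, forall x, f ^~ x @ \oo --> g x * D x}.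
  apply: filterS (ae_geometric_bound m1 n1 b1) => x [C hC].
  have hC' k : `|f k.+1 x - f k x| <= Num.sqrt C * 2 ^- k.
    have := hC k; rewrite lee_fin => h.
    have C0 : 0 <= C.
      by have := le_trans (sqr_ge0 _) h; rewrite pmulr_lge0// invr_gt0 exprn_gt0.
    have p0 : 0 <= Num.sqrt C * 2 ^- k by rewrite mulr_ge0 ?sqrtr_ge0// invr_ge0 exprn_ge0.
    rewrite -[leRHS](ger0_norm p0) -!sqrtr_sqr ler_sqrt ?sqr_ge0//.
    by rewrite exprMn sqr_sqrtr// exprVn -exprM mulnC exprM (_ : 2 ^+ 2 = 4 :> R)//; ring.
  have [cf _] := geometric_steps_cvg hC'.
  have /cvg_ex[l fl] := cf.
  have gl : g x = l.
    have : (EFin \o f ^~ x) @ \oo --> l%:E by apply: cvg_EFin => //; exact: nearW.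
    move=> h; rewrite /g is_cvg_limn_esupE; last by apply/cvg_ex; exists l%:E.
    by rewrite (cvg_lim _ h).
  have [D0|D1] := D01 x.
    rewrite D0 mulr0; have : f ^~ x = fun=> 0.
      by apply/funext => k; rewrite -fD D0 mulr0.
    by move=> ->; exact: cvg_cst.
  by rewrite D1 mulr1 gl.
have key k : sqint mu (fun x => g x * D x) /\ sqn mu (fun x => g x * D x - f k x) <= 8 ^- k.
  by apply: (fatou_sqn (f_ := f)) => // l kl; exact: Hf.
exists g; split=> //; first by case: (key 0%N).
apply: (sq_cvg_le (fun k => (key k).2)).
under eq_fun do rewrite -exprVn; apply: cvg_expr.
by rewrite ger0_norm ?invr_ge0// invf_lt1//; lra.
Qed.

Lemma indic01 (X : Type) (A : set X) (x : X) : (\1_A x : R) = 0 \/ (\1_A x : R) = 1.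
Proof. by rewrite indicE; case: (_ \in _); [right|left]. Qed.

Lemma F2_inl (Q : seq (step T F)) x : F2 (map inl Q) x = 0.
Proof. by rewrite /F2 big_map big1// => a _; rewrite /f2 /box indicE memNset ?mul0r. Qed.

Lemma F1_inr (Q : seq (marked_step T F nu)) x : F1 (map inr Q) x = 0.
Proof. by rewrite /F1 big_map big1. Qed.

Lemma isometry_inl (Q Q' : seq (step T F)) :
  sqn P (fun w => gint (map inl Q) T w - gint (map inl Q') T w) =
  sqn mu1 (fun x => F1 (map inl Q) x - F1 (map inl Q') x).
Proof.
rewrite isometry_dist [X in _ + X](_ : _ = 0) ?addr0// /sqn -[RHS](Ex0 mu2).
by apply: Ex_ext => x; rewrite !F2_inl subrr expr0n.
Qed.

Lemma isometry_inr (Q Q' : seq (marked_step T F nu)) :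
  sqn P (fun w => gint (map inr Q) T w - gint (map inr Q') T w) =
  sqn mu2 (fun x => F2 (map inr Q) x - F2 (map inr Q') x).
Proof.
rewrite isometry_dist [X in X + _](_ : _ = 0) ?add0r// /sqn -[RHS](Ex0 mu1).
by apply: Ex_ext => x; rewrite !F1_inr subrr expr0n.
Qed.

Lemma ito_limit (Q : nat -> seq (step T F)) :
  (forall k l, (k <= l)%N -> sqn mu1 (fun x => F1 (map inl (Q l)) x - F1 (map inl (Q k)) x) <= 8 ^- k / 4) ->
  exists q M, [/\ is_ito_integral P T F B q M, mart2 M &
    sq_cvg P (fun k => gint (map inl (Q k)) T) (M T)].
Proof.
move=> HQ.
have [M [cM mM cvM]] : exists M, [/\ cadlag_adapted T F M, mart2 M &
    forall t, 0 <= t <= T -> sqint P (M t) /\ sq_cvg P (fun k => gint (map inl (Q k)) t) (M t)].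
  by apply: martingale_limit => k l kl; rewrite isometry_inl; exact: HQ.
have [|||||g [Sg sg cg]] := @sq_complete _ _ mu1 pred1 (fun k => F1 (map inl (Q k))) \1_D1 pred1_sigma (measurable_indic mD1) (@indic01 _ D1).
- exact: mwrt_cut1.
- by move=> k x; exact: F1_D1.
- by move=> k; exact: pred_F1.
- by move=> k; exact: sqint_F1.
- move=> k l kl; apply: le_trans (HQ k l kl) _.
  by rewrite ler_pdivrMr// ler_peMr ?invr_ge0 ?exprn_ge0//; lra.
exists (fun t w => g (t, w)), M; split=> //; last by case: (cvM T T_itv).
apply/is_ito_integralP; split=> //.
- apply/predictableP; rewrite (_ : (fun x => _) = g)//.
  by apply/funext => -[].
- by apply: sqint_ext sg => -[t w]; rewrite /cut1.
exists Q; split=> //.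
by rewrite (_ : cut1 _ = fun x => g x * \1_D1 x)//; apply/funext => -[].
Qed.

Lemma poisson_limit (Q : nat -> seq (marked_step T F nu)) :
  (forall k l, (k <= l)%N -> sqn mu2 (fun x => F2 (map inr (Q l)) x - F2 (map inr (Q k)) x) <= 8 ^- k / 4) ->
  exists r M, [/\ is_poisson_integral P T F nu N r M, mart2 M &
    sq_cvg P (fun k => gint (map inr (Q k)) T) (M T)].
Proof.
move=> HQ.
have [M [cM mM cvM]] : exists M, [/\ cadlag_adapted T F M, mart2 M &
    forall t, 0 <= t <= T -> sqint P (M t) /\ sq_cvg P (fun k => gint (map inr (Q k)) t) (M t)].
  by apply: martingale_limit => k l kl; rewrite isometry_inr; exact: HQ.
have [|||||g [Sg sg cg]] := @sq_complete _ _ mu2 pred2 (fun k => F2 (map inr (Q k))) \1_D2 pred2_sigma (measurable_indic mD2) (@indic01 _ D2).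
- exact: mwrt_cut2.
- by move=> k x; exact: F2_D2.
- by move=> k; exact: pred_F2.
- by move=> k; exact: sqint_F2.
- move=> k l kl; apply: le_trans (HQ k l kl) _.
  by rewrite ler_pdivrMr// ler_peMr ?invr_ge0 ?exprn_ge0//; lra.
exists (fun t z w => g (t, z, w)), M; split=> //; last by case: (cvM T T_itv).
apply/is_poisson_integralP; split=> //.
- apply/predictable_markedP; rewrite (_ : (fun x => _) = g)//.
  by apply/funext => -[[]].
- by apply: sqint_ext sg => -[[t z] w]; rewrite /cut2.
exists Q; split=> //.
by rewrite (_ : cut2 _ = fun x => g x * \1_D2 x)//; apply/funext => -[[]].
Qed.

(** By the isometry, the squared distance of two elementary integrals is the sum of those of their
    dB- and dNtilde-integrands, so convergence of the sums makes both parts Cauchy separately. *)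
Theorem representation_limit (Q : nat -> seq (step T F)) (Q' : nat -> seq (marked_step T F nu)) (Y : Omega -> R) :
  sqint P Y -> sq_cvg P (fun k => gint (map inl (Q k) ++ map inr (Q' k)) T) Y ->
  exists q r MB MN, [/\ is_ito_integral P T F B q MB, is_poisson_integral P T F nu N r MN,
     mart2 MB, mart2 MN & {ae P, forall w, Y w = MB T w + MN T w}].
Proof.
move=> sY cY; pose G k : seq elt := map inl (Q k) ++ map inr (Q' k).
have sG k : sqint P (gint (G k) T) by exact: sqint_gint T_itv.
(* The factor 4 produces the bound 8^-k / 4 required by [ito_limit] and [poisson_limit]. *)
pose Dk k l := sqn P (fun w => gint (G k) T w - gint (G l) T w) * 4.
have [||s [s1 s2]] := @cauchy_fast_subseq _ Dk 8^-1; first by rewrite invr_gt0; lra.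
  move=> e e0; have e16 : 0 < e / 16 by lra.
  have /cvgrPdist_le/(_ _ e16)[n0 _ Hn] := cY; exists n0 => k l kn ln.
  have := Hn k kn; have := Hn l ln; rewrite /= !sub0r !normrN !ger0_norm ?sqn_ge0// => h1 h2.
  have h3 := sqn_tri (sG k) sY (sG l); rewrite sqnBC in h2.
  by rewrite /Dk; lra.
have H k l : (k <= l)%N -> sqn P (fun w => gint (G (s l)) T w - gint (G (s k)) T w) <= 8 ^- k / 4.
  move=> kl; rewrite ler_pdivlMr//; have := s2 k (s l) (subseq_le s1 kl) (s k) (leqnn _).
  by rewrite exprVn.
have F1E k x : F1 (G k) x = F1 (map inl (Q k)) x by rewrite F1_cat F1_inr addr0.
have F2E k x : F2 (G k) x = F2 (map inr (Q' k)) x by rewrite F2_cat F2_inl add0r.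
have [q [MB [itoB mB' cB]]] : exists q M, [/\ is_ito_integral P T F B q M, mart2 M &
    sq_cvg P (fun k => gint (map inl (Q (s k))) T) (M T)].
  apply: ito_limit => k l kl; apply: le_trans (H k l kl); rewrite isometry_dist.
  under [X in _ <= X + _]sqn_ext do rewrite !F1E.
  by rewrite lerDl sqn_ge0.
have [r [MN [poiN mN' cN]]] : exists r M, [/\ is_poisson_integral P T F nu N r M, mart2 M &
    sq_cvg P (fun k => gint (map inr (Q' (s k))) T) (M T)].
  apply: poisson_limit => k l kl; apply: le_trans (H k l kl); rewrite isometry_dist.
  under [X in _ <= _ + X]sqn_ext do rewrite !F2E.
  by rewrite lerDr sqn_ge0.
have sB : sqint P (MB T) by case: mB' => _ /(_ T T_itv).
have sN : sqint P (MN T) by case: mN' => _ /(_ T T_itv).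
exists q, r, MB, MN; split=> //.
apply: (@sq_cvg_unique _ _ _ P (fun k => gint (G (s k)) T)) => //.
- exact: sqintD.
- move=> U /cY[N0 _ HN]; exists N0 => // k /= kN; apply: HN => /=.
  exact: leq_trans kN (subseq_ge s1 k).
have -> : (fun k => gint (G (s k)) T) = (fun k w => gint (map inl (Q (s k))) T w + gint (map inr (Q' (s k))) T w).
  by apply/funext => k; apply/funext => w; rewrite /G gint_cat.
by apply: sq_cvgD => // k; exact: sqint_gint T_itv.
Qed.

(** * One step of the representation *)

(** The Gaussian semigroup: phi convolved with the law of the increment, that is, the conditional
    expectation of phi(B_v) given B_u = x. *)
Definition cnv u v (phi : R -> R) (x : R) : R := Ex P (fun w => phi (x + dB u v w)).

Lemma m_shift u v (phi : R -> R) x : measurable_fun setT phi ->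
  measurable_fun setT (fun w => phi (x + dB u v w)).
Proof.
move=> mp; apply: (measurableT_comp mp); apply: measurable_funD => //; exact: m_dB.
Qed.

Lemma intg_shift u v (phi : R -> R) K x : measurable_fun setT phi -> (forall x, `|phi x| <= K) ->
  intg P (fun w => phi (x + dB u v w)).
Proof. by move=> mp b; apply: bounded_intg (m_shift _ _ _ mp) _ => w; exact: b. Qed.

Lemma m_cnv u v (phi : R -> R) K : measurable_fun setT phi -> (forall x, `|phi x| <= K) ->
  measurable_fun setT (cnv u v phi).
Proof.
(* Adding K makes the integrand nonnegative, so that Tonelli gives measurability in x. *)
move=> mp b; pose f (x : X1) := (phi (x.1 + dB u v x.2) + K)%:E.
have mf : measurable_fun setT f.
  apply/measurable_EFinP; apply: measurable_funD => //; apply: (measurableT_comp mp).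
  apply: measurable_funD; first exact: measurable_fst.
  by apply: measurableT_comp; [exact: m_dB|exact: measurable_snd].
have f0 x : (0 <= f x)%E.
  by rewrite lee_fin; have := b (x.1 + dB u v x.2); rewrite ler_norml => /andP[]; lra.
have H := @measurable_fun_fubini_tonelli_F _ _ _ _ R P _ mf f0.
have -> : cnv u v phi = fun x => fine (fubini_F P f x) - K.
  apply/funext => x; rewrite /cnv /fubini_F /f/=.
  have i1 := @intg_shift u v _ _ x mp b.
  rewrite (_ : fine _ = Ex P (fun w => phi (x + dB u v w) + K))//.
  by rewrite ExD ?Ex_cst ?addrK//; exact: intg_cst.
by apply: measurable_funB => //; exact: measurableT_comp.
Qed.

Lemma cnv_bound u v (phi : R -> R) K x : measurable_fun setT phi -> (forall x, `|phi x| <= K) ->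
  `|cnv u v phi x| <= K.
Proof. by move=> mp b; apply: Ex_bound; [exact: intg_shift mp b|move=> w; exact: b]. Qed.

(** All bounds of the class are averages of pointwise bounds, so K is unchanged, which allows
    arbitrarily many substeps. The factor p will be the probability of a void event. *)
Lemma Sfun_cnv u v p K (phi dphi : R -> R) : 0 <= p <= 1 -> Sfun K phi dphi ->
  Sfun K (fun x => p * cnv u v phi x) (fun x => p * cnv u v dphi x).
Proof.
move=> /andP[p0 p1] S; have K0 := Sfun_ge0 S; case: S => m1 m2 b db H.
have pb (y : R) : `|y| <= K -> `|p * y| <= K.
  by move=> h; rewrite normrM (ger0_norm p0) (le_trans _ h)// ler_piMl.
split.
- by apply: measurable_funM => //; exact: m_cnv b.
- by apply: measurable_funM => //; exact: m_cnv db.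
- by move=> x; apply: pb; exact: cnv_bound.
- by move=> x; apply: pb; exact: cnv_bound.
move=> x y.
have -> : p * cnv u v phi (x + y) - p * cnv u v phi x - p * cnv u v dphi x * y =
  p * (cnv u v phi (x + y) - cnv u v phi x - y * cnv u v dphi x) by ring.
have i1 := intg_shift u v (x + y) m1 b; have i2 := intg_shift u v x m1 b.
have i3 := intg_shift u v x m2 db.
rewrite normrM (ger0_norm p0); apply: (le_trans (ler_piMl (normr_ge0 _) p1)).
rewrite /cnv -(ExZ y i3) -(ExB i1 i2) -ExB; [|exact: intgB|exact: intgZ].
apply: Ex_bound; first by apply: intgB; [exact: intgB|exact: intgZ].
move=> w; have := H (x + dB u v w) y.
by rewrite (_ : x + dB u v w + y = x + y + dB u v w) 1?(mulrC _ y)//; ring.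
Qed.

Lemma B_adapted u : 0 <= u <= T -> measurable_wrt (F u) (B u).
Proof. by move=> uT; exact: (Z_adapted (i := None)). Qed.

(** B_v is B_u plus an increment independent of the pair (H, B_u), which can therefore be held fixed
    while the increment is averaged. *)
Lemma freeze u v K (phi dphi : R -> R) (H : Omega -> R) : 0 <= u -> u < v -> v <= T ->
  Sfun K phi dphi -> measurable_wrt (F u) H -> intg P H ->
  Ex P (fun w => H w * phi (B v w)) = Ex P (fun w => H w * cnv u v phi (B u w)).
Proof.
move=> u0 uv vT [mp _ b _ _] FH iH; have mH := intg_meas iH.
have uT : 0 <= u <= T by rewrite u0 (le_trans (ltW uv)).
have FB := B_adapted uT.
have mU : measurable_fun setT (fun w => (H w, B u w)) by exact: measurable_fun_pair.
pose U : {mfun Omega >-> (R * R)%type} := mfun_Sub (mem_set mU).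
pose V : {mfun Omega >-> R} := mfun_Sub (mem_set (m_dB u v)).
have ind : indep_maps P U V.
  move=> A C mA mC; apply: (F_indep_dB u0 uv).
    have sF := F_sigma u0.
    have mG : measurable_fun (setT : set (g_sigma_algebraType (F u))) (fun w => (H w, B u w)).
      by apply: measurable_fun_pair; exact/mwrtP.
    by have := mG measurableT A mA; rewrite setTI mwrt_id.
  by exists C => //; rewrite setTI.
pose g (z : (R * R) * R) := z.1.1 * phi (z.1.2 + z.2).
have mg : measurable_fun setT g.
  apply: measurable_funM; first by apply: measurableT_comp => //; exact: measurable_fst.
  apply: (measurableT_comp mp); apply: measurable_funD => //.
  by apply: measurableT_comp => //; exact: measurable_snd.
have BE w : B v w = B u w + dB u v w by rewrite /dB addrC subrK.
have K0 : 0 <= K := le_trans (normr_ge0 _) (b 0).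
have i1 : intg P (fun w => g (U w, V w)).
  apply: (intg_dom (g := fun w => K * `|H w|)).
  - exact: (measurableT_comp mg (measurable_fun_pair mU (m_dB u v))).
  - by apply: intgZ; exact: integrable_norm iH.
  - by move=> w; rewrite /g normrM mulrC ler_wpM2r.
have i2 w : intg P (fun y => g (U w, V y)).
  by apply: intgZ; exact: intg_shift b.
have [_ E] := joint_law_Ex ind mg i1 i2.
rewrite (@Ex_ext _ _ _ _ _ (fun w => g (U w, V w))); last by move=> w; rewrite BE.
rewrite E; apply: Ex_ext => w; rewrite /g/= ExZ//.
exact: intg_shift b.
Qed.

(* The constant in the O(h^2) bound of the squared one-step remainder. *)
Definition osc K (C : set (measurableTypeR R)) : R :=
  let l := fine (nu C) in
  2 * (K ^+ 2 * (32 * Num.sqrt 2)) + 4 * (K ^+ 2 * l ^+ 2) + 4 * (4 * K ^+ 2 * (l + l ^+ 2)).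

Lemma box_void_F C u v : goodmark (Some C) -> 0 <= u -> v <= T -> 0 <= v ->
  F v (void (`]u, v]%classic `*` C)).
Proof.
move=> [mC CR Coo] u0 vT v0; rewrite FE// /augmented_filtration.
apply: sub_sigma_algebra; left; right; apply: sub_sigma_algebra.
exists (`]u, v]%classic `*` C).
  rewrite min_l//; split; first exact: measurableX.
  move=> [x y] [/= + /CR]; rewrite !in_itv/= => /andP[ux ->] Ry.
  by rewrite (le_trans u0 (ltW ux)).
exists [set 0%E]; first exact: emeasurable_set1.
by rewrite setTI.
Qed.

Lemma box_void_after C u v : goodmark (Some C) -> 0 <= u -> v <= T ->
  after u (void (`]u, v]%classic `*` C)).
Proof.
move=> gC u0 vT; apply: sub_sigma_algebra; apply: vclass_void; first by right.
exact: jumps_after_box.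
Qed.

Lemma indic_bound (X : Type) (A : set X) (x : X) : `|(\1_A x : R)| <= 1.
Proof. by rewrite indicE; case: (_ \in _); rewrite ?normr1 ?normr0. Qed.

Lemma sqn_ae_bound (X Y : Omega -> R) : measurable_fun setT X -> intg P Y ->
  {ae P, forall w, X w ^+ 2 <= Y w} -> sqint P X /\ sqn P X <= Ex P Y.
Proof.
move=> mX iY XY; have mY := intg_meas iY.
have iY' : intg P (fun w => `|Y w|) by exact: (integrable_norm iY).
have I1 : (\int[P]_w (X w ^+ 2)%:E <= \int[P]_w `|Y w|%:E)%E.
  apply: ae_ge0_le_integral => //.
  - by move=> w _; rewrite lee_fin sqr_ge0.
  - by apply/measurable_EFinP; exact: measurable_funX.
  - by apply/measurable_EFinP; exact: intg_meas iY'.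
  - by apply: filterS XY => w h _; rewrite lee_fin (le_trans h)// ler_norm.
have E1 : Ex P Y = Ex P (fun w => `|Y w|).
  apply: Ex_ae => //; first exact: intg_meas iY'.
  by apply: filterS XY => w h; rewrite ger0_norm// (le_trans _ h)// sqr_ge0.
have sX : sqint P X by split=> //; apply: le_lt_trans I1 _; rewrite ExE// ltry.
by split=> //; rewrite E1 -lee_fin -sqnE// -ExE.
Qed.

Section one_step.
Variables (C : set (measurableTypeR R)) (u v K : R) (phi dphi : R -> R).
Hypotheses (gC : goodmark (Some C)) (u0 : 0 <= u) (uv : u < v) (vT : v <= T).
Hypothesis S : Sfun K phi dphi.

Let D : set RR := `]u, v]%classic `*` C.
Let I := \1_(void D) : Omega -> R.
Let p := Ex P I.
Let phi' x := p * cnv u v phi x.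
(* What remains of phi(B_v) 1_{no jump in ]u,v] x C} after subtracting its
   conditional expectation given F_u and the first-order dB- and dNtilde-terms. *)
Definition step_err w := phi (B v w) * \1_(void (`]u, v]%classic `*` C)) w - Ex P \1_(void (`]u, v]%classic `*` C)) * cnv u v phi (B u w)
   - (dphi (B u w) * dZ None u v w + - phi (B u w) * dZ (Some C) u v w).
Let V := step_err.

Let v0 : 0 <= v. Proof. exact: le_trans u0 (ltW uv). Qed.
Let uT : 0 <= u <= T. Proof. by rewrite u0 (le_trans (ltW uv)). Qed.
Let vT' : 0 <= v <= T. Proof. by rewrite v0. Qed.
Let fb : int_fin D. Proof. by case: gC => *; exact: int_fin_box. Qed.
Let mD : measurable D. Proof. by case: fb => -[]. Qed.
Let mI : measurable_fun setT I. Proof. by apply: measurable_indic; exact: mvoid. Qed.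
Let Ib w : `|I w| <= 1. Proof. exact: indic_bound. Qed.
Let p01 : 0 <= p <= 1.
Proof.
rewrite /p Ex_ge0 => [|w]; last by rewrite /I indicE.
rewrite -(Ex_cst P 1); apply: Ex_le; [exact: bounded_intg mI Ib|exact: intg_cst|].
by move=> w; exact: le_trans (ler_norm _) (Ib w).
Qed.
Let S' : Sfun K phi' (fun x => p * cnv u v dphi x). Proof. exact: Sfun_cnv. Qed.
Let wB (h : R -> R) : measurable_fun setT h -> measurable_wrt (F u) (fun w => h (B u w)).
Proof. by move=> mh; apply: (mwrt_comp (F_sigma u0) mh); exact: B_adapted. Qed.
Let wBv (h : R -> R) : measurable_fun setT h -> measurable_wrt (F v) (fun w => h (B v w)).
Proof. by move=> mh; apply: (mwrt_comp (F_sigma v0) mh); exact: B_adapted. Qed.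
Let mBu (h : R -> R) : measurable_fun setT h -> measurable_fun setT (fun w => h (B u w)).
Proof. by move=> mh; exact: measurableT_comp mh (mB u). Qed.

Lemma step_err_wrt : measurable_wrt (F v) V.
Proof.
have sF := F_sigma v0; case: (S) => m1 m2 _ _ _; case: (S') => m1' _ _ _ _.
have up (h : R -> R) : measurable_fun setT h -> measurable_wrt (F v) (fun w => h (B u w)).
  by move=> mh; apply: (mwrt_mono u0 (ltW uv)); exact: wB.
have dd i : goodmark i -> measurable_wrt (F v) (dZ i u v).
  by move=> gi; apply: dZ_wrt => //; exact: ltW.
apply: mwrtB => //; first (apply: mwrtB => //; last exact: up m1').
  apply: mwrtM => //; first exact: wBv.
  by apply: mwrt_indic => //; exact: box_void_F.
apply: mwrtD => //; apply: mwrtM => //; [exact: up|exact: dd| |exact: dd].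
by apply: (up (fun x => - phi x)); exact: measurable_funN.
Qed.

Lemma sqint_step_err : sqint P V.
Proof.
case: (S) => m1 m2 b db _; case: (S') => m1' _ b' _ _.
have uv' := ltW uv.
apply: sqintB.
  apply: sqintB.
    apply: (bounded_sqint P (c := K * 1)).
      by apply: measurable_funM => //; exact: measurableT_comp.
    by move=> w; rewrite normrM ler_pM.
  by apply: (bounded_sqint P (c := K)); [exact: mBu m1'|move=> w; exact: b'].
apply: sqintD.
  by apply: (sqintMb (sqint_dZ (i := None) _ u0 uv' vT) (mBu m2)) => // w; exact: db.
apply: (sqintMb (sqint_dZ gC u0 uv' vT) (c := K)).
  by apply: measurable_funN; exact: mBu.
by move=> w; rewrite normrN.
Qed.

(** The void event splits off because H phi(B_v) is known to [fullpast u], and [freeze] then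
    averages phi(B_v); this matches the subtracted conditional expectation. The dB- and
    dNtilde-terms are martingale increments. *)
Lemma step_err_orth (H : Omega -> R) : measurable_wrt (F u) H -> sqint P H ->
  Ex P (fun w => H w * V w) = 0.
Proof.
move=> FH sH; case: (S) => m1 m2 b db _; case: (S') => m1' _ b' _ _.
have uv' := ltW uv; have sF := F_sigma u0.
have iH := sqint_intg sH; have mH := sH.1.
have bd (h : R -> R) : measurable_fun setT h -> (forall x, `|h x| <= K) ->
    measurable_wrt (F u) (fun w => H w * h (B u w)) /\ intg P (fun w => H w * h (B u w)).
  move=> mh hb; split; first by apply: mwrtM => //; exact: wB.
  apply: sqint_intg; apply: sqint_ext (sqintMb sH (mBu mh) (fun w => hb (B u w))) => w.
  by rewrite mulrC.
have [w1 i1] := bd _ m2 db; have [w2 i2] := bd (fun x => - phi x) (measurable_funN m1) (fun x => eq_ind_r (fun y => y <= K) (b x) (normrN (phi x))).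
have [w3 i3] := bd _ m1' b'.
have [j1 e1] := martingale_dZ (i := None) Logic.I u0 uv' vT w1 i1.
have [j2 e2] := martingale_dZ gC u0 uv' vT w2 i2.
have i4 : intg P (fun w => H w * phi (B v w)).
  apply: sqint_intg; apply: sqint_ext (sqintMb sH (measurableT_comp m1 (mB v)) (fun w => b (B v w))) => w.
  by rewrite mulrC.
have ind : indep_maps P (fun w => H w * phi (B v w)) I.
  apply: (indep_wrt (fullpast_indep u0)).
    apply: mwrtM; first exact: fullpast_sigma.
      exact: mwrt_sub (F_fullpast u0) FH.
    apply: (mwrt_sub (@sigB_fullpast u)); apply: (mwrt_comp sigB_sigma m1).
    by apply: B_wrt; rewrite /= in_itv/= v0.
  by apply: mwrt_indic; [exact: after_sigma|exact: box_void_after].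
have [i5 e5] := Ex_indep ind i4 (bounded_intg P mI Ib).
rewrite (@Ex_ext _ _ _ _ _ (fun w => (H w * phi (B v w) * I w - H w * phi' (B u w)) -
    (H w * dphi (B u w) * dZ None u v w + H w * - phi (B u w) * dZ (Some C) u v w))); last first.
  by move=> w; rewrite /V /step_err -/D -/I -/p /phi'; ring.
rewrite ExB; [|exact: intgB|exact: intgD].
rewrite ExB// ExD// e1 e2 e5 addr0 subr0 (freeze u0 uv vT S FH iH) -/p.
rewrite (@Ex_ext _ _ _ P (fun w => H w * phi' (B u w)) (fun w => p * (H w * cnv u v phi (B u w)))); last first.
  by move=> w; rewrite /phi'; ring.
rewrite ExZ; first by ring.
have mc := m_cnv u v m1 b.
apply: sqint_intg; apply: sqint_ext (sqintMb sH (mBu mc) (fun w => cnv_bound u v (B u w) m1 b)) => w.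
by rewrite mulrC.
Qed.

(** [V] is orthogonal to the past, so adding a function of B_u can only increase its norm. A
    suitable one removes the conditional expectation and leaves explicit terms of second order. *)
Lemma step_err_sqn : v - u <= 1 -> sqn P V <= osc K C * (v - u) ^+ 2.
Proof.
move=> h1; case: (S) => m1 m2 b db R2; case: (S') => m1' _ b' _ _.
have uv' := ltW uv; have sF := F_sigma u0; have sV := sqint_step_err.
set h := v - u in h1 *; have h0 : 0 <= h by rewrite subr_ge0.
pose l := fine (nu C); have l0 : 0 <= l by exact: fine_ge0.
have lE : intens D = h * l by case: gC => *; rewrite intens_box.
(* Chosen to cancel the conditional expectation and the compensator and to subtract phi(B_u). *)
pose m0 w := phi' (B u w) - phi (B u w) + phi (B u w) * (h * l).
have m0E : m0 = fun w => (fun x => phi' x - phi x + phi x * (h * l)) (B u w) by [].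
have mm0 : measurable_fun setT (fun x => phi' x - phi x + phi x * (h * l)).
  by apply: measurable_funD; [exact: measurable_funB|exact: measurable_funM].
have Fm0 : measurable_wrt (F u) m0 by rewrite m0E; exact: (wB mm0).
have sm0 : sqint P m0.
  apply: (bounded_sqint P (c := K + K + K * (h * l))); first exact: mBu mm0.
  have hl : `|h * l| = h * l by rewrite ger0_norm// mulr_ge0.
  move=> w; apply: (le_trans (ler_normD _ _)); rewrite normrM hl lerD//.
    by apply: (le_trans (ler_normB _ _)); exact: lerD.
  by rewrite ler_wpM2r// mulr_ge0.
have VW : sqn P V <= sqn P (fun w => V w + m0 w).
  rewrite (sqnD sV sm0) [X in 2 * X](_ : _ = 0).
    by rewrite mulr0 addr0 lerDl sqn_ge0.
  by rewrite -(step_err_orth Fm0 sm0); apply: Ex_ext => w; rewrite mulrC.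
apply: (le_trans VW).
pose n := cnt D.
(* [A1] is a Taylor remainder, of mean square O(h^2) by the fourth moment. [A2] is almost surely
   phi(B_v) times the positive part of n - 1, whose square is at most n (n - 1), of mean (h l)^2.
   [A3] is dominated by a Brownian increment times an independent count, whose squares both have
   means of order h. *)
pose A1 w := phi (B v w) - phi (B u w) - dphi (B u w) * dB u v w.
pose A2 w := phi (B v w) * (I w - 1 + n w).
pose A3 w := (phi (B v w) - phi (B u w)) * n w.
have BE w : B v w = B u w + dB u v w by rewrite /dB addrC subrK.
have aeW : {ae P, forall w, V w + m0 w = A1 w + (A2 w - A3 w)}.
  apply: filterS (dZ_cmp gC u0 uv' vT) => w e; rewrite /V /step_err -/D -/I -/p e.
  rewrite /m0 /phi' /A1 /A2 /A3 /cmp -/D -/n lE /dZ /= -/(dB u v w); ring.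
have mn : measurable_fun setT n by exact: m_cnt.
have mphiv : measurable_fun setT (fun w => phi (B v w)) by exact: measurableT_comp.
have mphiu : measurable_fun setT (fun w => phi (B u w)) by exact: mBu.
have mA1 : measurable_fun setT A1.
  apply: measurable_funB; first exact: measurable_funB.
  by apply: measurable_funM; [exact: mBu|exact: m_dB].
have mA2 : measurable_fun setT A2.
  by apply: measurable_funM => //; apply: measurable_funD => //; exact: measurable_funB.
have mA3 : measurable_fun setT A3.
  by apply: measurable_funM => //; exact: measurable_funB.
have [i4 e4] := dB_moment4 u0 uv.
have [sB eB] := sqint_dB u0 uv.
have K0 := Sfun_ge0 S.
have bound := sqn_ae_bound.
have [i1 e1] := intg_cnt fb; have [i2 e2] := intg_cnt2 fb.
have [s1 q1] : sqint P A1 /\ sqn P A1 <= K ^+ 2 * (32 * Num.sqrt 2 * h ^+ 2).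
  have [|s q] := bound A1 (fun w => K ^+ 2 * dB u v w ^+ 4) mA1 (intgZ _ i4).
    apply: filterE => w; rewrite /A1 BE; have := R2 (B u w) (dB u v w); set z := _ - _ - _ => hz.
    rewrite (_ : 4 = 2 * 2)%N// exprM -exprMn -(real_normK (num_real z)).
    by rewrite lerXn2r ?nnegrE// mulr_ge0// sqr_ge0.
  by split=> //; apply: (le_trans q); rewrite ExZ// ler_wpM2l// sqr_ge0.
have [s2 q2] : sqint P A2 /\ sqn P A2 <= K ^+ 2 * (h * l) ^+ 2.
  have [|s q] := bound A2 (fun w => K ^+ 2 * (cnt D w * (cnt D w - 1))) mA2 (intgZ _ i2).
    apply: filterS (cnt_ae_nat fb) => w [k [Nk nk]].
    have K2 : phi (B v w) ^+ 2 <= K ^+ 2.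
      by rewrite -(real_normK (num_real (phi _))) lerXn2r ?nnegrE.
    rewrite /A2 exprMn /n nk /I indicE; case: k Nk nk => [|k] Nk nk.
      by rewrite mem_set// subrr addr0 expr0n mulr0 mul0r mulr0.
    rewrite memNset/=; last by rewrite /void/= Nk => /eqP; rewrite eqe pnatr_eq0.
    rewrite sub0r -natr1 addrK [-1 + _]addrC addrK.
    have k0 : 0 <= k%:R :> R by [].
    apply: ler_pM => //; rewrite ?sqr_ge0// expr2; nra.
  by split=> //; apply: (le_trans q); rewrite ExZ// e2 -lE.
have iBn : intg P (fun w => dB u v w ^+ 2 * n w ^+ 2) /\
    Ex P (fun w => dB u v w ^+ 2 * n w ^+ 2) = h * ((h * l) ^+ 2 + h * l).
  have sn : intg P (fun w => n w ^+ 2) /\ Ex P (fun w => n w ^+ 2) = (h * l) ^+ 2 + h * l.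
    have nE w : n w ^+ 2 = cnt D w * (cnt D w - 1) + cnt D w by rewrite /n; ring.
    split; first by apply: intg_ext (intgD i2 i1) => w; rewrite nE.
    by rewrite (Ex_ext P nE) ExD// e1 e2 lE.
  have ind : indep_maps P (fun w => dB u v w ^+ 2) (fun w => n w ^+ 2).
    have m2' : measurable_fun setT (fun x : R => x ^+ 2) by exact: measurable_funX.
    apply: (indep_wrt (fullpast_indep u0)).
      apply: (mwrt_comp (fullpast_sigma u) m2').
      by apply: mwrt_sub (@sigB_fullpast u) _; exact: dB_wrt.
    apply: (mwrt_comp (after_sigma u) m2').
    by apply: after_cnt; exact: jumps_after_box.
  have [ii ee] := Ex_indep ind ((sqintP P _).1 sB).2 sn.1.
  by split=> //; rewrite ee sn.2 -/(sqn P (dB u v)) eB.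
have [s3 q3] : sqint P A3 /\ sqn P A3 <= 4 * K ^+ 2 * (h * ((h * l) ^+ 2 + h * l)).
  have [|s q] := bound A3 (fun w => 4 * K ^+ 2 * (dB u v w ^+ 2 * n w ^+ 2)) mA3 (intgZ _ iBn.1).
    apply: filterE => w; rewrite /A3 BE exprMn mulrA ler_wpM2r ?sqr_ge0//.
    have := Sfun_lip (B u w) (dB u v w) S; set z := _ - _ => hz.
    rewrite -(real_normK (num_real z)) -(real_normK (num_real (dB u v w))).
    have -> : 4 * K ^+ 2 * `|dB u v w| ^+ 2 = (2 * K * `|dB u v w|) ^+ 2 by ring.
    by rewrite lerXn2r ?nnegrE// !mulr_ge0.
  by split=> //; apply: (le_trans q); rewrite ExZ ?iBn.2//; case: iBn.
have s23 := sqintB s2 s3.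
rewrite /sqn (@Ex_ae _ _ _ P _ (fun w => (A1 w + (A2 w - A3 w)) ^+ 2)); last 3 first.
- by apply: measurable_funX; exact: (sqintD sV sm0).1.
- by apply: measurable_funX; exact: (sqintD s1 s23).1.
- by apply: filterS aeW => w ->.
rewrite -/(sqn P _); apply: (le_trans (sqn_leD s1 s23)); have := sqn_leB s2 s3.
have hl : h * ((h * l) ^+ 2 + h * l) <= h ^+ 2 * (l + l ^+ 2).
  have : h ^+ 2 * (h * l ^+ 2) <= h ^+ 2 * l ^+ 2 by rewrite ler_wpM2l ?sqr_ge0// ler_piMl ?sqr_ge0.
  by lra.
have : 4 * K ^+ 2 * (h * ((h * l) ^+ 2 + h * l)) <= 4 * K ^+ 2 * (h ^+ 2 * (l + l ^+ 2)).
  by rewrite ler_wpM2l// mulr_ge0// sqr_ge0.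
rewrite /osc -/l => a1 a2.
have -> : (2 * (K ^+ 2 * (32 * Num.sqrt 2)) + 4 * (K ^+ 2 * l ^+ 2) + 4 * (4 * K ^+ 2 * (l + l ^+ 2))) * h ^+ 2 =
  2 * (K ^+ 2 * (32 * Num.sqrt 2 * h ^+ 2)) + 4 * (K ^+ 2 * (h * l) ^+ 2) + 4 * (4 * K ^+ 2 * (h ^+ 2 * (l + l ^+ 2))) by ring.
lra.
Qed.

End one_step.

(** * Representable random variables *)

Lemma gint_cons a G t w : gint (a :: G) t w = ev a t w + gint G t w.
Proof. by rewrite /gint big_cons. Qed.

Lemma mul_elt a (xi : Omega -> R) c : measurable_wrt (F (lo a)) xi ->
  (forall w, `|xi w| <= c) ->
  exists a', lo a' = lo a /\ forall t w, ev a' t w = xi w * ev a t w.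
Proof.
move=> Fxi xc; have [c' hc'] := hgt_bound a.
have Fh : measurable_wrt (F (lo a)) (fun w => xi w * hgt a w).
  by apply: mwrtM; [exact: F_sigma (lo_ge0 a)|exact: Fxi|exact: hgt_wrt].
have bh : exists K, forall w, `|xi w * hgt a w| <= K.
  by exists (c * c') => w; rewrite normrM ler_pM.
case: a Fxi Fh bh {hc'} => [a|b] Fxi Fh bh.
  exists (inl (@Step R d Omega T F (step_lo a) (step_hi a) _ (lo_ge0 (inl a)) (lo_le_hi (inl a))
    (hi_leT (inl a)) Fh bh)); split=> // t w; by rewrite /ev /= mulrA.
exists (inr (@MarkedStep R d Omega T F nu (@Step R d Omega T F (step_lo b) (step_hi b) _
    (lo_ge0 (inr b)) (lo_le_hi (inr b)) (hi_leT (inr b)) Fh bh)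
  (step_marks b) (@step_marks_measurable _ _ _ _ _ _ b)
  (@step_marks_nz _ _ _ _ _ _ b) (step_marks_finite b))); split=> // t w.
by rewrite /ev /= mulrA.
Qed.

(** A bounded factor known at time r moves into the heights of integrands that start after r; this
    is why lower bounds on left ends are recorded in the representations below. *)
Lemma mul_gint G r (xi : Omega -> R) c : 0 <= r -> measurable_wrt (F r) xi ->
  (forall w, `|xi w| <= c) -> all (fun a => r <= lo a) G ->
  exists G', all (fun a => r <= lo a) G' /\ forall t w, gint G' t w = xi w * gint G t w.
Proof.
move=> r0 Fxi xc; elim: G => [_|a G ih /= /andP[ra /ih[G' [G'r G'E]]]].
  by exists [::]; split=> // t w; rewrite /gint !big_nil mulr0.
have [a' [la' a'E]] := mul_elt (mwrt_mono r0 ra Fxi) xc.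
exists (a' :: G'); split; first by rewrite /= la' ra.
by move=> t w; rewrite !gint_cons G'E a'E mulrDr.
Qed.

Lemma elt_exists i s t (H : Omega -> R) c : goodmark i -> 0 <= s -> s <= t -> t <= T ->
  measurable_wrt (F s) H -> (forall w, `|H w| <= c) ->
  exists a, lo a = s /\ forall w, ev a T w = H w * dZ i s t w.
Proof.
move=> gi s0 st tT FH Hc.
pose b : step T F := @Step R d Omega T F s t H s0 st tT FH (ex_intro _ c Hc).
case: i gi => [C|] gi.
  case: gi => mC CR Coo.
  by exists (inr (@MarkedStep R d Omega T F nu b C mC CR Coo)); split=> // w; rewrite ev_T.
by exists (inl b); split=> // w; rewrite ev_T.
Qed.

Lemma voidE C a b c : measurable C -> a <= b -> b <= c ->
  void (`]a, c]%classic `*` C) = void (`]a, b]%classic `*` C) `&` void (`]b, c]%classic `*` C).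
Proof. by move=> mC ab bc; rewrite (box_split _ ab bc) voidU//; exact: measurableX. Qed.

(* The remainders of the successive steps are orthogonal, so j of them add up to
   O(j h^2) = O(h) in mean square. *)
Lemma interval_steps C K t h (phi dphi : R -> R) : goodmark (Some C) -> t <= T -> 0 < h -> h <= 1 ->
  Sfun K phi dphi -> forall j : nat, 0 <= t - j%:R * h ->
  exists phi' dphi' G e, [/\ Sfun K phi' dphi', all (fun a => t - j%:R * h <= lo a) G,
    sqint P e /\ sqn P e <= j%:R * osc K C * h ^+ 2,
    forall H, measurable_wrt (F (t - j%:R * h)) H -> sqint P H -> Ex P (fun w => H w * e w) = 0 &
    forall w, phi (B t w) * \1_(void (`]t - j%:R * h, t]%classic `*` C)) w =
      phi' (B (t - j%:R * h) w) + gint G T w + e w].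
Proof.
move=> gC tT h0 h1 S; have mC : measurable C by case: gC.
elim=> [|j ih] tj0.
  exists phi, dphi, [::], (fun=> 0); split=> //.
  - by split; [exact: sqint0|rewrite mul0r mul0r /sqn -[leRHS](Ex0 P) le_eqVlt; apply/orP; left; apply/eqP; apply: Ex_ext => w; rewrite expr0n].
  - by move=> H _ _; rewrite -[RHS](Ex0 P); apply: Ex_ext => w; rewrite mulr0.
  - move=> w; rewrite mul0r subr0 set_itv_ge; last by rewrite bnd_simp ltxx.
    rewrite set0X /void (_ : [set _ | _] = setT); last first.
      by apply/seteqP; split=> // x _ /=; rewrite measure0.
    by rewrite indicE in_setT mulr1 /gint big_nil !addr0.
set r' := t - j.+1%:R * h in tj0 *; set r := t - j%:R * h in ih.
have rr : r - r' = h by rewrite /r /r' -natr1; ring.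
have r'r : r' < r by rewrite -subr_gt0 rr.
have r0 : 0 <= r := le_trans tj0 (ltW r'r).
have rt : r <= t by rewrite /r gerBl mulr_ge0// ltW.
have rT := le_trans rt tT.
have [phi' [dphi' [G [e [S' Gr [se qe] oe E]]]]] := ih r0.
pose xi := \1_(void (`]r', r]%classic `*` C)) : Omega -> R.
have Fxi : measurable_wrt (F r) xi by apply: mwrt_indic; [exact: F_sigma|exact: box_void_F].
have mxi : measurable_fun setT xi by apply: mwrt_measurable Fxi; exact: F_meas.
have xb w : `|xi w| <= 1 by exact: indic_bound.
have [G' [G'r G'E]] := mul_gint r0 Fxi xb Gr.
have := step_err_wrt gC tj0 r'r rT S'; have := sqint_step_err gC tj0 r'r rT S'.
have := step_err_orth gC tj0 r'r rT S'; have := step_err_sqn gC tj0 r'r rT S'.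
set V := step_err _ _ _ _ _; rewrite rr => /(_ h1) qV oV sV FV.
have p01 : 0 <= Ex P xi <= 1.
  rewrite Ex_ge0 => [|w]; last by rewrite /xi indicE.
  rewrite -(Ex_cst P 1); apply: Ex_le; [exact: bounded_intg mxi xb|exact: intg_cst|].
  by move=> w; exact: le_trans (ler_norm _) (xb w).
have r'T : 0 <= r' <= T by rewrite tj0 (le_trans (ltW r'r)).
have [m1 m2 b db _] := S'.
have F1r : measurable_wrt (F r') (fun w => dphi' (B r' w)).
  by apply: (mwrt_comp (F_sigma tj0) m2); exact: B_adapted.
have F2r : measurable_wrt (F r') (fun w => - phi' (B r' w)).
  by apply: (mwrt_comp (F_sigma tj0) (measurable_funN m1)); exact: B_adapted.
have [a1 [l1 E1]] := elt_exists (i := None) Logic.I tj0 (ltW r'r) rT F1r (fun w => db _).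
have nb w : `|- phi' (B r' w)| <= K by rewrite normrN.
have [a2 [l2 E2]] := elt_exists gC tj0 (ltW r'r) rT F2r nb.
have sxe : sqint P (fun w => xi w * e w) := sqintMb se mxi xb.
(* The previous decomposition is multiplied by the void indicator [xi] of the new slice: its
   function term is expanded by one step, its integral absorbs [xi], and its error becomes
   [xi * e]. *)
exists (fun x => Ex P xi * cnv r' r phi' x), (fun x => Ex P xi * cnv r' r dphi' x), (a1 :: a2 :: G'), (fun w => V w + xi w * e w); split.
- exact: Sfun_cnv.
- rewrite /= l1 l2 lexx/=; apply: sub_all G'r => a; exact: le_trans (ltW r'r).
- split; first exact: sqintD.
  rewrite (sqnD sV sxe) [X in 2 * X](_ : _ = 0).
    rewrite mulr0 addr0 -natr1 mulrDl mulrDl mul1r addrC lerD//.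
    apply: le_trans qe; apply: sqn_le => // w; rewrite normrM ler_piMl//.
  (* [V] and [xi] are known at time r while e is orthogonal to the past of r, so the two errors are
     orthogonal and their squared norms add. *)
  rewrite -(oe (fun w => V w * xi w)).
  + by apply: Ex_ext => w; rewrite mulrA.
  + by apply: mwrtM => //; exact: F_sigma.
  + by apply: sqint_ext (sqintMb sV mxi xb) => w; rewrite mulrC.
- move=> H FH sH; rewrite (@Ex_ext _ _ _ P _ (fun w => H w * V w + H w * (xi w * e w))); last first.
    by move=> w; rewrite mulrDr.
  rewrite ExD; [|exact: sqintM|exact: sqintM]; rewrite (oV H FH sH) add0r.
  rewrite -(oe (fun w => xi w * H w)).
  + by apply: Ex_ext => w; ring.
  + by apply: mwrtM; [exact: F_sigma|exact: Fxi|exact: mwrt_mono (ltW r'r) FH].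
  + exact: sqintMb sH mxi xb.
- move=> w; rewrite (@voidE C r' r t)//; last exact: ltW.
  rewrite indicI/= -/xi mulrA [_ * xi w]mulrC -mulrA E.
  rewrite !gint_cons G'E E1 E2 /V /step_err -/xi; ring.
Qed.

Lemma interval_rep C K s t (phi dphi : R -> R) eps : goodmark (Some C) -> 0 <= s -> s < t -> t <= T ->
  Sfun K phi dphi -> 0 < eps ->
  exists phi' dphi' G, [/\ Sfun K phi' dphi', all (fun a => s <= lo a) G &
    sqn P (fun w => phi (B t w) * \1_(void (`]s, t]%classic `*` C)) w - phi' (B s w) - gint G T w) <= eps].
Proof.
move=> gC s0 st tT S e0; have d0 : 0 < t - s by rewrite subr_gt0.
have o0 : 0 <= osc K C.
  rewrite /osc; have l0 : 0 <= fine (nu C) by exact: fine_ge0.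
  set l := fine _ in l0 *; have k2 := sqr_ge0 K; have l2 := sqr_ge0 l.
  have a1 : 0 <= K ^+ 2 * (32 * Num.sqrt 2) by rewrite mulr_ge0// mulr_ge0 ?sqrtr_ge0.
  have a2 := mulr_ge0 k2 l2; have a3 := mulr_ge0 k2 (addr_ge0 l0 l2); lra.
(* More than t - s substeps make h at most 1, and more than osc (t - s)^2 / eps of them make the
   accumulated error at most eps. *)
pose q := (t - s) + osc K C * (t - s) ^+ 2 / eps.
have r0 : 0 <= osc K C * (t - s) ^+ 2 / eps.
  by apply: divr_ge0; [rewrite mulr_ge0// sqr_ge0|exact: ltW].
have q0 : 0 <= q by rewrite addr_ge0// ltW.
pose n := (Num.truncn q).+1; have qn : q < n%:R by have /andP[] := truncn_itv q0.
have n0 : 0 < n%:R :> R by rewrite ltr0n.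
pose h := (t - s) / n%:R; have h0 : 0 < h by rewrite divr_gt0.
have nh : n%:R * h = t - s by rewrite mulrC divfK// gt_eqF.
have h1 : h <= 1.
  by rewrite ler_pdivrMr// mul1r (le_trans _ (ltW qn))// lerDl.
have E : t - n%:R * h = s by rewrite nh; ring.
have := interval_steps gC tT h0 h1 S (j := n); rewrite E => /(_ s0).
move=> [phi' [dphi' [G [e [S' Gs [se qe] _ EE]]]]].
exists phi', dphi', G; split=> //.
rewrite (sqn_ext _ (_ : _ =1 e)); last by move=> w; rewrite EE; ring.
apply: (le_trans qe); have -> : n%:R * osc K C * h ^+ 2 = osc K C * (t - s) ^+ 2 / n%:R.
  by rewrite -nh; field; rewrite gt_eqF.
rewrite ler_pdivrMr// -ler_pdivrMl// mulrC (le_trans _ (ltW qn))// lerDr ltW//.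
Qed.

(** Membership in the L2 closure of constants plus elementary integrals, a closed linear space.
    Actual integrands are produced once, by completeness, in [martingale_representation]. *)
Definition rep (Y : Omega -> R) := sqint P Y /\ forall eps, 0 < eps ->
  exists c G, sqn P (fun w => Y w - (c + gint G T w)) <= eps.

Lemma sqint_rep c G : sqint P (fun w => c + gint G T w).
Proof. by apply: sqintD; [exact: sqint_cst|exact: sqint_gint T_itv]. Qed.

Lemma rep_ae Y Y' : measurable_fun setT Y' -> {ae P, forall w, Y w = Y' w} -> rep Y -> rep Y'.
Proof.
move=> mY' YY' [sY H]; have sY' := ae_sqint mY' YY' sY; split=> // eps e0.
have [c [G h]] := H _ e0; exists c, G; apply: le_trans h.
have sG := sqint_rep c G.
rewrite le_eqVlt; apply/orP; left; apply/eqP; apply: Ex_ae.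
- by apply: measurable_funX; exact: (sqintB sY' sG).1.
- by apply: measurable_funX; exact: (sqintB sY sG).1.
- by apply: filterS YY' => w ->.
Qed.

Lemma rep_closed Y : sqint P Y ->
  (forall eps, 0 < eps -> exists2 Y', rep Y' & sqn P (fun w => Y w - Y' w) <= eps) -> rep Y.
Proof.
move=> sY H; split=> // eps e0; have e4 : 0 < eps / 4 by lra.
have [Y' [sY' /(_ _ e4)[c [G h]]] h'] := H _ e4.
exists c, G; have := sqn_tri sY sY' (sqint_rep c G); lra.
Qed.

Lemma rep_lim (Y_ : nat -> Omega -> R) Y : (forall k, rep (Y_ k)) -> sqint P Y ->
  sq_cvg P Y_ Y -> rep Y.
Proof.
move=> rY sY cY; apply: rep_closed => // eps e0.
have /cvgrPdist_le/(_ _ e0)[k _ /(_ k (leqnn k)) /=] := cY.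
rewrite sub0r normrN ger0_norm ?sqn_ge0// => h; by exists (Y_ k).
Qed.

Lemma rep_cst c : rep (fun=> c).
Proof.
split; first exact: sqint_cst.
move=> eps e0; exists c, [::]; rewrite (sqn_ext _ (_ : _ =1 fun=> 0)).
  by rewrite /sqn (Ex_ext _ (_ : _ =1 fun=> 0)) ?Ex0 ?ltW// => w; rewrite expr0n.
by move=> w; rewrite /gint big_nil; ring.
Qed.

Lemma repD Y Y' : rep Y -> rep Y' -> rep (fun w => Y w + Y' w).
Proof.
move=> [sY H] [sY' H']; split; first exact: sqintD.
move=> eps e0; have e4 : 0 < eps / 4 by lra.
have [c [G h]] := H _ e4; have [c' [G' h']] := H' _ e4.
exists (c + c'), (G ++ G').
rewrite (sqn_ext _ (_ : _ =1 fun w => (Y w - (c + gint G T w)) + (Y' w - (c' + gint G' T w)))).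
  have := sqn_leD (sqintB sY (sqint_rep c G)) (sqintB sY' (sqint_rep c' G')); lra.
by move=> w; rewrite gint_cat; ring.
Qed.

Lemma repZ k Y : rep Y -> rep (fun w => k * Y w).
Proof.
move=> [sY H]; split; first exact: sqintZ.
move=> eps e0; have k1 : 0 < k ^+ 2 + 1 by rewrite ltr_wpDl// sqr_ge0.
have [c [G h]] := H _ (divr_gt0 e0 k1).
have [|G' [_ G'E]] := @mul_gint G 0 (fun=> k) `|k| (lexx _) (mwrt_cst (F_sigma (lexx 0)) k) (fun=> lexx _).
  by elim: (G) => //= a s ->; rewrite lo_ge0.
exists (k * c), G'; rewrite (sqn_ext _ (_ : _ =1 fun w => k * (Y w - (c + gint G T w)))).
  rewrite sqnZ; last exact: sqintB sY (sqint_rep c G).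
  rewrite ler_pdivlMr// in h; apply: le_trans h; rewrite mulrC ler_wpM2l ?sqn_ge0//.
  by rewrite lerDl.
by move=> w; rewrite G'E; ring.
Qed.

(** * Products over the cells of a dyadic grid *)

Section grid.
Variables (n : nat) (C : nat -> set (measurableTypeR R)) (psi dpsi : nat -> R -> R) (K : R).
Hypothesis gC : forall k, goodmark (Some (C k)).
Hypothesis S : forall k, Sfun K (psi k) (dpsi k).

Definition slot k w : R := psi k (B (dyad T n k.+1) w) *
  \1_(void (`]dyad T n k, dyad T n k.+1]%classic `*` C k)) w.

Let K0 : 0 <= K. Proof. exact: Sfun_ge0 (S 0%N). Qed.

Let slotP k : (k < 2 ^ n)%N ->
  measurable_wrt (F (dyad T n k.+1)) (slot k) /\ forall w, `|slot k w| <= K.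
Proof.
move=> kn; have /andP[k0 _] := dyad_itv T_gt0 (ltnW kn).
have kT := dyad_itv T_gt0 kn; have /andP[k0' kT'] := kT; case: (S k) => m1 _ b _ _.
split.
  apply: mwrtM; first exact: F_sigma.
    by apply: (mwrt_comp (F_sigma k0') m1); exact: B_adapted.
  by apply: mwrt_indic; [exact: F_sigma|exact: box_void_F].
by move=> w; rewrite normrM -[leRHS]mulr1 ler_pM// indic_bound.
Qed.

Let m_slot k : (k < 2 ^ n)%N -> measurable_fun setT (slot k).
Proof.
move=> kn; apply: mwrt_measurable (slotP kn).1; apply: F_meas.
by have /andP[] := dyad_itv T_gt0 kn.
Qed.

Let X j w : R := \prod_(j <= k < 2 ^ n) slot k w.

Let sX j : sqint P (X j).
Proof.
have [jn|jn] := leqP (2 ^ n) j.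
  by apply: sqint_ext (sqint_cst P 1) => w; rewrite /X big_geq.
rewrite -(subKn (ltnW jn)); elim: (2 ^ n - j)%N (leq_subr j (2 ^ n)) => [_|i ih i_n].
  by apply: sqint_ext (sqint_cst P 1) => w; rewrite /X subn0 big_geq.
have j'n : (2 ^ n - i.+1 < 2 ^ n)%N by rewrite ltn_subrL expn_gt0.
apply: sqint_ext (sqintMb (ih (ltnW i_n)) (m_slot j'n) (slotP j'n).2) => w.
by rewrite /X [RHS]big_ltn// -subSn.
Qed.

(** Backward over the cells: the new slot multiplies the function term, which stays in the class by
    [SfunM] and is expanded by [interval_rep], and the integral, which stays elementary by
    [mul_gint]. The class constant grows from cell to cell, but the grid is fixed. *)
Lemma grid_rep i : (i <= 2 ^ n)%N -> forall eps, 0 < eps ->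
  exists K' phi dphi G, [/\ Sfun K' phi dphi, all (fun a => dyad T n (2 ^ n - i) <= lo a) G &
    sqn P (fun w => X (2 ^ n - i) w - phi (B (dyad T n (2 ^ n - i)) w) - gint G T w) <= eps].
Proof.
elim: i => [|i ih] i_n eps e0.
  exists 1, (fun=> 1), (fun=> 0), [::]; split=> //; first exact: Sfun_cst.
  rewrite (sqn_ext _ (_ : _ =1 fun=> 0)).
    by rewrite /sqn (Ex_ext _ (_ : _ =1 fun=> 0)) ?Ex0 ?ltW// => w; rewrite expr0n.
  by move=> w; rewrite /X subn0 big_geq// /gint big_nil; ring.
set j' := (2 ^ n - i.+1)%N; have jE : (2 ^ n - i)%N = j'.+1 by rewrite /j' -subSn.
have j'n : (j' < 2 ^ n)%N by rewrite ltn_subrL expn_gt0.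
have /andP[s0 _] := dyad_itv T_gt0 (ltnW j'n); have /andP[t0 tT] := dyad_itv T_gt0 j'n.
have st : dyad T n j' < dyad T n j'.+1.
  by rewrite /dyad ltr_pM2r ?ltr_nat// divr_gt0// exprn_gt0.
(* The previous error is multiplied by a slot of size at most K, and [sqn_leD] doubles squared
   norms; with eps / (4 (K^2 + 1)) prescribed for it, each of the two contributions is at most half
   of eps. *)
have K1 : 0 < 4 * (K ^+ 2 + 1) by rewrite mulr_gt0// ltr_wpDl// sqr_ge0.
have [K' [phi [dphi [G [S1 Gl q1]]]]] := ih (ltnW i_n) _ (divr_gt0 e0 K1).
rewrite jE in Gl q1.
have [Fxi xib] := slotP j'n.
have [G' [G'l G'E]] := mul_gint t0 Fxi xib Gl.
have S2 := SfunM (S j') S1.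
have e4 : 0 < eps / 4 by lra.
have [phi' [dphi' [G2 [S3 G2l q2]]]] := interval_rep (gC j') s0 st tT S2 e4.
exists (4 * K * K'), phi', dphi', (G2 ++ G'); split=> //.
  by rewrite all_cat G2l/=; apply: sub_all G'l => a; exact: le_trans (ltW st).
set e1 := (fun w => X j'.+1 w - _ - _) in q1; set e2 := (fun w => _ - _ - _) in q2.
rewrite (sqn_ext _ (_ : _ =1 fun w => e2 w + slot j' w * e1 w)); last first.
  by move=> w; rewrite /X [LHS]/= big_ltn// gint_cat G'E /e1 /e2 /X /slot; ring.
have mBd k (f : R -> R) : measurable_fun setT f -> measurable_fun setT (fun w => f (B k w)).
  by move=> mf; exact: measurableT_comp.
have bphi (L : R) (f df : R -> R) k : Sfun L f df -> sqint P (fun w => f (B k w)).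
  by case=> mf _ fb _ _; apply: (bounded_sqint P (c := L)); [exact: mBd|move=> w; exact: fb].
have sg G0 := sqint_gint G0 T_itv.
have s1 : sqint P e1 by apply: sqintB => //; apply: sqintB; [exact: sX|exact: bphi S1].
have s2 : sqint P e2.
  apply: sqintB => //; apply: sqintB; last exact: bphi S3.
  have mI : measurable_fun setT (\1_(void (`]dyad T n j', dyad T n j'.+1]%classic `*` C j')) : Omega -> R).
    apply: measurable_indic; apply: mvoid; apply: measurableX => //; by case: (gC j').
  apply: sqint_ext (sqintMb (bphi _ _ _ (dyad T n j'.+1) S2) mI (fun w => indic_bound _ w)) => w.
  by rewrite mulrC.
have s3 : sqint P (fun w => slot j' w * e1 w) := sqintMb s1 (m_slot j'n) xib.
apply: (le_trans (sqn_leD s2 s3)).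
have q3 : sqn P (fun w => slot j' w * e1 w) <= K ^+ 2 * sqn P e1.
  rewrite -sqnZ//; apply: sqn_le => //; first exact: sqintZ.
  by move=> w; rewrite (normrM (slot j' w)) (normrM K) (ger0_norm K0) ler_wpM2r.
have q4 : K ^+ 2 * sqn P e1 <= eps / 4.
  rewrite ler_pdivlMr// in q1; have := sqn_ge0 P e1; nra.
lra.
Qed.

Lemma grid_rep0 : rep (fun w => \prod_(0 <= k < 2 ^ n) slot k w).
Proof.
split; first exact: sX.
move=> eps e0; have := grid_rep (leqnn _) e0; rewrite subnn.
move=> [K' [phi [dphi [G [S1 _ q1]]]]]; exists (phi 0), G.
(* At time 0 the function term is constant because B_0 = 0 almost surely. *)
apply: le_trans q1; have [B0 _ _ _] := BM; have sG := sqint_gint G T_itv.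
have d0 : dyad T n 0 = 0 by rewrite /dyad mul0r.
rewrite d0 le_eqVlt; apply/orP; left; apply/eqP; apply: Ex_ae.
- apply: measurable_funX; apply: measurable_funB; first exact: (sX 0).1.
  by apply: measurable_funD => //; exact: sG.1.
- apply: measurable_funX; apply: measurable_funB; last exact: sG.1.
  apply: measurable_funB; first exact: (sX 0).1.
  by case: S1 => mf _ _ _ _; exact: measurableT_comp.
- by apply: filterS B0 => w ->; congr (_ ^+ 2); rewrite /X; ring.
Qed.

End grid.

(** * Grid events and the sigma-algebra they generate *)

Lemma bounded_pointwise_sq (f_ : nat -> Omega -> R) (f : Omega -> R) c :
  (forall k, measurable_fun setT (f_ k)) -> measurable_fun setT f ->
  (forall k w, `|f_ k w| <= c) -> (forall w, f_ ^~ w @ \oo --> f w) ->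
  sqint P f /\ sq_cvg P f_ f.
Proof. by move=> mf_ mf fc cf; apply: (bounded_cvg_sq mf_ mf fc); exact: filterE. Qed.

Lemma Sfun_mono K K' (phi dphi : R -> R) : K <= K' -> Sfun K phi dphi -> Sfun K' phi dphi.
Proof.
move=> KK [m1 m2 b db H]; split=> // [x|x|x y]; [exact: le_trans KK|exact: le_trans KK|].
by apply: le_trans (H x y) _; rewrite ler_wpM2r// sqr_ge0.
Qed.

Lemma prod_cvg (N0 : nat) (u : nat -> nat -> R) (l : nat -> R) :
  (forall k, u k @ \oo --> l k) ->
  (fun m => \prod_(0 <= k < N0) u k m) @ \oo --> \prod_(0 <= k < N0) l k.
Proof.
move=> H; elim: N0 => [|N0 ih].
  rewrite big_geq//; under eq_fun do rewrite big_geq//; exact: cvg_cst.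
rewrite big_nat_recr//=; under eq_fun do rewrite big_nat_recr//=; exact: cvgM.
Qed.

(** [None] puts no constraint at a time, which lets an event of a coarse grid be read on a finer
    one. *)
Definition ray (o : option R) : set R := if o is Some a then `]-oo, a]%classic else setT.

Definition bset n (U : nat -> option R) : set Omega :=
  [set w | forall k, (k < 2 ^ n)%N -> ray (U k) (B (dyad T n k.+1) w)].

Definition gbox n (C : nat -> set (measurableTypeR R)) k : set RR :=
  `]dyad T n k, dyad T n k.+1]%classic `*` C k.

Definition gboxes n C : set RR := \big[setU/set0]_(0 <= k < 2 ^ n) gbox n C k.

Definition Bn n : set (set Omega) := [set A | exists U, A = bset n U].
Definition Jn n : set (set RR) :=
  [set E | exists C, (forall k, goodmark (Some (C k))) /\ E = gboxes n C].

Lemma m_gbox n C k : (forall k, goodmark (Some (C k))) -> measurable (gbox n C k).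
Proof. by move=> gC; apply: measurableX => //; case: (gC k). Qed.

Lemma void_big (E : nat -> set RR) N0 : (forall k, measurable (E k)) ->
  measurable (\big[setU/set0]_(0 <= k < N0) E k) /\
  void (\big[setU/set0]_(0 <= k < N0) E k) = [set w | forall k, (k < N0)%N -> void (E k) w].
Proof.
move=> mE; elim: N0 => [|N0 [m1 e1]].
  rewrite big_geq//; split; first exact: measurable0.
  by apply/seteqP; split=> // w _; rewrite /void/= measure0.
rewrite big_nat_recr//=; split; first exact: measurableU.
rewrite voidU// e1; apply/seteqP; split=> w /=.
  move=> [h1 h2] k; rewrite ltnS leq_eqVlt => /predU1P[->//|]; exact: h1.
by move=> h; split=> [k kN|]; apply: h => //; exact: ltnW.
Qed.

Lemma m_ray o : measurable (ray o).
Proof. by case: o => [a|] //=. Qed.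

Lemma bset_sub n : Bn n `<=` measurable.
Proof.
move=> _ [U ->]; rewrite (_ : bset n U = \bigcap_(k in [set k | (k < 2 ^ n)%N]) (B (dyad T n k.+1) @^-1` ray (U k))).
  apply: bigcap_measurableType => k _; rewrite -[X in measurable X]setTI; apply: mB => //; exact: m_ray.
by apply/seteqP; split.
Qed.

Lemma Jn_sub n : Jn n `<=` jump_sets T.
Proof.
move=> _ [C [gC ->]]; rewrite /gboxes big_nat; elim/big_ind: _ => //.
  exact: jump_setsU.
move=> k /andP[_ kn]; case: (gC k) => mC CR Coo.
have /andP[k0 _] := dyad_itv T_gt0 (ltnW kn); have /andP[_ kT] := dyad_itv T_gt0 kn.
by have [] := int_fin_box k0 kT mC CR Coo.
Qed.

(** Half-line indicators are pointwise limits of rescaled [cut], and the finite products stay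
    bounded by 1, so bounded convergence carries [grid_rep0] over to the indicator. *)
Lemma gset_rep n U C : (forall k, goodmark (Some (C k))) ->
  rep \1_(bset n U `&` void (gboxes n C)).
Proof.
move=> gC.
pose psi m k x := if U k is Some a then cut (m.+1%:R * (x - a)) else 1.
pose dpsi m k x := if U k is Some a then m.+1%:R * dcut (m.+1%:R * (x - a)) else 0.
have S m k : Sfun (4 * m.+1%:R ^+ 2) (psi m k) (dpsi m k).
  have m1 : 1 <= m.+1%:R :> R by rewrite ler1n.
  rewrite /psi /dpsi; case: (U k) => [a|]; first exact: Sfun_affine Sfun_cut.
  apply: Sfun_mono (Sfun_cst ler01).
  have : 1 <= m.+1%:R ^+ 2 :> R by rewrite exprn_ege1.
  lra.
have rm m := grid_rep0 n gC (S m).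
have psi1 m k x : `|psi m k x| <= 1.
  by rewrite /psi; case: (U k) => [a|]; [exact: cut_bound|rewrite normr1].
have mvd := (void_big (2 ^ n) (fun k => m_gbox n k gC)).
have mI : measurable_fun setT (\1_(bset n U `&` void (gboxes n C)) : Omega -> R).
  apply: measurable_indic; apply: measurableI; first by apply: (@bset_sub n); exists U.
  by apply: mvoid; case: mvd.
have mm m : measurable_fun setT (fun w => \prod_(0 <= k < 2 ^ n) slot n C (psi m) k w) by case: (rm m) => -[].
have bb m w : `|\prod_(0 <= k < 2 ^ n) slot n C (psi m) k w| <= 1.
  suff /andP[] : 0 <= `|\prod_(0 <= k < 2 ^ n) slot n C (psi m) k w| <= 1 by [].
  rewrite normr_prod; apply: (big_ind (fun x : R => 0 <= x <= 1)) => [|x y /andP[x0 x1] /andP[y0 y1]|k _].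
  - by rewrite ler01 lexx.
  - by rewrite mulr_ge0// mulr_ile1.
  - by rewrite normr_ge0/= normrM mulr_ile1// indic_bound.
have cc w : (fun m => \prod_(0 <= k < 2 ^ n) slot n C (psi m) k w) @ \oo --> (\1_(bset n U `&` void (gboxes n C)) w : R).
  have -> : (\1_(bset n U `&` void (gboxes n C)) w : R) =
      \prod_(0 <= k < 2 ^ n) (\1_(ray (U k)) (B (dyad T n k.+1) w) * \1_(void (gbox n C k)) w).
    rewrite indicE; have [|nw] := boolP (w \in _).
      rewrite inE => -[wB]; rewrite /gboxes mvd.2 => wv.
      rewrite big_nat big1// => k /andP[_ kn]; rewrite !indicE !mem_set ?mulr1//; first exact: wv.
      exact: wB.
    have [k kn Hk] : exists2 k, (k < 2 ^ n)%N & ~ (ray (U k) (B (dyad T n k.+1) w) /\ void (gbox n C k) w).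
      apply: contrapT => H; move: nw => /negP; apply; rewrite inE.
      have HH k : (k < 2 ^ n)%N -> ray (U k) (B (dyad T n k.+1) w) /\ void (gbox n C k) w.
        by move=> kn; apply: contrapT => nk; apply: H; exists k.
      split; first by move=> k /HH[].
      by rewrite /gboxes mvd.2 => k /HH[].
    apply/esym/eqP; rewrite prodf_seq_eq0; apply/hasP; exists k; first by rewrite mem_index_iota.
    rewrite /= mulf_eq0 !indicE; apply/orP.
    have [r|r] := pselect (ray (U k) (B (dyad T n k.+1) w)); last by left; rewrite memNset.
    by right; rewrite memNset// => v; apply: Hk.
  apply: (@prod_cvg _ (fun k m => slot n C (psi m) k w)) => k; apply: cvgMl.
  rewrite /psi; case: (U k) => [a|] /=; first exact: cut_cvg.
  by rewrite indicE in_setT; exact: cvg_cst.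
have [sI cI] := bounded_pointwise_sq mm mI bb cc.
exact: rep_lim rm sI cI.
Qed.

Lemma minr_ray o o' : exists o2, ray o2 = ray o `&` ray o'.
Proof.
case: o o' => [a|] [b|] /=; last by exists None; rewrite setTI.
- exists (Some (Num.min a b)); apply/seteqP; split=> x /=; rewrite !in_itv/= le_min.
    by move=> /andP[].
  by move=> [-> ->].
- by exists (Some a); rewrite setIT.
- by exists (Some b); rewrite setTI.
Qed.

Lemma Bn_setI n : setI_closed (Bn n).
Proof.
move=> _ _ [U ->] [U' ->].
have /choice[V HV] k : exists o, ray o = ray (U k) `&` ray (U' k) by exact: minr_ray.
exists V; apply/seteqP; split=> w.
  by move=> [h h'] k kn; rewrite HV; split; [exact: h|exact: h'].
by move=> h; split=> k /h; rewrite HV => -[].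
Qed.

Lemma goodmarkU C C' : goodmark (Some C) -> goodmark (Some C') -> goodmark (Some (C `|` C')).
Proof.
move=> [mC CR Coo] [mC' CR' Coo']; split; [exact: measurableU|by rewrite subUset|].
apply: (@le_lt_trans _ _ (nu C + nu C')%E); first exact: measureU2.
by rewrite lte_add_pinfty.
Qed.

Lemma Jn_setU n E E' : Jn n E -> Jn n E' -> Jn n (E `|` E').
Proof.
move=> [C [gC ->]] [C' [gC' ->]]; exists (fun k => C k `|` C' k); split.
  by move=> k; exact: goodmarkU.
rewrite /gboxes -big_split/=; apply: eq_bigr => k _; rewrite /gbox.
apply/seteqP; split=> -[x y] /=; first by move=> [[? ?]|[? ?]]; split=> //; [left|right].
by move=> [? [?|?]]; [left|right].
Qed.

Lemma bigU_double (f : nat -> set RR) N0 :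
  \big[setU/set0]_(0 <= k < N0.*2) f k =
  \big[setU/set0]_(0 <= k < N0) (f k.*2 `|` f k.*2.+1).
Proof.
elim: N0 => [|N0 ih]; first by rewrite !big_geq.
by rewrite doubleS !big_nat_recr//= ih setUA.
Qed.

Lemma dyad_mid n k : dyad T n.+1 k.*2 = dyad T n k /\ dyad T n.+1 k.*2.+2 = dyad T n k.+1.
Proof. by rewrite -doubleS !dyad_double. Qed.

Lemma Jn_S n : Jn n `<=` Jn n.+1.
Proof.
(* Cells 2k and 2k + 1 of the finer grid both inherit the marks of cell k. *)
move=> _ [C [gC ->]]; exists (fun k => C k./2); split=> //.
rewrite /gboxes expnS mul2n bigU_double; apply: eq_bigr => k _.
have [d1 d2] := dyad_mid n k.
rewrite /gbox /= doubleK uphalf_double d1 d2 -box_split//.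
  by rewrite -d1; exact: dyad_mono.
by rewrite -d2; exact: dyad_mono.
Qed.

Lemma Bn_S n : Bn n `<=` Bn n.+1.
Proof.
(* Constraints sit at right ends of cells, and cell k of the coarse grid ends where cell 2k + 1 of
   the finer one does; even cells receive none. *)
move=> _ [U ->]; exists (fun k => if odd k then U k./2 else None).
apply/seteqP; split=> w h k kn.
  case: ifPn => // ok; have kE : k = (k./2).*2.+1 by rewrite -[LHS]odd_double_half ok.
  have [_ d2] := dyad_mid n k./2; rewrite {2}kE d2; apply: h.
  by move: kn; rewrite expnS mul2n {1}kE -doubleS leq_double.
have := h k.*2.+1; rewrite /= odd_double/= uphalf_double.
have [_ ->] := dyad_mid n k; apply.
by rewrite expnS mul2n -doubleS leq_double.
Qed.

Lemma Jn_le m n : (m <= n)%N -> Jn m `<=` Jn n.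
Proof.
elim: n => [|n ih]; first by rewrite leqn0 => /eqP ->.
rewrite leq_eqVlt => /predU1P[->//|]; rewrite ltnS => /ih h.
by apply: subset_trans h _; exact: Jn_S.
Qed.

Lemma Bn_le m n : (m <= n)%N -> Bn m `<=` Bn n.
Proof.
elim: n => [|n ih]; first by rewrite leqn0 => /eqP ->.
rewrite leq_eqVlt => /predU1P[->//|]; rewrite ltnS => /ih h.
by apply: subset_trans h _; exact: Bn_S.
Qed.

Definition gridcl : set (set Omega) := [set A | exists n, vclass (Bn n) (Jn n) A].

Lemma vclass_mono (G G' : set (set Omega)) (J J' : set (set RR)) : G `<=` G' -> J `<=` J' ->
  vclass G J `<=` vclass G' J'.
Proof.
by move=> GG JJ A [D [E [GD JE H]]]; exists D, E; split=> //; [exact: GG|exact: JJ].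
Qed.

Lemma gridcl_setI : setI_closed gridcl.
Proof.
move=> A A' [n An] [m Am]; exists (maxn n m).
apply: vclassI.
- exact: Bn_setI.
- exact: Jn_setU.
- exact: Jn_sub.
- exact: vclass_mono (Bn_le (leq_maxl _ _)) (Jn_le (leq_maxl _ _)) _ An.
- exact: vclass_mono (Bn_le (leq_maxr _ _)) (Jn_le (leq_maxr _ _)) _ Am.
Qed.

Lemma gridcl_measurable : gridcl `<=` measurable.
Proof. move=> A [n]; apply: vclass_measurable; [exact: bset_sub|exact: Jn_sub]. Qed.

Lemma gridcl_rep A : gridcl A -> rep \1_A.
Proof.
move=> gA; have mA := gridcl_measurable gA; case: gA => n [_ [_ [[U ->] [C [gC ->]] H]]].
refine (rep_ae _ _ (gset_rep n U gC)); first exact: measurable_indic.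
apply: filterS H => w H; rewrite !indicE; congr (_%:R); congr nat_of_bool.
apply/idP/idP; rewrite !inE; first by move=> [? ?]; apply/H.
by move=> /H[].
Qed.

(** Sets with representable indicator form a lambda-system: [rep] is stable under differences and,
    by bounded convergence, under increasing unions. *)
Lemma rep_salg A : <<s gridcl >> A -> rep \1_A.
Proof.
suff : <<s gridcl >> `<=` [set A | measurable A /\ rep \1_A] by move=> H /H[].
apply: lambda_system_subset => //; last first.
  by move=> D gD; split; [exact: gridcl_measurable|exact: gridcl_rep].
2: exact: gridcl_setI.
split => //.
- split; first exact: measurableT.
  apply: rep_ae (rep_cst 1); first exact: measurable_indic.
  by apply: filterE => w; rewrite indicE in_setT.
- move=> D E ED [mD rD] [mE rE]; split; first exact: measurableD.
  apply: rep_ae (repD rD (repZ (-1) rE)).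
    by apply: measurable_indic; exact: measurableD.
  apply: filterE => w; rewrite mulN1r !indicE in_setD.
  have [Ew|nE] := boolP (w \in E); last by rewrite andbT subr0.
  have Dw : w \in D by move: Ew; rewrite !inE; exact: ED.
  by rewrite Dw subrr.
- move=> E ndE HE; have mU : measurable (\bigcup_n E n) by apply: bigcupT_measurable => n; case: (HE n).
  split=> //.
  have mm n : measurable_fun setT (\1_(E n) : Omega -> R) by apply: measurable_indic; case: (HE n).
  have cc w : (fun n => \1_(E n) w : R) @ \oo --> (\1_(\bigcup_n E n) w : R).
    rewrite (indicE R (\bigcup_n E n)); have [|nw] := boolP (w \in _).
      rewrite inE => -[n _ En]; apply: cvg_near_cst; exists n => // m /= nm.
      by rewrite indicE mem_set//; have /subsetPset := ndE _ _ nm; apply.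
    apply: cvg_near_cst; apply: nearW => n; rewrite indicE memNset// => En.
    by move/negP: nw; apply; rewrite inE; exists n.
  have [sI cI] := bounded_pointwise_sq mm (measurable_indic mU) (fun n w => indic_bound (E n) w) cc.
  by apply: rep_lim sI cI => n; case: (HE n).
Qed.

(** * The martingale representation theorem *)

Definition grid_salg := <<s gridcl >>.

Lemma grid_salg_sigma : sigma_algebra setT grid_salg.
Proof. exact: smallest_sigma_algebra. Qed.

Lemma goodmark0 : goodmark (Some (set0 : set (measurableTypeR R))).
Proof. by split; [exact: measurable0|exact: sub0set|rewrite measure0]. Qed.

Lemma gboxes0 n : gboxes n (fun=> set0) = set0.
Proof. by rewrite /gboxes big1// => k _; rewrite /gbox setX0. Qed.

Lemma bset0 n : bset n (fun=> None) = setT.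
Proof. by apply/seteqP; split. Qed.

Lemma void0 : void set0 = setT.
Proof. by apply/seteqP; split=> // w _; rewrite /void/= measure0. Qed.

Lemma grid_salg_negl : P.-negligible `<=` grid_salg.
Proof.
move=> A nA; rewrite -(setCK A); apply: (salgC grid_salg_sigma); apply: sub_sigma_algebra.
exists 0%N, setT, set0; split.
- by exists (fun=> None); rewrite bset0.
- exists (fun=> set0); split; first by move=> k; exact: goodmark0.
  by rewrite gboxes0.
case: nA => Z0 [mZ PZ AZ]; exists Z0; split=> // w H; apply: AZ; apply: contrapT => nAw.
by apply: H; split=> // _; split=> //; rewrite void0.
Qed.

Lemma grid_salg_wrtP (X : Omega -> R) : (forall a, grid_salg (X @^-1` `]-oo, a]%classic)) -> measurable_wrt grid_salg X.
Proof.
move=> H; apply/(mwrtP grid_salg_sigma).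
apply: (@measurability _ _ (g_sigma_algebraType grid_salg) (measurableTypeR R) setT X _ (RGenOInfty.measurableE R)).
move=> _ [_ [a ->] <-]; rewrite setTI (mwrt_id grid_salg_sigma).
rewrite (_ : _ @^-1` _ = ~` (X @^-1` `]-oo, a]%classic)); first exact: (salgC grid_salg_sigma (H a)).
by apply/seteqP; split=> w /=; rewrite !in_itv/= andbT ltNge => /negP.
Qed.

Lemma grid_salg_B_dyad n k : (k < 2 ^ n)%N -> measurable_wrt grid_salg (B (dyad T n k.+1)).
Proof.
move=> kn; apply: grid_salg_wrtP => a; apply: sub_sigma_algebra.
exists n, (bset n (fun j => if j == k then Some a else None)), set0; split.
- by exists (fun j => if j == k then Some a else None).
- exists (fun=> set0); split; first by move=> j; exact: goodmark0.
  by rewrite gboxes0.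
apply: filterE => w; rewrite void0; split=> [h|[h _]].
  by split=> // j jn; case: eqP => [->|_].
by have := h k kn; rewrite eqxx.
Qed.

Lemma grid_salg_gbox n k C : (k < 2 ^ n)%N -> goodmark (Some C) -> grid_salg (void (gbox n (fun=> C) k)).
Proof.
move=> kn gC; pose C' j := if j == k then C else set0.
have gC' j : goodmark (Some (C' j)) by rewrite /C'; case: eqP => _ //; exact: goodmark0.
apply: sub_sigma_algebra; exists n, setT, (gboxes n C'); split.
- by exists (fun=> None); rewrite bset0.
- by exists C'.
have [_ vE] := void_big (2 ^ n) (fun j => m_gbox n j gC').
apply: filterE => w; rewrite /gboxes vE; split=> [h|[_ /(_ k kn)]].
  split=> // j jn; rewrite /gbox /C'; case: eqP => [->//|_].
  by rewrite setX0 void0.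
by rewrite /gbox /C' eqxx.
Qed.

Lemma grid_salg_box n a b C : (b <= 2 ^ n)%N -> goodmark (Some C) ->
  grid_salg (void (`]dyad T n a, dyad T n b]%classic `*` C)).
Proof.
move=> bn gC; have empty b' : (b' <= a)%N -> grid_salg (void (`]dyad T n a, dyad T n b']%classic `*` C)).
  move=> ba; rewrite set_itv_ge; last by rewrite bnd_simp -leNgt dyad_mono.
  by rewrite set0X void0; exact: salgT grid_salg_sigma.
elim: b bn => [|b ih] bn; first exact: empty.
have [|ab] := leqP b.+1 a; first exact: empty.
have mC : measurable C by case: gC.
rewrite (@voidE C _ (dyad T n b))//; try exact: dyad_mono.
by apply: (salgI grid_salg_sigma); [apply: ih; exact: ltnW|exact: grid_salg_gbox].
Qed.

Lemma dyad_scale n m i : dyad T (n + m) (i * 2 ^ m) = dyad T n i.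
Proof.
rewrite /dyad natrM exprD natrX; field.
by rewrite !expf_neq0.
Qed.

Lemma dyad_max p a b : Num.max (dyad T p a) (dyad T p b) = dyad T p (maxn a b).
Proof.
case: (leqP a b) => ab; first by rewrite max_r// dyad_mono.
by rewrite max_l// dyad_mono// ltnW.
Qed.

Lemma dyad_min p a b : Num.min (dyad T p a) (dyad T p b) = dyad T p (minn a b).
Proof.
case: (leqP a b) => ab; first by rewrite min_l// dyad_mono.
by rewrite min_r// dyad_mono// ltnW.
Qed.

Lemma itvI_strip (a b c e : R) (C : set (measurableTypeR R)) :
  (`]a, b]%classic `*` C) `&` strip c e = `]Num.max a c, Num.min b e]%classic `*` C.
Proof.
apply/seteqP; rewrite /strip; split=> -[x y] /=.
  rewrite !in_itv/= => -[[/andP[ax xb] Cy] [/andP[cx xe] _]].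
  by split=> //; rewrite gt_max ax cx le_min xb xe.
rewrite !in_itv/= gt_max le_min => -[/andP[/andP[ax cx] /andP[xb xe]] Cy].
by rewrite ax cx xb xe.
Qed.

(** The 8^m slices used by [jump_measurable1] are dyadic intervals of level 3 m, so both partitions
    live on the grid of level n + 3 m. *)
Lemma grid_salg_cnt n k C : (k <= 2 ^ n)%N -> goodmark (Some C) ->
  measurable_wrt grid_salg (cnt (`]0, dyad T n k]%classic `*` C)).
Proof.
move=> kn gC; have [mC CR Coo] := gC.
have kT : dyad T n k <= T by have /andP[] := dyad_itv T_gt0 kn.
have [jE _] := int_fin_box (lexx 0) kT mC CR Coo.
apply: (jump_measurable1 grid_salg_sigma grid_salg_negl jE _ mC Coo).
  move=> [x y] [/= + Cy]; rewrite !in_itv/= => /andP[/ltW -> xk]; split=> //=.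
  by rewrite (le_trans xk).
move=> m i im; rewrite itvI_strip.
have d8 j : j%:R * (T / (8 ^ m)%:R) = dyad T (n + 3 * m) (j * 2 ^ n).
  by rewrite addnC dyad_scale /dyad natrX (_ : 8 = 2 ^ 3)%N// natrX -exprM.
have -> : (0 : R) = dyad T (n + 3 * m) 0 by rewrite /dyad mul0r.
rewrite !d8 -(dyad_scale n (3 * m) k) dyad_max dyad_min; apply: grid_salg_box => //.
apply: (leq_trans (geq_minl _ _)).
by rewrite expnD leq_mul2r kn orbT.
Qed.

(** Dyadic times approach t strictly from the right along cadlag paths. Time T is dyadic, and for B
    the grid time 0, at which no cell ends, is settled by B_0 = 0. *)
Lemma grid_salg_Z i t : goodmark i -> 0 <= t <= T -> measurable_wrt grid_salg (Z i t).
Proof.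
move=> gi; have dy n k : (k <= 2 ^ n)%N -> measurable_wrt grid_salg (Z i (dyad T n k)).
  move=> kn; case: i gi => [C|] gi.
    apply: (mwrtB grid_salg_sigma); last exact: mwrt_cst grid_salg_sigma _.
    exact: grid_salg_cnt.
  case: k kn => [|k] kn; last exact: grid_salg_B_dyad.
  have [B0 _ _ _] := BM; rewrite /dyad mul0r.
  apply: (ae_eq_mwrt grid_salg_sigma grid_salg_negl (mwrt_cst grid_salg_sigma 0)).
  by apply: filterS B0 => w; rewrite /= => ->.
move=> /andP[t0]; rewrite le_eqVlt => /predU1P[->|tT].
  by rewrite -(dyad_last T 0); exact: dy.
have /choice[s Hs] m : exists s, [/\ t < s, s < t + m.+1%:R^-1 & exists n k, (k <= 2 ^ n)%N /\ s = dyad T n k].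
  have [||n [k [kn h1 h2]]] := @dyadic_right _ T t m.+1%:R^-1; first by rewrite t0.
    by rewrite invr_gt0 ltr0n.
  by exists (dyad T n k); split=> //; exists n, k.
have sc : s @ \oo --> t.
  apply: (squeeze_cvgr _ (cvg_cst t) (_ : (fun m => t + m.+1%:R^-1) @ \oo --> t)).
    by apply: nearW => m; case: (Hs m) => /ltW -> /ltW ->.
  by rewrite -[X in _ --> X]addr0; apply: cvgD; [exact: cvg_cst|exact: cvg_harmonic].
apply: (ae_cvg_mwrt grid_salg_sigma grid_salg_negl (X_ := fun m => Z i (s m))).
  by move=> m; case: (Hs m) => _ _ [n [k [kn ->]]]; exact: dy.
apply: filterS (Z_cadlag gi) => w [cr _].
have {}cr : Z i x w @[x --> t^'+] --> Z i t w by apply: cr; rewrite t0.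
move/cvg_at_rightP : cr; apply; split=> // m; by case: (Hs m).
Qed.

(** A pi-system whose traces on ]0, T] x A are boxes starting at time 0, that is, the sets counted
    by [Z]. *)
Definition rects : set (set RR) :=
  [set E | exists t (Y : set (measurableTypeR R)), measurable Y /\ E = `]-oo, t]%classic `*` Y].

Lemma rects_setI : setI_closed rects.
Proof.
move=> _ _ [t [Y [mY ->]]] [t' [Y' [mY' ->]]]; exists (Num.min t t'), (Y `&` Y').
split; first exact: measurableI.
rewrite -setXI; congr (_ `*` _).
by apply/seteqP; split=> x /=; rewrite !in_itv/= le_min; [move=> [-> ->]|move=> /andP[]].
Qed.

Lemma rects_gen : (@measurable _ RR) `<=` <<s rects >>.
Proof.
have sS : sigma_algebra setT <<s rects >> by exact: smallest_sigma_algebra.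
have fstE : forall X : set (measurableTypeR R), measurable X -> <<s rects >> (X `*` setT).
  have mf : measurable_fun (setT : set (g_sigma_algebraType rects)) (fun x : g_sigma_algebraType rects => (x : RR).1 : measurableTypeR R).
    apply: (@measurability _ _ (g_sigma_algebraType rects) (measurableTypeR R) setT _ _ (RGenOInfty.measurableE R)).
    move=> _ [_ [a ->] <-]; rewrite setTI.
    have : <<s rects >> (~` (`]-oo, a]%classic `*` setT)).
      by apply: (salgC sS); apply: sub_sigma_algebra; exists a, setT.
    congr (<<s rects >> _); apply/seteqP; split=> -[x y] /=; rewrite !in_itv/= andbT ltNge.
      by move=> h; apply/negP => xa; apply: h.
    by move=> /negP h [].
  move=> X mX; have := mf measurableT X mX; rewrite setTI.
  by congr (<<s rects >> _); apply/seteqP; split=> -[x y] //= [].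
have sndE : forall Y : set (measurableTypeR R), measurable Y -> <<s rects >> (setT `*` Y).
  move=> Y mY; rewrite (_ : setT `*` Y = \bigcup_n (`]-oo, n%:R]%classic `*` Y)).
    apply: (salg_bigcup sS) => n; apply: sub_sigma_algebra; by exists n%:R, Y.
  apply/seteqP; split=> -[x y] /=; last by move=> [n _ []].
  move=> [_ Yy]; have [n xn] : exists n : nat, x <= n%:R.
    exists (Num.truncn `|x|).+1; apply: (le_trans (ler_norm x)); apply: ltW.
    by have /andP[] := truncn_itv (normr_ge0 x).
  by exists n => //; split=> //=; rewrite in_itv/=.
rewrite measurable_prod_measurableType; apply: smallest_sub => //.
move=> _ [X mX [Y mY <-]]; rewrite (_ : X `*` Y = (X `*` setT) `&` (setT `*` Y)).
  by apply: (salgI sS); [exact: fstE|exact: sndE].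
by apply/seteqP; split=> -[x y] /=; [move=> [? ?]|move=> [[? _] [_ ?]]].
Qed.

(** Counts rather than void events go through the monotone class argument: they are additive, hence
    stable under differences, and almost surely finite on the window ]0, T] x A. *)
Lemma grid_salg_lambda (A : set (measurableTypeR R)) E : goodmark (Some A) -> measurable E ->
  measurable_wrt grid_salg (cnt (E `&` (`]0, T]%classic `*` A))).
Proof.
move=> gA mE; have [mA AR Aoo] := gA.
set W : set RR := `]0, T]%classic `*` A.
have Wf : int_fin W by exact: int_fin_box.
have mW : measurable W by case: Wf => -[].
have Wi D : measurable D -> int_fin (D `&` W).
  by move=> mD; apply: (int_finS Wf); [exact: measurableI|move=> x []].
suff : <<s rects >> `<=` [set E | measurable E /\ measurable_wrt grid_salg (cnt (E `&` W))].
  by move=> /(_ _ (rects_gen mE))[].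
apply: lambda_system_subset => //; last first.
  move=> _ [t [Y [mY ->]]]; split; first exact: measurableX.
  have -> : (`]-oo, t]%classic `*` Y) `&` W = `]0, Num.min t T]%classic `*` (Y `&` A).
    rewrite /W; apply/seteqP; split=> -[x y] /=; rewrite !in_itv/= le_min.
      by move=> [[-> ?] [/andP[-> ->] ?]].
    by move=> [/andP[-> /andP[-> ->]] [? ?]].
  have gYA : goodmark (Some (Y `&` A)).
    split; [exact: measurableI|by move=> x [_ /AR]|].
    by apply: le_lt_trans Aoo; apply: le_measure; rewrite ?inE//; exact: measurableI.
  have [t0|t0] := leP 0 t; last first.
    rewrite set_itv_ge; last by rewrite bnd_simp -leNgt ge_min ltW.
    rewrite set0X (_ : cnt set0 = fun=> 0); first exact: mwrt_cst grid_salg_sigma _.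
    by apply/funext => w; rewrite /cnt measure0.
  have := grid_salg_Z gYA (t := Num.min t T); rewrite ge_min lexx orbT le_min t0 ltW// => /(_ isT) h.
  have := mwrtD grid_salg_sigma h (mwrt_cst grid_salg_sigma (intens (`]0, Num.min t T]%classic `*` (Y `&` A)))).
  by congr (measurable_wrt grid_salg _); apply/funext => w; rewrite /Z /cmp subrK.
2: exact: rects_setI.
split => //.
- split; first exact: measurableT.
  by rewrite setTI /W -(dyad_last T 0); exact: grid_salg_cnt.
- move=> D D' DD [mD rD] [mD' rD']; split; first exact: measurableD.
  apply: (ae_eq_mwrt grid_salg_sigma grid_salg_negl (mwrtB grid_salg_sigma rD rD')).
  have dj : (D' `&` W) `&` ((D `\` D') `&` W) = set0.
    by apply/seteqP; split=> // x [[? ?] [[_ ?] _]].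
  apply: filterS (cntU (Wi _ mD') (Wi _ (measurableD mD mD')) dj) => w.
  rewrite -setIUl setDUK// => ->; ring.
- move=> D ndD HD; have mD n : measurable (D n) by case: (HD n).
  have mU : measurable (\bigcup_n D n) by exact: bigcupT_measurable.
  split=> //; apply: (ae_cvg_mwrt grid_salg_sigma grid_salg_negl (X_ := fun n => cnt (D n `&` W))).
    by move=> n; case: (HD n).
  apply: filterS (cnt_ae_nat Wf) => w [k [Nk _]].
  rewrite /cnt; apply: fine_cvg; rewrite fineK; last first.
    rewrite ge0_fin_numE//; apply: le_lt_trans (ltry k%:R); rewrite -Nk.
    by apply: le_measure; rewrite ?inE//; exact: measurableI.
  rewrite setI_bigcupl; apply: nondecreasing_cvg_mu.
  + by move=> n; exact: measurableI.
  + by apply: bigcupT_measurable => n; exact: measurableI.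
  + move=> m n mn; apply/subsetPset => x [Dx Wx]; split=> //.
    by have /subsetPset := ndD _ _ mn; apply.
Qed.

(** Exhaust E by sets of finite intensity and drop time 0, which almost surely carries no point of
    them; voidness is then the vanishing of counts known to [grid_salg]. *)
Lemma grid_salg_void E : jump_sets T E -> grid_salg (void E).
Proof.
move=> jE; have mE : measurable E by case: jE.
have /sigma_finiteP [A [A_T A_nd A_oo]] := sigma_finiteT nu.
pose A' n := A n `&` Rnz R.
have gA n : goodmark (Some (A' n)).
  have [mAn Aoo] := A_oo n; split; first by apply: measurableI => //; exact: mRnz.
    by move=> x [].
  apply: le_lt_trans Aoo; apply: le_measure; rewrite ?inE//; last by move=> x [].
  by apply: measurableI => //; exact: mRnz.
pose En n := E `&` (setT `*` A n).
have mEn n : measurable (En n).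
  by apply: measurableI => //; apply: measurableX => //; case: (A_oo n).
have vE : void E = \bigcap_n void (En n).
  apply/seteqP; split=> w.
    move=> h n _; apply/eqP; rewrite eq_le measure_ge0 andbT -h.
    by apply: le_measure; rewrite ?inE// => x [].
  move=> h; have : N w (\bigcup_n En n) = 0%E.
    apply/eqP; rewrite eq_le measure_ge0 andbT.
    apply: (@le_trans _ _ (\sum_(0 <= n <oo) N w (En n))%E).
      by apply: measure_sigma_subadditive => //; exact: bigcupT_measurable.
    by rewrite eseries0// => n _ _; exact: h.
  by rewrite /En -setI_bigcupr -setX_bigcupr -A_T setXTT setIT.
rewrite vE; apply: (salg_bigcap grid_salg_sigma) => n.
have Enf : int_fin (En n).
  have [mAn Aoo] := A_oo n.
  apply: (int_fin_bounded (A := A n)) => //.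
    split; first exact: mEn.
    by move=> x [Exy _]; case: jE => _ /(_ x Exy).
  by move=> [x y] [Exy [_ Ay]]; split=> //; case: jE => _ /(_ _ Exy)[].
pose W : set RR := `]0, T]%classic `*` A' n.
have Wf : int_fin W by have [? ? ?] := gA n; exact: int_fin_box.
have mW : measurable W by case: Wf => -[].
have h1 : int_fin (En n `&` W) by apply: (int_finS Enf); [exact: measurableI|move=> x []].
have h2 : int_fin (En n `\` W) by apply: (int_finS Enf); [exact: measurableD|move=> x []].
have z : {ae P, forall w, cnt (En n `\` W) w = 0}.
  have [i1 e1] := intg_cnt h2.
  apply: (Ex_eq0_ae i1); first by move=> w; exact: cnt_ge0.
  rewrite e1; apply/eqP; rewrite eq_le intens_ge0 andbT -lee_fin -intensE//.
  apply: (@le_trans _ _ (leb2 ([set 0] `*` A n))).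
    apply: le_measure; rewrite ?inE//; first exact: measurableD.
      by apply: measurableX => //; case: (A_oo n).
    move=> [x y] [[Exy [_ Ay]] nW]; split=> //=.
    case: jE => _ /(_ _ Exy) [/= + Ry]; rewrite in_itv/= => /andP[x0 xT].
    apply/eqP; rewrite eq_le x0 andbT leNgt; apply/negP => x0'.
    by apply: nW; split=> //=; rewrite in_itv/= x0' xT.
  by rewrite product_measure1E//= ?lebesgue_measure_set1 ?mul0e//; case: (A_oo n).
have dj : (En n `&` W) `&` (En n `\` W) = set0.
  by apply/seteqP; split=> // x [[_ ?] [_ ?]].
have SGW := grid_salg_lambda (gA n) (mEn n).
apply: (ae_eq_salg grid_salg_sigma grid_salg_negl (SGW [set 0] (measurable_set1 0))).
apply: filterS3 (cnt_ae_nat Enf) z (cntU h1 h2 dj) => w [k [Nk ck]] z0.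
rewrite setUIDK => c1; rewrite /void/=.
have -> : cnt (En n `&` W) w = k%:R by move: c1; rewrite z0 addr0 ck.
by rewrite Nk; split=> [->|[]].
Qed.

(** Every generator of [F T] is reached: B at each time by [grid_salg_Z], counts through void events
    by [jump_measurable], and null sets directly. *)
Lemma F_SG : F T `<=` grid_salg.
Proof.
rewrite FE ?ltW//; apply: smallest_sub; first exact: grid_salg_sigma.
move=> A [[GA|]|nA]; [|move: A|exact: grid_salg_negl].
  move: A GA; apply: smallest_sub; first exact: grid_salg_sigma.
  move=> A [t tT [C mC <-]]; rewrite setTI; exact: (@grid_salg_Z None).
apply: smallest_sub; first exact: grid_salg_sigma.
rewrite minxx => A [E JE [C mC <-]]; rewrite setTI.
apply: (@jump_measurable grid_salg (jump_sets T)) => //.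
- exact: grid_salg_sigma.
- exact: grid_salg_negl.
- by move=> D D' [mD DJ] mD' D'D; split=> // x /D'D /DJ.
- exact: grid_salg_void.
Qed.

Lemma rep_sum (I : Type) (s : seq I) (f : I -> Omega -> R) :
  (forall i, rep (f i)) -> rep (fun w => \sum_(i <- s) f i w).
Proof.
move=> rf; elim: s => [|i s ih].
  by under [fun w => _]eq_fun do rewrite big_nil; exact: rep_cst.
by under [fun w => _]eq_fun do rewrite big_cons; exact: repD.
Qed.

Lemma rep_nneg (X : Omega -> R) : measurable_wrt (F T) X -> sqint P X ->
  (forall w, 0 <= X w) -> rep X.
Proof.
move=> FX sX X0; have T0 : 0 <= T := ltW T_gt0; have sF := F_sigma T0.
have mX : measurable_fun (setT : set (g_sigma_algebraType (F T))) (EFin \o X).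
  by apply/measurable_EFinP; exact/mwrtP.
(* The simple functions are built on Omega with the sigma-algebra [F T], so their level sets belong
   to it and [rep_salg] applies through [F_SG]. *)
pose g := nnsfun_approx measurableT mX.
have X0' w : [set: g_sigma_algebraType (F T)] w -> (0 <= (EFin \o X) w)%E by rewrite lee_fin.
have gX w : (g ^~ w) @ \oo --> X w.
  have := cvg_nnsfun_approx measurableT mX X0' (x := w) Logic.I.
  by move=> /fine_cvgP[].
have gle n w : g n w <= X w.
  rewrite -(cvg_lim (@Rhausdorff R) (gX w)); apply: nondecreasing_cvgn_le.
    by move=> m k mk; have /lefP := nd_nnsfun_approx measurableT mX mk; apply.
  by apply/cvg_ex; exists (X w).
have rg n : rep (g n).
  have -> : (g n : Omega -> R) = fun w => \sum_(y <- finmap.enum_fset (fset_set (range (g n)))) y * \1_(g n @^-1` [set y]) w.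
    by apply/funext => w; rewrite fimfunE fsbig_finite.
  apply: rep_sum => y; apply: repZ; apply: rep_salg; apply: F_SG.
  have := measurable_sfunP (g n) (measurable_set1 y); by rewrite (mwrt_id sF).
have sg n : sqint P (g n) by case: (rg n).
apply: (rep_lim rg sX); apply: (dominated_sq (g := X)).
- by move=> n; exact: (sg n).1.
- exact: sX.1.
- exact: sX.
- apply: filterE => w n; rewrite !ger0_norm ?subr_ge0//.
  by rewrite gerBl; exact: fun_ge0.
- exact: filterE.
Qed.

Lemma rep_FT (Y : Omega -> R) : measurable_wrt (F T) Y -> sqint P Y -> rep Y.
Proof.
move=> FY sY; have sF := F_sigma (ltW T_gt0).
have YE : Y = fun w => Num.max (Y w) 0 + -1 * Num.max (- Y w) 0.
  apply/funext => w; case: (lerP (Y w) 0) => Y0.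
    by rewrite [Num.max (- _) _]max_l ?oppr_ge0//; ring.
  by rewrite [Num.max (- _) _]max_r ?oppr_le0 ?ltW//; ring.
have F0 : measurable_wrt (F T) (fun=> 0 : R) := mwrt_cst sF 0.
have FN : measurable_wrt (F T) (fun w => - Y w).
  by have := mwrtB sF F0 FY; under eq_fun do rewrite sub0r.
have h (X : Omega -> R) : measurable_wrt (F T) X -> sqint P X -> rep (fun w => Num.max (X w) 0).
  move=> FX sX; have mX := sX.1; apply: rep_nneg; first exact: mwrt_max.
    apply: (sqint_dom _ sX) => [|w]; first by apply: measurable_maxr => //; exact: mX.
     rewrite ger0_norm; last by rewrite le_max lexx orbT.
    by rewrite ge_max normr_ge0 ler_norm.
  by move=> w; rewrite le_max lexx orbT.
by rewrite YE; apply: repD; [exact: h|apply: repZ; apply: h => //; exact: sqintN].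
Qed.

Lemma gint0 G w : gint G 0 w = 0.
Proof. by rewrite /gint big1// => a _; rewrite ev_lo// lo_ge0. Qed.

Lemma mart2_mean M : mart2 M -> (forall w, M 0 w = 0) -> forall t, 0 <= t <= T -> Ex P (M t) = 0.
Proof.
move=> [aM sM oM] M0 t /andP[t0 tT].
rewrite -(oM 0 t (fun=> 1) (lexx _) t0 tT (mwrt_cst (F_sigma (lexx 0)) 1) (sqint_cst P 1)).
by apply: Ex_ext => w; rewrite M0 subr0 mul1r.
Qed.

Lemma gint_split G : exists (Q : seq (step T F)) (Q' : seq (marked_step T F nu)),
  forall t w, gint (map inl Q ++ map inr Q') t w = gint G t w.
Proof.
elim: G => [|a G [Q [Q' ih]]]; first by exists [::], [::].
case: a => [a|b].
  by exists (a :: Q), Q' => t w; rewrite /= !gint_cons ih.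
exists Q, (b :: Q') => t w; rewrite gint_cons -ih !gint_cat /= gint_cons; ring.
Qed.

Theorem martingale_representation (Y : Omega -> R) : measurable_wrt (F T) Y -> sqint P Y ->
  exists q r MB MN, [/\ is_ito_integral P T F B q MB, is_poisson_integral P T F nu N r MN,
     mart2 MB, mart2 MN & {ae P, forall w, Y w = Ex P Y + MB T w + MN T w}].
Proof.
move=> FY sY; have [_ H] := rep_FT FY sY.
have /choice[QQ HQ] k : exists Q : seq (step T F) * seq (marked_step T F nu),
    sqn P (fun w => (Y w - Ex P Y) - gint (map inl Q.1 ++ map inr Q.2) T w) <= 2 ^- k.
  have [|c [G h]] := H (2 ^- k); first by rewrite invr_gt0 exprn_gt0.
  have [Q [Q' E]] := gint_split G; exists (Q, Q'); apply: le_trans h.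
  (* Centering does not increase the norm, and since elementary integrals have mean 0 it turns the
     constant c into the expectation of Y. *)
  have sX := sqintB sY (sqint_rep c G); apply: le_trans (sqn_center sX).
  rewrite le_eqVlt; apply/orP; left; apply/eqP; apply: sqn_ext => w /=.
  have iY := sqint_intg sY; have iG := sqint_intg (sqint_gint G T_itv).
  rewrite E ExB//; last exact: sqint_intg (sqint_rep c G).
  rewrite (ExD (intg_cst P c) iG) Ex_cst (mart2_mean (mart2_gint G) (gint0 G) T_itv); ring.
have sYc : sqint P (fun w => Y w - Ex P Y) by apply: sqintB => //; exact: sqint_cst.
have cY : sq_cvg P (fun k => gint (map inl (QQ k).1 ++ map inr (QQ k).2) T) (fun w => Y w - Ex P Y).
  apply: (sq_cvg_le HQ); under eq_fun do rewrite -exprVn; apply: cvg_expr.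
  by rewrite ger0_norm ?invr_ge0// invf_lt1//; lra.
have [q [r [MB [MN [iB iN mMB mMN E]]]]] := representation_limit sYc cY.
exists q, r, MB, MN; split=> //; apply: filterS E => w e.
by rewrite -addrA -e; ring.
Qed.

(** * Time integrals *)

(** Holds because the integral of a nonnegative function is a supremum over simple functions below
    it. It serves for the supremum over all times in [S2], whose measurability is not
    established. *)
Lemma ge0_le_integral_nonmeasurable (d1 : measure_display) (X : measurableType d1) (mu : {measure set X -> \bar R})
    (f g : X -> \bar R) : (forall x, 0 <= f x)%E -> (forall x, f x <= g x)%E ->
  (\int[mu]_x f x <= \int[mu]_x g x)%E.
Proof.
move=> f0 fg; have g0 x : (0 <= g x)%E := le_trans (f0 x) (fg x).
rewrite !ge0_integralTE//=; apply: ereal_sup_le => _ [h hf <-]; exists h => //.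
by move=> x; exact: le_trans (hf x) (fg x).
Qed.

Definition tint (g : X1 -> R) (w : Omega) : R := Ex leb (fun s => g (s, w)).

Lemma tint_fubini g : intg mu1 g ->
  [/\ intg P (tint g), Ex P (tint g) = Ex mu1 g & {ae P, forall w, intg leb (fun s => g (s, w))}].
Proof.
move=> ig; have mg := measurable_int _ ig.
have E := @integral21_prod_meas1 _ _ _ _ R lebesgue_measure P _ ig.
have a := @ae_integrable2 _ _ _ _ R lebesgue_measure P _ ig.
have mG := @measurable_fubini_G _ _ _ _ R lebesgue_measure P _ ig.
have goo := (@integrable21ltyP _ _ _ _ R lebesgue_measure P _ mg).1 ig.
set G := fubini_G _ _ in mG E.
have iG : P.-integrable setT G.
  apply/integrableP; split=> //; apply: le_lt_trans goo; apply: ge0_le_integral => //.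
  - exact: measurableT_comp.
  - apply: (@measurable_fun_fubini_tonelli_G _ _ _ _ R lebesgue_measure (fun x => `|(g x)%:E|%E)) => //.
    exact: measurableT_comp.
  - move=> w _; apply: le_abse_integral => //.
    by apply: (measurableT_comp mg (measurable_pair2 w)).
have mt : measurable_fun setT (tint g) by apply: (measurableT_comp _ mG).
have GE : {ae P, forall w, setT w -> G w = (tint g w)%:E}.
  by apply: filterS a => w iw _; rewrite -ExE.
have mt' : measurable_fun setT (EFin \o tint g) by exact/measurable_EFinP.
have it : intg P (tint g).
  apply: (le_integrable measurableT mt' _ iG) => w _; rewrite /= /tint /Ex /Rintegral.
  rewrite -[X in (_ <= `|X|)%E]/(\int[lebesgue_measure]_x (EFin \o g) (x, w))%E.
  by case: integral => [x| |]; rewrite //= ?normr0 ?leey.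
split=> //; rewrite /Ex /Rintegral; congr fine; rewrite -E.
by apply: ae_eq_integral => //; apply: filterS GE => w h /h ->.
Qed.

(** Vanishing off [0, T] makes Lebesgue measure on the line act as a finite measure, so that
    square-integrability implies integrability. *)
Definition on_D1 (g : X1 -> R) := forall x, g x * \1_D1 x = g x.

Lemma cut1_on_D1 u : on_D1 (cut1 u).
Proof.
by move=> x; rewrite /cut1 -mulrA; congr (_ * _); case: (indic01 D1 x) => ->; rewrite ?mulr0 ?mulr1.
Qed.

Lemma D1E (x : X1) : \1_D1 x = \1_`[0, T]%classic x.1 :> R.
Proof.
rewrite !indicE; case: (pselect (`[0, T]%classic x.1)) => h.
  by rewrite !mem_set.
by rewrite !memNset// => -[].
Qed.

Lemma leb_T : [/\ intg leb (\1_`[0, T]%classic : R -> R), sqint leb (\1_`[0, T]%classic : R -> R) &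
  Ex leb (\1_`[0, T]%classic : R -> R) = T].
Proof.
have E : lebesgue_measure (`[0, T]%classic : set R) = T%:E.
  by rewrite lebesgue_measure_itv/= lte_fin T_gt0 oppr0 adde0.
have [||h1 h2 h3] := @indic_intg _ (measurableTypeR R) leb `[0, T]%classic.
- exact: measurable_itv.
- by rewrite /= E ltry.
by split=> //; rewrite h3 /= E.
Qed.

Lemma sqint_D1 H : sqint P H -> sqint mu1 (fun x => H x.2 * \1_D1 x).
Proof.
move=> sH; have [_ s1 _] := leb_T.
apply: sqint_ext (@sqint_prod _ _ _ _ lebesgue_measure P _ _ s1 sH) => x.
by rewrite D1E mulrC.
Qed.

Lemma intg_mul_D1 g H : sqint mu1 g -> on_D1 g -> sqint P H -> intg mu1 (fun x => H x.2 * g x).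
Proof.
move=> sg Dg sH; apply: intg_ext (sqintM (sqint_D1 sH) sg) => x.
by rewrite -[in RHS](Dg x); ring.
Qed.

Lemma sqint_intg_D1 g : sqint mu1 g -> on_D1 g -> intg mu1 g.
Proof.
move=> sg Dg; apply: intg_ext (intg_mul_D1 sg Dg (sqint_cst P 1)) => x; exact: mul1r.
Qed.

Lemma m_section1 (g : X1 -> R) w : measurable_fun setT g -> measurable_fun setT (fun s : measurableTypeR R => g (s, w)).
Proof. by move=> mg; exact: (measurableT_comp mg (measurable_pair2 w)). Qed.

Lemma m_section2 (g : X1 -> R) s : measurable_fun setT g -> measurable_fun setT (fun w => g (s, w)).
Proof. by move=> mg; exact: (measurableT_comp mg (measurable_pair1 s)). Qed.

(** Cauchy-Schwarz against the indicator of [0, T], for almost every path. *)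
Lemma tint_sq g : sqint mu1 g -> on_D1 g ->
  intg P (tint (fun x => g x ^+ 2)) /\ {ae P, forall w, tint g w ^+ 2 <= T * tint (fun x => g x ^+ 2) w}.
Proof.
move=> sg Dg; have [mg i2] := (sqintP _ _).1 sg.
have [it _ a2] := tint_fubini i2; split=> //.
apply: filterS a2 => w iw; have [_ s1 e1] := leb_T.
have sgw : sqint leb (fun s => g (s, w)) by apply/sqintP; split=> //; exact: m_section1.
have := cauchy_schwarz s1 sgw.
have -> : Ex leb (fun x => \1_`[0, T]%classic x * g (x, w)) = tint g w.
  by apply: Ex_ext => s; rewrite -[in RHS]Dg D1E mulrC.
suff -> : sqn leb (\1_`[0, T]%classic : R -> R) = T by [].
rewrite -[RHS]e1; apply: Ex_ext => s.
by case: (indic01 `[0, T]%classic s) => ->; rewrite ?expr1n ?expr0n.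
Qed.

Lemma sqint_tint g : sqint mu1 g -> on_D1 g -> sqint P (tint g).
Proof.
move=> sg Dg; have [i2 b] := tint_sq sg Dg.
have [it _ _] := tint_fubini (sqint_intg_D1 sg Dg).
by have [] := sqn_ae_bound (intg_meas it) (intgZ T i2) b.
Qed.

Lemma Ex_tint_mul g H : sqint mu1 g -> on_D1 g -> sqint P H ->
  Ex P (fun w => H w * tint g w) = Ex mu1 (fun x => H x.2 * g x).
Proof.
move=> sg Dg sH; have i1 := intg_mul_D1 sg Dg sH.
have [it <- _] := tint_fubini i1; have [it' _ a] := tint_fubini (sqint_intg_D1 sg Dg).
apply: Ex_ae.
- by apply: measurable_funM; [exact: sH.1|exact: (intg_meas it')].
- exact: (intg_meas it).
by apply: filterS a => w iw; symmetry; exact: (ExZ (H w) iw).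
Qed.

Lemma sqn_tint g : sqint mu1 g -> Ex P (tint (fun x => g x ^+ 2)) = sqn mu1 g.
Proof. by move=> /sqintP[_ i2]; have [] := tint_fubini i2. Qed.

Lemma ae_sections (f g : X1 -> R) : measurable_fun setT f -> measurable_fun setT g ->
  {ae mu1, forall x, f x = g x} -> {ae P, forall w, {ae leb, forall s, f (s, w) = g (s, w)}}.
Proof.
move=> mf mg fg.
have mh : measurable_fun setT (fun x : X1 => `|f x - g x|%:E).
  by apply/measurable_EFinP; apply: measurableT_comp => //; exact: measurable_funB.
have h0 (x : X1) : (0 <= `|f x - g x|%:E)%E by rewrite lee_fin.
have I0 : (\int[mu1]_x `|f x - g x|%:E = 0)%E.
  rewrite -[RHS](integral0 mu1 setT); apply: ae_eq_integral => //.
  by apply: filterS fg => x -> _; rewrite subrr normr0.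
rewrite (@fubini_tonelli2 _ _ _ _ R lebesgue_measure P _ mh h0) in I0.
have mG := @measurable_fun_fubini_tonelli_G _ _ _ _ R lebesgue_measure _ mh h0.
set G := fubini_G _ _ in I0 mG.
have G0 w : (0 <= G w)%E by apply: integral_ge0 => s _; exact: h0.
have : (\int[P]_w `|G w| = 0)%E by rewrite -I0; apply: eq_integral => w _; rewrite gee0_abs.
move=> /(ae_eq_integral_abs P measurableT mG); apply: filterS => w /(_ Logic.I) Gw.
have mw : measurable_fun setT (fun s : measurableTypeR R => (f (s, w) - g (s, w))%:E).
  by apply/measurable_EFinP; exact: (m_section1 w (measurable_funB mf mg)).
have : (\int[leb]_s `|(f (s, w) - g (s, w))%:E| = 0)%E by exact: Gw.
move=> /(ae_eq_integral_abs leb measurableT mw).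
by apply: filterS => s /(_ Logic.I) [] /eqP; rewrite subr_eq0 => /eqP.
Qed.

(** Joint measurability lets the exceptional sets, which depend on s, be collected into one null set
    of the product. *)
Lemma ae_slices (f g : X1 -> R) : measurable_fun setT f -> measurable_fun setT g ->
  (forall s, {ae P, forall w, f (s, w) = g (s, w)}) -> {ae mu1, forall x, f x = g x}.
Proof.
move=> mf mg fg.
have mh : measurable_fun setT (fun x : X1 => `|f x - g x|%:E).
  by apply/measurable_EFinP; apply: measurableT_comp => //; exact: measurable_funB.
have h0 (x : X1) : (0 <= `|f x - g x|%:E)%E by rewrite lee_fin.
have mh' : measurable_fun setT (fun x : X1 => (f x - g x)%:E).
  by apply/measurable_EFinP; exact: measurable_funB.
have : (\int[mu1]_x `|(f x - g x)%:E| = 0)%E.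
  rewrite [LHS](@fubini_tonelli1 _ _ _ _ R lebesgue_measure P _ mh h0).
  rewrite /fubini_F; apply: integral0_eq => s _.
  rewrite -[RHS](integral0 P setT); apply: ae_eq_integral => //.
    by apply: (measurableT_comp mh (measurable_pair1 s)).
  by apply: filterS (fg s) => x -> _; rewrite subrr normr0.
move=> /(ae_eq_integral_abs mu1 measurableT mh').
by apply: filterS => s /(_ Logic.I) [] /eqP; rewrite subr_eq0 => /eqP.
Qed.

Lemma Rintegral_tint (u : R -> Omega -> R) t w : 0 <= t <= T ->
  \int[lebesgue_measure]_(s in `[0, t]) u s w = tint (fun x => cut1 u x * \1_`[0, t]%classic x.1) w.
Proof.
move=> /andP[t0 tT]; rewrite Rintegral_mkcond; apply: (@Ex_ext _ _ _ leb) => s.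
rewrite patchE /cut1 D1E /= !indicE; case: ifPn => st; last by rewrite mulr0.
rewrite mem_set ?mulr1//; move: st; rewrite inE /= !in_itv/= => /andP[-> /le_trans]; exact.
Qed.

Lemma Rintegral_tintT (u : R -> Omega -> R) w :
  \int[lebesgue_measure]_(s in `[0, T]) u s w = tint (cut1 u) w.
Proof.
rewrite Rintegral_tint ?T_itv//; apply: Ex_ext => s.
by rewrite -[RHS]cut1_on_D1 D1E.
Qed.

(** * Ito and Poisson integrals as martingales *)

(** Sum of a dB- and a dNtilde-integral with one common approximating sequence; isometry and
    uniqueness then hold for the pair of integrands at once. *)
Definition is_int (f : X1 -> R) (g : X2 -> R) (M : R -> Omega -> R) :=
  [/\ sqint mu1 f, sqint mu2 g, cadlag_adapted T F M &
    exists G : nat -> seq elt, [/\ sq_cvg mu1 (fun k => F1 (G k)) f,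
      sq_cvg mu2 (fun k => F2 (G k)) g &
      forall t, 0 <= t <= T -> sqint P (M t) /\ sq_cvg P (fun k => gint (G k) t) (M t)]].

Lemma sq_cvg_cst (d1 : measure_display) (X : measurableType d1) (mu : {measure set X -> \bar R})
   (f_ : nat -> X -> R) f : (forall k, f_ k =1 f) -> sq_cvg mu f_ f.
Proof.
move=> E; rewrite /sq_cvg (_ : (fun k => _) = fun=> 0); first exact: cvg_cst.
apply/funext => k; rewrite /sqn -[RHS](Ex0 mu); apply: Ex_ext => x.
by rewrite E subrr expr0n.
Qed.

Lemma ito_is_int q M : is_ito_integral P T F B q M -> is_int (cut1 q) (fun=> 0) M.
Proof.
move=> /is_ito_integralP[_ sq cM [Q [c1 c2]]]; split=> //; first exact: sqint0.
exists (fun k => map inl (Q k)); split=> //.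
by apply: sq_cvg_cst => k x; exact: F2_inl.
Qed.

Lemma poisson_is_int r M : is_poisson_integral P T F nu N r M -> is_int (fun=> 0) (cut2 r) M.
Proof.
move=> /is_poisson_integralP[_ sq cM [Q [c1 c2]]]; split=> //; first exact: sqint0.
exists (fun k => map inr (Q k)); split=> //.
by apply: sq_cvg_cst => k x; exact: F1_inr.
Qed.

Lemma F_mwrtZ t (X : Omega -> R) c : 0 <= t -> measurable_wrt (F t) X -> measurable_wrt (F t) (fun w => c * X w).
Proof. by move=> t0; apply: mwrt_comp; [exact: F_sigma|exact: mulrl_measurable]. Qed.

Lemma cadlag_adaptedD M M' : cadlag_adapted T F M -> cadlag_adapted T F M' ->
  cadlag_adapted T F (fun t w => M t w + M' t w).
Proof.
move=> [aM cM] [aM' cM']; split=> [t tT|w]; last exact: cadlagD.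
by apply: mwrtD; [apply: F_sigma; case/andP: tT|exact: aM|exact: aM'].
Qed.

Lemma cadlag_adaptedB M M' : cadlag_adapted T F M -> cadlag_adapted T F M' ->
  cadlag_adapted T F (fun t w => M t w - M' t w).
Proof.
move=> [aM cM] [aM' cM']; split=> [t tT|w]; last exact: cadlagB.
by apply: mwrtB; [apply: F_sigma; case/andP: tT|exact: aM|exact: aM'].
Qed.

Lemma cadlag_adaptedZ c M : cadlag_adapted T F M -> cadlag_adapted T F (fun t w => c * M t w).
Proof.
move=> [aM cM]; split=> [t tT|w]; last exact: cadlagZ.
by apply: F_mwrtZ; [case/andP: tT|exact: aM].
Qed.

Lemma sq_cvgB (d1 : measure_display) (X : measurableType d1) (mu : {measure set X -> \bar R})
   (f_ g_ : nat -> X -> R) f g :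
  (forall k, sqint mu (f_ k)) -> (forall k, sqint mu (g_ k)) ->
  sqint mu f -> sqint mu g -> sq_cvg mu f_ f -> sq_cvg mu g_ g ->
  sq_cvg mu (fun k x => f_ k x - g_ k x) (fun x => f x - g x).
Proof.
move=> sf_ sg_ sf sg cf cg.
apply: (sq_cvgD sf_ (fun k => sqintN (sg_ k)) sf (sqintN sg) cf).
rewrite /sq_cvg; under eq_fun do under sqn_ext do rewrite opprK addrC.
by under eq_fun do rewrite sqnBC.
Qed.

Lemma is_intD f g M f' g' M' : is_int f g M -> is_int f' g' M' ->
  is_int (fun x => f x + f' x) (fun x => g x + g' x) (fun t w => M t w + M' t w).
Proof.
move=> [sf sg cM [G [cf cg cI]]] [sf' sg' cM' [G' [cf' cg' cI']]]; split.
- exact: sqintD.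
- exact: sqintD.
- exact: cadlag_adaptedD.
exists (fun k => G k ++ G' k); split.
- rewrite (_ : (fun k => _) = fun k x => F1 (G k) x + F1 (G' k) x).
    by apply: sq_cvgD => // k; exact: sqint_F1.
  by apply/funext => k; apply/funext => x; exact: F1_cat.
- rewrite (_ : (fun k => _) = fun k x => F2 (G k) x + F2 (G' k) x).
    by apply: sq_cvgD => // k; exact: sqint_F2.
  by apply/funext => k; apply/funext => x; exact: F2_cat.
move=> t tT; have [s c] := cI t tT; have [s' c'] := cI' t tT; split; first exact: sqintD.
rewrite (_ : (fun k => _) = fun k x => gint (G k) t x + gint (G' k) t x).
  by apply: sq_cvgD => // k; exact: sqint_gint.
by apply/funext => k; apply/funext => x; exact: gint_cat.
Qed.

Lemma is_intB f g M f' g' M' : is_int f g M -> is_int f' g' M' ->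
  is_int (fun x => f x - f' x) (fun x => g x - g' x) (fun t w => M t w - M' t w).
Proof.
move=> [sf sg cM [G [cf cg cI]]] [sf' sg' cM' [G' [cf' cg' cI']]]; split.
- exact: sqintB.
- exact: sqintB.
- exact: cadlag_adaptedB.
exists (fun k => subG (G k) (G' k)); split.
- rewrite (_ : (fun k => _) = fun k x => F1 (G k) x - F1 (G' k) x).
    by apply: sq_cvgB => // k; exact: sqint_F1.
  by apply/funext => k; apply/funext => x; exact: F1_sub.
- rewrite (_ : (fun k => _) = fun k x => F2 (G k) x - F2 (G' k) x).
    by apply: sq_cvgB => // k; exact: sqint_F2.
  by apply/funext => k; apply/funext => x; exact: F2_sub.
move=> t tT; have [s c] := cI t tT; have [s' c'] := cI' t tT; split; first exact: sqintB.
rewrite (_ : (fun k => _) = fun k x => gint (G k) t x - gint (G' k) t x).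
  by apply: sq_cvgB => // k; exact: sqint_gint.
by apply/funext => k; apply/funext => x; exact: gint_sub.
Qed.

Lemma is_int_mart2 f g M : is_int f g M -> mart2 M.
Proof. by move=> [_ _ [aM _] [G [_ _ cI]]]; apply: (mart2_lim (fun k => mart2_gint (G k))). Qed.

Lemma is_int_isometry f g M : is_int f g M -> sqn P (M T) = sqn mu1 f + sqn mu2 g.
Proof.
move=> [sf sg _ [G [cf cg cI]]]; have [sM cM] := cI T T_itv.
have h0 := sq_cvg_sqn (fun k => sqint_gint (G k) T_itv) sM cM.
have h1 := sq_cvg_sqn (fun k => sqint_F1 (G k)) sf cf.
have h2 := sq_cvg_sqn (fun k => sqint_F2 (G k)) sg cg.
have h : sqn mu1 (F1 (G k)) + sqn mu2 (F2 (G k)) @[k --> \oo] --> sqn mu1 f + sqn mu2 g by exact: cvgD.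
move: h0; under eq_fun do rewrite isometry_sqn.
move=> h0; exact: (cvg_unique (@Rhausdorff R) h0 h).
Qed.

Lemma is_int_0 f g M : is_int f g M -> {ae P, forall w, M 0 w = 0}.
Proof.
move=> [_ _ _ [G [_ _ cI]]]; have t0 : (0 : R) <= 0 <= T by rewrite lexx ltW.
have [sM cM] := cI 0 t0.
apply: (sq_cvg_unique (fun k => sqint_gint (G k) t0) sM (sqint0 P) cM).
by apply: sq_cvg_cst => k w; exact: gint0.
Qed.

(** Doob's inequality upgrades vanishing at the final time to indistinguishability from 0. *)
Lemma mart2_eq0 M : mart2 M -> (forall w, cadlag T (M ^~ w)) -> sqn P (M T) = 0 ->
  {ae P, forall w, forall t, 0 <= t <= T -> M t w = 0}.
Proof.
move=> mM cM M0; have [|a [ma a0]] := doob_sup mM; first exact: filterE.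
rewrite M0 mulr0 => ia b.
have : (\int[P]_w `|a w| = 0)%E.
  under eq_integral do rewrite gee0_abs//.
  by apply/eqP; rewrite eq_le ia integral_ge0.
move=> /(ae_eq_integral_abs P measurableT ma); apply: filterS2 b => w b /(_ Logic.I) aw t tT.
have := b t tT; rewrite aw lee_fin => h; apply/eqP.
by rewrite -sqrf_eq0 eq_le h sqr_ge0.
Qed.

Lemma is_int_eq0 f g M : is_int f g M -> sqn mu1 f = 0 -> sqn mu2 g = 0 ->
  {ae P, forall w, forall t, 0 <= t <= T -> M t w = 0}.
Proof.
move=> iM f0 g0; apply: (mart2_eq0 (is_int_mart2 iM)); first by case: iM => _ _ [].
by rewrite (is_int_isometry iM) f0 g0 addr0.
Qed.

Lemma sqn0 (d1 : measure_display) (X : measurableType d1) (mu : {measure set X -> \bar R}) (f : X -> R) :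
  (forall x, f x = 0) -> sqn mu f = 0.
Proof. by move=> f0; rewrite /sqn -[RHS](Ex0 mu); apply: Ex_ext => x; rewrite f0 expr0n. Qed.

Lemma is_int_unique f g M f' g' M' : is_int f g M -> is_int f' g' M' -> f =1 f' -> g =1 g' ->
  {ae P, forall w, forall t, 0 <= t <= T -> M t w = M' t w}.
Proof.
move=> iM iM' ff gg; have := is_int_eq0 (is_intB iM iM').
rewrite !sqn0; last 2 first.
- by move=> x; rewrite gg subrr.
- by move=> x; rewrite ff subrr.
move=> /(_ erefl erefl); apply: filterS => w H t /H /eqP; rewrite subr_eq0 => /eqP.
exact.
Qed.

Lemma F_meas_wrt t (X : Omega -> R) : 0 <= t -> measurable_wrt (F t) X -> measurable_fun setT X.
Proof. by move=> t0; apply: mwrt_measurable; exact: F_meas. Qed.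

Lemma mart2D M M' : mart2 M -> mart2 M' -> mart2 (fun t w => M t w + M' t w).
Proof.
move=> mM mM'; have [a s o] := mM; have [a' s' o'] := mM'; split.
- by move=> t tT; apply: mwrtD; [apply: F_sigma; case/andP: tT|exact: a|exact: a'].
- by move=> t tT; apply: sqintD; [exact: s|exact: s'].
move=> u t H u0 ut tT FH sH.
have i1 := mart2_increment mM u0 ut tT FH sH.
have i2 := mart2_increment mM' u0 ut tT FH sH.
rewrite -[RHS]addr0 -{1}(o u t H)// -(o' u t H)// -ExD//.
by apply: Ex_ext => w; ring.
Qed.

Lemma mart2Z c M : mart2 M -> mart2 (fun t w => c * M t w).
Proof.
move=> mM; have [a s o] := mM; split.
- by move=> t tT; apply: F_mwrtZ; [case/andP: tT|exact: a].
- by move=> t tT; apply: sqintZ; exact: s.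
move=> u t H u0 ut tT FH sH.
have i1 := mart2_increment mM u0 ut tT FH sH.
rewrite -[RHS](mulr0 c) -(o u t H)// -ExZ//.
by apply: Ex_ext => w; ring.
Qed.

Lemma mart2B M M' : mart2 M -> mart2 M' -> mart2 (fun t w => M t w - M' t w).
Proof.
move=> mM mM'; have := mart2D mM (mart2Z (-1) mM').
by under eq_fun do under eq_fun do rewrite mulN1r.
Qed.

Lemma mart2_init X : measurable_wrt (F 0) X -> sqint P X -> mart2 (fun=> X).
Proof.
move=> FX sX; split=> [t /andP[t0 _]|//|s t H *].
  exact: mwrt_mono FX.
by rewrite -[RHS](Ex0 P); apply: Ex_ext => w; rewrite subrr mulr0.
Qed.

Lemma mart2_ae M M' : mart2 M -> adapted T F M' ->
  (forall t, 0 <= t <= T -> {ae P, forall w, M t w = M' t w}) -> mart2 M'.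
Proof.
move=> mM aM' MM'; have [a s o] := mM.
have m' t : 0 <= t <= T -> measurable_fun setT (M' t).
  by move=> tT; apply: (F_meas_wrt _ (aM' _ tT)); case/andP: tT.
split=> // [t tT|u t H u0 ut tT FH sH].
  by apply: (ae_sqint (m' t tT) (MM' t tT)); exact: s.
have tT' : 0 <= t <= T by rewrite (le_trans u0).
have uT' : 0 <= u <= T by rewrite u0 (le_trans ut).
rewrite -(o u t H)//; apply: Ex_ae.
- by apply: measurable_funM; [exact: sH.1|apply: measurable_funB; exact: m'].
- by apply: measurable_funM; [exact: sH.1|apply: measurable_funB; [exact: (s _ tT').1|exact: (s _ uT').1]].
by apply: filterS2 (MM' _ tT') (MM' _ uT') => w -> ->.
Qed.

(** * Cadlag processes on a dyadic grid *)

Definition cell n i : set R := `]dyad T n i, dyad T n i.+1]%classic.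

Lemma cell_exists n s : 0 < s <= T -> exists2 i, (i < 2 ^ n)%N & cell n i s.
Proof.
move=> /andP[s0 sT]; have : s <= dyad T n (2 ^ n) by rewrite dyad_last.
elim: (2 ^ n)%N => [|k ih] sk; first by move: sk; rewrite /dyad mul0r leNgt s0.
have [/ih[i ik si]|h] := leP s (dyad T n k); first by exists i => //; exact: ltnW.
by exists k => //; rewrite /cell/= in_itv/= h.
Qed.

Lemma cell_sum n s i (h : nat -> R) : (i < 2 ^ n)%N -> cell n i s ->
  \sum_(0 <= j < 2 ^ n) h j * \1_(cell n j) s = h i.
Proof.
move=> iN si; rewrite (bigD1_seq i) ?mem_index_iota ?iota_uniq//=.
rewrite indicE mem_set// mulr1 big1 ?addr0// => j ji.
rewrite indicE memNset ?mulr0//; move: si; rewrite /cell/= !in_itv/= => /andP[i1 i2] /andP[j1 j2].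
case: (ltngtP i j) ji => // ij _.
  by have := dyad_mono n T_gt0 ij; lra.
by have := dyad_mono n T_gt0 ij; lra.
Qed.

Lemma cell_T n i s : (i < 2 ^ n)%N -> cell n i s -> 0 < s <= T.
Proof.
move=> iN; rewrite /cell/= in_itv/= => /andP[h1 h2].
have /andP[a0 _] := dyad_itv T_gt0 (ltnW iN); have /andP[_ b0] := dyad_itv T_gt0 iN.
by rewrite (le_lt_trans a0)//= (le_trans h2).
Qed.

Lemma cell_sum0 n s (h : nat -> R) : ~ 0 < s <= T ->
  \sum_(0 <= j < 2 ^ n) h j * \1_(cell n j) s = 0.
Proof.
move=> sT; rewrite big_nat big1// => j /andP[_ jN].
by rewrite indicE memNset ?mulr0// => /(cell_T jN).
Qed.

Lemma cell_size n i : dyad T n i.+1 - dyad T n i = T / 2 ^+ n.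
Proof. by rewrite /dyad -natr1; ring. Qed.

Lemma mesh_cvg : T / 2 ^+ n @[n --> \oo] --> 0.
Proof.
rewrite -[X in _ --> X](mulr0 T); apply: cvgMr; under eq_fun do rewrite -exprVn.
by apply: cvg_expr; rewrite ger0_norm ?invr_ge0// invf_lt1//; lra.
Qed.

Lemma right_approx (Y : R -> R) s (r : nat -> R) : cadlag T Y -> 0 <= s <= T ->
  (forall n, s <= r n <= T) -> (forall n, r n <= s + T / 2 ^+ n) -> Y (r n) @[n --> \oo] --> Y s.
Proof.
move=> [cr _] /andP[s0]; rewrite le_eqVlt => /predU1P[->|sT] sr rs.
  rewrite (_ : (fun n => _) = fun=> Y T); first exact: cvg_cst.
  by apply/funext => n; congr Y; apply/eqP; rewrite eq_le; have /andP[-> ->] := sr n.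
have : Y x @[x --> s^'+] --> Y s by apply: cr; rewrite s0.
move=> /cvgrPdist_le H; apply/cvgrPdist_le => e e0.
have [dl dl0 Hd] := H e e0.
have /cvgrPdist_lt/(_ dl dl0) M := mesh_cvg.
near=> n; have [/andP[h1 h2] h3] := (sr n, rs n).
move: h1; rewrite le_eqVlt => /predU1P[<-|h1]; first by rewrite subrr normr0 ltW.
apply: Hd => //=; rewrite distrC ger0_norm ?subr_ge0 ?ltW//.
have : `|0 - T / 2 ^+ n| < dl by near: n.
rewrite sub0r normrN ger0_norm; first by lra.
by rewrite divr_ge0 ?exprn_ge0// ltW.
Unshelve. all: by end_near. Qed.

Lemma m_cell_mul n i (H : Omega -> R) : measurable_fun setT H ->
  measurable_fun setT (fun x : X1 => H x.2 * \1_(cell n i) x.1).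
Proof.
move=> mH; apply: measurable_funM; first exact: measurableT_comp.
apply: (measurableT_comp (_ : measurable_fun setT (\1_(cell n i) : measurableTypeR R -> R))) => //.
by apply: measurable_indic; exact: measurable_itv.
Qed.

Lemma m_cell_sum n (H : nat -> Omega -> R) : (forall i, (i < 2 ^ n)%N -> measurable_fun setT (H i)) ->
  measurable_fun setT (fun x : X1 => \sum_(0 <= i < 2 ^ n) H i x.2 * \1_(cell n i) x.1).
Proof.
move=> mH; under eq_fun do rewrite big_nat.
pose H' i := if (i < 2 ^ n)%N then H i else fun=> 0.
have -> : (fun x : X1 => \sum_(0 <= i < 2 ^ n | (0 <= i < 2 ^ n)%N) H i x.2 * \1_(cell n i) x.1) =
   fun x : X1 => \sum_(0 <= i < 2 ^ n) H' i x.2 * \1_(cell n i) x.1.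
  apply/funext => x; rewrite [RHS]big_nat; apply: eq_bigr => i /andP[_ iN].
  by rewrite /H' iN.
apply: measurable_sum => i; apply: m_cell_mul; rewrite /H'; case: ifPn => [/mH//|_].
exact: measurable_cst.
Qed.

(** Values at the right ends of the cells converge by right continuity. The cells cover ]0, T] only,
    so time 0 has its own term. *)
Lemma cadlag_joint (Y : R -> Omega -> R) : (forall t, 0 <= t <= T -> measurable_fun setT (Y t)) ->
  (forall w, cadlag T (Y ^~ w)) -> measurable_fun setT (cut1 Y).
Proof.
move=> mY cY; have t0 : (0 : R) <= 0 <= T by rewrite lexx ltW.
pose Yn n (x : X1) := \sum_(0 <= i < 2 ^ n) Y (dyad T n i.+1) x.2 * \1_(cell n i) x.1 +
   Y 0 x.2 * \1_[set 0] x.1.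
apply: (measurable_fun_cvg (h := Yn)) => [n|[s w] _].
  apply: measurable_funD.
    by apply: (@m_cell_sum n (fun i => Y (dyad T n i.+1))) => i iN; apply: mY; exact: dyad_itv.
  apply: measurable_funM; first by apply: measurableT_comp => //; exact: mY.
  apply: (measurableT_comp (_ : measurable_fun setT (\1_[set 0] : measurableTypeR R -> R))) => //.
have [s0|s0] := eqVneq s 0.
  rewrite (_ : (fun n => _) = fun=> cut1 Y (s, w)); first exact: cvg_cst.
  apply/funext => n; rewrite /Yn cell_sum0 ?s0 ?ltxx// add0r /cut1 D1E !indicE !mem_set//=.
have E n : Yn n (s, w) = \sum_(0 <= i < 2 ^ n) Y (dyad T n i.+1) w * \1_(cell n i) s.
  by rewrite /Yn /= [\1_[set 0] s]indicE memNset ?mulr0 ?addr0// => /eqP; rewrite (negbTE s0).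
under eq_fun do rewrite E.
rewrite /cut1 D1E /= indicE; case: (pselect (`[0, T]%classic s)) => sT; last first.
  rewrite memNset// mulr0 (_ : (fun n => _) = fun=> 0); first exact: cvg_cst.
  apply/funext => n; apply: cell_sum0 => /andP[h1 h2]; apply: sT.
  by rewrite /= in_itv/= ltW.
rewrite mem_set// mulr1; move: sT; rewrite /= in_itv/= => /andP[s1 sT].
have sT0 : 0 < s <= T by rewrite lt_neqAle eq_sym s0 s1.
have /choice[r Hr] n : exists i, (i < 2 ^ n)%N /\ cell n i s by have [i] := cell_exists n sT0; exists i.
have -> : (fun n => \sum_(0 <= i < 2 ^ n) Y (dyad T n i.+1) w * \1_(cell n i) s) =
   fun n => Y (dyad T n (r n).+1) w.
  by apply/funext => n; have [h1 h2] := Hr n; rewrite (cell_sum (fun i => Y (dyad T n i.+1) w) h1 h2).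
apply: (right_approx (Y := Y ^~ w)) => // [|n|n]; first by rewrite s1.
  have [h1] := Hr n; rewrite /cell/= in_itv/= => /andP[_ ->].
  by have /andP[] := dyad_itv T_gt0 h1.
have [_] := Hr n; rewrite /cell/= in_itv/= => /andP[h1 _].
by have := cell_size n (r n); lra.
Qed.

(** A mean-square bound at each time, integrated over time; time 0 is exempt as a null set, since no
    cell contains it. *)
Lemma sqn_slice_le (g : X1 -> R) (b : R -> R) : measurable_fun setT g -> intg leb b ->
  (forall s, 0 <= b s) ->
  (forall s, s != 0 -> (\int[P]_w ((g (s, w)) ^+ 2)%:E <= (b s)%:E)%E) ->
  sqint mu1 g /\ sqn mu1 g <= Ex leb b.
Proof.
move=> mg ib b0 H.
have mg2 : measurable_fun setT (fun x : X1 => ((g x) ^+ 2)%:E).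
  by apply/measurable_EFinP; exact: measurable_funX.
have g0 (x : X1) : (0 <= ((g x) ^+ 2)%:E)%E by rewrite lee_fin sqr_ge0.
have mb : measurable_fun setT (EFin \o b) by exact: measurable_int _ ib.
have le : (\int[mu1]_x ((g x) ^+ 2)%:E <= (Ex leb b)%:E)%E.
  rewrite [leLHS](@fubini_tonelli1 _ _ _ _ R lebesgue_measure P _ mg2 g0).
  rewrite -ExE//; apply: ae_ge0_le_integral => //.
  - by move=> s _; apply: integral_ge0.
  - exact: measurable_fun_fubini_tonelli_F.
  - by move=> s _; rewrite lee_fin.
  exists [set 0]; split; first exact: measurable_set1.
    by rewrite [LHS]lebesgue_measure_set1.
  move=> s /= Hs; apply: contrapT => /eqP s0; apply: Hs => _; exact: H.
have sg : sqint mu1 g by split=> //; apply: (le_lt_trans le); rewrite ltry.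
by split=> //; rewrite -lee_fin -sqnE.
Qed.

Lemma sqint_mart2 M : mart2 M -> (forall w, cadlag T (M ^~ w)) -> sqint mu1 (cut1 M).
Proof.
move=> mM cM; have [aM sM _] := mM; have [i1 _ _] := leb_T.
have mj : measurable_fun setT (cut1 M) by apply: cadlag_joint => // t tT; exact: (sM t tT).1.
have [] // := sqn_slice_le mj (intgZ (sqn P (M T)) i1).
  by move=> s; rewrite mulr_ge0 ?sqn_ge0// indicE.
move=> s _; rewrite /cut1/=; under eq_integral do rewrite D1E.
rewrite indicE/=; case: (pselect (`[0, T]%classic s)) => sT; last first.
  rewrite memNset// mulr0 integral0_eq// => w _; by rewrite mulr0 expr0n.
rewrite mem_set// mulr1; under eq_integral do rewrite mulr1.
have sT' : 0 <= s <= T by move: sT; rewrite /= in_itv.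
by rewrite sqnE ?lee_fin; [exact: mart2_sqn_le|exact: sM].
Qed.

(* The function s |-> E (M s)^2 is nondecreasing, so the errors of the cells telescope. *)
Lemma mart2_approx M n (phi : R -> R) : mart2 M -> (forall w, cadlag T (M ^~ w)) ->
  measurable_fun setT phi -> phi 0 = 0 -> (forall x y, `|phi x - phi y| <= `|x - y|) ->
  let v := fun x : X1 => \sum_(0 <= i < 2 ^ n) phi (M (dyad T n i) x.2) * \1_(cell n i) x.1 in
  sqint mu1 (fun x => phi (M x.1 x.2) * \1_D1 x - v x) /\
  sqn mu1 (fun x => phi (M x.1 x.2) * \1_D1 x - v x) <= T / 2 ^+ n * sqn P (M T).
Proof.
move=> mM cM mphi phi0 lip v; have [aM sM _] := mM.
have mMt t : 0 <= t <= T -> measurable_fun setT (M t) by move=> tT; exact: (sM t tT).1.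
have mphiM t : 0 <= t <= T -> measurable_fun setT (fun w => phi (M t w)).
  by move=> tT; apply: measurableT_comp => //; exact: mMt.
have mj : measurable_fun setT (cut1 M) by exact: cadlag_joint.
have mv : measurable_fun setT v.
  by apply: (@m_cell_sum n (fun i w => phi (M (dyad T n i) w))) => i iN; apply: mphiM; exact: dyad_itv T_gt0 (ltnW iN).
have mg : measurable_fun setT (fun x : X1 => phi (M x.1 x.2) * \1_D1 x - v x).
  apply: measurable_funB => //.
  rewrite (_ : (fun x => _) = fun x => phi (cut1 M x)); first exact: measurableT_comp.
  by apply/funext => x; rewrite /cut1; case: (indic01 D1 x) => ->; rewrite ?mulr0 ?mulr1.
pose q i := sqn P (M (dyad T n i)).
have q_mono i : (i < 2 ^ n)%N -> q i <= q i.+1.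
  move=> iN; have /andP[i0 _] := dyad_itv T_gt0 (ltnW iN); have /andP[_ iT] := dyad_itv T_gt0 iN.
  by rewrite /q (mart2_contraction mM i0 (dyad_mono n T_gt0 (leqnSn i)) iT) lerDl sqn_ge0.
pose c i := if (i < 2 ^ n)%N then q i.+1 - q i else 0.
have c0 i : 0 <= c i by rewrite /c; case: ifPn => // /q_mono; rewrite subr_ge0.
pose b (s : R) := \sum_(0 <= i < 2 ^ n) c i * \1_(cell n i) s.
have icell i : [/\ intg leb (\1_(cell n i) : R -> R), sqint leb (\1_(cell n i) : R -> R) &
     Ex leb (\1_(cell n i) : R -> R) = T / 2 ^+ n].
  have [||h1 h2 h3] := @indic_intg _ (measurableTypeR R) leb (cell n i); rewrite ?leb_itv_lty//.
    exact: measurable_itv.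
  split=> //; rewrite h3 /cell /= lebesgue_measure_itv/= lte_fin -subr_gt0 cell_size divr_gt0 ?exprn_gt0//=.
  exact: cell_size.
have ib : intg leb b by apply: intg_sum => i; apply: intgZ; case: (icell i).
have Eb : Ex leb b = T / 2 ^+ n * (q (2 ^ n)%N - q 0%N).
  rewrite Ex_sum; last by move=> i; apply: intgZ; case: (icell i).
  rewrite -(telescope_sumr q) ?leq0n// mulr_sumr; apply: eq_big_nat => i /andP[_ iN].
  by have [h1 _ h2] := icell i; rewrite ExZ// h2 /c iN mulrC.
have [] := sqn_slice_le mg ib.
- by move=> s; apply: sumr_ge0 => i _; rewrite mulr_ge0// indicE.
- move=> s s0; have [sT|sT] := pselect (0 < s <= T); last first.
    rewrite /b cell_sum0// integral0_eq// => w _; rewrite /v /= cell_sum0// subr0 D1E indicE memNset ?mulr0 ?expr0n//.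
    by rewrite /= in_itv/= => /andP[h1 h2]; apply: sT; rewrite lt_neqAle eq_sym s0 h1.
  have [i iN si] := cell_exists n sT; rewrite /b (cell_sum _ iN si) /c iN.
  have := si; rewrite /cell/= in_itv/= => /andP[/ltW si1 si2].
  have /andP[i0 _] := dyad_itv T_gt0 (ltnW iN); have /andP[_ iT] := dyad_itv T_gt0 iN.
  have /andP[_ sT'] := sT.
  have s0' := le_trans i0 si1.
  have sTT : 0 <= s <= T by rewrite s0'.
  have sd : sqint P (fun w => M s w - M (dyad T n i) w).
    by apply: sqintB; apply: sM => //; exact: dyad_itv T_gt0 (ltnW iN).
  apply: (@le_trans _ _ (\int[P]_w ((M s w - M (dyad T n i) w) ^+ 2)%:E)%E).
    apply: ge0_le_integral_nonmeasurable => w; rewrite lee_fin ?sqr_ge0// /v /=.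
    rewrite (cell_sum (fun i => phi (M (dyad T n i) w)) iN si) D1E indicE mem_set; last by rewrite /= in_itv.
    by rewrite mulr1 -[leLHS]real_normK ?num_real// -[leRHS]real_normK ?num_real// lerXn2r ?nnegrE.
  rewrite sqnE// lee_fin.
  have h1 := mart2_contraction mM i0 si1 sT'.
  have h2 := mart2_contraction mM s0' si2 iT.
  have := sqn_ge0 P (fun w => M (dyad T n i.+1) w - M s w); rewrite /q; lra.
move=> sg le; split=> //; apply: (le_trans le); rewrite Eb ler_wpM2l//.
  by rewrite divr_ge0 ?exprn_ge0// ltW.
by rewrite /q dyad_last gerBl sqn_ge0.
Qed.

(** For fixed s the section of g belongs to the past of s, so M_T may be replaced by M_s under the
    expectation; Fubini then integrates over s. Square-integrability of the section is known for
    almost every s. *)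
Lemma Ex_mart2_mul M g : mart2 M -> (forall w, cadlag T (M ^~ w)) -> sqint mu1 g -> on_D1 g ->
  (forall s, 0 <= s <= T -> measurable_wrt (F s) (fun w => g (s, w))) ->
  Ex mu1 (fun x => M T x.2 * g x) = Ex mu1 (fun x => cut1 M x * g x).
Proof.
move=> mM cM sg Dg ag; have [aM sM oM] := mM; have sMT := sM T T_itv.
have i1 := intg_mul_D1 sg Dg sMT; have sj := sqint_mart2 mM cM; have i2 := sqintM sj sg.
apply/eqP; rewrite -subr_eq0 -ExB//; apply/eqP.
have ih := intgB i1 i2; set h := fun x => _ in ih *.
rewrite /Ex /Rintegral -(@integral12_prod_meas1 _ _ _ _ R lebesgue_measure P _ ih).
rewrite (_ : (\int[lebesgue_measure]_x _ = 0)%E)// -[RHS](integral0 lebesgue_measure setT).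
have mh := measurable_int _ ih.
apply: ae_eq_integral => //; first exact: (@measurable_fubini_F _ _ _ _ R lebesgue_measure P _ ih).
have [_ ig2] := (sqintP _ _).1 sg.
have := @ae_integrable1 _ _ _ _ R lebesgue_measure P _ ig2; apply: filterS => s is2 _.
have sgs : sqint P (fun w => g (s, w)) by apply/sqintP; split=> //; exact: m_section2 sg.1.
rewrite /fubini_F; case: (pselect (`[0, T]%classic s)) => sT; last first.
  rewrite integral0_eq// => w _; rewrite /h /= -(Dg (s, w)) D1E indicE memNset// !mulr0.
  by rewrite subrr.
have sT' : 0 <= s <= T by move: sT; rewrite /= in_itv.
have /andP[s0 sT1] := sT'.
have o := oM s T _ s0 sT1 (lexx T) (ag s sT') sgs.
have i3 := mart2_increment mM s0 sT1 (lexx T) (ag s sT') sgs.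
rewrite -[RHS]/(0%:E) -o -ExE//; apply: eq_integral => w _; congr EFin.
by rewrite /h /cut1 D1E indicE mem_set//=; ring.
Qed.

(** The sets whose section at s lies in [F s] form a sigma-algebra on the strip, and a generator ]a,
    b] x D with a < s has D in [F a], hence in [F s]. *)
Lemma pred1_section (X : X1 -> R) s : measurable_wrt pred1 X -> 0 <= s <= T ->
  measurable_wrt (F s) (fun w => X (s, w)).
Proof.
move=> pX sT C mC; have s0 : 0 <= s by case/andP: sT.
have := pX C mC; rewrite /pred1 /=.
have sF := F_sigma s0.
suff H : predictable_sets T F `<=` [set A | F s (fun w => A (s, w))].
  move=> /H /=; congr (F s _); apply/seteqP; split=> w /=; first by move=> [].
  by move=> h; split=> //; split=> //=; rewrite in_itv.
apply: smallest_sub.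
- split=> /=.
  + by case: sF.
  + move=> A FA; rewrite (_ : (fun w => _) = ~` (fun w => A (s, w))); first exact: (salgC sF).
    apply/seteqP; split=> w /=; first by move=> [].
    by move=> h; split=> //; split=> //=; rewrite in_itv.
  + move=> A FA; rewrite (_ : (fun w => _) = \bigcup_n (fun w => A n (s, w))).
      exact: (salg_bigcup sF).
    by apply/seteqP; split=> w [n _ h]; exists n.
move=> A [[D FD ->]|[a [b [D [a0 ab bT FD ->]]]]] /=.
  have [->|s1] := eqVneq s 0.
    rewrite (_ : (fun w => _) = D)//.
    by apply/seteqP; split=> w //= [].
  rewrite (_ : (fun w => _) = set0); first by case: sF.
  by apply/seteqP; split=> w //= [/= /eqP]; rewrite (negbTE s1).
have [h|h] := pselect (`]a, b]%classic s); last first.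
  rewrite (_ : (fun w => _) = set0); first by case: sF.
  by apply/seteqP; split=> w //= [].
rewrite (_ : (fun w => _) = D).
  by apply: F_mono FD => //; move: h; rewrite /= in_itv/= => /andP[/ltW].
by apply/seteqP; split=> w //= [].
Qed.

(** * The state equation *)

Lemma S2_bound (Y : R -> Omega -> R) (a : Omega -> \bar R) : cadlag_adapted T F Y ->
  measurable_fun setT a -> (forall w, 0 <= a w)%E -> (\int[P]_w a w < +oo)%E ->
  {ae P, forall w, forall t, 0 <= t <= T -> (((Y t w) ^+ 2)%:E <= a w)%E} -> S2 P T F Y.
Proof.
move=> cY ma a0 aoo [A [mA PA Aa]]; split=> //.
(* Infinite on the exceptional null set, so that b bounds the supremum for every outcome while
   having the same integral as [a]. *)
pose b w := (a w + (\1_A w)%:E * +oo)%E.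
have mI : measurable_fun setT (fun w => ((\1_A w : R)%:E * +oo)%E).
  apply: emeasurable_funM; last exact: measurable_cst.
  by apply/measurable_EFinP; exact: measurable_indic.
have mb : measurable_fun setT b by exact: emeasurable_funD.
have ab : {ae P, forall w, setT w -> b w = a w}.
  exists A; split=> // w /= H; apply: contrapT => nA; apply: H => _.
  by rewrite /b indicE memNset// mul0e adde0.
have Eb : (\int[P]_w b w = \int[P]_w a w)%E by apply: ae_eq_integral.
rewrite -Eb in aoo.
apply: le_lt_trans aoo; apply: ge0_le_integral_nonmeasurable => w.
  apply: le_trans (_ : ((Y 0 w) ^+ 2)%:E <= _)%E; first by rewrite lee_fin sqr_ge0.
  by apply: ereal_sup_ubound; exists 0 => //=; rewrite in_itv/= lexx ltW.
apply: ub_ereal_sup => _ [t + <-]; rewrite /= in_itv/= => tT.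
rewrite /b indicE; have [wA|wA] := pselect (A w).
  rewrite mem_set// mul1e (_ : (a w + +oo = +oo)%E) ?leey//.
  by have := a0 w; case: (a w).
rewrite memNset// mul0e adde0; apply: (contrapT _) => H; apply: wA; apply: Aa => /=.
by move=> h; apply: H; exact: h.
Qed.

Lemma S2_sqint Y t : S2 P T F Y -> 0 <= t <= T -> sqint P (Y t).
Proof.
move=> [[aY _] oo] tT; split; first by apply: (F_meas_wrt _ (aY t tT)); case/andP: tT.
apply: le_lt_trans oo; apply: ge0_le_integral_nonmeasurable => w; first by rewrite lee_fin sqr_ge0.
by apply: ereal_sup_ubound; exists t.
Qed.

Lemma section_cut (g : X1 -> R) t w : intg leb (fun s => g (s, w)) ->
  intg leb (fun s => g (s, w) * \1_`[0, t]%classic s).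
Proof.
move=> ig; apply: (intg_dom _ (_ : intg leb (fun s => `|g (s, w)|))).
- apply: measurable_funM; first exact: intg_meas ig.
  by apply: measurable_indic; exact: measurable_itv.
- exact: integrable_norm.
- by move=> s; case: (indic01 `[0, t]%classic s) => ->; rewrite ?mulr1// mulr0 normr0.
Qed.

Lemma section_intg (u : R -> Omega -> R) : sqint mu1 (cut1 u) ->
  {ae P, forall w, intg leb (fun s => cut1 u (s, w))}.
Proof. by move=> su; have [_ _] := tint_fubini (sqint_intg_D1 su (cut1_on_D1 u)). Qed.

Lemma ae_Rintegral_eq (u v : R -> Omega -> R) : measurable_fun setT (cut1 u) -> measurable_fun setT (cut1 v) ->
  {ae mu1, forall x, cut1 u x = cut1 v x} -> {ae P, forall w, forall t, 0 <= t <= T ->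
    \int[lebesgue_measure]_(s in `[0, t]) u s w = \int[lebesgue_measure]_(s in `[0, t]) v s w}.
Proof.
move=> mu_ mv uv; apply: filterS (ae_sections mu_ mv uv) => w h t tT.
have mi : measurable_fun setT (\1_`[0, t]%classic : measurableTypeR R -> R).
  by apply: measurable_indic; exact: measurable_itv.
rewrite !Rintegral_tint//; apply: Ex_ae.
- by apply: measurable_funM => //; exact: m_section1 mu_.
- by apply: measurable_funM => //; exact: m_section1 mv.
by apply: filterS h => s /= ->.
Qed.

Lemma sqr_Rintegral_le (u : R -> Omega -> R) : sqint mu1 (cut1 u) ->
  {ae P, forall w, forall t, 0 <= t <= T ->
    (\int[lebesgue_measure]_(s in `[0, t]) u s w) ^+ 2 <= T * tint (fun x => cut1 u x ^+ 2) w}.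
Proof.
move=> su; have [mu_ i2] := (sqintP _ _).1 su; have [_ _ a2] := tint_fubini i2.
apply: filterS a2 => w iw t tT; have /andP[t0 tT'] := tT; rewrite Rintegral_tint//.
have E : lebesgue_measure (`[0, t]%classic : set R) = t%:E.
  rewrite lebesgue_measure_itv/= lte_fin oppr0 adde0; case: ltP => //= h.
  by congr EFin; apply/eqP; rewrite eq_le t0 h.
have [||h1 h2 h3] := @indic_intg _ (measurableTypeR R) leb `[0, t]%classic.
- exact: measurable_itv.
- by rewrite /= E ltry.
have sgw : sqint leb (fun s => cut1 u (s, w)) by apply/sqintP; split=> //; exact: m_section1.
have := cauchy_schwarz sgw h2.
have -> : sqn leb (\1_`[0, t]%classic : R -> R) = t.
  transitivity (Ex leb (\1_`[0, t]%classic : R -> R)); last by rewrite h3 /= E.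
  by apply: Ex_ext => s; case: (indic01 `[0, t]%classic s) => ->; rewrite ?expr1n ?expr0n.
move=> /le_trans; apply; rewrite mulrC ler_wpM2r//.
exact: sqn_ge0.
Qed.

Section state.
Variables (sigma x0 : R) (gamma : R -> R).
(** The zero summands, here and in [gamma_part], are those that [is_intD] produces from a pure dB-
    and a pure dNtilde-integral. *)
Definition sigma_part (x : X1) : R := cut1 (fun _ _ => sigma) x + 0.
Definition gamma_part (x : X2) : R := 0 + cut2 (fun _ z _ => gamma z) x.

Local Notation steq := (state_equation P T F nu N B sigma gamma x0).

Lemma state_noise u X : steq u X -> cadlag_adapted T F X /\ exists I, [/\ is_int sigma_part gamma_part I,
    cadlag_adapted T F I &
    {ae P, forall w, forall t, 0 <= t <= T ->
       X t w = x0 + \int[lebesgue_measure]_(s in `[0, t]) u s w + I t w}].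
Proof.
move=> [cX [MB [MN [iB iN E]]]]; split=> //; exists (fun t w => MB t w + MN t w).
have iI := is_intD (ito_is_int iB) (poisson_is_int iN).
split=> //; first by case: iI.
by apply: filterS E => w h t tT; rewrite h// addrA.
Qed.

(** Two state equations come with their own versions of the stochastic integrals; being
    indistinguishable, they cancel in differences of states. *)
Lemma noise_unique I I' : is_int sigma_part gamma_part I -> is_int sigma_part gamma_part I' ->
  {ae P, forall w, forall t, 0 <= t <= T -> I t w = I' t w}.
Proof. by move=> h h'; exact: is_int_unique h h' _ _. Qed.

Lemma state_sqint u X : steq u X -> sqint mu1 (cut1 u) -> sqint P (X T).
Proof.
move=> /state_noise[[aX _] [I [iI _ E]]] su; have [_ _ _ [G [_ _ cI]]] := iI.
have [sI _] := cI T T_itv.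
apply: (ae_sqint _ _ (sqintD (sqintD (sqint_cst P x0) (sqint_tint su (cut1_on_D1 u))) sI)).
  exact: (F_meas_wrt (ltW T_gt0) (aX T T_itv)).
by apply: filterS E => w /(_ T T_itv) ->; rewrite Rintegral_tintT.
Qed.

(** The square of a sum of three terms is at most three times the sum of the squares; Cauchy-Schwarz
    bounds the drift uniformly in time and [doob_sup] the noise. *)
Lemma state_S2 u X : steq u X -> sqint mu1 (cut1 u) -> S2 P T F X.
Proof.
move=> /state_noise[cX [I [iI cI E]]] su.
have mI := is_int_mart2 iI; have [|a [ma a0 ia Ia]] := doob_sup mI.
  by apply: filterE; case: cI.
have [i2 _] := tint_sq su (cut1_on_D1 u).
set Q := tint _ in i2.
have Q0 w : 0 <= Q w by apply: Ex_ge0 => s; exact: sqr_ge0.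
pose c w : R := 3 * x0 ^+ 2 + 3 * (T * Q w).
have ic : intg P c by apply: intgD; [exact: intg_cst|do 2! apply: intgZ].
have mc : measurable_fun setT (EFin \o c) := measurable_int _ ic.
have c0 w : 0 <= c w.
  by apply: addr_ge0; apply: mulr_ge0 => //; [exact: sqr_ge0|exact: mulr_ge0 (ltW T_gt0) (Q0 w)].
apply: (@S2_bound _ (fun w => (c w)%:E + 3%:E * a w)%E cX).
- by apply: emeasurable_funD => //; exact: measurable_funeM.
- by move=> w; rewrite adde_ge0// ?lee_fin// mule_ge0// lee_fin.
- rewrite ge0_integralD//; last 3 first.
  + by move=> w _; rewrite lee_fin.
  + by move=> w _; rewrite mule_ge0// lee_fin.
  + exact: measurable_funeM.
  rewrite ge0_integralZl_EFin// ExE//; apply: lte_add_pinfty; first by rewrite ltry.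
  by apply: lte_mul_pinfty => //; apply: (le_lt_trans ia); rewrite ltry.
apply: filterS3 E Ia (sqr_Rintegral_le su) => w Ew Iw Uw t tT.
rewrite Ew//; have h1 := Uw t tT; have h2 := Iw t tT.
set U := Rintegral _ _ _ in h1 *.
have h3 : (x0 + U + I t w) ^+ 2 <= 3 * x0 ^+ 2 + 3 * U ^+ 2 + 3 * I t w ^+ 2.
  have := sqr_ge0 (x0 - U); have := sqr_ge0 (x0 - I t w); have := sqr_ge0 (U - I t w).
  by rewrite -subr_ge0 => *; nra.
apply: (@le_trans _ _ ((c w)%:E + 3%:E * ((I t w) ^+ 2)%:E)%E); last first.
  by apply: leeD => //; rewrite lee_pmul2l.
rewrite -EFinM -EFinD lee_fin; apply: (le_trans h3); rewrite lerD2r /c lerD2l.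
by rewrite ler_wpM2l.
Qed.

Lemma performanceE u X : sqint mu1 (cut1 u) -> sqint P (X T) ->
  performance P T X u = (- 2^-1 * sqn P (X T) - 2^-1 * sqn mu1 (cut1 u))%:E.
Proof.
move=> su sX; have [i2 _] := tint_sq su (cut1_on_D1 u).
have [_ iX] := (sqintP _ _).1 sX.
have i3 : intg P (fun w => - 2^-1 * X T w ^+ 2 - 2^-1 * tint (fun x => cut1 u x ^+ 2) w).
  by apply: intgB; exact: intgZ.
rewrite /performance unlock.
transitivity (\int[P]_w (- 2^-1 * X T w ^+ 2 - 2^-1 * tint (fun x => cut1 u x ^+ 2) w)%:E)%E.
  apply: eq_integral => w _; congr (_ - _ * _)%:E.
  rewrite (Rintegral_tintT (fun t w => u t w ^+ 2)); apply: (@Ex_ext _ _ _ leb) => s.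
  by rewrite /cut1 exprMn; case: (indic01 D1 (s, w)) => ->; rewrite ?expr1n ?expr0n.
rewrite ExE// ExB//; [|exact: intgZ|exact: intgZ].
by rewrite !ExZ// sqn_tint.
Qed.

(** * The maximum principle *)

Lemma Ex_indic_mul A (f : Omega -> R) : measurable A -> intg P f ->
  (\int[P]_(w in A) (f w)%:E = (Ex P (fun w => \1_A w * f w))%:E)%E.
Proof.
move=> mA jf; rewrite -ExE.
  rewrite [LHS]integral_mkcond; apply: eq_integral => w _; rewrite patchE indicE.
  by case: ifPn => _; rewrite ?mul1r// mul0r.
apply: (intg_dom _ (_ : intg P (fun w => `|f w|))); last 2 first.
- exact: integrable_norm.
- by move=> w; case: (indic01 A w) => ->; rewrite ?mul1r// mul0r normr0.
by apply: measurable_funM; [exact: measurable_indic|exact: intg_meas jf].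
Qed.

(** A derivative at 0 from the right. If b < 0, the choice of e as the minimum of 1 and -b / (a + 1)
    makes e a + 2 b negative. *)
Lemma quadratic_ge0 (a b : R) : 0 <= a -> (forall e, 0 < e <= 1 -> 0 <= e ^+ 2 * a + 2 * e * b) -> 0 <= b.
Proof.
move=> a0 H; rewrite leNgt; apply/negP => b0; pose e := Num.min 1 (- b / (a + 1)).
have a1 : 0 < a + 1 by rewrite ltr_wpDl.
have e0 : 0 < e by rewrite lt_min ltr01 divr_gt0// oppr_gt0.
have e1 : e <= 1 by rewrite ge_min lexx.
have eb : e * (a + 1) <= - b by rewrite -ler_pdivlMr// ge_min lexx orbT.
have := H e; rewrite e0 e1 => /(_ isT).
rewrite (_ : _ + _ = e * (e * a + 2 * b)); last by ring.
rewrite pmulr_rge0//; lra.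
Qed.

Lemma sqnDZ (d1 : measure_display) (X : measurableType d1) (mu : {measure set X -> \bar R})
   (f g : X -> R) e : sqint mu f -> sqint mu g ->
  sqn mu (fun x => f x + e * g x) = sqn mu f + e ^+ 2 * sqn mu g + 2 * (e * Ex mu (fun x => f x * g x)).
Proof.
move=> sf sg; rewrite (sqnD sf (sqintZ e sg)) (sqnZ e sg) -(ExZ e (sqintM sf sg)).
by congr (_ + 2 * _); apply: Ex_ext => x; ring.
Qed.

Lemma cut1_pos p x : cut1 (fun t w => Num.max (p t w) 0) x = pos (cut1 p x).
Proof. by rewrite /cut1 /pos; case: (indic01 D1 x) => ->; rewrite ?mulr1// !mulr0 maxxx. Qed.

Lemma measurable_pos : measurable_fun setT (pos : R -> R).
Proof. exact: measurable_maxr. Qed.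

Lemma norm_pos_le (x : R) : `|pos x| <= `|x|.
Proof. by rewrite ger0_norm ?pos_ge0// /pos ge_max normr_ge0 ler_norm. Qed.

Lemma sqint_pos_part p : mart2 p -> (forall w, cadlag T (p ^~ w)) ->
  sqint mu1 (cut1 (fun t w => Num.max (p t w) 0)).
Proof.
move=> mp cp; have sp := sqint_mart2 mp cp.
apply: (sqint_dom _ sp) => [|x]; last by rewrite cut1_pos norm_pos_le.
by rewrite (_ : cut1 _ = fun x => pos (cut1 p x)); [apply: (measurableT_comp measurable_pos); exact: sp.1|exact/funext/cut1_pos].
Qed.

Section variation.
Variables (u X p : R -> Omega -> R).
Hypothesis optX : optimal P T F nu N B sigma gamma x0 u X.
Hypothesis mp : mart2 p.
Hypothesis cp : forall w, cadlag T (p ^~ w).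
Hypothesis pT : {ae P, forall w, p T w = - X T w}.

Lemma optimal_sqint : [/\ predictable T F u, sqint mu1 (cut1 u) & steq u X].
Proof. by case: optX => -[/L2P[pu su] _] sX _; split. Qed.

(* The derivative of the performance in the direction v - u, in which the terminal
   term becomes a term in p by the martingale property. *)
Lemma variational_inequality v V : admissible P T F v -> cadlag_adapted T F V ->
  (forall t w, 0 <= t <= T -> V t w = \int[lebesgue_measure]_(s in `[0, t]) v s w) ->
  Ex mu1 (fun x => (cut1 p x - cut1 u x) * (cut1 v x - cut1 u x)) <= 0.
Proof.
move=> av cV VE; have [pu su sX] := optimal_sqint; have [L2v v0] := av.
have [pv sv] := (L2P v).1 L2v.
have [[_ u0] [cX [MB [MN [iB iN E]]]] opt] := optX.
pose h (x : X1) := cut1 v x - cut1 u x.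
have sh : sqint mu1 h by exact: sqintB.
have Dh : on_D1 h by move=> x; rewrite /h mulrBl !cut1_on_D1.
have sXT := state_sqint sX su; have sth := sqint_tint sh Dh.
have sp := sqint_mart2 mp cp.
have sjp : sqint P (p T) by case: mp => _ /(_ T T_itv).
pose b1 := Ex P (fun w => X T w * tint h w); pose b2 := Ex mu1 (fun x => cut1 u x * h x).
pose b := b1 + b2.
have b0 : 0 <= b.
  (* Moving u by e (v - u) changes the cost by half of this quadratic in e, and optimality makes the
     change nonnegative. *)
  apply: (@quadratic_ge0 (sqn P (tint h) + sqn mu1 h)); first by rewrite addr_ge0 ?sqn_ge0.
  move=> e /andP[e0 e1].
  pose ve t w := u t w + e * (v t w - u t w).
  have cve x : cut1 ve x = cut1 u x + e * h x by rewrite /h /cut1 /ve /=; ring.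
  have seh : sqint mu1 (fun x => e * h x) by exact: sqintZ.
  have sve : sqint mu1 (cut1 ve) by apply: sqint_ext (sqintD su seh) => x; rewrite cve.
  (* X - x0 - MB - MN equals the time integral of u almost surely, and it is already known to be
     adapted and cadlag for every outcome, as a state must be. The process V serves the same purpose
     for v. *)
  pose Y t w := X t w + e * (V t w - (X t w - x0 - MB t w - MN t w)).
  have cY : cadlag_adapted T F Y.
    have [_ _ cMB _] := ito_is_int iB; have [_ _ cMN _] := poisson_is_int iN.
    have c0 : cadlag_adapted T F (fun _ _ => x0).
      by split=> [t /andP[t0 _]|w]; [exact: mwrt_cst (F_sigma t0) _|exact: cadlag_cst].
    have cN := cadlag_adaptedB (cadlag_adaptedB (cadlag_adaptedB cX c0) cMB) cMN.
    exact: cadlag_adaptedD cX (cadlag_adaptedZ e (cadlag_adaptedB cV cN)).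
  have Yeq : {ae P, forall w t, 0 <= t <= T ->
      Y t w = X t w + e * (V t w - \int[lebesgue_measure]_(s in `[0, t]) u s w)}.
    by apply: filterS E => w H t tT; rewrite /Y H//; ring.
  have sY : steq ve Y.
    split=> //; exists MB, MN; split=> //.
    have iuv : {ae P, forall w, intg leb (fun s => cut1 u (s, w)) /\ intg leb (fun s => cut1 v (s, w))}.
      by apply: filterS2 (section_intg su) (section_intg sv) => w; split.
    apply: filterS3 Yeq E iuv => w Yw Xw [iu iv] t tT.
    rewrite Yw// Xw// VE// !Rintegral_tint//.
    have iu' := section_cut t iu; have iv' := section_cut t iv.
    have -> : tint (fun x => cut1 ve x * \1_`[0, t]%classic x.1) w =
      tint (fun x => cut1 u x * \1_`[0, t]%classic x.1) w + e * (tint (fun x => cut1 v x * \1_`[0, t]%classic x.1) w - tint (fun x => cut1 u x * \1_`[0, t]%classic x.1) w).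
      rewrite /tint -(ExB iv' iu') -(ExZ e (intgB iv' iu')) -(ExD iu' (intgZ e (intgB iv' iu'))).
      by apply: Ex_ext => s; rewrite cve /h /=; ring.
    ring.
  have ave : admissible P T F ve.
    split; last first.
      move=> t w tT; rewrite /ve (_ : _ + _ = (1 - e) * u t w + e * v t w); last by ring.
      by rewrite addr_ge0// mulr_ge0 ?subr_ge0 ?u0 ?v0// ltW.
    apply/L2P; split=> //; apply/predictableP.
    have pu' := (predictableP u).1 pu; have pv' := (predictableP v).1 pv.
    apply: (mwrtD pred1_sigma pu').
    exact: (mwrt_comp pred1_sigma (mulrl_measurable e) (mwrtB pred1_sigma pv' pu')).
  have sYT := state_sqint sY sve.
  have : (performance P T Y ve <= performance P T X u)%E.
    by rewrite opt; apply: ereal_sup_ubound; exists ve, Y.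
  rewrite !performanceE// lee_fin.
  have -> : sqn mu1 (cut1 ve) = sqn mu1 (cut1 u) + e ^+ 2 * sqn mu1 h + 2 * (e * b2).
    by rewrite (sqn_ext _ cve) sqnDZ.
  have seth : sqint P (fun w => e * tint h w) by exact: sqintZ.
  have -> : sqn P (Y T) = sqn P (X T) + e ^+ 2 * sqn P (tint h) + 2 * (e * b1).
    transitivity (sqn P (fun w => X T w + e * tint h w)).
      apply: Ex_ae.
      - by apply: measurable_funX; exact: sYT.1.
      - by apply: measurable_funX; exact: (sqintD sXT seth).1.
      apply: filterS3 Yeq (section_intg su) (section_intg sv) => w Yw iu iv.
      rewrite Yw ?T_itv// VE ?T_itv// !Rintegral_tintT /tint -ExB//.
    exact: sqnDZ.
  rewrite /b; move: (b1) (b2) (sqn P (X T)) (sqn P (tint h)) (sqn mu1 (cut1 u)) (sqn mu1 h) => *; lra.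
have sph : intg mu1 (fun x => cut1 p x * h x) by exact: sqintM.
have suh : intg mu1 (fun x => cut1 u x * h x) by exact: sqintM.
have -> : Ex mu1 (fun x => (cut1 p x - cut1 u x) * (cut1 v x - cut1 u x)) =
   Ex mu1 (fun x => cut1 p x * h x) - Ex mu1 (fun x => cut1 u x * h x).
  by rewrite -ExB//; apply: Ex_ext => x; rewrite /h; ring.
rewrite -Ex_mart2_mul//; last first.
  have sE (w' : R -> Omega -> R) : measurable_wrt pred1 (fun x => w' x.1 x.2) ->
      forall s, 0 <= s <= T -> measurable_wrt (F s) (fun w => cut1 w' (s, w)).
    move=> pw s sT; rewrite (_ : (fun w => _) = fun w => w' s w).
      exact: (pred1_section pw sT).
    by apply/funext => w; rewrite /cut1 D1E indicE mem_set ?mulr1//= in_itv.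
  move=> s sT; have s0 : 0 <= s by case/andP: sT.
  by apply: (mwrtB (F_sigma s0)); apply: sE => //; exact/predictableP.
rewrite -(Ex_tint_mul sh Dh sjp).
have -> : Ex P (fun w => p T w * tint h w) = - Ex P (fun w => X T w * tint h w).
  rewrite -ExN; last exact: sqintM.
  have m1 := intg_meas (sqintM sXT sth); have m2 := intg_meas (sqintM sjp sth).
  apply: Ex_ae => //; first exact: measurableT_comp.
  by apply: filterS pT => w ->; rewrite mulNr.
by move: b0; rewrite /b /b1 /b2 -oppr_le0 opprD.
Qed.

Lemma cell_cut n i t : 0 <= t <= T -> (i < 2 ^ n)%N ->
  Ex leb (fun s => \1_(cell n i) s * \1_`[0, t]%classic s) =
  Num.min (dyad T n i.+1) t - Num.min (dyad T n i) t.
Proof.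
move=> /andP[t0 tT] iN; have /andP[i0 _] := dyad_itv T_gt0 (ltnW iN).
have ii := dyad_mono n T_gt0 (leqnSn i).
rewrite (@Ex_ext _ _ _ leb _ (\1_(`]Num.min (dyad T n i) t, Num.min (dyad T n i.+1) t]%classic : set R))); last first.
  move=> s; have -> : \1_(cell n i) s * \1_`[0, t]%classic s = \1_(cell n i `&` `[0, t]%classic) s :> R by rewrite indicI.
  congr (\1__ s); apply/seteqP; split=> r; rewrite /cell/= !in_itv/=.
    by move=> [/andP[h1 h2] /andP[h3 h4]]; rewrite le_min gt_min h1 h2 h4.
  case: (leP (dyad T n i) t) => h; case: (leP (dyad T n i.+1) t) => h' /andP[h1 h2].
  - by rewrite h1 h2 (le_trans h2 h') (le_trans i0 (ltW h1)).
  - by rewrite h1 h2 (le_trans h2 (ltW h')) (le_trans i0 (ltW h1)).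
  - by have := lt_le_trans h1 h2; lra.
  - by have := lt_le_trans h1 h2; lra.
have [||_ _ ->] := @indic_intg _ (measurableTypeR R) leb `]Num.min (dyad T n i) t, Num.min (dyad T n i.+1) t]%classic.
- exact: measurable_itv.
- exact: leb_itv_lty.
rewrite /= lebesgue_measure_itv/= lte_fin; case: ltP => [//|h].
apply/eqP; rewrite eq_sym subr_eq0 eq_le h /=.
by case: (leP (dyad T n i) t) => h1; case: (leP (dyad T n i.+1) t) => h2; lra.
Qed.

(** Left-end values make the control predictable. Its time integral is an explicit sum over cells
    stopped at t, which supplies the cadlag adapted process asked for by [variational_inequality].
    At time 0 the control is 0, as no cell contains it. *)
Lemma pos_cell_control n : let v t w := \sum_(0 <= i < 2 ^ n) pos (p (dyad T n i) w) * \1_(cell n i) t in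
  [/\ admissible P T F v, forall x, cut1 v x = v x.1 x.2 &
   exists V, cadlag_adapted T F V /\ forall t w, 0 <= t <= T ->
     V t w = \int[lebesgue_measure]_(s in `[0, t]) v s w].
Proof.
move=> v; have [ap sp _] := mp.
have mpos : measurable_fun setT (pos : R -> R) by apply: measurable_maxr.
pose H i := if (i < 2 ^ n)%N then fun w => pos (p (dyad T n i) w) else fun=> 0.
have vE t w : v t w = \sum_(0 <= i < 2 ^ n) H i w * \1_(cell n i) t.
  by apply: eq_big_nat => i /andP[_ iN]; rewrite /H iN.
have FH i : (i < 2 ^ n)%N -> measurable_wrt (F (dyad T n i)) (H i).
  move=> iN; rewrite /H iN; have tT := dyad_itv T_gt0 (ltnW iN).
  by apply: (mwrt_comp _ mpos (ap _ tT)); apply: F_sigma; case/andP: tT.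
have sH i : sqint P (H i).
  rewrite /H; case: ifPn => iN; last exact: sqint0.
  have spi := sp _ (dyad_itv T_gt0 (ltnW iN)).
  apply: (sqint_dom _ spi); first by apply: measurableT_comp => //; exact: spi.1.
  by move=> w; rewrite ger0_norm ?pos_ge0// /pos ge_max normr_ge0 ler_norm.
have cv x : cut1 v x = v x.1 x.2.
  rewrite /cut1; have [h|h] := pselect (0 < x.1 <= T); last by rewrite /v cell_sum0// mul0r.
  by rewrite D1E indicE mem_set ?mulr1//= in_itv/=; case/andP: h => /ltW -> ->.
have sv : sqint mu1 (cut1 v).
  apply: (@sqint_ext _ _ _ _ (fun x : X1 => \sum_(0 <= i < 2 ^ n) H i x.2 * \1_(cell n i) x.1)).
    by move=> x; rewrite cv vE.
  apply: sqint_sum => i.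
  have [||_ s1 _] := @indic_intg _ (measurableTypeR R) leb (cell n i).
  - exact: measurable_itv.
  - exact: leb_itv_lty.
  by apply: sqint_ext (@sqint_prod _ _ _ _ lebesgue_measure P _ _ s1 (sH i)) => x; rewrite mulrC.
split=> //.
  split; last by move=> t w _; apply: sumr_ge0 => i _; rewrite mulr_ge0 ?pos_ge0// indicE.
  apply/L2P; split=> //; apply/predictableP.
  rewrite (_ : (fun x => _) = fun x : X1 => \sum_(0 <= i < 2 ^ n) (if (i < 2 ^ n)%N then \1_(cell n i) x.1 * H i x.2 else 0)).
    apply: mwrt_sum; first exact: pred1_sigma.
    move=> i; case: (boolP (i < 2 ^ n)%N) => iN; last exact: mwrt_cst pred1_sigma _.
    apply: (mwrt_indic_prod pred1_sigma) => C mC.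
    have /andP[i0 _] := dyad_itv T_gt0 (ltnW iN); have /andP[_ iT] := dyad_itv T_gt0 iN.
    exact: (pred1_itv i0 (dyad_mono n T_gt0 (leqnSn i)) iT (FH i iN C mC)).
  by apply/funext => x; rewrite vE; apply: eq_big_nat => i /andP[_ iN]; rewrite iN mulrC.
exists (fun t w => \sum_(0 <= i < 2 ^ n) (if (i < 2 ^ n)%N then
   H i w * (Num.min (dyad T n i.+1) t - Num.min (dyad T n i) t) else 0)); split.
  split=> [t tT|w]; last first.
    apply: cadlag_sum => i; case: (boolP (i < 2 ^ n)%N) => _; last exact: cadlag_cst.
    by apply: cadlagZ; apply: cadlagB; apply: (cadlag_min _ (cadlag_id T)).
  have t0 : 0 <= t by case/andP: tT.
  apply: mwrt_sum; first exact: (F_sigma t0).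
  move=> i; case: (boolP (i < 2 ^ n)%N) => iN; last exact: mwrt_cst (F_sigma t0) _.
  have [ti|ti] := leP (dyad T n i) t; last first.
    rewrite (_ : (fun w => _) = fun=> 0); first exact: mwrt_cst (F_sigma t0) _.
    apply/funext => w; have h := le_trans (ltW ti) (dyad_mono n T_gt0 (leqnSn i)).
    by rewrite (min_r h) subrr mulr0.
  apply: (mwrtM (F_sigma t0)); last exact: mwrt_cst (F_sigma t0) _.
  have /andP[i0 _] := dyad_itv T_gt0 (ltnW iN).
  exact: mwrt_mono i0 ti (FH i iN).
move=> t w tT; rewrite Rintegral_tint//.
have ic i : intg leb (fun s => H i w * (\1_(cell n i) s * \1_`[0, t]%classic s)).
  apply: intgZ.
  have [||i1 _ _] := @indic_intg _ (measurableTypeR R) leb (cell n i).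
  - exact: measurable_itv.
  - exact: leb_itv_lty.
  apply: (intg_dom _ i1); last by move=> s; case: (indic01 `[0, t]%classic s) => ->; rewrite ?mulr1 ?mulr0 ?normr0 ?ger0_norm// indicE.
  by apply: measurable_funM; apply: measurable_indic; exact: measurable_itv.
rewrite /tint (@Ex_ext _ _ _ leb _ (fun s => \sum_(0 <= i < 2 ^ n) H i w * (\1_(cell n i) s * \1_`[0, t]%classic s))); last first.
  by move=> s; rewrite cv vE /= mulr_suml; apply: eq_bigr => i _; ring.
rewrite Ex_sum//; apply: eq_big_nat => i /andP[_ iN]; rewrite iN ExZ ?cell_cut//.
have [||i1 _ _] := @indic_intg _ (measurableTypeR R) leb (cell n i `&` `[0, t]%classic).
- by apply: measurableI; exact: measurable_itv.
- apply: (le_lt_trans (_ : _ <= lebesgue_measure (cell n i))%E); last exact: leb_itv_lty.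
  apply: le_measure; rewrite ?inE//; first by apply: measurableI; exact: measurable_itv.
  exact: measurable_itv.
by apply: intg_ext i1 => s; rewrite indicI.
Qed.

Lemma optimal_feedback : {ae mu1, forall x, cut1 u x = cut1 (fun t w => Num.max (p t w) 0) x}.
Proof.
have [pu su sX] := optimal_sqint; have sp := sqint_mart2 mp cp.
pose pp := cut1 (fun t w => Num.max (p t w) 0).
have ppE x : pp x = pos (cut1 p x) := cut1_pos p x; have spp : sqint mu1 pp := sqint_pos_part mp cp.
pose v n t w := \sum_(0 <= i < 2 ^ n) pos (p (dyad T n i) w) * \1_(cell n i) t.
have adm n := pos_cell_control n.
have sv n : sqint mu1 (cut1 (v n)) by case: (adm n) => -[/L2P[]].
have cv : sq_cvg mu1 (fun n => cut1 (v n)) pp.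
  apply: (@sq_cvg_le _ _ _ _ _ _ (fun n => T / 2 ^+ n * sqn P (p T))).
    move=> n; have pos0 : pos (0 : R) = 0 by rewrite /pos maxxx.
    have lip (x y : R) : `|pos x - pos y| <= `|x - y|.
      by have := pos_diff y (x - y); rewrite subrKC.
    have [_] := mart2_approx n mp cp measurable_pos pos0 lip; congr (_ <= _).
    apply: sqn_ext => x; have [_ -> _] := adm n; by [].
  by rewrite -[X in _ --> X](mul0r (sqn P (p T))); apply: cvgMl; exact: mesh_cvg.
have sh := sqintB sp su.
have c2 := sq_cvg_inner sv spp sh cv.
have le : Ex mu1 (fun x => (cut1 p x - cut1 u x) * pp x) - Ex mu1 (fun x => (cut1 p x - cut1 u x) * cut1 u x) <= 0.
  rewrite subr_le0; apply: (ler_cvg_to c2 (cvg_cst _)).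
  apply: nearW => n; have [av _ [V [cV VE]]] := adm n.
  have := variational_inequality av cV VE.
  rewrite (@Ex_ext _ _ _ _ _ (fun x => (cut1 p x - cut1 u x) * cut1 (v n) x - (cut1 p x - cut1 u x) * cut1 u x)).
    by rewrite ExB ?subr_le0//; exact: sqintM.
  by move=> x; rewrite mulrBr.
rewrite -ExB in le; [|exact: sqintM|exact: sqintM].
have sd := sqintB spp su.
have z : sqn mu1 (fun x => pp x - cut1 u x) = 0.
  apply/eqP; rewrite eq_le sqn_ge0 andbT; apply: le_trans le.
  apply: Ex_le; first by have [] := (sqintP _ _).1 sd.
    by apply: intgB; exact: sqintM.
  (* The square of p^+ - u is at most (p - u) (p^+ - u): there is equality where p > 0, and where p
     <= 0 the claim reads u^2 <= u^2 - p u, which holds since u >= 0. *)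
  move=> x; rewrite ppE -mulrBr.
  have u0 : 0 <= cut1 u x.
    rewrite /cut1 D1E indicE; have [h|h] := pselect (`[0, T]%classic x.1); last by rewrite memNset// mulr0.
    rewrite mem_set// mulr1; case: optX => -[_ a] _ _; apply: a.
    by move: h; rewrite /= in_itv.
  rewrite /pos; case: (leP (cut1 p x) 0) => h; last by rewrite expr2.
  by rewrite sub0r sqrrN mulrN -subr_ge0; have := mulr_ge0 u0 u0; have := mulr_le0_ge0 h u0; rewrite expr2; lra.
by apply: filterS (sqn_eq0_ae sd z) => x /eqP; rewrite subr_eq0 => /eqP.
Qed.

End variation.

(** * The forward-backward system *)

Local Notation solution := (fbsde_solution P T F nu N B sigma gamma x0).

Lemma cadlag_adapted_cst X : measurable_wrt (F 0) X -> cadlag_adapted T F (fun=> X).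
Proof.
move=> FX; split=> [t /andP[t0 _]|w]; last exact: cadlag_cst.
exact: mwrt_mono FX.
Qed.

(** The martingale property of p is derived from its equation: an initial value, square-integrable
    by [S2], plus a stochastic integral. *)
Lemma solution_integral X p q r : solution X p q r ->
  exists I, [/\ is_int (fun x => cut1 q x + 0) (fun x => 0 + cut2 r x) I, mart2 p &
    {ae P, forall w, forall t, 0 <= t <= T -> p t w = p 0 w + I t w}].
Proof.
move=> [_ Sp _ _ [_ [MB [MN [iB iN E _]]]]].
have iI := is_intD (ito_is_int iB) (poisson_is_int iN).
have Ep : {ae P, forall w, forall t, 0 <= t <= T -> p t w = p 0 w + (MB t w + MN t w)}.
  by apply: filterS E => w h t tT; rewrite h// addrA.
have t0 : (0 : R) <= 0 <= T by rewrite lexx ltW.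
exists (fun t w => MB t w + MN t w); split=> //.
have [[ap _] _] := Sp.
have m0 := mart2_init (ap 0 t0) (S2_sqint Sp t0).
apply: (mart2_ae (mart2D m0 (is_int_mart2 iI)) ap) => t tT.
by apply: filterS Ep => w /(_ t tT) ->.
Qed.

Lemma ae_eq_of_sqn0 (d1 : measure_display) (X : measurableType d1) (mu : {measure set X -> \bar R})
  (f g : X -> R) : sqint mu f -> sqint mu g -> sqn mu (fun x => f x - g x) = 0 ->
  {ae mu, forall x, f x = g x}.
Proof.
move=> sf sg /(sqn_eq0_ae (sqintB sf sg)).
by apply: filterS => x /eqP; rewrite subr_eq0 => /eqP.
Qed.

Lemma cut1_at q t w : 0 <= t <= T -> cut1 q (t, w) = q t w.
Proof. by move=> tT; rewrite /cut1 D1E indicE mem_set ?mulr1//= in_itv. Qed.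

Lemma solution_unique X p q r X' p' q' r' : solution X p q r -> solution X' p' q' r' ->
  [/\ {ae P, forall w, forall t, 0 <= t <= T -> X' t w = X t w /\ p' t w = p t w},
      {ae mu1, forall x, 0 <= x.1 <= T -> q' x.1 x.2 = q x.1 x.2} &
      {ae mu2, forall x, 0 <= x.1.1 <= T -> Rnz R x.1.2 -> r' x.1.1 x.1.2 x.2 = r x.1.1 x.1.2 x.2}].
Proof.
move=> S S'; have [I [iI mp E]] := solution_integral S; have [I' [iI' mp' E']] := solution_integral S'.
have [SX Sp _ _ [sX [_ [_ [_ _ _ pT]]]]] := S; have [SX' Sp' _ _ [sX' [_ [_ [_ _ _ pT']]]]] := S'.
have [[_ cp] _] := Sp; have [[_ cp'] _] := Sp'.
have [_ [W [iW _ EX]]] := state_noise sX; have [_ [W' [iW' _ EX']]] := state_noise sX'.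
have WW := noise_unique iW iW'.
have su := sqint_pos_part mp cp; have su' := sqint_pos_part mp' cp'.
pose P1 := cut1 (fun t w => Num.max (p t w) 0); pose P1' := cut1 (fun t w => Num.max (p' t w) 0).
pose g x := P1 x - P1' x.
have sg : sqint mu1 g by exact: sqintB.
have Dg : on_D1 g by move=> x; rewrite /g mulrBl !cut1_on_D1.
have mD := mart2B mp mp'.
have cD w : cadlag T (fun t => p t w - p' t w) by exact: cadlagB.
have [ap _ _] := mp; have [ap' _ _] := mp'.
have sDT : sqint P (fun w => p T w - p' T w) by case: mD => _ /(_ T T_itv).
(* The initial state and the noise are common to both solutions, so only the difference of the
   drifts remains at time T. *)
have DT : {ae P, forall w, p T w - p' T w = - tint g w}.
  have pTT : {ae P, forall w, p T w = - X T w /\ p' T w = - X' T w} by apply: filterS2 pT pT' => w; split.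
  have iuv : {ae P, forall w, intg leb (fun s => P1 (s, w)) /\ intg leb (fun s => P1' (s, w))}.
    by apply: filterS2 (section_intg su) (section_intg su') => w; split.
  have XX : {ae P, forall w, X T w - X' T w = \int[lebesgue_measure]_(s in `[0, T]) Num.max (p s w) 0 - \int[lebesgue_measure]_(s in `[0, T]) Num.max (p' s w) 0}.
    apply: filterS3 EX EX' WW => w e1 e2 e3; rewrite (e1 _ T_itv) (e2 _ T_itv) (e3 _ T_itv); ring.
  apply: filterS3 pTT iuv XX => w [-> ->] [i1 i2] H.
  have -> : tint g w = X T w - X' T w.
    by rewrite H (Rintegral_tintT (fun t w => Num.max (p t w) 0)) (Rintegral_tintT (fun t w => Num.max (p' t w) 0)) /tint -ExB.
  ring.
have sth := sqint_tint sg Dg.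
have mm : Ex P (fun w => (p T w - p' T w) * tint g w) = - sqn P (tint g).
  have i2 := ((sqintP _ _).1 sth).2; rewrite -ExN//; apply: Ex_ae.
  - exact: intg_meas (sqintM sDT sth).
  - by apply: measurableT_comp => //; exact: intg_meas i2.
  by apply: filterS DT => w ->; rewrite mulNr expr2.
(* The positive part is nondecreasing, so this product is nonnegative; together with [mm] this
   forces the time integral of g, and hence p - p' at T, to vanish. *)
have pos_part x : 0 <= cut1 (fun t w => p t w - p' t w) x * g x.
  rewrite /g /P1 /P1' /cut1; case: (indic01 D1 x) => ->; rewrite ?mulr0 ?mul0r// !mulr1.
  set a := p _ _; set b := p' _ _; case: (leP a 0) => a0; case: (leP b 0) => b0.
  - by rewrite subrr mulr0.
  - by apply: mulr_le0; lra.
  - by apply: mulr_ge0; lra.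
  - by rewrite -expr2 sqr_ge0.
have ag s : 0 <= s <= T -> measurable_wrt (F s) (fun w => g (s, w)).
  move=> sT; have s0 : 0 <= s by case/andP: sT.
  have mpos : measurable_fun setT (pos : R -> R) by apply: measurable_maxr.
  rewrite (_ : (fun w => _) = fun w => pos (p s w) - pos (p' s w)).
    exact: (mwrtB (F_sigma s0) (mwrt_comp (F_sigma s0) mpos (ap s sT)) (mwrt_comp (F_sigma s0) mpos (ap' s sT))).
  by apply/funext => w; rewrite /g /P1 /P1' !cut1_at.
have z : sqn P (tint g) = 0.
  apply/eqP; rewrite eq_le sqn_ge0 andbT -oppr_ge0 -mm (Ex_tint_mul sg Dg sDT).
  by rewrite (Ex_mart2_mul mD cD sg Dg ag); exact: Ex_ge0.
have pp : {ae P, forall w, forall t, 0 <= t <= T -> p t w - p' t w = 0}.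
  apply: (mart2_eq0 mD cD); rewrite -[RHS]z; apply: Ex_ae.
  - by apply: measurable_funX; exact: sDT.1.
  - by apply: measurable_funX; exact: sth.1.
  by apply: filterS DT => w ->; rewrite sqrrN.
have pp' : {ae P, forall w, forall t, 0 <= t <= T -> p' t w = p t w}.
  by apply: filterS pp => w h t /h /eqP; rewrite subr_eq0 => /eqP ->.
(* The initial values agree as well, so the integral parts coincide at T and the isometry identifies
   both integrands. *)
have zI : sqn P (fun w => I T w - I' T w) = 0.
  have [_ sI _] := is_int_mart2 iI; have [_ sI' _] := is_int_mart2 iI'.
  rewrite -[RHS](Ex0 P); apply: Ex_ae.
  - apply: measurable_funX; apply: measurable_funB; [exact: (sI T T_itv).1|exact: (sI' T T_itv).1].
  - exact: measurable_cst.
  have t0 : (0 : R) <= 0 <= T by rewrite lexx ltW.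
  apply: filterS3 E E' pp' => w h h' k.
  have := h T T_itv; have := h' T T_itv; rewrite !k ?T_itv// => -> /addrI ->.
  by rewrite subrr expr0n.
have := is_int_isometry (is_intB iI iI'); rewrite zI => /esym/eqP.
rewrite paddr_eq0 ?sqn_ge0// => /andP[/eqP z1 /eqP z2].
have [s1 s2 _ _] := iI; have [s1' s2' _ _] := iI'.
split.
- have XE : {ae P, forall w, (forall t, 0 <= t <= T -> X t w = x0 + \int[lebesgue_measure]_(s in `[0, t]) Num.max (p s w) 0 + W t w) /\
      (forall t, 0 <= t <= T -> X' t w = x0 + \int[lebesgue_measure]_(s in `[0, t]) Num.max (p' s w) 0 + W' t w)}.
    by apply: filterS2 EX EX' => w; split.
  apply: filterS3 XE WW pp' => w [h h'] k l t tT; split; last exact: l.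
  rewrite h// h'// k//; congr (_ + _ + _); rewrite /Rintegral; congr fine.
  apply: eq_integral => s; rewrite inE /= in_itv/= => /andP[s0 st].
  by rewrite l// s0 (le_trans st)//; case/andP: tT.
- apply: filterS (ae_eq_of_sqn0 s1 s1' z1) => -[s w] /= + sT.
  by rewrite !addr0 !cut1_at.
- apply: filterS (ae_eq_of_sqn0 s2 s2' z2) => -[[s y] w] /= + sT yR.
  by rewrite !add0r /cut2 /= indicE mem_set ?mulr1//; split=> //; split=> //=; rewrite in_itv.
Qed.

Lemma solution_exists u X : optimal P T F nu N B sigma gamma x0 u X ->
  exists p q r, [/\ solution X p q r, mart2 p, (forall w, cadlag T (p ^~ w)) &
    {ae mu1, forall x, cut1 u x = cut1 (fun t w => Num.max (p t w) 0) x}].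
Proof.
move=> opt; have [pu su sX] := optimal_sqint opt.
have sXT := state_sqint sX su; have [[aX cX] _] := sX.
pose Y w := - X T w.
have sY : sqint P Y by exact: sqintN.
have FY : measurable_wrt (F T) Y.
  have := F_mwrtZ (-1) (ltW T_gt0) (aX T T_itv).
  by rewrite (_ : (fun w => _) = Y)//; apply/funext => w; rewrite mulN1r.
have [q [r [MB [MN [iB iN mB' mN' E]]]]] := martingale_representation FY sY.
pose p t w := Ex P Y + (MB t w + MN t w).
have iI := is_intD (ito_is_int iB) (poisson_is_int iN).
have c0 : measurable_wrt (F 0) (fun=> Ex P Y) := mwrt_cst (F_sigma (lexx 0)) _.
have mp : mart2 p.
  exact: mart2D (mart2_init c0 (sqint_cst P _)) (mart2D mB' mN').
have [_ _ cI _] := iI.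
have cp := cadlag_adaptedD (cadlag_adapted_cst c0) cI.
have pT : {ae P, forall w, p T w = - X T w} by apply: filterS E => w; rewrite /p /Y addrA => ->.
have fb := optimal_feedback opt mp cp.2 pT.
exists p, q, r; split=> //; last exact: cp.2.
have [Lq _ _] := iB; have [Lr _ _] := iN; split=> //.
- exact: state_S2 sX su.
- have [|a [ma a0 ia pa]] := doob_sup mp; first by apply: filterE; exact: cp.2.
  by apply: S2_bound cp ma a0 _ pa; apply: (le_lt_trans ia); rewrite ltry.
split.
  (* X already solves the state equation with control u; since u is almost everywhere the positive
     part of p, the time integrals agree for almost every path. *)
  have [cX' [MB0 [MN0 [iB0 iN0 EX]]]] := sX; split=> //; exists MB0, MN0; split=> //.
  have sp := sqint_pos_part mp cp.2.
  apply: filterS2 EX (ae_Rintegral_eq su.1 sp.1 fb) => w h k t tT.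
  by rewrite h// k.
exists MB, MN; split=> //.
by apply: filterS (is_int_0 iI) => w z t tT; rewrite /p z addr0 addrA.
Qed.

(** * Conditional expectations and the final statement *)

Lemma mart2_cond_exp p X t : mart2 p -> {ae P, forall w, p T w = - X w} -> sqint P X -> 0 <= t <= T ->
  is_cond_exp P (F t) X (fun w => - p t w).
Proof.
move=> mp pT sX tT; have [ap sp op] := mp; have /andP[t0 tT'] := tT.
have sF := F_sigma t0; have spt := sp t tT; have sjp := sp T T_itv.
split.
- have := F_mwrtZ (-1) t0 (ap t tT).
  by congr (measurable_wrt _ _); apply/funext => w; rewrite mulN1r.
- exact: sqint_intg (sqintN spt).
move=> A FA; have mA := F_meas t0 FA.
have sA : sqint P (\1_A : Omega -> R).
  by apply: (@bounded_sqint _ _ _ P _ 1) => //; exact: indic_bound.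
have o := op t T \1_A t0 tT' (lexx T) (mwrt_indic sF FA) sA.
rewrite !Ex_indic_mul//; [|exact: sqint_intg|exact: sqint_intg (sqintN spt)]; congr EFin.
have i1 := sqintM sA sjp; have i2 := sqintM sA spt; have i3 := sqintM sA sX.
have : Ex P (fun w => \1_A w * p T w) - Ex P (fun w => \1_A w * p t w) = 0.
  by rewrite -ExB// -[RHS]o; apply: Ex_ext => w; rewrite mulrBr.
have -> : Ex P (fun w => \1_A w * p T w) = - Ex P (fun w => \1_A w * X w).
  rewrite -ExN//; apply: Ex_ae; [exact: intg_meas i1|exact: (intg_meas (intgN i3))|].
  by apply: filterS pT => w ->; rewrite mulrN.
have -> : Ex P (fun w => \1_A w * - p t w) = - Ex P (fun w => \1_A w * p t w).
  by rewrite -ExN//; apply: Ex_ext => w; rewrite mulrN.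
lra.
Qed.

(** Both versions are tested on the event Y > Z, which lies in G: there Y - Z is positive, yet its
    integral over the event is 0. *)
Lemma cond_exp_le G X Y Z : sigma_algebra setT G -> G `<=` measurable -> is_cond_exp P G X Y -> is_cond_exp P G X Z ->
  {ae P, forall w, Y w <= Z w}.
Proof.
move=> sG Gm [wY iY HY] [wZ iZ HZ].
pose A := [set w | 0 < Y w - Z w].
have wD := mwrtB sG wY wZ.
have GA : G A.
  have := wD `]0, +oo[%classic (measurable_itv _); congr (G _).
  by apply/seteqP; split=> w; rewrite /A /= in_itv/= andbT.
have mA := Gm _ GA.
have iD : intg P (fun w => Y w - Z w) by exact: intgB.
have iA : intg P (fun w => \1_A w * (Y w - Z w)).
  apply: (intg_dom _ (_ : intg P (fun w => `|Y w - Z w|))); last 2 first.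
  - exact: integrable_norm.
  - by move=> w; case: (indic01 A w) => ->; rewrite ?mul1r// mul0r normr0.
  by apply: measurable_funM; [exact: measurable_indic|exact: intg_meas iD].
have : Ex P (fun w => \1_A w * (Y w - Z w)) = 0.
  apply/eqP; rewrite -eqe -(Ex_indic_mul mA iD); apply/eqP.
  under eq_integral do rewrite EFinB.
  rewrite integralB//; last 2 first.
  - exact: integrableS iY.
  - exact: integrableS iZ.
  rewrite HY// HZ// subee// -HY//.
  by apply: integrable_fin_num => //; exact: integrableS iY.
move=> /(Ex_eq0_ae iA _); case.
  move=> w; rewrite indicE; have [h|h] := pselect (A w); last by rewrite memNset// mul0r.
  by rewrite mem_set// mul1r ltW.
move=> M [mM PM AM]; exists M; split=> // w /= H; apply: AM => /= E.
apply: H; rewrite leNgt; apply/negP => h.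
have Aw : A w by rewrite /A /= subr_gt0.
by move: E; rewrite indicE mem_set// mul1r => E; move: Aw; rewrite /A /= E ltxx.
Qed.

Lemma cond_exp_unique G X Y Z : sigma_algebra setT G -> G `<=` measurable -> is_cond_exp P G X Y -> is_cond_exp P G X Z ->
  {ae P, forall w, Y w = Z w}.
Proof.
move=> sG Gm hY hZ; apply: filterS2 (cond_exp_le sG Gm hY hZ) (cond_exp_le sG Gm hZ hY) => w h1 h2.
by apply/eqP; rewrite eq_le h1.
Qed.

Lemma cut1_restrict (Z0 : R -> Omega -> R) :
  measurable_fun (`[0, T] `*` setT : set (measurableTypeR R * Omega)) (fun x => Z0 x.1 x.2) <->
  measurable_fun setT (cut1 Z0).
Proof.
rewrite (_ : cut1 Z0 = (fun x : X1 => Z0 x.1 x.2) \_ D1).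
  exact: (measurable_restrictT (fun x : X1 => Z0 x.1 x.2) mD1).
apply/funext => x; rewrite patchE /cut1 indicE; case: ifPn => _; rewrite ?mulr1//.
by rewrite mulr0.
Qed.

Theorem optimal_feedback_solution uhat Xhat :
  optimal P T F nu N B sigma gamma x0 uhat Xhat ->
  exists phat qhat rhat,
    [/\ solution Xhat phat qhat rhat,
        forall X p q r, solution X p q r ->
          [/\ {ae P, forall w, forall t, 0 <= t <= T ->
                 X t w = Xhat t w /\ p t w = phat t w},
              {ae mu1, forall x, 0 <= x.1 <= T ->
                 q x.1 x.2 = qhat x.1 x.2} &
              {ae mu2, forall x,
                 0 <= x.1.1 <= T -> Rnz R x.1.2 ->
                 r x.1.1 x.1.2 x.2 = rhat x.1.1 x.1.2 x.2}],
        exists Z, is_cond_exp_process P T F (Xhat T) Z &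
        forall Z, is_cond_exp_process P T F (Xhat T) Z ->
          {ae mu1, forall x, 0 <= x.1 <= T ->
             uhat x.1 x.2 = Num.max (phat x.1 x.2) 0 /\
             Num.max (phat x.1 x.2) 0 = Num.max (- Z x.1 x.2) 0}].
Proof.
move=> opt; have [p [q [r [S mp cp fb]]]] := solution_exists opt.
have [_ su sX] := optimal_sqint opt; have sXT := state_sqint sX su.
have pT : {ae P, forall w, p T w = - Xhat T w} by case: S => _ _ _ _ [_ [? [? []]]].
have sp := sqint_mart2 mp cp.
have ce t := mart2_cond_exp mp pT sXT (t := t).
exists p, q, r; split=> //.
- by move=> X' p' q' r' S'; exact: solution_unique S S'.
- exists (fun t w => - p t w); split; last exact: ce.
  apply: (cut1_restrict (fun t w => - p t w)).2.
  rewrite (_ : cut1 _ = fun x => - cut1 p x); first by apply: measurableT_comp => //; exact: sp.1.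
  by apply/funext => x; rewrite /cut1 mulNr.
move=> Z0 [/cut1_restrict mZ0 cZ].
(* At each time the two versions agree almost surely; both are jointly measurable, so they agree
   almost everywhere on the product. *)
have ZE : {ae mu1, forall x, cut1 Z0 x = cut1 (fun t w => - p t w) x}.
  apply: ae_slices => //.
    rewrite (_ : cut1 (fun t w => - p t w) = fun x => - cut1 p x); first by apply: measurableT_comp => //; exact: sp.1.
    by apply/funext => x; rewrite /cut1 mulNr.
  move=> s; have [sT|sT] := pselect (0 <= s <= T); last first.
    apply: filterE => w; rewrite /cut1 D1E indicE memNset ?mulr0//.
  have s0 : 0 <= s by case/andP: sT.
  apply: filterS (cond_exp_unique (F_sigma s0) (F_meas s0) (cZ s sT) (ce s sT)) => w.
  by rewrite !cut1_at.
apply: filterS2 ZE fb => -[s w] /= + + sT; rewrite !cut1_at// => -> ->.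
by rewrite opprK.
Qed.

End state.
End noise.

Theorem theorem4p2 (R : realType) (d : measure_display)
    (Omega : measurableType d) (P : probability Omega R)
    (T : R) (F : R -> set (set Omega)) (B : R -> {RV P >-> R})
    (nu : {sigma_finite_measure set (measurableTypeR R) -> \bar R})
    (N : R.-ker Omega ~> (measurableTypeR R * measurableTypeR R)%type)
    (sigma x0 : R) (gamma : R -> R) (uhat Xhat : R -> Omega -> R) :
  0 < T ->
  filtration F -> usual_conditions P F ->
  (forall t, 0 <= t -> F t = augmented_filtration P T N B t) ->
  brownian_motion P B ->
  (\int[nu]_(z in Rnz R) (z ^+ 2)%:E < +oo)%E ->
  poisson_random_measure P T nu N ->
  independent_algebras P (generated_by `[0, +oo[ B)
    (generated_by (jump_sets T) (fun E w => N w E)) ->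
  measurable_fun (Rnz R) gamma ->
  (\int[nu]_(z in Rnz R) ((gamma z) ^+ 2)%:E < +oo)%E ->
  optimal P T F nu N B sigma gamma x0 uhat Xhat ->
  exists phat qhat rhat,
    [/\ fbsde_solution P T F nu N B sigma gamma x0 Xhat phat qhat rhat,
        forall X p q r,
          fbsde_solution P T F nu N B sigma gamma x0 X p q r ->
          [/\ {ae P, forall w, forall t, 0 <= t <= T ->
                 X t w = Xhat t w /\ p t w = phat t w},
              {ae (lebesgue_measure \x P)%E, forall x, 0 <= x.1 <= T ->
                 q x.1 x.2 = qhat x.1 x.2} &
              {ae ((lebesgue_measure \x nu) \x P)%E, forall x,
                 0 <= x.1.1 <= T -> Rnz R x.1.2 ->
                 r x.1.1 x.1.2 x.2 = rhat x.1.1 x.1.2 x.2}],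
        exists Z, is_cond_exp_process P T F (Xhat T) Z &
        forall Z, is_cond_exp_process P T F (Xhat T) Z ->
          {ae (lebesgue_measure \x P)%E, forall x, 0 <= x.1 <= T ->
             uhat x.1 x.2 = Num.max (phat x.1 x.2) 0 /\
             Num.max (phat x.1 x.2) 0 = Num.max (- Z x.1 x.2) 0}].
Proof.
move=> T0 filtF usualF FE BM _ PRM BN _ _ opt.
exact: (optimal_feedback_solution (fun t => measurable_funPT (B t)) T0 filtF usualF FE BM PRM BN opt).
Qed.
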